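(* Let $\Omega \subset \mathbb{R}^n$ be open and bounded with smooth boundary, let $\nu$ be its outward unit normal, and let $\Gamma_+ := \{ x \in \partial \Omega : x\cdot \nu >0 \}$. Let $\mathfrak{U} := \mathbb{R}^m \times \Omega$, and fix $R>0$ such that $\Omega \subseteq \{ r<R \}$. Let $\varepsilon, a, b >0$ be constants such that \[ a \geqslant (m+n)^2, \qquad a \gg R, \qquad \varepsilon \ll_{m,n} b \ll R^{-1}. \] Fix $\sigma >0$ and define $\omega := \mathcal{O}_\sigma (\Gamma_+) \cap \Omega$, where $\mathcal{O}_\sigma(\Gamma_+) := \{ y \in \mathbb{R}^n : |y-x|< \sigma \text{ for some } x \in \Gamma_+ \}$. Then there exists $C>0$ such that for any $z \in C^2(\mathfrak{U})\cap C^1(\bar{\mathfrak{U}})$ satisfying $z|_{\partial\mathfrak{U} \cap \mathfrak{D}} = 0$, we have \begin{align*} C\varepsilon \int_{\mathfrak{U} \cap \mathfrak{D}} \zeta_{a,b;\varepsilon}\, r^{-1}\big(|u\partial_u z |^2 + |v\partial_v z |^2 + f g^{ab}\nabla^{\omega_x}_a z\, \nabla^{\omega_x}_b z - f g^{CD} \nabla^{\omega_t}_C z\, \nabla^{\omega_t}_D z \big) + Cba^2\int_{\mathfrak{U} \cap \mathfrak{D}}\zeta_{a,b;\varepsilon} f^{-\frac{1}{2}} z^2 \\ \leqslant \frac{1}{a} \int_{\mathfrak{U}\cap \mathfrak{D}} \zeta_{a,b;\varepsilon} f |\square z|^2 + a^2 R^3 \int_{( \mathbb{R}^m \times \omega )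 \cap \mathfrak{D}} \zeta_{a,b;\varepsilon} f^{-2} |\nabla_t z|^2 + a^4 R^4 \int_{( \mathbb{R}^m \times \omega ) \cap \mathfrak{D}} \zeta_{a,b;\varepsilon} f^{-3} z^2, \end{align*} where \[ \zeta_{ a, b; \varepsilon } := \left\{ \frac{ f }{ ( 1 + \varepsilon u ) ( 1 - \varepsilon v ) } \cdot \exp \left[ \frac{ 2 b f^\frac{1}{2} }{ ( 1 - \varepsilon u )^\frac{1}{2} ( 1 + \varepsilon v )^\frac{1}{2} } \right] \right\}^{2a}. \]
   Context: Fix $m,n\in\mathbb{N}$. On $\mathbb{R}^{m+n}$ with Cartesian coordinates $t=(t_1,\dots,t_m)$, $x=(x_1,\dots,x_n)$, let $g=-dt_1^2-\dots-dt_m^2+dx_1^2+\dots+dx_n^2$, $\nabla$ its Levi-Civita connection and $\square=g^{\alpha\beta}\nabla_{\alpha\beta}$. Let $r=|x|$, $\tau=|t|$, $u=\frac12(\tau-r)$, $v=\frac12(\tau+r)$, $f=-uv=\frac14(|x|^2-|t|^2)$, and $\mathfrak{D}=\{f>0\}$ (exterior of the null cone centred at the origin). In polar coordinates $(u,v,\omega_x,\omega_t)$, $\omega_x\in\mathbb{S}^{n-1}$, $\omega_t\in\mathbb{S}^{m-1}$, $g=-4\,du\,dv+r^2\mathring\gamma_{\mathbb{S}^{n-1}}-\tau^2\mathring\gamma_{\mathbb{S}^{m-1}}$. Indices $a,b$ denote spatial angular components and $C,D$ temporal angular components; $\nabla^{\omega_x}_a$ denotes derivatives (w.r.t. $g$)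 in the spatial angular directions and $\nabla^{\omega_t}_C$ in the temporal angular directions; $\nabla_t z=(\partial_{t_1}z,\dots,\partial_{t_m}z)$. *)

(* Defs.v *)
From HB Require Import structures.
From mathcomp Require Import all_boot all_order all_algebra.
From mathcomp Require Import all_classical all_reals all_analysis.
Set Implicit Arguments. Unset Strict Implicit. Unset Printing Implicit Defensive.
Import Order.TTheory GRing.Theory Num.Theory.
Import numFieldNormedType.Exports.
Local Open Scope classical_set_scope.
Local Open Scope ring_scope.

Section Defs.
Variable R : realType.

Definition dotv N (x y : 'rV[R]_N) : R := \sum_(i < N) x ord0 i * y ord0 i.
Definition enorm N (x : 'rV[R]_N) : R := Num.sqrt (dotv x x).

Definition evec N (i : 'I_N) : 'rV[R]_N := \row_(j < N) (i == j)%:R.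
Definition partial N (i : 'I_N) (h : 'rV[R]_N -> R) : 'rV[R]_N -> R :=
  fun p => 'D_(evec i) h p.
Definition grad N (h : 'rV[R]_N -> R) (p : 'rV[R]_N) : 'rV[R]_N :=
  \row_(i < N) partial i h p.

Definition C2_on N (U : set 'rV[R]_N) (h : 'rV[R]_N -> R) : Prop :=
  [/\ {in U, continuous h},
      (forall i p, U p -> derivable h p (evec i)),
      (forall i, {in U, continuous (partial i h)}),
      (forall i j p, U p -> derivable (partial i h) p (evec j)) &
      (forall i j, {in U, continuous (partial j (partial i h))})].

Definition C1_closure N (U : set 'rV[R]_N) (h : 'rV[R]_N -> R) : Prop :=
  {within closure U, continuous h} /\
  forall i, exists g : 'rV[R]_N -> R,
      {within closure U, continuous g} /\ forall p, U p -> g p = partial i h p.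

Fixpoint iter_partial N (l : seq 'I_N) (h : 'rV[R]_N -> R) : 'rV[R]_N -> R :=
  match l with [::] => h | i :: l' => partial i (iter_partial l' h) end.
Definition smooth_on N (V : set 'rV[R]_N) (h : 'rV[R]_N -> R) : Prop :=
  forall l : seq 'I_N,
    {in V, continuous (iter_partial l h)} /\
    forall i p, V p -> derivable (iter_partial l h) p (evec i).

(* Omega has smooth boundary, and nu is its outward unit normal:
   near each boundary point Omega = {rho < 0} for a smooth local defining
   function rho with nonvanishing gradient, and nu = grad rho / |grad rho|. *)
Definition smooth_boundary_normal N (Om : set 'rV[R]_N)
    (nu : 'rV[R]_N -> 'rV[R]_N) : Prop :=
  forall x, (closure Om `\` Om) x ->
    exists (V : set 'rV[R]_N) (rho : 'rV[R]_N -> R),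
      [/\ open V /\ V x, smooth_on V rho,
          (forall p, V p -> grad rho p != 0),
          (forall p, V p -> (Om p <-> rho p < 0)) &
          nu x = (enorm (grad rho x))^-1 *: grad rho x].


(* Lebesgue integral over R^N of a nonnegative extended-real function,
   written as an iterated one-dimensional Lebesgue integral (Tonelli). *)
Fixpoint lebint (N : nat) : ('rV[R]_N -> \bar R) -> \bar R :=
  match N return ('rV[R]_N -> \bar R) -> \bar R with
  | 0 => fun F => F 0
  | N'.+1 => fun F =>
      (\int[@lebesgue_measure R]_x lebint (fun y : 'rV[R]_N' =>
          F (row_mx (const_mx x : 'rV[R]_1) y)))%E
  end.

Definition int_over N (A : set 'rV[R]_N) (F : 'rV[R]_N -> R) : \bar R :=
  lebint (fun p => if `[< A p >] then (F p)%:E else 0%E).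

Section Spacetime.
Variables m n : nat.
Notation pt := 'rV[R]_(m + n).

Definition tcoord (p : pt) : 'rV[R]_m := lsubmx p.
Definition xcoord (p : pt) : 'rV[R]_n := rsubmx p.
Definition rr (p : pt) : R := enorm (xcoord p).
Definition tau (p : pt) : R := enorm (tcoord p).
Definition uu (p : pt) : R := (tau p - rr p) / 2.
Definition vv (p : pt) : R := (tau p + rr p) / 2.
Definition ff (p : pt) : R := - (uu p * vv p).
(* exterior of the null cone *)
Definition Dom : set pt := [set p | 0 < ff p].

Definition dt (i : 'I_m) (z : pt -> R) : pt -> R := partial (lshift n i) z.
Definition dx (j : 'I_n) (z : pt -> R) : pt -> R := partial (rshift m j) z.
Definition grad_t (z : pt -> R) (p : pt) : 'rV[R]_m := \row_(i < m) dt i z p.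
Definition grad_x (z : pt -> R) (p : pt) : 'rV[R]_n := \row_(j < n) dx j z p.

(* radial derivatives d_r = (x/r).grad_x, d_tau = (t/tau).grad_t
   (d_tau set to 0 on the null set tau = 0) *)
Definition d_r (z : pt -> R) (p : pt) : R :=
  (rr p)^-1 * dotv (xcoord p) (grad_x z p).
Definition d_tau (z : pt -> R) (p : pt) : R :=
  (tau p)^-1 * dotv (tcoord p) (grad_t z p).
Definition d_u (z : pt -> R) (p : pt) : R := d_tau z p - d_r z p.
Definition d_v (z : pt -> R) (p : pt) : R := d_tau z p + d_r z p.

Definition ang_x (z : pt -> R) (p : pt) : 'rV[R]_n :=
  grad_x z p - (d_r z p / rr p) *: xcoord p.
Definition ang_t (z : pt -> R) (p : pt) : 'rV[R]_m :=
  grad_t z p - (d_tau z p / tau p) *: tcoord p.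
(* g^{ab} nabla_a z nabla_b z  (metric r^2 gamma on S^{n-1}) *)
Definition gab_term (z : pt -> R) (p : pt) : R := dotv (ang_x z p) (ang_x z p).
(* g^{CD} nabla_C z nabla_D z  (metric -tau^2 gamma on S^{m-1}) *)
Definition gCD_term (z : pt -> R) (p : pt) : R := - dotv (ang_t z p) (ang_t z p).

Definition box (z : pt -> R) (p : pt) : R :=
  - (\sum_(i < m) dt i (dt i z) p) + \sum_(j < n) dx j (dx j z) p.

Definition zeta (a b eps : R) (p : pt) : R :=
  powR ((ff p / ((1 + eps * uu p) * (1 - eps * vv p))) *
        expR (2 * b * Num.sqrt (ff p) /
              (Num.sqrt (1 - eps * uu p) * Num.sqrt (1 + eps * vv p))))
       (2 * a).

Definition cyl (Om : set 'rV[R]_n) : set pt := [set p | Om (xcoord p)].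

End Spacetime.

Definition Gamma_plus N (Om : set 'rV[R]_N) (nu : 'rV[R]_N -> 'rV[R]_N) :=
  [set x | (closure Om `\` Om) x /\ 0 < dotv x (nu x)].
Definition nbhd_sigma N (G : set 'rV[R]_N) (sigma : R) :=
  [set y | exists2 x, G x & enorm (y - x) < sigma].

End Defs.

(* Main.v *)
Require Import Defs.
From HB Require Import structures.
From mathcomp Require Import all_boot all_order all_algebra.
From mathcomp Require Import all_classical all_reals all_analysis.
From mathcomp Require Import ring lra.
Import Order.TTheory GRing.Theory Num.Theory.
Import numFieldNormedType.Exports.
Local Open Scope classical_set_scope.
Local Open Scope ring_scope.
Set Implicit Arguments. Unset Strict Implicit. Unset Printing Implicit Defensive.

(** The constant [C] may depend on everything but [z], so on the bounded set
    [U `&` D] the weight [zeta] may be replaced by the comparable [W^2 / f], where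
    [W = f^(a + 1/2) exp (be (r + r^2))] with [be] small.

    For [psi = W w] and the multiplier [M = 2 A S + 2 B X + q psi], where [S] is the
    derivative of [psi] along the scaling field, [X] its spatial part and
    [A = lam / (2 f)], [B = be (1 / r + 2)] come from the gradient of [ln W], one has
    a pointwise identity [- (W box w) M = M^2 + (quadratic form) + div J]; the factor
    [exp (be (r + r^2))] makes the quadratic form control the left-hand side of the
    theorem.  Take [w = chi z] with [chi] vanishing on [Gamma_+].  As [z = 0] on the
    boundary, the gradient of [psi] is normal there and the outward flux of [J] is
    [- (A + B) |grad psi|^2 (x . n) >= 0].  Where [chi <> 1] the spatial gradient of
    [z] is absorbed by an energy identity localized by [xi], at the price of [z^2]
    and [|grad_t z|^2] on [omega].

    Nothing is known a priori about integrability: all integrations by parts are done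
    against cut-offs compactly supported in [U `&` D], the null cone contributes
    nothing in the limit because [J] decays like [f^2] there, and Fatou's lemma
    removes the cut-offs. *)

(** * Integrals of continuous functions of compact support *)

(** [W] has the exponent [lam = a + 1/2] because [W^2 / f] is then [f^(2 a) exp (2 be (r + r^2))],
    while [zeta] is [f^(2 a)] up to bounded factors once [eps R <= 1/4]. Since [C] may depend on
    [a], [b], [eps] and [R], no power of them has to be tracked. A power of [f] alone does not
    suffice: for [be = 0] the identity contains, besides the divergence, only multiples of
    [(S + c psi)^2], [c = (m + n - 4) / 2]. In the exponent, [r] yields [be / r] times the Euclidean
    gradient squared, whose angular part is kept, and [r^2] yields a further [2 be] times it, which
    absorbs errors; for small [be] the quadratic effects of this perturbation stay below the linear
    gain. The condition [a >= (m + n)^2] dominates the dimensional constants. The flux has a sign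
    only on the boundary, and only a weak one, whereas the cut-offs act inside. Adding a small
    multiple of [grad rho] to [J] makes the sign strict, hence valid in a thin layer by compactness.
    The integrals of the theorem are treated as they stand, without measurability: only monotonicity
    and Fatou's lemma with continuous approximants are applied to them. *)

Section IntegralCc.
Variable R : realType.
Notation mu := (@lebesgue_measure R).

Lemma cvg_at_epsP (V W : normedModType R) (F : V -> W) (p : V) :
  (F @ p --> F p) <->
  (forall e : R, 0 < e -> exists2 d : R, 0 < d &
     forall q, `|p - q| < d -> `|F p - F q| < e).
Proof.
split => [/cvgrPdist_lt cF e e0|h].
  have /nbhs_ballP[d /= d0 hd] := cF e e0.
  by exists d => // q pq; apply: hd; rewrite -ball_normE.
apply/cvgrPdist_lt => e e0; have [d d0 hd] := h e e0.
by apply/nbhs_ballP; exists d => //= q; rewrite -ball_normE /= => /hd.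
Qed.

Lemma continuous_addr (V : topologicalType) (F G : V -> R) :
  continuous F -> continuous G -> continuous (fun p => F p + G p).
Proof. by move=> cF cG p; apply: cvgD; [exact: cF|exact: cG]. Qed.

Lemma continuous_mulr (V : topologicalType) (F G : V -> R) :
  continuous F -> continuous G -> continuous (fun p => F p * G p).
Proof. by move=> cF cG p; apply: cvgM; [exact: cF|exact: cG]. Qed.

Lemma continuous_fcst (V : topologicalType) (c : R) : continuous (fun _ : V => c).
Proof. by move=> p; exact: cvg_cst. Qed.

(** The splitting built into [lebint]: a section of an integrand fixes the first coordinate. *)
Definition row_cons N (x : R) (y : 'rV[R]_N) : 'rV[R]_N.+1 :=
  row_mx (const_mx x : 'rV[R]_1) y.

Lemma row_cons0 N (x : R) (y : 'rV[R]_N) : row_cons x y ord0 ord0 = x.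
Proof.
by rewrite mxE; case: splitP => // j _; rewrite mxE.
Qed.

Lemma row_consS N (x : R) (y : 'rV[R]_N) i :
  row_cons x y ord0 (lift ord0 i) = y ord0 i.
Proof.
rewrite mxE; case: splitP => [j|j] /=; first by rewrite (ord1 j).
by rewrite /bump /= !add1n => -[/val_inj ->].
Qed.

Lemma coord_le_norm N (p : 'rV[R]_N) i : `|p ord0 i| <= `|p|.
Proof.
rewrite [leRHS]/Num.norm /= mx_normrE; apply/bigmax_geP; right => /=.
by exists (ord0, i).
Qed.

Lemma norm_row_le N (p : 'rV[R]_N) (K : R) :
  0 <= K -> (forall i, `|p ord0 i| <= K) -> `|p| <= K.
Proof.
move=> K0 h; rewrite [leLHS]/Num.norm /= mx_normrE; apply/bigmax_leP; split => //.
by move=> [i j] _ /=; rewrite (ord1 i).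
Qed.

Lemma row_cons_le N (x : R) (y : 'rV[R]_N) (K : R) :
  `|x| <= K -> `|y| <= K -> `|row_cons x y| <= K.
Proof.
move=> xK yK; apply: norm_row_le => [|i]; first exact: le_trans xK.
case: (unliftP ord0 i) => [j|] ->; first rewrite row_consS.
  exact: le_trans (coord_le_norm _ _) yK.
by rewrite row_cons0.
Qed.

Lemma row_cons_gel N (x : R) (y : 'rV[R]_N) : `|x| <= `|row_cons x y|.
Proof. by rewrite -{1}(row_cons0 x y) coord_le_norm. Qed.

Lemma row_cons_ger N (x : R) (y : 'rV[R]_N) : `|y| <= `|row_cons x y|.
Proof.
by apply: norm_row_le => // i; rewrite -(row_consS x y) coord_le_norm.
Qed.

Lemma row_consB N (x x' : R) (y y' : 'rV[R]_N) :
  row_cons x y - row_cons x' y' = row_cons (x - x') (y - y').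
Proof.
have e n (a b : 'rV[R]_n) j : (a - b) ord0 j = a ord0 j - b ord0 j.
  by rewrite !mxE.
apply/rowP => i; rewrite e.
by case: (unliftP ord0 i) => [j|] ->; rewrite ?row_consS ?row_cons0 ?e.
Qed.

Definition Cc N (F : 'rV[R]_N -> R) :=
  continuous F /\ exists K : R, forall p, K < `|p| -> F p = 0.

Lemma Cc_supp N (F : 'rV[R]_N -> R) : Cc F ->
  exists2 K : R, 0 < K & forall p, K < `|p| -> F p = 0.
Proof.
move=> [_ [K hK]]; exists (Num.max K 1); first by rewrite lt_max ltr01 orbT.
by move=> p; rewrite gt_max => /andP[/hK].
Qed.

Lemma closed_ball_rV_compact N (K : R) :
  compact [set p : 'rV[R]_N | `|p| <= K].
Proof.
apply: bounded_closed_compact.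
  exists K; split; first exact: num_real.
  by move=> M KM p /= pK; rewrite (le_trans pK) ?ltW.
rewrite (_ : mkset _ = Num.norm @^-1` [set x : R | x <= K]) //.
by apply: preimage_closed; [move=> p _; exact: norm_continuous|exact: closed_le].
Qed.

(** Heine-Cantor on the ball of radius [K + 1]. The margin 1 settles the rest: if [p] is outside
    that ball and [q] is at distance less than 1 from [p], both lie outside the support. *)
Lemma Cc_unif N (F : 'rV[R]_N -> R) : Cc F -> forall e, 0 < e ->
  exists2 d, 0 < d & forall p q, `|p - q| < d -> `|F p - F q| <= e.
Proof.
move=> cF e e0; have [K K0 hK] := Cc_supp cF; case: cF => cF _.
pose B := [set p : 'rV[R]_N | `|p| <= K + 1].
have /compact_near_coveringP cB : compact B by exact: closed_ball_rV_compact.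
have [|d /= d0 hd] := cB R (0:R)^'+ (fun d p => forall q, `|p - q| < d -> `|F p - F q| <= e) _.
  move=> p _.
  have /cvgrPdist_lt /(_ _ (divr_gt0 e0 (ltr0n _ 2))) := cF p.
  move=> /nbhs_ballP[r /= r0 hr].
  exists (ball p (r / 2), [set d | d < r / 2]); first split => /=.
  - by apply: nbhsx_ballx; rewrite divr_gt0.
  - by apply: nbhs_right_lt; rewrite divr_gt0.
  move=> [p' d] /= [pp' dr] q p'q.
  have h1 : `|F p - F p'| < e / 2.
    apply: hr; apply: le_ball pp'; lra.
  have h2 : `|F p - F q| < e / 2.
    apply: hr; rewrite -ball_normE /=.
    rewrite (_ : p - q = (p - p') + (p' - q)); last by rewrite addrA subrK.
    apply: le_lt_trans (ler_normD _ _) _.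
    have : `|p - p'| < r / 2 by move: pp'; rewrite -ball_normE.
    lra.
  rewrite (_ : F p' - F q = - (F p - F p') + (F p - F q)); last by ring.
  by apply: le_trans (ler_normD _ _) _; rewrite normrN; lra.
exists (Num.min (d / 2) 1); first by rewrite lt_min ltr01 divr_gt0.
have d20 : 0 < d / 2 by rewrite divr_gt0.
move=> p q; rewrite lt_min => /andP[pq pq1].
have [pB|pB] := leP `|p| (K + 1).
  apply: (hd (d / 2)) => //=.
  by rewrite sub0r normrN gtr0_norm //; lra.
rewrite (hK p); last by lra.
rewrite (hK q) ?subrr ?normr0 ?ltW //.
have := ler_normD (p - q) q; rewrite subrK; lra.
Qed.

Lemma CcD N (F G : 'rV[R]_N -> R) : Cc F -> Cc G -> Cc (fun p => F p + G p).
Proof.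
move=> [cF [K hK]] [cG [L hL]]; split; first exact: continuous_addr.
exists (Num.max K L) => p; rewrite gt_max => /andP[/hK -> /hL ->].
by rewrite addr0.
Qed.

Lemma CcMl N (F G : 'rV[R]_N -> R) : continuous G -> Cc F -> Cc (fun p => G p * F p).
Proof.
move=> cG [cF [K hK]]; split; first exact: continuous_mulr.
by exists K => p /hK ->; rewrite mulr0.
Qed.

Lemma CcZ N (c : R) (F : 'rV[R]_N -> R) : Cc F -> Cc (fun p => c * F p).
Proof. by apply: CcMl; exact: continuous_fcst. Qed.

Lemma Cc0 N : Cc (fun _ : 'rV[R]_N => 0 : R).
Proof. by split; [exact: continuous_fcst|exists 0]. Qed.

Lemma Cc_sum N (I : Type) (s : seq I) (F : I -> 'rV[R]_N -> R) :
  (forall i, Cc (F i)) -> Cc (fun p => \sum_(i <- s) F i p).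
Proof.
move=> cF; elim: s => [|i s IH].
  by rewrite (_ : (fun _ => _) = fun=> 0); [exact: Cc0|
    apply/funext => p; rewrite big_nil].
rewrite (_ : (fun _ => _) = fun p => F i p + \sum_(j <- s) F j p).
  exact: CcD.
by apply/funext => p; rewrite big_cons.
Qed.

Lemma Cc_section N (F : 'rV[R]_N.+1 -> R) x : Cc F -> Cc (fun y => F (row_cons x y)).
Proof.
move=> [cF [K hK]]; split; last first.
  exists K => y yK; apply: hK; apply: lt_le_trans yK _; exact: row_cons_ger.
move=> y; apply/cvg_at_epsP => e e0.
have [d d0 hd] := (cvg_at_epsP F (row_cons x y)).1 (cF _) e e0.
exists d => // y' yy'; apply: hd; rewrite row_consB subrr.
by apply: le_lt_trans yy'; apply: row_cons_le; rewrite ?normr0.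
Qed.

(** The counterpart of [Cc] on [R] itself, since [lebint] integrates over [R] and not over rows of
    length 1. *)
Definition Cc1 (h : R -> R) :=
  continuous h /\ exists K : R, forall x, K < `|x| -> h x = 0.

Lemma Cc1_restrict (h : R -> R) (K : R) : (forall x, K < `|x| -> h x = 0) ->
  h \_ `[- K, K] = h.
Proof.
move=> hK; apply/funext => x; rewrite patchE; case: ifPn => //.
rewrite notin_setE /= in_itv /= => /negP; rewrite -ler_norml -ltNge => /hK.
by move=> ->.
Qed.

Lemma Cc1_integrable (h : R -> R) : Cc1 h -> mu.-integrable setT (EFin \o h).
Proof.
move=> [ch [K hK]]; rewrite -(Cc1_restrict hK) -restrict_EFin.
apply/(integrable_mkcond _ _).1 => //.
apply: (@continuous_compact_integrable R h `[- K, K]).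
  exact: segment_compact.
exact: continuous_subspaceT.
Qed.

(** The real-valued twin of [lebint]. For integrands in [Cc] every inner integral is finite, so
    linear manipulations can be made in [R]. *)
Fixpoint Rint (N : nat) : ('rV[R]_N -> R) -> R :=
  match N return ('rV[R]_N -> R) -> R with
  | 0 => fun F => F 0
  | N'.+1 => fun F => (\int[mu]_x Rint (fun y : 'rV[R]_N' => F (row_cons x y)))%R
  end.

Lemma Rint_eq N (F G : 'rV[R]_N -> R) : F =1 G -> Rint F = Rint G.
Proof. by move=> /funext ->. Qed.

(** These properties go through one induction together: in dimension [N + 1], integrability of the
    section integrals comes from their continuity, which rests on linearity and on the sup bound in
    dimension [N]. *)
Definition Rint_spec N :=
  [/\ forall F G : 'rV[R]_N -> R, Cc F -> Cc G ->
        Rint (fun p => F p + G p) = Rint F + Rint G,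
      forall (c : R) (F : 'rV[R]_N -> R), Cc F -> Rint (fun p => c * F p) = c * Rint F,
      forall F : 'rV[R]_N -> R, Cc F -> (forall p, 0 <= F p) -> 0 <= Rint F,
      forall (F : 'rV[R]_N -> R) (K e : R), Cc F -> 0 <= K -> 0 <= e ->
        (forall p, K < `|p| -> F p = 0) -> (forall p, `|F p| <= e) ->
        `|Rint F| <= e * (2 * K) ^+ N &
      forall F : 'rV[R]_N -> R, Cc F -> lebint (EFin \o F) = (Rint F)%:E].

(** Uniform continuity of [F] makes neighbouring sections uniformly close, and the sup bound over a
    cube turns this into closeness of their integrals. *)
Lemma Rint_section_Cc1 N (F : 'rV[R]_N.+1 -> R) : Rint_spec N -> Cc F ->
  Cc1 (fun x => Rint (fun y => F (row_cons x y))).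
Proof.
move=> [hD hZ _ hB _] cF; have [K K0 hK] := Cc_supp cF; split; last first.
  exists K => x xK; rewrite (@Rint_eq _ _ (fun p => 0 * 0)).
    by rewrite hZ ?mul0r //; exact: Cc0.
  by move=> p; rewrite hK ?mul0r // (lt_le_trans xK) // row_cons_gel.
move=> x; apply/cvg_at_epsP => e e0.
pose e' := e / ((2 * K) ^+ N + 1).
have K2 : 0 <= (2 * K) ^+ N by rewrite exprn_ge0 // mulr_ge0 // ltW.
have e'0 : 0 < e' by rewrite divr_gt0 //; lra.
have [d d0 hd] := Cc_unif cF e'0.
exists d => // x' xx'.
have -> : Rint (fun y => F (row_cons x y)) - Rint (fun y => F (row_cons x' y)) =
  Rint (fun y => F (row_cons x y) + (-1) * F (row_cons x' y)).
  rewrite hD ?hZ ?mulN1r //; try exact: Cc_section.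
  by apply: CcZ; exact: Cc_section.
apply: le_lt_trans (hB _ K e' _ _ _ _ _) _; rewrite ?(ltW K0) ?(ltW e'0) //.
- by apply: CcD; [|apply: CcZ]; exact: Cc_section.
- move=> p pK; rewrite !hK ?mulr0 ?addr0 //; apply: lt_le_trans pK _;
  exact: row_cons_ger.
- move=> p; rewrite mulN1r; apply: hd; rewrite row_consB subrr.
  by apply: le_lt_trans xx'; apply: row_cons_le; rewrite ?normr0.
rewrite /e' mulrAC ltr_pdivrMr ?ltr_pM2l //; lra.
Qed.

Lemma RintP N : Rint_spec N.
Proof.
elim: N => [|N IH].
  split=> //=.
  - by move=> F K e cF K0 e0 hK he; rewrite expr0 mulr1.
have [hD hZ hP hB hL] := IH.
have Is F (cF : Cc F) := Cc1_integrable (Rint_section_Cc1 IH cF).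
split => /=.
- move=> F G cF cG; rewrite -RintegralD //; try exact: Is.
  apply: eq_Rintegral => x _; rewrite hD //; exact: Cc_section.
- move=> c F cF; rewrite -RintegralZl //; last exact: Is.
  apply: eq_Rintegral => x _; rewrite hZ //; exact: Cc_section.
- by move=> F cF F0; apply: Rintegral_ge0 => x _; apply: hP => //; exact: Cc_section.
- move=> F K e cF K0 e0 hK he.
  set h := fun x => Rint _.
  have hh x : K < `|x| -> h x = 0.
    move=> xK; rewrite /h (@Rint_eq _ _ (fun p => 0 * 0)).
      by rewrite hZ ?mul0r //; exact: Cc0.
    by move=> p; rewrite hK ?mul0r // (lt_le_trans xK) // row_cons_gel.
  have ih := Is _ cF; rewrite -/h in ih.
  rewrite -(Cc1_restrict hh) -Rintegral_mkcond.
  have ih' : mu.-integrable `[- K, K] (EFin \o h).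
    by apply: integrableS ih.
  apply: le_trans (le_normr_Rintegral _ ih') _ => //.
  have hle x : `|h x| <= e * (2 * K) ^+ N.
    apply: hB => //; first exact: Cc_section.
    by move=> y yK; apply: hK; apply: lt_le_trans yK _; exact: row_cons_ger.
  have -> : e * (2 * K) ^+ N.+1 = (\int[mu]_(x in `[- K, K]) (e * (2 * K) ^+ N)).
    rewrite Rintegral_cst // /= lebesgue_measure_itv /= lte_fin.
    case: ifPn => [_|]; first by rewrite -EFinD /= exprSr mulrA opprK mulr2n mulrDl !mul1r.
    rewrite -leNgt => h1; have -> : K = 0 by lra.
    by rewrite mulr0 exprS mul0r !mulr0.
  apply: le_Rintegral => //.
  - apply/integrable_norm => //.
  - apply: continuous_compact_integrable; first exact: segment_compact.
    by apply: continuous_subspaceT => x; exact: cvg_cst.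
- move=> F cF; rewrite /Rintegral fineK; last exact: integrable_fin_num (Is _ cF).
  apply: eq_integral => x _ /=; rewrite -(hL (fun y => F (row_cons x y))) //.
  exact: Cc_section.
Qed.


(** No measurability is assumed: the integral of a nonnegative function is a supremum over simple
    functions below it. The inner integrals of [int_over] may fail to be measurable, so this form is
    essential. *)
Lemma le_integral_ge0 (f g : R -> \bar R) : (forall x, 0 <= f x)%E ->
  (forall x, f x <= g x)%E -> (\int[mu]_x f x <= \int[mu]_x g x)%E.
Proof.
move=> f0 fg; have g0 x : (0 <= g x)%E by apply: le_trans (fg x).
rewrite !ge0_integralTE //; apply: ereal_sup_le => _ [h hf <-].
by exists h => // x; apply: le_trans (hf x) (fg x).
Qed.

Lemma lebint_ge0 N (F : 'rV[R]_N -> \bar R) :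
  (forall p, 0 <= F p)%E -> (0 <= lebint F)%E.
Proof.
elim: N F => [|N IH] F F0 //=.
by apply: integral_ge0 => x _; apply: IH.
Qed.

Lemma lebint_le N (F G : 'rV[R]_N -> \bar R) : (forall p, 0 <= F p)%E ->
  (forall p, F p <= G p)%E -> (lebint F <= lebint G)%E.
Proof.
elim: N F G => [|N IH] F G F0 FG //=.
apply: le_integral_ge0 => x; first exact: lebint_ge0.
exact: IH.
Qed.

(** Only the approximants are continuous; [G] is arbitrary. By induction the section integral of [G]
    is below the lower limit of the section integrals of [F n], which are continuous, so the
    one-dimensional Fatou lemma applies to them. *)
Lemma lebint_fatou N (F : nat -> 'rV[R]_N -> R) (G : 'rV[R]_N -> \bar R) :
  (forall n, Cc (F n)) -> (forall n p, 0 <= F n p) -> (forall p, 0 <= G p)%E ->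
  (forall p, G p <= limn_einf (fun n => (F n p)%:E))%E ->
  (lebint G <= limn_einf (fun n => (Rint (F n))%:E))%E.
Proof.
elim: N F G => [|N IH] F G cF F0 G0 FG //=.
have [_ _ _ _ hL] := RintP N.
have cs n := Rint_section_Cc1 (RintP N) (cF n).
pose S n x := Rint (fun y => F n (row_cons x y)).
have S0 n x : 0 <= S n x.
  by have [_ _ hP _ _] := RintP N; apply: hP => //; exact: Cc_section.
apply: (@le_trans _ _ (\int[mu]_x limn_einf (fun n => (S n x)%:E))%E).
  apply: le_integral_ge0 => x; first exact: lebint_ge0.
  apply: IH => // n; exact: Cc_section.
apply: le_trans (fatou mu _ _ _) _ => //.
- move=> n; apply/measurable_realfun.measurable_EFinP; apply: measurable_realfun.continuous_measurable_fun.
  by case: (cs n).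
- by move=> n x _; rewrite lee_fin.
rewrite le_eqVlt; apply/orP; left; apply/eqP; congr limn_einf.
apply/funext => n; rewrite /Rintegral fineK //.
exact: integrable_fin_num (Cc1_integrable (cs n)).
Qed.

(** Along [w] the map [phi] moves with constant velocity [v], so the two difference quotients are
    the same function; no chain rule is involved. *)
Lemma is_derive_comp_affine (V W : normedModType R) (phi : W -> V) (G : V -> R)
    (y w : W) (v : V) (d : R) :
  (forall h : R, phi (h *: w + y) = h *: v + phi y) ->
  is_derive (phi y) v G d -> is_derive y w (fun q => G (phi q)) d.
Proof.
move=> hphi [dG <-].
have e : (fun h : R => h^-1 *: (((fun q => G (phi q)) \o shift y) (h *: w) - G (phi y))) =
         (fun h : R => h^-1 *: ((G \o shift (phi y)) (h *: v) - G (phi y))).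
  by apply/funext => h /=; rewrite hphi.
by split; rewrite /derivable /derive e.
Qed.

Lemma is_derive_eps (H : R -> R) (x d : R) :
  (forall e, 0 < e -> exists2 r, 0 < r & forall h, h != 0 -> `|h| < r ->
     `|d - h^-1 * (H (h + x) - H x)| < e) -> is_derive x 1 H d.
Proof.
move=> hd.
have c : h^-1 *: ((H \o shift x) (h *: 1) - H x) @[h --> 0^'] --> d.
  apply/cvgrPdist_lt => e /hd[r r0 hr].
  near=> h.
  rewrite /= [h *: _]mulr1; apply: hr; first by near: h; exact: nbhs_dnbhs_neq.
  by near: h; exact: dnbhs0_lt.
split; [apply/cvg_ex; by exists d|exact: cvg_lim c].
Unshelve. all: by end_near. Qed.

(** The mean value theorem for increments of either sign, or zero, as they occur for the coordinates
    of a vector. *)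
Lemma mvt_local (f df : R -> R) (a h : R) :
  (forall t : R, `|t| <= `|h| -> is_derive (a + t) 1 f (df (a + t))) ->
  exists2 t, `|t| <= `|h| & f (a + h) - f a = h * df (a + t).
Proof.
move=> fdf.
have fd (x : R) : `|x - a| <= `|h| -> is_derive x 1 f (df x).
  by move=> /fdf; rewrite (_ : a + (x - a) = x) //; ring.
have cf (x : R) : `|x - a| <= `|h| -> {for x, continuous f}.
  move=> /fd dx; apply: differentiable_continuous; apply/derivable1_diffP.
  exact: ex_derive.
have [h0|h0|->] := ltgtP h 0.
- have [||| c /[!in_itv] /= /andP[c1 c2] e] := @MVT R f df (a + h) a.
  + by rewrite gtrDl.
  + move=> x /[!in_itv] /= /andP[x1 x2]; apply: fd.
    by rewrite ltr0_norm ?ltr0_norm //; lra.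
  + apply: continuous_in_subspaceT => x; rewrite inE /= in_itv /= => /andP[x1 x2].
    by apply: cf; rewrite ler0_norm ?ltr0_norm //; lra.
  exists (c - a).
    by rewrite ler0_norm ?ltr0_norm //; lra.
  rewrite (_ : a + (c - a) = c); last by ring.
  have -> : f (a + h) - f a = - (f a - f (a + h)) by ring.
  by rewrite e; ring.
- have [||| c /[!in_itv] /= /andP[c1 c2] e] := @MVT R f df a (a + h).
  + by rewrite ltrDl.
  + move=> x /[!in_itv] /= /andP[x1 x2]; apply: fd.
    by rewrite gtr0_norm ?gtr0_norm //; lra.
  + apply: continuous_in_subspaceT => x; rewrite inE /= in_itv /= => /andP[x1 x2].
    by apply: cf; rewrite ger0_norm ?gtr0_norm //; lra.
  exists (c - a).
    by rewrite ger0_norm ?gtr0_norm //; lra.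
  rewrite (_ : a + (c - a) = c); last by ring.
  by rewrite e; ring.
- by exists 0 => //; rewrite addr0 subrr mul0r.
Qed.

Lemma evec_ord0 N : evec R (ord0 : 'I_N.+1) = row_cons 1 0.
Proof.
apply/rowP => i; rewrite mxE.
by case: (unliftP ord0 i) => [j|] ->; rewrite ?row_cons0 ?row_consS ?mxE //=.
Qed.

Lemma evec_lift N (j : 'I_N) : evec R (lift ord0 j) = row_cons 0 (evec R j).
Proof.
apply/rowP => i; rewrite mxE.
by case: (unliftP ord0 i) => [k|] ->; rewrite ?row_cons0 ?row_consS ?mxE.
Qed.

Lemma row_consD N (h x x' : R) (y y' : 'rV[R]_N) :
  h *: row_cons x y + row_cons x' y' = row_cons (h * x + x') (h *: y + y').
Proof.
have e n (a b : 'rV[R]_n) j : (h *: a + b) ord0 j = h * a ord0 j + b ord0 j.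
  by rewrite !mxE.
apply/rowP => i; rewrite e.
by case: (unliftP ord0 i) => [j|] ->; rewrite ?row_consS ?row_cons0 ?e.
Qed.

(** The section integrals of [G] are differentiable with derivative those of [G'], by the mean value
    theorem on each line and uniform continuity of [G']. The fundamental theorem on an interval
    containing the support then gives 0. *)
Lemma Rint_derive_first N (G G' : 'rV[R]_N.+1 -> R) : Cc G -> Cc G' ->
  (forall p, is_derive p (evec R ord0) G (G' p)) -> Rint G' = 0.
Proof.
move=> cG cG' dG /=; have [hD hZ _ hB _] := RintP N.
pose H x := Rint (fun y => G (row_cons x y)).
pose H' x := Rint (fun y => G' (row_cons x y)).
have [K1 K10 hK1] := Cc_supp cG; have [K2 K20 hK2] := Cc_supp cG'.
pose K := Num.max K1 K2.
have KK : K1 <= K /\ K2 <= K by rewrite /K !le_max !lexx orbT.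
have K0 : 0 < K by lra.
have dline (s : R) y : is_derive s 1 (fun x => G (row_cons x y)) (G' (row_cons s y)).
  apply: (@is_derive_comp_affine _ _ (fun x : R => row_cons x y) G s 1 (evec R ord0)).
  by move=> h; rewrite evec_ord0 row_consD scaler0 add0r.
have dH (x : R) : is_derive x 1 H (H' x).
  apply: is_derive_eps => e e0.
  pose e' := e / ((2 * K) ^+ N + 1).
  have K22 : 0 <= (2 * K) ^+ N by rewrite exprn_ge0 // mulr_ge0 // ltW.
  have e'0 : 0 < e' by rewrite divr_gt0 //; lra.
  have [d d0 hd] := Cc_unif cG' e'0.
  exists d => // h h0 hd'.
  have -> : H' x - h^-1 * (H (h + x) - H x) =
    Rint (fun y => G' (row_cons x y) + (- h^-1) * (G (row_cons (h + x) y) + (-1) * G (row_cons x y))).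
    rewrite !(hD, hZ); try exact: Cc_section; rewrite /H /H'; first by ring.
    + by apply: CcZ; exact: Cc_section.
    + by apply: CcD; [|apply: CcZ]; exact: Cc_section.
    + by apply: CcZ; apply: CcD; [|apply: CcZ]; exact: Cc_section.
  apply: le_lt_trans (hB _ K e' _ _ _ _ _) _; rewrite ?(ltW K0) ?(ltW e'0) //.
  - apply: CcD; [|apply: CcZ; apply: CcD; [|apply: CcZ]]; exact: Cc_section.
  - move=> y yK.
    have z1 s : G (row_cons s y) = 0.
      apply: hK1; apply: lt_le_trans (row_cons_ger _ _); lra.
    have z2 s : G' (row_cons s y) = 0.
      apply: hK2; apply: lt_le_trans (row_cons_ger _ _); lra.
    by rewrite !z1 z2 !(mulr0, addr0).
  - move=> y; 
    have [t tle e1] := @mvt_local (fun x => G (row_cons x y))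
      (fun x => G' (row_cons x y)) x h (fun t _ => dline (x + t) y).
    rewrite [h + x]addrC mulN1r e1 mulNr mulKf //.
    apply: hd; rewrite row_consB subrr.
    rewrite (_ : x - (x + t) = - t); last by ring.
    by apply: le_lt_trans hd'; apply: row_cons_le; rewrite ?normrN ?normr0.
  rewrite /e' mulrAC ltr_pdivrMr ?ltr_pM2l //; lra.
have hH x : K < `|x| -> H x = 0.
  move=> xK; rewrite /H (@Rint_eq _ _ (fun p => 0 * 0)).
    by rewrite hZ ?mul0r //; exact: Cc0.
  move=> p; rewrite hK1 ?mul0r //; apply: lt_le_trans (row_cons_gel _ _); lra.
have hH' x : K < `|x| -> H' x = 0.
  move=> xK; rewrite /H' (@Rint_eq _ _ (fun p => 0 * 0)).
    by rewrite hZ ?mul0r //; exact: Cc0.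
  move=> p; rewrite hK2 ?mul0r //; apply: lt_le_trans (row_cons_gel _ _); lra.
have cH : continuous H by have [] := Rint_section_Cc1 (RintP N) cG.
have cH' : continuous H' by have [] := Rint_section_Cc1 (RintP N) cG'.
(* [H] is known to vanish only strictly beyond [K], so the endpoints are pushed one unit further. *)
pose L := K + 1.
rewrite -/H' -(@Cc1_restrict H' L); last by move=> x xL; apply: hH'; rewrite /L in xL; lra.
rewrite -Rintegral_mkcond /Rintegral.
rewrite (@continuous_FTC2 R H' H (- L) L).
- have KL : K < `|L| by rewrite gtr0_norm /L; lra.
  by rewrite !hH ?normrN // subee.
- by rewrite /L; lra.
- exact: continuous_subspaceT.
- split.
  + by move=> x _; exact: (@ex_derive _ _ _ _ _ _ _ (dH x)).
  + by apply: cvg_at_right_filter; exact: cH.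
  + by apply: cvg_at_left_filter; exact: cH.
- by move=> x _; rewrite derive1E (@derive_val _ _ _ _ _ _ _ (dH x)).
Qed.

(** The only form of the divergence theorem in use: compact support, hence no boundary term. For a
    later coordinate it holds section by section. *)
Lemma Rint_derive N (i : 'I_N) (G G' : 'rV[R]_N -> R) : Cc G -> Cc G' ->
  (forall p, is_derive p (evec R i) G (G' p)) -> Rint G' = 0.
Proof.
elim: N i G G' => [[]//|N IH] i G G' cG cG'.
case: (unliftP ord0 i) => [j|] -> dG; last exact: Rint_derive_first dG.
rewrite /= (_ : (fun x => _) = fun=> 0).
  by rewrite /Rintegral integral0.
apply/funext => x; apply: (IH j (fun y => G (row_cons x y))).
- exact: Cc_section.
- exact: Cc_section.
move=> y; apply: (@is_derive_comp_affine _ _ (row_cons x) G y (evec R j) (evec R (lift ord0 j))).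
by move=> h; rewrite evec_lift row_consD mulr0 add0r.
Qed.

End IntegralCc.

(** * Directional derivatives and C^2 functions *)

Section Calculus.
Variable R : realType.

Lemma is_derive_cast (V : normedModType R) (F : V -> R) (p v : V) (a b : R) :
  a = b -> is_derive p v F a -> is_derive p v F b.
Proof. by move=> ->. Qed.

Lemma is_derive_add (V : normedModType R) (F G : V -> R) (p v : V) (a b : R) :
  is_derive p v F a -> is_derive p v G b ->
  is_derive p v (fun q => F q + G q) (a + b).
Proof. by move=> dF dG; exact: is_deriveD. Qed.

Lemma is_derive_opp (V : normedModType R) (F : V -> R) (p v : V) (a : R) :
  is_derive p v F a -> is_derive p v (fun q => - F q) (- a).
Proof. by move=> dF; exact: is_deriveN. Qed.

Lemma is_derive_mul (V : normedModType R) (F G : V -> R) (p v : V) (a b : R) :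
  is_derive p v F a -> is_derive p v G b ->
  is_derive p v (fun q => F q * G q) (a * G p + F p * b).
Proof.
move=> dF dG; have := is_deriveM dF dG; apply: is_derive_cast.
by rewrite /GRing.scale /= addrC mulrC.
Qed.

Lemma is_derive_fcst (V : normedModType R) (c : R) (p v : V) :
  is_derive p v (fun _ => c) 0.
Proof. exact: is_derive_cst. Qed.

Lemma is_derive_scale (V : normedModType R) (c : R) (F : V -> R) (p v : V) (a : R) :
  is_derive p v F a -> is_derive p v (fun q => c * F q) (c * a).
Proof.
move=> dF; have := is_derive_mul (is_derive_fcst c p v) dF.
by apply: is_derive_cast; rewrite mul0r add0r.
Qed.

Lemma is_derive_bigsum (V : normedModType R) (I : Type) (s : seq I)
    (F : I -> V -> R) (p v : V) (a : I -> R) :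
  (forall i, is_derive p v (F i) (a i)) ->
  is_derive p v (fun q => \sum_(i <- s) F i q) (\sum_(i <- s) a i).
Proof.
move=> dF; elim: s => [|i s IH].
  rewrite big_nil (_ : (fun q => _) = fun=> 0); first exact: is_derive_fcst.
  by apply/funext => q; rewrite big_nil.
rewrite big_cons (_ : (fun q => _) = fun q => F i q + \sum_(j <- s) F j q).
  exact: is_derive_add.
by apply/funext => q; rewrite big_cons.
Qed.

Lemma is_derive_lineP (V : normedModType R) (F : V -> R) (p v : V) (a : R) :
  is_derive p v F a <-> is_derive (0 : R) 1 (fun s : R => F (s *: v + p)) a.
Proof.
have e : (fun h : R => h^-1 *: (((fun s : R => F (s *: v + p)) \o shift 0) (h *: 1) -
            F ((0 : R) *: v + p))) =
         (fun h : R => h^-1 *: ((F \o shift p) (h *: v) - F p)).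
  by apply/funext => h /=; rewrite addr0 [h *: 1]mulr1 scale0r add0r.
split=> -[dF <-]; split.
- by rewrite /derivable e.
- by rewrite /derive e.
- by move: dF; rewrite /derivable e.
- by rewrite /derive e.
Qed.

Lemma is_derive_chain (V : normedModType R) (phi : R -> R) (F : V -> R)
    (p v : V) (a c : R) :
  is_derive (F p) 1 phi c -> is_derive p v F a ->
  is_derive p v (fun q => phi (F q)) (c * a).
Proof.
move=> dphi /is_derive_lineP dF; apply/is_derive_lineP.
apply: (@is_derive1_comp R phi (fun s : R => F (s *: v + p)) 0).
by rewrite scale0r add0r.
Qed.

Lemma is_derive_inv (V : normedModType R) (F : V -> R) (p v : V) (a : R) :
  F p != 0 -> is_derive p v F a ->
  is_derive p v (fun q => (F q)^-1) (- a / F p ^+ 2).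
Proof.
move=> F0 dF; apply: DeriveDef; first exact: derivableV.
rewrite (deriveV F0) // derive_val /GRing.scale /=; by rewrite mulrC mulrN mulNr.
Qed.

Lemma is_derive_coord N (p : 'rV[R]_N) i j :
  is_derive p (evec R i) (fun q => q ord0 j) (i == j)%:R.
Proof.
apply/is_derive_lineP.
have -> : (fun s : R => (s *: evec R i + p) ord0 j) =
          (fun s => (i == j)%:R * s + p ord0 j).
  by apply/funext => s; rewrite !mxE mulrC.
have h : is_derive (0 : R) 1 (fun s : R => (i == j)%:R * s + p ord0 j)
    ((i == j)%:R * 1 + 0).
  by apply: is_derive_add; apply: is_derive_scale; exact: is_derive_id.
by rewrite mulr1 addr0 in h.
Qed.

Lemma is_derive_continuous1 (f : R -> R) (x d : R) :
  is_derive x 1 f d -> {for x, continuous f}.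
Proof.
move=> df; apply: differentiable_continuous; apply/derivable1_diffP.
exact: ex_derive.
Qed.

(** The truncated power, of class C^(k-1). Polynomial bumps built from it are smooth enough, since
    no cut-off is differentiated more than twice. *)
Definition posp (k : nat) (s : R) : R := Num.max s 0 ^+ k.

Lemma posp_ge0 k s : 0 <= posp k s.
Proof. by rewrite exprn_ge0 // le_max lexx orbT. Qed.

Lemma posp_eq0 k s : s <= 0 -> posp k.+1 s = 0.
Proof. by move=> s0; rewrite /posp max_r // expr0n. Qed.

Lemma posp_gt0 k s : 0 < s -> posp k s = s ^+ k.
Proof. by move=> s0; rewrite /posp max_l // ltW. Qed.

(** In each of the four sign cases the second-order remainder of [posp 2] is at most [h^2], so the
    error of the difference quotient is at most [|h|]. *)
Lemma is_derive_posp2 (s : R) : is_derive s 1 (posp 2) (2 * posp 1 s).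
Proof.
apply: is_derive_eps => e e0; exists e => // h h0 he.
apply: le_lt_trans he.
have -> : 2 * posp 1 s - h^-1 * (posp 2 (h + s) - posp 2 s) =
  - (h^-1 * (posp 2 (h + s) - posp 2 s - 2 * h * posp 1 s)).
  by field.
rewrite normrN normrM normfV ler_pdivrMl ?normr_gt0 // -expr2 real_normK ?num_real //.
rewrite /posp expr1.
by have [h1|h1] := leP (h + s) 0; have [h2|h2] := leP s 0; rewrite ler_norml; nra.
Qed.

Lemma is_derive_posp (k : nat) (s : R) :
  is_derive s 1 (posp k.+2) (k.+2%:R * posp k.+1 s).
Proof.
elim: k s => [|k IH] s; first exact: is_derive_posp2.
have E j (t : R) : posp j.+2 t = t * posp j.+1 t.
  by rewrite /posp !exprS; case: (leP t 0) => // _; rewrite !mul0r mulr0.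
rewrite (_ : posp k.+3 = fun t => t * posp k.+2 t); last exact/funext/E.
have := is_derive_mul (@is_derive_id R R^o s 1) (IH s).
apply: is_derive_cast.
by rewrite mul1r mulrCA -E -[k.+3%:R]natr1; ring.
Qed.

Lemma posp_continuous k : continuous (posp k.+1).
Proof.
move=> s; rewrite /posp.
have c1 : {for s, continuous (fun t : R => Num.max t 0)}.
  have -> : (fun t : R => Num.max t 0) = (fun t => (t + `|t|) / 2).
    by apply/funext => t; case: (leP t 0) => [/ler0_norm|/ltW/ger0_norm] ->; lra.
  apply: cvgMl; apply: cvgD; first exact: cvg_id.
  by apply: cvg_norm; exact: cvg_id.
exact: (@cvg_comp _ _ _ (fun t : R => Num.max t 0) (fun t => t ^+ k.+1) _ _ _ c1 (@exprn_continuous _ _ _)).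
Qed.

(* A C^1 step: 0 up to 1, 1 from 2 on. *)
Definition step (s : R) : R :=
  2 * posp 2 (s - 1) - 4 * posp 2 (s - 3 / 2) + 2 * posp 2 (s - 2).
Definition step' (s : R) : R :=
  4 * posp 1 (s - 1) - 8 * posp 1 (s - 3 / 2) + 4 * posp 1 (s - 2).

Lemma is_derive_step (s : R) : is_derive s 1 step (step' s).
Proof.
have d (c k : R) : is_derive s 1 (fun t => k * posp 2 (t - c)) (k * (2 * posp 1 (s - c) * 1)).
  apply: is_derive_scale; apply: is_derive_chain; first exact: is_derive_posp2.
  have := is_derive_add (@is_derive_id R R^o s 1) (@is_derive_fcst R^o (- c) s 1).
  by apply: is_derive_cast; rewrite addr0.
have := is_derive_add (is_derive_add (d 1 2) (is_derive_opp (d (3/2) 4))) (d 2 2).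
by apply: is_derive_cast; rewrite /step'; ring.
Qed.

Lemma step'_continuous : continuous step'.
Proof.
have c (k a : R) : continuous (fun t => k * posp 1 (t - a)).
  apply: continuous_mulr; first exact: continuous_fcst.
  move=> t; apply: (@cvg_comp _ _ _ (fun t => t - a) (posp 1)); last exact: posp_continuous.
  by apply: cvgB; [exact: cvg_id|exact: cvg_cst].
apply: continuous_addr; last exact: c.
apply: continuous_addr; first exact: c.
by move=> t; apply: cvgN; exact: c.
Qed.

Ltac step_cases s := rewrite /step /step' /posp ?expr1;
  case: (leP (s - 1) 0) => ?; case: (leP (s - 3/2) 0) => ?; case: (leP (s - 2) 0) => ?.

Lemma step_le1 s : s <= 1 -> step s = 0.
Proof. by move=> h; step_cases s; nra. Qed.

Lemma step'_le1 s : s <= 1 -> step' s = 0.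
Proof. by move=> h; step_cases s; lra. Qed.

Lemma step_ge2 s : 2 <= s -> step s = 1.
Proof. by move=> h; step_cases s; try lra; nra. Qed.

Lemma step'_ge2 s : 2 <= s -> step' s = 0.
Proof. by move=> h; step_cases s; lra. Qed.

Lemma step_itv s : 0 <= step s <= 1.
Proof. by step_cases s; try lra; apply/andP; split; nra. Qed.

Lemma step'_itv s : 0 <= step' s <= 2.
Proof. by step_cases s; lra. Qed.

End Calculus.

(** * Relative continuity, Taylor expansion and functions of class C^2 *)

Section C2.
Variable R : realType.

(** Continuity at [p] relative to [A]. With [A = setT] it is interior continuity, with
    [A = closure U] continuity up to the boundary, so that one set of closure rules serves both. *)
Definition contw (V : topologicalType) (A : set V) (p : V) (F : V -> R) :=
  F q @[q --> within A (nbhs p)] --> F p.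

Section Contw.
Context (V : topologicalType) (A : set V) (p : V).
Implicit Types F G : V -> R.

Lemma contw_cst (c : R) : contw A p (fun=> c).
Proof. exact: cvg_cst. Qed.

Lemma contwD F G : contw A p F -> contw A p G -> contw A p (fun q => F q + G q).
Proof. by move=> cF cG; exact: cvgD. Qed.

Lemma contwN F : contw A p F -> contw A p (fun q => - F q).
Proof. by move=> cF; exact: cvgN. Qed.

Lemma contwB F G : contw A p F -> contw A p G -> contw A p (fun q => F q - G q).
Proof. by move=> cF cG; exact: cvgB. Qed.

Lemma contwM F G : contw A p F -> contw A p G -> contw A p (fun q => F q * G q).
Proof. by move=> cF cG; exact: cvgM. Qed.

Lemma contwX F n : contw A p F -> contw A p (fun q => F q ^+ n).
Proof.
move=> cF; elim: n => [|n IH].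
  by rewrite (_ : (fun _ => _) = fun=> 1) //; exact: contw_cst.
rewrite (_ : (fun _ => _) = fun q => F q * F q ^+ n); first exact: contwM.
by apply/funext => q; rewrite exprS.
Qed.

Lemma contwV F : F p != 0 -> contw A p F -> contw A p (fun q => (F q)^-1).
Proof. by move=> F0 cF; exact: cvgV. Qed.

Lemma contw_comp (phi : R -> R) F : {for F p, continuous phi} ->
  contw A p F -> contw A p (fun q => phi (F q)).
Proof. by move=> cphi cF; apply: (@cvg_comp _ _ _ F phi) cF _; exact: cphi. Qed.

Lemma contw_sum (I : Type) (s : seq I) (F : I -> V -> R) :
  (forall i, contw A p (F i)) -> contw A p (fun q => \sum_(i <- s) F i q).
Proof.
move=> cF; elim: s => [|i s IH].
  by rewrite (_ : (fun _ => _) = fun=> 0); [exact: contw_cst|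
    apply/funext => q; rewrite big_nil].
rewrite (_ : (fun _ => _) = fun q => F i q + \sum_(j <- s) F j q).
  exact: contwD.
by apply/funext => q; rewrite big_cons.
Qed.

Lemma contw_near F G : (\forall q \near p, A q -> F q = G q) -> F p = G p ->
  contw A p F -> contw A p G.
Proof.
move=> FG Fp; rewrite /contw -Fp; apply: cvg_trans; apply: near_eq_cvg.
by rewrite near_withinE; apply: filterS FG => q h Aq; rewrite h.
Qed.

Lemma contwS B F : B `<=` A -> contw A p F -> contw B p F.
Proof.
move=> BA; apply: cvg_trans; apply: cvg_app => S.
by rewrite !nbhs_nearE !near_withinE; apply: filterS => q h /BA.
Qed.

Lemma contw_nbhs F : nbhs p A -> contw A p F -> contw setT p F.
Proof.
move=> pA; apply: cvg_trans; apply: cvg_app => S.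
rewrite !nbhs_nearE !near_withinE => h.
by apply: filterS2 pA h => q Aq AS _; exact: AS.
Qed.

Lemma contwTP F : contw setT p F <-> {for p, continuous F}.
Proof.
rewrite /contw (_ : within setT (nbhs p) = nbhs p) //.
rewrite /within /=; apply/funext => S; apply/propext; split => h.
  by apply: filterS (h : nbhs p (fun q => setT q -> S q)) => q; apply.
by apply: filterS h.
Qed.

Lemma contw_gt F (c : R) : contw A p F -> c < F p ->
  \forall q \near p, A q -> c < F q.
Proof.
move=> cF cp; have : \forall q \near within A (nbhs p), c < F q by exact: (cvgr_gt _ cF).
by rewrite near_withinE.
Qed.

Lemma contw_lt F (c : R) : contw A p F -> F p < c ->
  \forall q \near p, A q -> F q < c.
Proof.
move=> cF cp; have : \forall q \near within A (nbhs p), F q < c by exact: (cvgr_lt _ cF).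
by rewrite near_withinE.
Qed.

End Contw.

Lemma contw_epsP (V : normedModType R) (A : set V) (p : V) (F : V -> R) :
  contw A p F <-> (forall e, 0 < e -> exists2 d, 0 < d &
     forall q, A q -> `|p - q| < d -> `|F p - F q| < e).
Proof.
split => [/cvgrPdist_lt cF e e0|h].
  have := cF e e0; rewrite near_withinE => /nbhs_ballP[d /= d0 hd].
  by exists d => // q Aq pq; apply: hd => //; rewrite -ball_normE.
apply/cvgrPdist_lt => e e0; have [d d0 hd] := h e e0.
rewrite near_withinE; apply/nbhs_ballP; exists d => //= q.
by rewrite -ball_normE /= => /hd h1 /h1.
Qed.

Lemma evec_norm N (i : 'I_N) : `|evec R i| <= 1.
Proof.
apply: norm_row_le => // j; rewrite mxE.
by case: (i == j); rewrite ?normr1 ?normr0.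
Qed.

Lemma is_derive_line N (F : 'rV[R]_N -> R) (c v : 'rV[R]_N) (t d : R) :
  is_derive (t *: v + c) v F d -> is_derive t 1 (fun s : R => F (s *: v + c)) d.
Proof.
apply: (@is_derive_comp_affine _ _ _ (fun s : R => s *: v + c) F t 1 v).
by move=> h; rewrite scalerDl [h *: 1]mulr1 addrA.
Qed.

Section Taylor.
Variables (N : nat) (F : 'rV[R]_N -> R) (F1 : 'I_N -> 'rV[R]_N -> R).
Variables (q : 'rV[R]_N) (r : R).
Hypothesis dF : forall p i, `|p - q| <= r -> is_derive p (evec R i) F (F1 i p).

Let trunc (s : seq 'I_N) (h : 'rV[R]_N) : 'rV[R]_N :=
  \row_j (if j \in s then h ord0 j else 0).

(** Go from [q] to [h + q] changing one coordinate at a time, the partial points being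
    [trunc s h + q], and apply the mean value theorem on each leg. All these points stay in the
    sup-norm ball of radius [r]. *)
Lemma C1_taylor (e : R) (h : 'rV[R]_N) :
  (forall p i, `|p - q| <= r -> `|F1 i p - F1 i q| <= e) -> `|h| <= r ->
  `|F (h + q) - F q - \sum_i h ord0 i * F1 i q| <= e * \sum_i `|h ord0 i|.
Proof.
move=> he hr.
have main s : uniq s -> `|F (trunc s h + q) - F q - \sum_(i <- s) h ord0 i * F1 i q|
    <= e * \sum_(i <- s) `|h ord0 i|.
  elim: s => [_|i s IH /= /andP[iNs us]].
    have -> : trunc [::] h = 0 by apply/rowP => j; rewrite !mxE.
    by rewrite !big_nil add0r !subrr normr0 mulr0.
  have E : trunc (i :: s) h = h ord0 i *: evec R i + trunc s h.
    apply/rowP => j; rewrite !mxE in_cons eq_sym.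
    have [<-|ij] := eqVneq i j; first by rewrite (negbTE iNs) mulr1 addr0.
    by rewrite mulr0 add0r.
  have [t|t th e1] := @mvt_local R (fun t => F (t *: evec R i + (trunc s h + q)))
     (fun t => F1 i (t *: evec R i + (trunc s h + q))) 0 (h ord0 i).
    move=> th; rewrite add0r; apply: is_derive_line; apply: dF.
    rewrite addrA addrK; apply: le_trans hr; apply: norm_row_le => // j.
    rewrite !mxE; have [<-|ij] := eqVneq i j.
      by rewrite (negbTE iNs) mulr1 addr0 (le_trans th) // coord_le_norm.
    rewrite mulr0 add0r; case: ifP => // _; first exact: coord_le_norm.
    by rewrite normr0.
  move: e1; rewrite !add0r scale0r add0r => e1.
  rewrite E !big_cons mulrDr -[h ord0 i *: _ + _ + q]addrA.
  set c := trunc s h + q in e1 IH *.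
  have -> : F (h ord0 i *: evec R i + c) - F q - (h ord0 i * F1 i q + \sum_(j <- s) h ord0 j * F1 j q)
    = h ord0 i * (F1 i (t *: evec R i + c) - F1 i q) + (F c - F q - \sum_(j <- s) h ord0 j * F1 j q).
    by rewrite mulrBr -e1; ring.
  apply: le_trans (ler_normD _ _) _; apply: lerD; last exact: IH.
  rewrite normrM mulrC ler_wpM2r //; apply: he.
  rewrite /c addrA addrK; apply: le_trans hr; apply: norm_row_le => // j.
  rewrite !mxE; have [<-|ij] := eqVneq i j.
    by rewrite (negbTE iNs) mulr1 addr0 (le_trans th) // coord_le_norm.
  rewrite mulr0 add0r; case: ifP => // _; first exact: coord_le_norm.
  by rewrite normr0.
have := main (enum 'I_N) (enum_uniq _).
rewrite !big_enum /= (_ : trunc _ h = h) //.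
by apply/rowP => j; rewrite mxE mem_enum.
Qed.

End Taylor.

Lemma sum_coord_le N (h : 'rV[R]_N) : \sum_i `|h ord0 i| <= N%:R * `|h|.
Proof.
apply: (@le_trans _ _ (\sum_(i < N) `|h|)).
  by apply: ler_sum => i _; exact: coord_le_norm.
by rewrite sumr_const card_ord mulr_natl.
Qed.

Definition gradcont N (O : set 'rV[R]_N) (F : 'rV[R]_N -> R) (F1 : 'I_N -> 'rV[R]_N -> R) :=
  forall p, O p -> (forall i, is_derive p (evec R i) F (F1 i p)) /\
    (forall i, contw setT p (F1 i)).

Lemma open_cball N (O : set 'rV[R]_N) p : open O -> O p ->
  exists2 r, 0 < r & forall q, `|q - p| <= r -> O q.
Proof.
move=> oO Op; have /nbhs_ballP[r /= r0 hr] : nbhs p O by exact: open_nbhs_nbhs.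
exists (r / 2); first by rewrite divr_gt0.
move=> q qp; apply: hr; rewrite -ball_normE /= distrC.
by apply: le_lt_trans qp _; lra.
Qed.

Lemma gradcont_taylor N (O : set 'rV[R]_N) F F1 q : open O -> gradcont O F F1 -> O q ->
  forall e, 0 < e -> exists2 d, 0 < d & forall h, `|h| <= d ->
    `|F (h + q) - F q - \sum_i h ord0 i * F1 i q| <= e * `|h|.
Proof.
move=> oO gF Oq e e0; have [r r0 hr] := open_cball oO Oq.
(* The sum of the [|h i|] is at most [N] times the sup norm; the added 1 avoids division by 0. *)
pose e' := e / (N%:R + 1).
have N0 : 0 <= N%:R :> R by [].
have e'0 : 0 < e' by rewrite divr_gt0 //; lra.
have near i : exists2 d, 0 < d & forall p, `|p - q| <= d -> `|F1 i p - F1 i q| <= e'.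
  have [_ /(_ i) /contw_epsP /(_ e' e'0)[d d0 hd]] := gF q Oq.
  exists (d / 2); first by rewrite divr_gt0.
  move=> p pq; rewrite distrC ltW // hd //.
  by rewrite distrC (le_lt_trans pq) //; lra.
have {near} [d d0 hd] : exists2 d, 0 < d & forall i p, `|p - q| <= d -> `|F1 i p - F1 i q| <= e'.
  have : forall i, exists d, 0 < d /\ forall p, `|p - q| <= d -> `|F1 i p - F1 i q| <= e'.
    by move=> i; have [d ? ?] := near i; exists d.
  move=> /choice[dd hdd].
  exists (\big[Num.min/1]_i dd i).
    by apply: lt_bigmin => // i _; have [] := hdd i.
  move=> i p pd; have [_ h] := hdd i; apply: h; apply: le_trans pd _.
  exact: bigmin_le.
exists (Num.min r d); first by rewrite lt_min r0.
move=> h; rewrite le_min => /andP[h1 h2].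
have : `|F (h + q) - F q - \sum_i h ord0 i * F1 i q| <= e' * \sum_i `|h ord0 i|.
  apply: (@C1_taylor N F F1 q (Num.min r d)).
  - move=> p i; rewrite le_min => /andP[pr _]; have [+ _] := gF p (hr _ pr).
    exact.
  - by move=> p i; rewrite le_min => /andP[_ pr]; exact: hd.
  - by rewrite le_min h1.
move=> H; apply: le_trans H _.
apply: le_trans (ler_wpM2l (ltW e'0) (sum_coord_le h)) _.
rewrite mulrA ler_wpM2r // /e' mulrAC ler_pdivrMr ?ler_wpM2l ?(ltW e0) //; lra.
Qed.

Lemma gradcont_is_derive N (O : set 'rV[R]_N) F F1 q v : open O -> gradcont O F F1 -> O q ->
  is_derive q v F (\sum_i v ord0 i * F1 i q).
Proof.
move=> oO gF Oq; apply/is_derive_lineP; apply: is_derive_eps => e e0.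
pose e' := e / (`|v| + 1).
have v0 : 0 <= `|v| by [].
have e'0 : 0 < e' by rewrite divr_gt0 //; lra.
have [d d0 hd] := gradcont_taylor oO gF Oq e'0.
exists (d / (`|v| + 1)); first by rewrite divr_gt0 //; lra.
move=> h h0 hh; rewrite addr0 scale0r add0r.
have hv : `|h *: v| <= d.
  rewrite normrZ; rewrite ltr_pdivlMr in hh; last by lra.
  have := normr_ge0 h; nra.
have := hd _ hv.
have -> : \sum_i (h *: v) ord0 i * F1 i q = h * \sum_i v ord0 i * F1 i q.
  by rewrite mulr_sumr; apply: eq_bigr => i _; rewrite mxE mulrA.
set S := \sum_i _ => H.
have -> : S - h^-1 * (F (h *: v + q) - F q) = - (h^-1 * (F (h *: v + q) - F q - h * S)).
  by field.
rewrite normrN normrM normfV mulrC ltr_pdivrMr ?normr_gt0 //.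
apply: le_lt_trans H _; rewrite normrZ mulrA [e' * _]mulrC -mulrA [e * _]mulrC.
rewrite ltr_pM2l ?normr_gt0 // /e' mulrAC ltr_pdivrMr ?ltr_pM2l //; lra.
Qed.

(** * Symmetry of the second derivatives *)

Section Schwarz.
Variables (N : nat) (F : 'rV[R]_N -> R) (F1 : 'I_N -> 'rV[R]_N -> R).
Variable (F2 : 'I_N -> 'I_N -> 'rV[R]_N -> R).
Variables (q : 'rV[R]_N) (r : R).
Hypothesis dF : forall p i, `|p - q| <= r -> is_derive p (evec R i) F (F1 i p).
Hypothesis dF1 : forall p i j, `|p - q| <= r -> is_derive p (evec R j) (F1 i) (F2 i j p).

(** The mean value theorem in direction [i], applied to the increment in direction [j], and then in
    direction [j]. *)
Lemma double_difference i j h : 0 < h -> 2 * h <= r ->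
  exists2 p, `|p - q| <= 2 * h &
  F (h *: evec R i + (h *: evec R j + q)) - F (h *: evec R i + q)
    - F (h *: evec R j + q) + F q = h * (h * F2 i j p).
Proof.
move=> h0 hr.
have nb (t s : R) : `|t| <= h -> `|s| <= h -> `|t *: evec R i + (s *: evec R j + q) - q| <= 2 * h.
  move=> th sh; rewrite addrA addrK; apply: le_trans (ler_normD _ _) _.
  rewrite !normrZ; have := evec_norm i; have := evec_norm j.
  have := normr_ge0 t; have := normr_ge0 s; nra.
have h0' : `|0 : R| <= h by rewrite normr0 ltW.
have [t th|t th e1] := @mvt_local R (fun t => F (t *: evec R i + (h *: evec R j + q)) - F (t *: evec R i + q))
  (fun t => F1 i (t *: evec R i + (h *: evec R j + q)) - F1 i (t *: evec R i + q)) 0 h.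
  rewrite add0r; rewrite (gtr0_norm h0) in th.
  apply: is_derive_add; last apply: is_derive_opp; apply: is_derive_line; apply: dF.
    by apply: le_trans hr; apply: nb => //; rewrite gtr0_norm.
  have := nb t 0 th h0'; rewrite scale0r add0r => H; exact: le_trans hr.
rewrite (gtr0_norm h0) in th.
have [s sh|s sh e2] := @mvt_local R (fun s => F1 i (s *: evec R j + (t *: evec R i + q)))
  (fun s => F2 i j (s *: evec R j + (t *: evec R i + q))) 0 h.
  rewrite add0r; rewrite (gtr0_norm h0) in sh; apply: is_derive_line; apply: dF1.
  by rewrite addrCA; apply: le_trans hr; exact: nb.
rewrite (gtr0_norm h0) in sh.
exists (s *: evec R j + (t *: evec R i + q)); first by rewrite addrCA; exact: nb.
move: e1 e2; rewrite !add0r !scale0r !add0r => e1 e2.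
rewrite -e2 [h *: evec R j + (t *: _ + _)]addrCA -e1; ring.
Qed.

(** The double difference is symmetric in [i] and [j], so the two mixed derivatives coincide at a
    pair of points that both tend to [q]. In the Carleman identity this is what lets the terms with
    second derivatives cancel. *)
Lemma schwarz_sym i j : 0 < r -> contw setT q (F2 i j) -> contw setT q (F2 j i) ->
  F2 i j q = F2 j i q.
Proof.
move=> r0 /contw_epsP c1 /contw_epsP c2; apply/eqP; rewrite eq_le.
suff H : forall e, 0 < e -> `|F2 i j q - F2 j i q| <= e.
  by apply/andP; split; apply/ler_addgt0Pr => e /H; rewrite ler_norml => /andP[]; lra.
move=> e e0; have e20 : 0 < e / 2 by rewrite divr_gt0.
have [d1 d10 h1] := c1 _ e20; have [d2 d20 h2] := c2 _ e20.
pose h := Num.min (r / 2) (Num.min (d1 / 4) (d2 / 4)).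
have h0 : 0 < h by rewrite !lt_min !divr_gt0.
have [hr [hd1 hd2]] : h <= r / 2 /\ h <= d1 / 4 /\ h <= d2 / 4.
  by rewrite /h !ge_min !lexx ?orbT.
have [|p pq e1] := @double_difference i j h h0; first by lra.
have [|p' pq' e2] := @double_difference j i h h0; first by lra.
have E : F2 i j p = F2 j i p'.
  apply: (mulfI (lt0r_neq0 h0)); apply: (mulfI (lt0r_neq0 h0)).
  by rewrite -e1 -e2 [h *: evec R i + (h *: _ + _)]addrCA; ring.
have k1 : `|F2 i j q - F2 i j p| < e / 2.
  by apply: h1 => //; rewrite distrC (le_lt_trans pq) //; lra.
have k2 : `|F2 j i q - F2 j i p'| < e / 2.
  by apply: h2 => //; rewrite distrC (le_lt_trans pq') //; lra.
have -> : F2 i j q - F2 j i q = (F2 i j q - F2 i j p) - (F2 j i q - F2 j i p').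
  by rewrite E; ring.
by apply: le_trans (ler_normB _ _) _; lra.
Qed.

End Schwarz.

(** The derivatives are carried as explicit functions. This gives closed formulas for products and
    compositions, and lets [F1] be a continuous extension of the gradient beyond [O]. *)
Definition C2d N (O : set 'rV[R]_N) (F : 'rV[R]_N -> R)
    (F1 : 'I_N -> 'rV[R]_N -> R) (F2 : 'I_N -> 'I_N -> 'rV[R]_N -> R) :=
  forall p, O p ->
  [/\ contw setT p F, forall i, contw setT p (F1 i),
      forall i j, contw setT p (F2 i j),
      forall i, is_derive p (evec R i) F (F1 i p) &
      forall i j, is_derive p (evec R j) (F1 i) (F2 i j p)].

Lemma C2d_gradcont N (O : set 'rV[R]_N) F F1 F2 : C2d O F F1 F2 -> gradcont O F F1.
Proof. by move=> h p /h []. Qed.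

Lemma C2dS N (O O' : set 'rV[R]_N) F F1 F2 : O' `<=` O -> C2d O F F1 F2 -> C2d O' F F1 F2.
Proof. by move=> OO h p /OO /h. Qed.

Lemma C2d_sym N (O : set 'rV[R]_N) F F1 F2 : open O -> C2d O F F1 F2 ->
  forall p i j, O p -> F2 i j p = F2 j i p.
Proof.
move=> oO h p i j Op; have [r r0 hr] := open_cball oO Op.
apply: (@schwarz_sym N F F1 F2 p r) => //.
- by move=> q k qr; have [_ _ _ + _] := h q (hr _ qr); apply.
- by move=> q k l qr; have [_ _ _ _ +] := h q (hr _ qr); apply.
- by have [_ _ + _ _] := h p Op.
- by have [_ _ + _ _] := h p Op.
Qed.

Lemma C2dM N (O : set 'rV[R]_N) F F1 F2 G G1 G2 :
  C2d O F F1 F2 -> C2d O G G1 G2 ->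
  C2d O (fun p => F p * G p) (fun i p => F1 i p * G p + F p * G1 i p)
    (fun i j p => F2 i j p * G p + F1 i p * G1 j p + (F1 j p * G1 i p + F p * G2 i j p)).
Proof.
move=> hF hG p Op; have [f0 f1 f2 f3 f4] := hF p Op.
have [g0 g1 g2 g3 g4] := hG p Op; split.
- exact: contwM.
- by move=> i; apply: contwD; exact: contwM.
- by move=> i j; apply: contwD; apply: contwD; exact: contwM.
- by move=> i; exact: is_derive_mul.
- by move=> i j; apply: is_derive_add; exact: is_derive_mul.
Qed.

Lemma C2dD N (O : set 'rV[R]_N) F F1 F2 G G1 G2 :
  C2d O F F1 F2 -> C2d O G G1 G2 ->
  C2d O (fun p => F p + G p) (fun i p => F1 i p + G1 i p)
    (fun i j p => F2 i j p + G2 i j p).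
Proof.
move=> hF hG p Op; have [f0 f1 f2 f3 f4] := hF p Op.
have [g0 g1 g2 g3 g4] := hG p Op; split.
- exact: contwD.
- by move=> i; exact: contwD.
- by move=> i j; exact: contwD.
- by move=> i; exact: is_derive_add.
- by move=> i j; exact: is_derive_add.
Qed.

Lemma C2d_cst N (O : set 'rV[R]_N) (c : R) :
  C2d O (fun=> c) (fun _ _ => 0) (fun _ _ _ => 0).
Proof.
by move=> p _; split=> *; try exact: contw_cst; exact: is_derive_fcst.
Qed.

Lemma C2d_sum N (O : set 'rV[R]_N) (I : eqType) (s : seq I) (F : I -> 'rV[R]_N -> R) F1 F2 :
  (forall k, k \in s -> C2d O (F k) (F1 k) (F2 k)) ->
  C2d O (fun p => \sum_(k <- s) F k p) (fun i p => \sum_(k <- s) F1 k i p)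
    (fun i j p => \sum_(k <- s) F2 k i j p).
Proof.
elim: s => [_|k s IH h].
  have := @C2d_cst N O 0; congr C2d; apply/funext => ?; rewrite ?big_nil //;
    apply/funext => ?; rewrite ?big_nil //; apply/funext => ?; by rewrite ?big_nil.
have hs j : j \in s -> C2d O (F j) (F1 j) (F2 j).
  by move=> js; apply: h; rewrite in_cons js orbT.
have := C2dD (h k (mem_head _ _)) (IH hs).
congr C2d; apply/funext => ?; rewrite ?big_cons //;
  apply/funext => ?; rewrite ?big_cons //; apply/funext => ?; by rewrite ?big_cons.
Qed.

Lemma C2d_comp N (O : set 'rV[R]_N) F F1 F2 (phi phi1 phi2 : R -> R) :
  C2d O F F1 F2 ->
  (forall p, O p -> [/\ is_derive (F p) 1 phi (phi1 (F p)),
     is_derive (F p) 1 phi1 (phi2 (F p)) & {for F p, continuous phi2}]) ->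
  C2d O (fun p => phi (F p)) (fun i p => phi1 (F p) * F1 i p)
    (fun i j p => phi2 (F p) * F1 j p * F1 i p + phi1 (F p) * F2 i j p).
Proof.
move=> hF hphi p Op; have [f0 f1 f2 f3 f4] := hF p Op.
have [d1 d2 c2] := hphi p Op.
have c0 : contw setT p (fun q => phi (F q)).
  by apply: contw_comp f0; exact: is_derive_continuous1 d1.
have c1 : contw setT p (fun q => phi1 (F q)).
  by apply: contw_comp f0; exact: is_derive_continuous1 d2.
split=> //.
- by move=> i; exact: contwM.
- move=> i j; apply: contwD; apply: contwM => //; apply: contwM => //.
  exact: contw_comp.
- by move=> i; exact: is_derive_chain.
- by move=> i j; apply: is_derive_mul => //; exact: is_derive_chain.
Qed.

(** Extension by zero: [F] is controlled only on [O], but near a point off the closed set [K] the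
    product and all its derivatives vanish identically. *)
Lemma C2dM_supp N (O K : set 'rV[R]_N) B B1 B2 F F1 F2 :
  open O -> closed K -> K `<=` O -> C2d setT B B1 B2 -> C2d O F F1 F2 ->
  (forall p, ~ K p -> [/\ B p = 0, forall i, B1 i p = 0 & forall i j, B2 i j p = 0]) ->
  C2d setT (fun p => B p * F p) (fun i p => B1 i p * F p + B p * F1 i p)
    (fun i j p => B2 i j p * F p + B1 i p * F1 j p + (B1 j p * F1 i p + B p * F2 i j p)).
Proof.
move=> oO cK KO hB hF h0 p _.
have [Kp|Kp] := pselect (K p).
  by apply: (C2dM (C2dS (@subsetT _ _) hB) hF); exact: KO.
have nK : \forall q \near p, ~ K q.
  by apply: open_nbhs_nbhs; split => //; exact: closed_openC.
have zc (G : 'rV[R]_N -> R) : (forall q, ~ K q -> G q = 0) -> contw setT p G.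
  move=> G0; apply: (@contw_near _ _ _ (fun=> 0)); [|by rewrite G0|exact: contw_cst].
  by apply: filterS nK => q /G0 ->.
have zd (G : 'rV[R]_N -> R) v : (forall q, ~ K q -> G q = 0) -> is_derive p v G 0.
  move=> G0; apply: (@near_eq_is_derive _ _ _ (fun=> 0)).
  by apply: filterS nK => q /G0 ->.
have e0 q : ~ K q -> B q * F q = 0 by move=> /h0[-> _ _]; rewrite mul0r.
have e1 i q : ~ K q -> B1 i q * F q + B q * F1 i q = 0.
  by move=> /h0[-> -> _]; rewrite !mul0r addr0.
have e2 i j q : ~ K q -> B2 i j q * F q + B1 i q * F1 j q + (B1 j q * F1 i q + B q * F2 i j q) = 0.
  by move=> /h0[-> h1 ->]; rewrite !h1 !mul0r !addr0.
split; [exact: zc|by move=> i; exact: zc (e1 i)|by move=> i j; exact: zc (e2 i j)| |].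
- by move=> i; rewrite e1 //; exact: zd.
- by move=> i j; rewrite e2 //; exact: zd (e1 i).
Qed.

End C2.

(** * A global defining function *)

Section Domain.
Variable R : realType.

Lemma contw_coord N (A : set 'rV[R]_N) p i : contw A p (fun q => q ord0 i).
Proof.
apply/contw_epsP => e e0; exists e => // q _ pq.
apply: le_lt_trans pq; rewrite -(_ : (p - q) ord0 i = p ord0 i - q ord0 i).
  exact: coord_le_norm.
by rewrite !mxE.
Qed.

Lemma sum_delta N (i : 'I_N) (g : 'I_N -> R) : \sum_j (i == j)%:R * g j = g i.
Proof.
rewrite (bigD1 i) //= eqxx mul1r big1 ?addr0 // => j.
by rewrite eq_sym => /negbTE ->; rewrite mul0r.
Qed.

(** Covers at once the Euclidean square, the square of the spatial radius and the indefinite form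
    [ff]. *)
Lemma C2d_diag N (c : 'I_N -> R) (y : 'rV[R]_N) :
  C2d setT (fun p => \sum_k c k * (p ord0 k - y ord0 k) ^+ 2)
    (fun i p => 2 * c i * (p ord0 i - y ord0 i))
    (fun i j _ => 2 * c i * (j == i)%:R).
Proof.
move=> p _.
have cc k : contw setT p (fun q => q ord0 k - y ord0 k).
  by apply: contwB; [exact: contw_coord|exact: contw_cst].
have dc i k : is_derive p (evec R i) (fun q => q ord0 k - y ord0 k) (i == k)%:R.
  have := is_derive_add (is_derive_coord p i k) (is_derive_fcst (- y ord0 k) p (evec R i)).
  by apply: is_derive_cast; rewrite addr0.
split.
- by apply: contw_sum => k; apply: contwM; [exact: contw_cst|exact: contwX].
- by move=> i; apply: contwM => //; exact: contw_cst.
- by move=> i j; exact: contw_cst.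
- move=> i.
  have := @is_derive_bigsum R _ _ (index_enum 'I_N) _ p (evec R i) _
     (fun k => is_derive_scale (c k) (is_derive_mul (dc i k) (dc i k))).
  apply: is_derive_cast; rewrite (eq_bigr (fun k => (i == k)%:R * (2 * c k * (p ord0 k - y ord0 k)))).
    exact: sum_delta.
  by move=> k _; ring.
- by move=> i j; apply: is_derive_scale; exact: dc.
Qed.

Definition esq N (x : 'rV[R]_N) : R := dotv x x.

Lemma esqE N (x : 'rV[R]_N) : esq x = \sum_i x ord0 i ^+ 2.
Proof. by apply: eq_bigr => i _; rewrite expr2. Qed.

Lemma esq_ge0 N (x : 'rV[R]_N) : 0 <= esq x.
Proof. by rewrite esqE sumr_ge0 // => i _; rewrite sqr_ge0. Qed.

Lemma coord_sq_le_esq N (x : 'rV[R]_N) i : x ord0 i ^+ 2 <= esq x.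
Proof.
by rewrite esqE (bigD1 i) //= lerDl sumr_ge0 // => j _; rewrite sqr_ge0.
Qed.

Lemma norm_sq_le_esq N (x : 'rV[R]_N) : `|x| ^+ 2 <= esq x.
Proof.
rewrite -[leRHS]sqr_sqrtr ?esq_ge0 // lerXn2r ?nnegrE ?sqrtr_ge0 //.
apply: norm_row_le; first exact: sqrtr_ge0.
by move=> i; rewrite -sqrtr_sqr ler_wsqrtr // coord_sq_le_esq.
Qed.

Lemma esq_eq0 N (x : 'rV[R]_N) : esq x = 0 -> x = 0.
Proof.
move=> x0; apply/rowP => i; rewrite mxE; apply/eqP.
by rewrite -sqrf_eq0 eq_le sqr_ge0 andbT -x0 coord_sq_le_esq.
Qed.

Lemma esq_gt0 N (x : 'rV[R]_N) : x != 0 -> 0 < esq x.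
Proof.
move=> x0; rewrite lt_neqAle esq_ge0 andbT eq_sym.
by apply: contra x0 => /eqP /esq_eq0 ->.
Qed.

Lemma C2d_esq N (y : 'rV[R]_N) :
  C2d setT (fun x => esq (x - y)) (fun i p => 2 * (p ord0 i - y ord0 i))
    (fun i j _ => 2 * (j == i)%:R).
Proof.
have := C2d_diag (fun _ : 'I_N => 1) y.
rewrite (_ : (fun p => _) = (fun x => esq (x - y))).
  by rewrite mulr1.
apply/funext => x; rewrite esqE; apply: eq_bigr => i _.
by rewrite mul1r !mxE.
Qed.

(** The third truncated power is the lowest one of class C^2. The radius enters through its square,
    which keeps the bump smooth at its centre. *)
Lemma C2d_bump N (y : 'rV[R]_N) (s : R) :
  C2d setT (fun x => posp 3 (s - esq (x - y)))
    (fun i x => 3 * posp 2 (s - esq (x - y)) * (- (2 * (x ord0 i - y ord0 i))))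
    (fun i j x => 3 * (2 * posp 1 (s - esq (x - y))) * (- (2 * (x ord0 j - y ord0 j))) * (- (2 * (x ord0 i - y ord0 i)))
      + 3 * posp 2 (s - esq (x - y)) * (- (2 * (j == i)%:R))).
Proof.
have h : C2d setT (fun x => s - esq (x - y)) (fun i p => - (2 * (p ord0 i - y ord0 i)))
    (fun i j _ => - (2 * (j == i)%:R)).
  move=> p _; have [c0 c1 c2 d1 d2] := @C2d_esq N y p I; split.
  - by apply: contwB => //; exact: contw_cst.
  - by move=> i; exact: contwN.
  - by move=> i j; exact: contwN.
  - move=> i; have := is_derive_add (is_derive_fcst s p (evec R i)) (is_derive_opp (d1 i)).
    by apply: is_derive_cast; rewrite add0r.
  - by move=> i j; exact: is_derive_opp.
apply: (@C2d_comp R N setT _ _ _ (posp 3) (fun t => 3 * posp 2 t) (fun t => 3 * (2 * posp 1 t)) h).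
move=> p _; split.
- exact: is_derive_posp.
- by apply: is_derive_scale; exact: is_derive_posp2.
- apply: continuous_mulr; first exact: continuous_fcst.
  by apply: continuous_mulr; [exact: continuous_fcst|exact: posp_continuous].
Qed.

Lemma finite_ball_cover N (A D : set 'rV[R]_N) (r : 'rV[R]_N -> R) : compact A ->
  (forall y, A y -> exists2 x, D x & esq (y - x) < r x) ->
  exists s : seq 'rV[R]_N, (forall x, x \in s -> D x) /\
    forall y, A y -> exists2 x, x \in s & esq (y - x) < r x.
Proof.
rewrite compact_cover => cA h.
have [||s sD hs] := cA 'rV[R]_N D (fun x => [set y | esq (y - x) < r x]).
- move=> x _; rewrite openE => y /= yx.
  have [c0 _ _ _ _] := @C2d_esq N x y I.
  by have := contw_lt c0 yx; apply: filterS => q; apply.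
- by move=> y /h[x Dx yx]; exists x.
exists (finmap.enum_fset s); split.
  by move=> x xs; have := sD x xs; rewrite inE.
by move=> y /hs[x /= xs yx]; exists x.
Qed.

(** Let [v0] be the part of [g'] orthogonal to [g]. Testing with [v0 - d g] and letting [d] tend to
    0 gives [|v0|^2 <= 0]; testing with [- g] gives the sign of the factor. *)
Lemma proportional_normals N (g g' : 'rV[R]_N) : g != 0 -> g' != 0 ->
  (forall v, dotv g v < 0 -> dotv g' v <= 0) ->
  exists2 c, 0 < c & g' = c *: g.
Proof.
move=> g0 g'0 h.
have dl (u v w : 'rV[R]_N) (a b : R) : dotv u (a *: v + b *: w) = a * dotv u v + b * dotv u w.
  rewrite /dotv !mulr_sumr -big_split /=; apply: eq_bigr => i _; rewrite !mxE; ring.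
have dC (u v : 'rV[R]_N) : dotv u v = dotv v u.
  by apply: eq_bigr => i _; rewrite mulrC.
have G0 : 0 < dotv g g by exact: esq_gt0.
pose c := dotv g' g / dotv g g.
have [v0 v0E] : exists v0, v0 = 1 *: g' + (- c) *: g by eexists.
have gv0 : dotv g v0 = 0.
  by rewrite v0E dl (dC g g') /c; field; rewrite lt0r_neq0.
have g'v0 : dotv g' v0 = esq v0.
  have -> : esq v0 = 1 * dotv v0 g' + (- c) * dotv v0 g by rewrite -dl -v0E.
  by rewrite (dC v0 g) gv0 (dC v0 g'); ring.
have v00 : v0 = 0.
  apply: esq_eq0; apply/eqP; rewrite eq_le esq_ge0 andbT; apply/ler_addgt0Pl => e e0.
  pose d := e / (`|dotv g' g| + 1).
  have N0 := normr_ge0 (dotv g' g).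
  have d0 : 0 < d by rewrite divr_gt0 //; lra.
  have := h ((- d) *: g + 1 *: v0); rewrite !dl gv0 g'v0.
  move=> /(_ _) H; have {}H : - d * dotv g' g + 1 * esq v0 <= 0 by apply: H; nra.
  have : d * dotv g' g <= e.
    apply: (@le_trans _ _ (d * `|dotv g' g|)); first by rewrite ler_pM2l // ler_norm.
    by rewrite /d mulrAC ler_pdivrMr ?ler_pM2l //; lra.
  lra.
have E : g' = c *: g.
  apply/rowP => i; move: v0E; rewrite v00 => /rowP /(_ i).
  by rewrite !mxE; lra.
exists c => //; rewrite lt_neqAle; apply/andP; split.
  by apply: contra g'0 => /eqP c0; rewrite E -c0 scale0r.
have := h (- g); have -> : - g = (-1) *: g + 0 *: g by rewrite scale0r addr0 scaleN1r.
rewrite !dl => /(_ _) H; have {}H : -1 * dotv g' g + 0 * dotv g' g <= 0 by apply: H; lra.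
by rewrite /c divr_ge0 ?(ltW G0) //; lra.
Qed.

Lemma evec_grad N (F : 'rV[R]_N -> R) V : open V -> smooth_on V F ->
  C2d V F (fun i => partial i F) (fun i j => partial j (partial i F)).
Proof.
move=> oV sF p Vp; split.
- by have [/(_ p) c _] := sF [::]; apply/contwTP; apply: c; rewrite inE.
- by move=> i; have [/(_ p) c _] := sF [:: i]; apply/contwTP; apply: c; rewrite inE.
- by move=> i j; have [/(_ p) c _] := sF [:: j; i]; apply/contwTP; apply: c; rewrite inE.
- by move=> i; have [_ d] := sF [::]; apply: derivableP; exact: d.
- by move=> i j; have [_ d] := sF [:: i]; apply: derivableP; exact: d.
Qed.

Section GlobalDefining.
Variables (n : nat) (Om : set 'rV[R]_n) (nu : 'rV[R]_n -> 'rV[R]_n).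
Hypotheses (oOm : open Om) (bOm : bounded_set Om) (sOm : smooth_boundary_normal Om nu).
Let bd := closure Om `\` Om.

Lemma bounded_closure_compact (A : set 'rV[R]_n) : bounded_set A -> compact (closure A).
Proof.
move=> [M [Mr hM]]; apply: bounded_closed_compact; last exact: closed_closure.
exists (M + 1); split; first exact: num_real.
move=> K MK p /= cp; apply: le_trans (ltW MK).
have cl : closed [set q : 'rV[R]_n | `|q| <= M + 1].
  rewrite (_ : mkset _ = Num.norm @^-1` [set x : R | x <= M + 1]) //.
  by apply: preimage_closed; [move=> q _; exact: norm_continuous|exact: closed_le].
apply: (cl p); move: cp; apply: closure_subset => q Aq /=.
by apply: hM Aq; rewrite ltrDl.
Qed.

Lemma bd_defining_eq0 (V : set 'rV[R]_n) F F1 F2 : open V ->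
  C2d V F F1 F2 -> (forall x, V x -> (Om x <-> F x < 0)) ->
  forall x, V x -> bd x -> F x = 0.
Proof.
move=> oV gF hF x Vx [cx nx].
have F0 : 0 <= F x by rewrite leNgt; apply/negP => /(hF x Vx).
apply/eqP; rewrite eq_le F0 andbT leNgt; apply/negP => F1x.
have [cF _ _ _ _] := gF x Vx.
have nV : nbhs x V by exact: open_nbhs_nbhs.
have [q [Omq [Vq Fq]]] := cx _ (filterI nV (contw_gt cF F1x)).
by have /hF := Omq; rewrite ltNge (ltW (Fq I)) => /(_ Vq).
Qed.

Lemma dir_taylor (V : set 'rV[R]_n) F F1 x v (e : R) : open V -> gradcont V F F1 ->
  V x -> 0 < e -> exists2 s0, 0 < s0 & forall s, 0 < s -> s <= s0 -> V (s *: v + x) /\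
    `|F (s *: v + x) - F x - s * \sum_i v ord0 i * F1 i x| <= e * s.
Proof.
move=> oV gF Vx e0.
pose e' := e / (`|v| + 1).
have v0 := normr_ge0 v.
have e'0 : 0 < e' by rewrite divr_gt0 //; lra.
have [d d0 hd] := gradcont_taylor oV gF Vx e'0.
have [r r0 hr] := open_cball oV Vx.
exists (Num.min d r / (`|v| + 1)); first by rewrite divr_gt0 ?lt_min ?d0 //; lra.
move=> s s0; rewrite ler_pdivlMr; last by lra.
rewrite le_min => /andP[sd sr].
have hv : `|s *: v| <= s * (`|v| + 1) by rewrite normrZ gtr0_norm // ler_pM2l //; lra.
split; first by apply: hr; rewrite addrK (le_trans hv).
have := hd _ (le_trans hv sd).
have -> : \sum_i (s *: v) ord0 i * F1 i x = s * \sum_i v ord0 i * F1 i x.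
  by rewrite mulr_sumr; apply: eq_bigr => i _; rewrite mxE mulrA.
move=> H; apply: le_trans H _; rewrite normrZ gtr0_norm // mulrCA [e * s]mulrC.
by rewrite ler_pM2l // /e' mulrAC ler_pdivrMr ?ler_pM2l //; lra.
Qed.

(** [nu x] is given by an unspecified chart at each boundary point. Two functions negative exactly
    on [Om] cannot disagree to first order on a direction: a short step along it would be inside by
    one and outside by the other. Hence their gradients are positively proportional. *)
Lemma chart_normal (V : set 'rV[R]_n) F F1 F2 : open V ->
  C2d V F F1 F2 -> (forall x, V x -> (Om x <-> F x < 0)) ->
  forall x, V x -> bd x -> (\row_j F1 j x) != 0 ->
  exists2 c, 0 < c & forall j, F1 j x = c * nu x ord0 j.
Proof.
move=> oV gF hF x Vx bx F10; have [W [rho [[oW Wx] srho rho0 hrho nux]]] := sOm bx.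
have grho := evec_grad oW srho.
have Fx := bd_defining_eq0 oV gF hF Vx bx.
have rx := bd_defining_eq0 oW grho hrho Wx bx.
have dE (g v : 'rV[R]_n) : dotv g v = \sum_i v ord0 i * g ord0 i.
  by apply: eq_bigr => i _; rewrite mulrC.
have [|c c0 hc] := proportional_normals (rho0 x Wx) F10.
  move=> v; rewrite !dE; set d1 := \sum_i _; set d2 := \sum_i _ => d10.
  rewrite leNgt; apply/negP => d20.
  have d1E : \sum_i v ord0 i * partial i rho x = d1.
    by apply: eq_bigr => i _; rewrite !mxE.
  have d2E : \sum_i v ord0 i * F1 i x = d2.
    by apply: eq_bigr => i _; rewrite !mxE.
  have e10 : 0 < - d1 / 2 by lra.
  have e20 : 0 < d2 / 2 by lra.
  have [s1 s10 h1] := dir_taylor v oW (C2d_gradcont grho) Wx e10.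
  have [s2 s20 h2] := dir_taylor v oV (C2d_gradcont gF) Vx e20.
  pose s := Num.min s1 s2.
  have s0 : 0 < s by rewrite lt_min s10.
  have [|W1] := h1 s s0; first by rewrite /s ge_min lexx.
  have [|V1] := h2 s s0; first by rewrite /s ge_min lexx orbT.
  rewrite d1E d2E rx Fx !subr0 !ler_norml => /andP[k1 k2] /andP[k3 k4].
  have : Om (s *: v + x) by apply/(hrho _ W1); nra.
  by move=> /(hF _ V1); nra.
have e0 : 0 < enorm (grad rho x) by rewrite sqrtr_gt0; exact: esq_gt0 (rho0 x Wx).
exists (c * enorm (grad rho x)); first exact: mulr_gt0.
move=> j; have /rowP /(_ j) := hc; rewrite nux !mxE => ->.
by rewrite -mulrA mulVKf // lt0r_neq0.
Qed.

Let chart := (R * set 'rV[R]_n * ('rV[R]_n -> R) * ('I_n -> 'rV[R]_n -> R) *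
  ('I_n -> 'I_n -> 'rV[R]_n -> R))%type.

(** [r] is a squared Euclidean radius, to match the bump [posp 3 (r - esq (x - y))]. *)
Let chartP (y : 'rV[R]_n) (d : chart) :=
  let: (r, V, F, F1, F2) := d in
  [/\ 0 < r /\ open V, (forall x, esq (x - y) <= r -> V x), C2d V F F1 F2,
      (forall x, V x -> (Om x <-> F x < 0)) &
      (forall x, V x -> bd x -> exists2 c, 0 < c & forall j, F1 j x = c * nu x ord0 j)].

Lemma open_esq_ball (V : set 'rV[R]_n) y : open V -> V y ->
  exists2 r, 0 < r & forall x, esq (x - y) <= r -> V x.
Proof.
move=> oV Vy; have [r r0 hr] := open_cball oV Vy.
exists (r ^+ 2); first exact: exprn_gt0.
move=> x xy; apply: hr; rewrite -ler_sqr ?nnegrE ?(ltW r0) //.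
exact: le_trans (norm_sq_le_esq _) xy.
Qed.

Lemma exists_chart y : closure Om y -> exists d, chartP y d.
Proof.
move=> cy; have [Oy|Oy] := pselect (Om y).
  have [r r0 hr] := open_esq_ball oOm Oy.
  (* Around an interior point the constant -1 serves as defining function, and its clause about
     boundary points is void. *)
  exists (r, Om, fun=> -1, fun _ _ => 0, fun _ _ _ => 0); split => //.
  - exact: C2d_cst.
  - by move=> x Ox [].
have [V [rho [[oV Vy] srho rho0 hrho _]]] := sOm (conj cy Oy).
have [r r0 hr] := open_esq_ball oV Vy.
exists (r, V, rho, fun i => partial i rho, fun i j => partial j (partial i rho)).
split => //; first exact: evec_grad.
move=> x Vx bx; apply: (chart_normal oV (evec_grad oV srho) hrho Vx bx).
exact: rho0.
Qed.

Lemma nu_neq0 x : bd x -> exists j, nu x ord0 j != 0.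
Proof.
move=> bx; have [V [rho [[oV Vy] srho rho0 hrho nux]]] := sOm bx.
have g0 := rho0 x Vy.
have [//|H] := pselect (exists j, nu x ord0 j != 0).
case/negP: g0; apply/eqP/rowP => j; rewrite [RHS]mxE.
have : nu x ord0 j = 0.
  by apply/eqP; apply/negPn/negP => nj; apply: H; exists j.
rewrite nux mxE => /eqP; rewrite mulf_eq0 invr_eq0 => /orP[|/eqP //].
by rewrite gt_eqF // sqrtr_gt0; exact: esq_gt0 (rho0 x Vy).
Qed.

(** A finite sum of bumps times local defining functions. Nothing is normalised, as only signs
    matter: all local functions have the sign prescribed by [Om], so they cannot cancel. At a
    boundary point each [F y] under a nonzero bump vanishes, so the gradient reduces to the sum of
    [b * F1], a nonnegative combination of multiples of [nu]. *)
Lemma global_defining_function : exists rho rho1 rho2,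
  [/\ C2d setT rho rho1 rho2, (forall x, Om x -> rho x < 0),
      (forall x, ~ Om x -> 0 <= rho x), (forall x, bd x -> rho x = 0) &
      (forall x, bd x -> exists2 c, 0 < c & forall j, rho1 j x = c * nu x ord0 j)].
Proof.
have /choice[ch hch] : forall y, exists d, closure Om y -> chartP y d.
  move=> y; have [cy|cy] := pselect (closure Om y).
    by have [d hd] := exists_chart cy; exists d.
  (* A dummy value where there is no chart; the centres selected below lie in the closure. *)
  by exists (0, setT, fun=> 0, fun _ _ => 0, fun _ _ _ => 0).
pose r y := (ch y).1.1.1.1. pose V y := (ch y).1.1.1.2. pose F y := (ch y).1.1.2.
pose F1 y := (ch y).1.2. pose F2 y := (ch y).2.
have hP y : closure Om y -> chartP y (r y, V y, F y, F1 y, F2 y).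
  by move=> /hch; rewrite /r /V /F /F1 /F2; case: (ch y) => [[[[]]]].
have [|s [sD hs]] := @finite_ball_cover n (closure Om) (closure Om) r
    (bounded_closure_compact bOm).
  move=> y cy; exists y => //; rewrite subrr.
  have [[r0 _] _ _ _ _] := hP y cy.
  by rewrite /esq /dotv big1 // => i _; rewrite !mxE mul0r.
pose b y x := posp 3 (r y - esq (x - y)).
have b0 y x : 0 <= b y x by exact: posp_ge0.
have bV y x : y \in s -> b y x != 0 -> V y x.
  move=> /sD cy bx; have [_ hV _ _ _] := hP y cy; apply: hV.
  rewrite leNgt; apply/negP => h; move: bx.
  by rewrite /b posp_eq0 ?eqxx //; lra.
pose b1 y (i : 'I_n) (x : 'rV[R]_n) := 3 * posp 2 (r y - esq (x - y)) * (- (2 * (x ord0 i - y ord0 i))).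
pose b2 y (i j : 'I_n) (x : 'rV[R]_n) := 3 * (2 * posp 1 (r y - esq (x - y))) * (- (2 * (x ord0 j - y ord0 j))) * (- (2 * (x ord0 i - y ord0 i)))
      + 3 * posp 2 (r y - esq (x - y)) * (- (2 * (j == i)%:R)).
pose G y x := b y x * F y x.
pose G1 y i x := b1 y i x * F y x + b y x * F1 y i x.
pose G2 y i j x := b2 y i j x * F y x + b1 y i x * F1 y j x + (b1 y j x * F1 y i x + b y x * F2 y i j x).
have hG y : y \in s -> C2d setT (G y) (G1 y) (G2 y).
  move=> /sD cy; have [[r0 oV] hV hF _ _] := hP y cy.
  pose K := [set x | esq (x - y) <= r y].
  apply: (@C2dM_supp R n (V y) K) => //.
  - rewrite (_ : K = (fun x => esq (x - y)) @^-1` [set t : R | t <= r y]) //.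
    apply: preimage_closed; last exact: closed_le.
    move=> x _; have [c _ _ _ _] := @C2d_esq n y x I; exact/contwTP.
  - exact: C2d_bump.
  - move=> x; rewrite /K /= => /negP; rewrite -ltNge => xr.
    have xr' : r y - esq (x - y) <= 0 by lra.
    have z k : posp k.+1 (r y - esq (x - y)) = 0 by exact: posp_eq0.
    split; [exact: z|by move=> i; rewrite /b1 z; ring|
      by move=> i j; rewrite /b2 !z; ring].
pose rho x := \sum_(y <- s) G y x.
exists rho, (fun i x => \sum_(y <- s) G1 y i x), (fun i j x => \sum_(y <- s) G2 y i j x).
have G1bd y x : y \in s -> bd x -> [/\ F y x = 0 \/ b y x = 0, b y x = 0 -> forall i, b1 y i x = 0 &
    exists2 c, 0 <= c & (forall j, b y x * F1 y j x = c * nu x ord0 j) /\ (0 < b y x -> 0 < c)].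
  move=> ys bx; have cy := sD _ ys; have [[r0 oV] hV hF hO hN] := hP y cy.
  have b10 : b y x = 0 -> forall i, b1 y i x = 0.
    move=> /eqP; rewrite expf_eq0 /= => /eqP m0 i.
    by rewrite /b1 /posp m0 expr0n /= mulr0 mul0r.
  have [b_0|bn0] := eqVneq (b y x) 0.
    split => //; first by right.
    by exists 0 => //; split=> [j|]; [rewrite b_0 !mul0r|rewrite b_0 ltxx].
  have Vx := bV _ _ ys bn0.
  split => //; first by left; exact: (bd_defining_eq0 oV hF hO Vx bx).
  have [c c0 hc] := hN x Vx bx.
  have bp : 0 < b y x by rewrite lt_neqAle eq_sym bn0 b0.
  exists (b y x * c); first by rewrite mulr_ge0 // ltW.
  by split=> [j|_]; [rewrite hc mulrA|exact: mulr_gt0].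
split.
- exact: C2d_sum.
- move=> x Ox.
  have le0 y : y \in s -> G y x <= 0.
    move=> ys; rewrite /G; have [->|bn0] := eqVneq (b y x) 0; first by rewrite mul0r.
    have [_ _ _ hO _] := hP y (sD _ ys).
    have /(hO x (bV _ _ ys bn0)) := Ox => Fx.
    by rewrite mulr_ge0_le0 // ltW.
  have [y ys yx] := hs x (subset_closure Ox).
  have bp : 0 < b y x by rewrite /b posp_gt0 ?exprn_gt0 //; lra.
  rewrite /rho (big_rem y) //=.
  have : \sum_(z <- rem y s) G z x <= 0.
    by rewrite big_seq; apply: sumr_le0 => z /mem_rem /le0.
  have : G y x < 0.
    rewrite /G pmulr_rlt0 //; have [_ _ _ hO _] := hP y (sD _ ys).
    by apply/(hO x) => //; apply: bV => //; rewrite gt_eqF.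
  lra.
- move=> x Ox; rewrite /rho big_seq sumr_ge0 // => y ys; rewrite /G.
  have [->|bn0] := eqVneq (b y x) 0; first by rewrite mul0r.
  have [_ _ _ hO _] := hP y (sD _ ys).
  rewrite mulr_ge0 // leNgt; apply/negP => Fx; apply: Ox.
  exact/(hO x (bV _ _ ys bn0)).
- move=> x bx; rewrite /rho big_seq big1 // => y ys; rewrite /G.
  by have [[->|->] _ _] := G1bd y x ys bx; rewrite ?mulr0 ?mul0r.
- move=> x bx.
  have [y ys yx] := hs x bx.1.
  have bp : 0 < b y x by rewrite /b posp_gt0 ?exprn_gt0 //; lra.
  (* Strict positivity comes from the single ball that is known to contain [x], hence the clause on
     [y \in t] carried through the induction. *)
  have E t : {subset t <= s} -> exists2 c, 0 <= c &
      (forall j, \sum_(z <- t) G1 z j x = c * nu x ord0 j) /\ (y \in t -> 0 < c).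
    elim: t => [_|z t IH ts].
      by exists 0 => //; split=> // j; rewrite big_nil mul0r.
    have [|c c0 [hc yc]] := IH; first by move=> w wt; apply: ts; rewrite in_cons wt orbT.
    have zs : z \in s by apply: ts; exact: mem_head.
    have [Fb b1z [c' c'0 [hc' bc']]] := G1bd z x zs bx.
    exists (c' + c); first exact: addr_ge0.
    split=> [j|].
      rewrite big_cons hc /G1 hc'.
      have -> : b1 z j x * F z x = 0.
        by case: Fb => [->|/b1z ->]; rewrite ?mulr0 ?mul0r.
      by rewrite add0r mulrDl.
    rewrite in_cons => /orP[/eqP yz|/yc cp]; last by lra.
    by have := bc'; rewrite -yz => /(_ bp); lra.
  have [//|c c0 [hc yc]] := E s.
  by exists c => //; exact: yc.
Qed.

End GlobalDefining.
End Domain.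

(** * Cut-offs and space-time coordinates *)

Section Cutoffs.
Variable R : realType.

Lemma enorm_lt n (v : 'rV[R]_n) (s : R) : 0 < s -> (enorm v < s) = (esq v < s ^+ 2).
Proof.
by move=> s0; rewrite -ltr_sqr ?nnegrE ?sqrtr_ge0 ?(ltW s0) // sqr_sqrtr // esq_ge0.
Qed.

(** Take a finite set of points of [Ga] whose balls of radius [sigma / 4] cover its closure, and
    sums of bumps of radii [sigma / 2] and [3 sigma / 4] at these points. With [q = sigma^2 / 16]
    the squared radii are [q], [4 q], [9 q], all below [sigma^2]. The inner sum is at least
    [m0 = (3 q)^3] on [Ga], and the outer one at least [m1 = (5 q)^3] wherever an inner bump is
    positive. *)
Lemma cutoffs n (Ga : set 'rV[R]_n) (sigma : R) : bounded_set Ga -> 0 < sigma ->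
  exists chi chi1 chi2 xi xi1 xi2,
  [/\ C2d setT chi chi1 chi2, C2d setT xi xi1 xi2,
      (forall x, Ga x -> chi x = 0),
      (forall x, [/\ chi x = 1, forall i, chi1 i x = 0 & forall i j, chi2 i j x = 0] \/ 1 <= xi x) &
      (forall x, nbhd_sigma Ga sigma x \/ (xi x = 0 /\ forall i, xi1 i x = 0))].
Proof.
move=> bG s0.
pose q := sigma ^+ 2 / 16.
have q0 : 0 < q by rewrite divr_gt0 // exprn_gt0.
have [|s [sG hs]] := @finite_ball_cover R n (closure Ga) Ga (fun=> q) (bounded_closure_compact bG).
  move=> y cy.
  have : nbhs y [set x | esq (y - x) < q].
    have [c0 _ _ _ _] := @C2d_esq R n y y I.
    have h : esq (y - y) < q by rewrite subrr /esq /dotv big1 // => i _; rewrite !mxE mul0r.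
    have := contw_lt c0 h; apply: filterS => x /(_ I) /=.
    by rewrite (_ : esq (x - y) = esq (y - x)) //; apply: eq_bigr => i _; rewrite !mxE; ring.
  by move=> /cy[x [Gx yx]]; exists x.
have sumb r := C2d_sum (fun (y : 'rV[R]_n) (_ : y \in s) => C2d_bump y r).
pose S r x := \sum_(y <- s) posp 3 (r - esq (x - y)).
pose S1 r (i : 'I_n) x := \sum_(y <- s) 3 * posp 2 (r - esq (x - y)) * - (2 * (x ord0 i - y ord0 i)).
pose S2 r (i j : 'I_n) x := \sum_(y <- s) (3 * (2 * posp 1 (r - esq (x - y))) * - (2 * (x ord0 j - y ord0 j)) *
        - (2 * (x ord0 i - y ord0 i)) + 3 * posp 2 (r - esq (x - y)) * - (2 * (j == i)%:R)).
have hS r : C2d setT (S r) (S1 r) (S2 r) by exact: sumb.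
have S0 r x : 0 <= S r x by apply: sumr_ge0 => y _; exact: posp_ge0.
have Sge r x y : y \in s -> posp 3 (r - esq (x - y)) <= S r x.
  by move=> ys; rewrite /S (big_rem y) //= lerDl sumr_ge0 // => z _; exact: posp_ge0.
have Sz r x : (exists2 y, y \in s & esq (x - y) < r) \/
    [/\ S r x = 0, forall i, S1 r i x = 0 & forall i j, S2 r i j x = 0].
  have [|H] := pselect (exists2 y, y \in s & esq (x - y) < r); first by left.
  right.
  have z k y : y \in s -> posp k.+1 (r - esq (x - y)) = 0.
    move=> ys; apply: posp_eq0; rewrite subr_le0 leNgt; apply/negP => h.
    by apply: H; exists y.
  split=> [|i|i j]; rewrite ?/S ?/S1 ?/S2 big_seq big1 // => y ys; rewrite !z //; ring.
pose m0 := (4 * q - q) ^+ 3; pose m1 := (9 * q - 4 * q) ^+ 3.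
have m00 : 0 < m0 by rewrite exprn_gt0 //; lra.
have m10 : 0 < m1 by rewrite exprn_gt0 //; lra.
(* A C^2 profile equal to 1 at 0 and vanishing from [m0] on; it turns the inner sum into [chi]. *)
pose phi t := posp 3 (1 - t / m0).
pose phi1 t := 3 * posp 2 (1 - t / m0) * (- m0^-1).
pose phi2 t := 3 * (2 * posp 1 (1 - t / m0) * (- m0^-1)) * (- m0^-1).
have dl (t : R) : is_derive t 1 (fun t => 1 - t / m0) (- m0^-1).
  have := is_derive_add (@is_derive_fcst R R^o 1 t 1) (is_derive_opp (is_derive_mul (@is_derive_id R R^o t 1) (@is_derive_fcst R R^o m0^-1 t 1))).
  by apply: is_derive_cast; rewrite mulr0 addr0 mul1r add0r.
have d0 (t : R) : is_derive t 1 phi (phi1 t).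
  by apply: is_derive_chain; exact: is_derive_posp.
have d1 (t : R) : is_derive t 1 phi1 (phi2 t).
  have := is_derive_mul (is_derive_scale 3 (is_derive_chain (is_derive_posp2 _) (dl t))) (@is_derive_fcst R R^o (- m0^-1) t 1).
  by apply: is_derive_cast; rewrite mulr0 addr0.
have c2 (t : R) : {for t, continuous phi2}.
  apply/contwTP; apply: contwM; last exact: contw_cst.
  apply: contwM; first exact: contw_cst.
  apply: contwM; last exact: contw_cst.
  apply: contwM; first exact: contw_cst.
  apply: (@contw_comp R R setT t (posp 1) (fun t => 1 - t / m0)); first exact: posp_continuous.
  by apply/contwTP; exact: is_derive_continuous1 (dl t).
have hchi := @C2d_comp R n setT _ _ _ phi phi1 phi2 (hS (4 * q))
  (fun p _ => And3 (d0 _) (d1 _) (c2 _)).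
have hxi := C2dM (@C2d_cst R n setT m1^-1) (hS (9 * q)).
do 6 eexists; split; [exact: hchi|exact: hxi| | |].
- move=> x Gx /=; have [y ys yx] := hs x (subset_closure Gx).
  rewrite /phi posp_eq0 // subr_le0 ler_pdivlMr // mul1r.
  apply: le_trans (Sge _ _ _ ys); rewrite posp_gt0; last by lra.
  by rewrite /m0 lerXn2r ?nnegrE //; lra.
- move=> x /=; have [[y ys yx]|[z0 z1 z2]] := Sz (4 * q) x.
    right; rewrite mulrC ler_pdivlMr // mul1r.
    apply: le_trans (Sge _ _ _ ys); rewrite posp_gt0; last by lra.
    by rewrite /m1 lerXn2r ?nnegrE //; lra.
  left; split.
  + by rewrite z0 /phi mul0r subr0 posp_gt0 // expr1n.
  + by move=> i; rewrite z1 mulr0.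
  + by move=> i j; rewrite !z1 z2 !mulr0 addr0.
- move=> x; have [[y ys yx]|[z0 z1 z2]] := Sz (9 * q) x; [left|right].
    exists y; first exact: sG.
    rewrite enorm_lt //; apply: lt_trans yx _; rewrite /q.
    have := exprn_gt0 2 s0; lra.
  by split=> [|i] /=; rewrite ?z0 ?z1 !mulr0 ?addr0 ?mul0r.
Qed.

End Cutoffs.

(** * Space-time coordinates, the functions f and r, and pull-backs from space *)

Section Spacetime.
Variables (R : realType) (m n : nat).
Notation pt := 'rV[R]_(m + n).
Notation al := ('I_(m + n)).

(** The indicator of the spatial indices, as a real number, and the diagonal [sg] of the metric:
    sums over time or space become weighted sums over one index set, where [ring] can work
    termwise. *)
Definition isx (k : al) : R := (m <= k)%:R.
Definition sg (k : al) : R := 2 * isx k - 1.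

Lemma isx_l i : isx (lshift n i) = 0.
Proof. by rewrite /isx /= leqNgt ltn_ord. Qed.

Lemma isx_r j : isx (rshift m j) = 1.
Proof. by rewrite /isx /= leq_addr. Qed.

Lemma sg_l i : sg (lshift n i) = -1.
Proof. by rewrite /sg isx_l mulr0 add0r. Qed.

Lemma sg_r j : sg (rshift m j) = 1.
Proof. by rewrite /sg isx_r; ring. Qed.

Lemma isx_sq k : isx k * isx k = isx k.
Proof. by rewrite /isx; case: (m <= k)%N; rewrite ?mulr0 ?mulr1. Qed.

Lemma sum_isx (g : al -> R) : \sum_k isx k * g k = \sum_(j < n) g (rshift m j).
Proof.
rewrite big_split_ord /= big1 ?add0r; last by move=> i _; rewrite isx_l mul0r.
by apply: eq_bigr => j _; rewrite isx_r mul1r.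
Qed.

Lemma sum_ist (g : al -> R) : \sum_k (1 - isx k) * g k = \sum_(i < m) g (lshift n i).
Proof.
rewrite big_split_ord /= [X in _ + X]big1 ?addr0.
  by apply: eq_bigr => i _; rewrite isx_l subr0 mul1r.
by move=> j _; rewrite isx_r subrr mul0r.
Qed.

Lemma esq_xcoord (p : pt) : esq (xcoord p) = \sum_k isx k * p ord0 k ^+ 2.
Proof. by rewrite sum_isx esqE; apply: eq_bigr => j _; rewrite mxE. Qed.

Lemma esq_tcoord (p : pt) : esq (tcoord p) = \sum_k (1 - isx k) * p ord0 k ^+ 2.
Proof. by rewrite sum_ist esqE; apply: eq_bigr => j _; rewrite mxE. Qed.

Lemma rr_sq (p : pt) : rr p ^+ 2 = esq (xcoord p).
Proof. by rewrite /rr sqr_sqrtr // esq_ge0. Qed.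

Lemma tau_sq (p : pt) : tau p ^+ 2 = esq (tcoord p).
Proof. by rewrite /tau sqr_sqrtr // esq_ge0. Qed.

Lemma rr_ge0 (p : pt) : 0 <= rr p. Proof. exact: sqrtr_ge0. Qed.
Lemma tau_ge0 (p : pt) : 0 <= tau p. Proof. exact: sqrtr_ge0. Qed.

Lemma ffE (p : pt) : 4 * ff p = rr p ^+ 2 - tau p ^+ 2.
Proof. by rewrite /ff /uu /vv; field. Qed.

Lemma ff_sum (p : pt) : ff p = \sum_k sg k / 4 * (p ord0 k - (0 : pt) ord0 k) ^+ 2.
Proof.
apply: (@mulfI _ 4) => //; rewrite ffE rr_sq tau_sq esq_xcoord esq_tcoord mulr_sumr -sumrB.
by apply: eq_bigr => k _; rewrite mxE /sg; field.
Qed.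

Lemma Dom_rr (p : pt) : Dom p -> 0 < rr p.
Proof.
rewrite /Dom /= => f0; rewrite lt_neqAle rr_ge0 andbT; apply/eqP => r0.
have := ffE p; rewrite -r0; have := sqr_ge0 (tau p); lra.
Qed.

Lemma Dom_tau (p : pt) : Dom p -> tau p < rr p.
Proof.
move=> Dp; rewrite -ltr_sqr ?nnegrE ?rr_ge0 ?tau_ge0 //.
by have := ffE p; have : 0 < ff p := Dp; lra.
Qed.

Lemma C2d_ff : C2d setT (@ff R m n) (fun i p => sg i * p ord0 i / 2)
  (fun i j _ => sg i * (j == i)%:R / 2).
Proof.
have := @C2d_diag R (m + n) (fun k => sg k / 4) 0; congr C2d.
- by apply/funext => p; rewrite ff_sum.
- by apply/funext => i; apply/funext => p; rewrite mxE; field.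
- by apply/funext => i; apply/funext => j; apply/funext => p; field.
Qed.

Lemma xcoord_norm (p : pt) : `|xcoord p| <= `|p|.
Proof. by apply: norm_row_le => // j; rewrite mxE coord_le_norm. Qed.

Lemma xcoordB (p q : pt) : xcoord (p - q) = xcoord p - xcoord q.
Proof. by apply/rowP => j; rewrite !mxE. Qed.

Lemma contw_pull A (F : 'rV[R]_n -> R) (p : pt) :
  contw setT (xcoord p) F -> contw A p (fun q => F (xcoord q)).
Proof.
move=> /contw_epsP cF; apply/contw_epsP => e /cF[d d0 hd]; exists d => // q _ pq.
by apply: hd => //; rewrite -xcoordB (le_lt_trans _ pq) // xcoord_norm.
Qed.

Definition pull1 (F1 : 'I_n -> 'rV[R]_n -> R) (k : al) (p : pt) : R :=
  match fintype.split k with inl _ => 0 | inr j => F1 j (xcoord p) end.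

Lemma pull1_l F1 i p : pull1 F1 (lshift n i) p = 0.
Proof. by rewrite /pull1 -[lshift n i]/(unsplit (inl i)) unsplitK. Qed.

Lemma pull1_r F1 j p : pull1 F1 (rshift m j) p = F1 j (xcoord p).
Proof. by rewrite /pull1 -[rshift m j]/(unsplit (inr j)) unsplitK. Qed.

Lemma contw_pull1 A F1 k (p : pt) :
  (forall j, contw setT (xcoord p) (F1 j)) -> contw A p (pull1 F1 k).
Proof.
move=> c1; rewrite /pull1; case: (fintype.split k) => [_|j]; first exact: contw_cst.
exact: contw_pull.
Qed.

Lemma is_derive_pull (F : 'rV[R]_n -> R) F1 (p : pt) k :
  (forall j, is_derive (xcoord p) (evec R j) F (F1 j (xcoord p))) ->
  is_derive p (evec R k) (fun q => F (xcoord q)) (pull1 F1 k p).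
Proof.
move=> dF; case: (split_ordP k) => [i ->|j ->]; rewrite ?pull1_l ?pull1_r.
  have d0 := is_derive0 F (xcoord p).
  apply: (@is_derive_comp_affine _ _ _ (@xcoord R m n) F p (evec R (lshift n i)) 0) => h.
  rewrite scaler0 add0r; apply/rowP => l; rewrite !mxE.
  by rewrite eq_lrshift mulr0 add0r.
have dj := dF j.
apply: (@is_derive_comp_affine _ _ _ (@xcoord R m n) F p (evec R (rshift m j)) (evec R j)) => h.
by apply/rowP => l; rewrite !mxE eq_rshift.
Qed.

Definition pull2 (F2 : 'I_n -> 'I_n -> 'rV[R]_n -> R) (k l : al) (p : pt) : R :=
  match fintype.split k with inl _ => 0 | inr j => pull1 (F2 j) l p end.

Lemma pull2_r F2 i j p : pull2 F2 (rshift m i) (rshift m j) p = F2 i j (xcoord p).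
Proof.
by rewrite /pull2 -[rshift m i]/(unsplit (inr i)) unsplitK pull1_r.
Qed.

Lemma pull2_l F2 i j p : pull2 F2 (lshift n i) j p = 0.
Proof. by rewrite /pull2 -[lshift n i]/(unsplit (inl i)) unsplitK. Qed.

Lemma C2d_pull F F1 F2 : C2d setT F F1 F2 ->
  C2d setT (fun p : pt => F (xcoord p)) (pull1 F1) (pull2 F2).
Proof.
move=> h p _; have [c0 c1 c2 d1 d2] := h (xcoord p) I; split.
- exact: contw_pull.
- by move=> k; exact: contw_pull1.
- move=> k l; rewrite /pull2; case: (fintype.split k) => [_|j]; first exact: contw_cst.
  exact: contw_pull1.
- by move=> k; exact: is_derive_pull.
- move=> k l; rewrite /pull2 /pull1; case: (fintype.split k) => [_|j].
    exact: is_derive_fcst.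
  exact: is_derive_pull.
Qed.

Lemma contw_ff A (p : pt) : contw A p (@ff R m n).
Proof. by apply: contwS (@subsetT _ _) _; have [] := C2d_ff I (p := p). Qed.

Lemma contw_rr A (p : pt) : contw A p (@rr R m n).
Proof.
apply: (@contw_pull A (fun x => Num.sqrt (esq x)) p).
apply: contw_comp; first exact: sqrt_continuous.
have [c _ _ _ _] := @C2d_esq R n 0 (xcoord p) I.
rewrite (_ : esq (N := n) = fun x => esq (x - 0)) //.
by apply/funext => x; rewrite subr0.
Qed.

Lemma contw_irr A (p : pt) : Dom p -> contw A p (fun q => (rr q)^-1).
Proof. by move=> Dp; apply: contwV; [rewrite lt0r_neq0 ?Dom_rr|exact: contw_rr]. Qed.

Lemma contw_iff A (p : pt) : Dom p -> contw A p (fun q => (ff q)^-1).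
Proof. by move=> Dp; apply: contwV; [rewrite lt0r_neq0|exact: contw_ff]. Qed.

Lemma is_derive_ff (p : pt) k : is_derive p (evec R k) (@ff R m n) (sg k * p ord0 k / 2).
Proof. by have [_ _ _ + _] := C2d_ff I (p := p); apply. Qed.

Lemma is_derive_rr (p : pt) k : Dom p ->
  is_derive p (evec R k) (@rr R m n) (isx k * p ord0 k / rr p).
Proof.
move=> Dp; have r0 := Dom_rr Dp.
have ds : is_derive p (evec R k) (fun q : pt => esq (xcoord q)) (2 * isx k * p ord0 k).
  have [_ _ _ + _] := @C2d_diag R (m + n) isx 0 p I.
  move=> /(_ k); rewrite mxE subr0 (_ : (fun q => _) = (fun q : pt => esq (xcoord q))) //.
  by apply/funext => q; rewrite esq_xcoord; apply: eq_bigr => l _; rewrite mxE subr0.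
have e0 : 0 < esq (xcoord p) by rewrite -rr_sq exprn_gt0.
have := @is_derive_chain R _ Num.sqrt (fun q : pt => esq (xcoord q)) p _ _ _
  (is_derive1_sqrt e0) ds; apply: is_derive_cast.
rewrite -/(rr p) -[Num.sqrt _]/(rr p); field; exact: lt0r_neq0.
Qed.

Lemma open_Dom : open (@Dom R m n).
Proof.
rewrite openE => p Dp.
by have := contw_gt (@contw_ff setT p) Dp; apply: filterS => q /(_ I).
Qed.

Lemma open_cyl Om : open Om -> open (@cyl R m n Om).
Proof.
move=> oO; rewrite openE => p Up.
have [r r0 hr] := open_cball oO Up.
apply/nbhs_ballP; exists r => //= q; rewrite -ball_normE /= => pq.
apply: hr; rewrite -xcoordB distrC in pq *; apply: le_trans (xcoord_norm _) _.
by rewrite distrC ltW // distrC.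
Qed.

Lemma closure_cyl Om (p : pt) : closure (cyl Om) p <-> closure Om (xcoord p).
Proof.
split.
  move=> cp B /nbhs_ballP[r /= r0 hr].
  have [|q [Uq pq]] := cp (ball p r); first exact: nbhsx_ballx.
  exists (xcoord q); split => //; apply: hr; move: pq; rewrite -!ball_normE /=.
  by rewrite -xcoordB; apply: le_lt_trans; exact: xcoord_norm.
move=> cx B /nbhs_ballP[r /= r0 hr].
have [|y [Oy pq]] := cx (ball (xcoord p) r); first exact: nbhsx_ballx.
exists (row_mx (tcoord p) y); split; first by rewrite /cyl /= /xcoord row_mxKr.
apply: hr; move: pq; rewrite -!ball_normE /=; apply: le_lt_trans.
apply: norm_row_le => // k; rewrite !mxE; case: split_ordP => j ->.
  by rewrite !mxE subrr normr0.
apply: le_trans (coord_le_norm _ j); by rewrite !mxE.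
Qed.

End Spacetime.

(** * The divergence estimate *)

Section CompactSupport.
Variable R : realType.

Lemma limn_einf_ge (u : nat -> \bar R) (a : \bar R) (k : nat) :
  (forall n, (k <= n)%N -> a <= u n)%E -> (a <= limn_einf u)%E.
Proof.
move=> h; rewrite limn_einf_lim; apply: lime_ge; first exact: is_cvg_einfs.
exists k => // n /= kn; apply: le_ereal_inf_tmp => _ [j /= nj <-].
by apply: h; exact: leq_trans nj.
Qed.

Lemma limn_einf_le (u : nat -> \bar R) (M : R) :
  (forall e : R, 0 < e -> exists k, forall n, (k <= n)%N -> (u n <= (M + e)%:E)%E) ->
  (limn_einf u <= M%:E)%E.
Proof.
move=> h; apply/lee_addgt0Pr => e e0; have [k hk] := h e e0.
rewrite limn_einf_lim; apply: lime_le; first exact: is_cvg_einfs.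
exists 0%N => // n _; apply: (@le_trans _ _ (u (maxn n k))).
  by apply: ereal_inf_lbound; exists (maxn n k) => //=; exact: leq_maxl.
by rewrite -EFinD; apply: hk; exact: leq_maxr.
Qed.

Lemma Cc_of_supp N (K : set 'rV[R]_N) (F : 'rV[R]_N -> R) : compact K ->
  (forall p, K p -> contw setT p F) -> (forall p, ~ K p -> F p = 0) -> Cc F.
Proof.
move=> cK cF F0.
have clK : closed K by apply: compact_closed => //; exact: norm_hausdorff.
split.
  move=> p; apply/contwTP; have [/cF //|Kp] := pselect (K p).
  apply: (@contw_near _ _ _ _ (fun=> 0)); [|by rewrite F0|exact: contw_cst].
  have nK : \forall q \near p, ~ K q.
    by apply: open_nbhs_nbhs; split => //; exact: closed_openC.
  by apply: filterS nK => q /F0 ->.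
have [M [_ hM]] := compact_bounded cK.
exists (M + 1) => p pM; apply: F0 => Kp.
have := hM (M + 1) _ p Kp; rewrite ltrDl ltr01 => /(_ isT) /=.
by rewrite leNgt pM.
Qed.

Lemma compact_bound N (K : set 'rV[R]_N) (F : 'rV[R]_N -> R) : compact K ->
  (forall p, K p -> contw K p F) -> exists2 M : R, 0 < M & forall p, K p -> `|F p| <= M.
Proof.
move=> cK cF; have [[q Kq]|K0] := pselect (K !=set0); last first.
  by exists 1 => // p Kp; case: K0; exists p.
have cabs : {within K, continuous (fun p => `|F p|)}.
  apply/subspace_continuousP => p Kp; apply: cvg_norm; exact: cF.
have [|c cK' hc] := compact_EVT_max _ cK cabs; first by exists q.
exists (`|F c| + 1); first by rewrite ltr_wpDl.
move=> p Kp; apply: le_trans (hc p _) _; first by rewrite inE.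
by rewrite lerDl.
Qed.

(** [E] is bounded only from below, so the sup bound is applied to its negative part, which lies
    between 0 and [c], and positivity to the rest. *)
Lemma Rint_lower N (E : 'rV[R]_N -> R) (c K : R) : Cc E -> 0 <= c -> 0 <= K ->
  (forall p, - c <= E p) -> (forall p, K < `|p| -> E p = 0) ->
  - (c * (2 * K) ^+ N) <= Rint E.
Proof.
move=> cE c0 K0 hc hK; have [hD hZ hP hB _] := @RintP R N.
pose Em p := posp 1 (- E p).
have cEm : Cc Em.
  case: (cE) => cc [L hL]; split.
    move=> p; apply/contwTP; apply: contw_comp; first exact: posp_continuous.
    by apply: contwN; apply/contwTP; exact: cc.
  by exists L => p /hL E0; rewrite /Em E0 oppr0 posp_eq0.
have s0 : 0 <= Rint (fun p => E p + Em p).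
  apply: hP; first exact: CcD.
  move=> p; rewrite /Em /posp expr1.
  by case: (leP (- E p) 0) => h; lra.
have b : `|Rint Em| <= c * (2 * K) ^+ N.
  apply: hB => //.
    by move=> p /hK E0; rewrite /Em E0 oppr0 posp_eq0.
  move=> p; rewrite ger0_norm ?posp_ge0 // /Em /posp expr1.
  by have := hc p; case: (leP (- E p) 0) => h; lra.
rewrite hD // in s0; move: b; rewrite ler_norml => /andP[_ b]; lra.
Qed.

Lemma Rint_sum N (I : Type) (s : seq I) (F : I -> 'rV[R]_N -> R) :
  (forall i, Cc (F i)) -> Rint (fun p => \sum_(i <- s) F i p) = \sum_(i <- s) Rint (F i).
Proof.
move=> cF; have [hD hZ _ _ _] := @RintP R N; elim: s => [|i s IH].
  rewrite big_nil (@Rint_eq R _ _ (fun _ => 0 * 0)).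
    by rewrite hZ ?mul0r //; exact: Cc0.
  by move=> p; rewrite big_nil mulr0.
rewrite big_cons -IH -hD //; last exact: Cc_sum.
by apply: Rint_eq => p; rewrite big_cons.
Qed.

Definition cutoff N (O : set 'rV[R]_N) (H : 'rV[R]_N -> R) :=
  [/\ forall p, contw setT p H, forall p, 0 <= H p <= 1 &
      exists2 K, compact K & K `<=` O /\ forall p, ~ K p -> H p = 0].

Lemma cutoff_Cc N (O : set 'rV[R]_N) H B : cutoff O H ->
  (forall p, O p -> contw setT p B) -> Cc (fun p => H p * B p).
Proof.
move=> [cH _ [K cK [KO H0]]] cB; apply: (Cc_of_supp cK).
  by move=> p Kp; apply: contwM => //; apply: cB; exact: KO.
by move=> p /H0 ->; rewrite mul0r.
Qed.

(** The integrand is the divergence of [H J]. The field [J] is controlled only on [O], but [H]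
    vanishes off the compact [K], so each component extends by zero. *)
Lemma Rint_div_cutoff N (O K : set 'rV[R]_N) H (H1 J J' : 'I_N -> 'rV[R]_N -> R) :
  compact K -> K `<=` O ->
  (forall p, ~ K p -> H p = 0 /\ forall k, H1 k p = 0) ->
  (forall p k, is_derive p (evec R k) H (H1 k p)) ->
  (forall p, contw setT p H) -> (forall p k, contw setT p (H1 k)) ->
  (forall p, O p -> forall k, [/\ is_derive p (evec R k) (J k) (J' k p),
     contw setT p (J k) & contw setT p (J' k)]) ->
  Cc (fun p => \sum_k (H1 k p * J k p + H p * J' k p)) /\
  Rint (fun p => \sum_k (H1 k p * J k p + H p * J' k p)) = 0.
Proof.
move=> cK KO H0 dH cH cH1 hJ.
have clK : closed K by apply: compact_closed => //; exact: norm_hausdorff.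
have c1 k : Cc (fun p => H1 k p * J k p + H p * J' k p).
  apply: (Cc_of_supp cK) => p.
    by move=> /KO /hJ /(_ k)[d c c']; apply: contwD; exact: contwM.
  by move=> /H0[-> ->]; rewrite !mul0r addr0.
have c0 k : Cc (fun p => H p * J k p).
  apply: (Cc_of_supp cK) => p.
    by move=> /KO /hJ /(_ k)[d c c']; exact: contwM.
  by move=> /H0[-> _]; rewrite !mul0r.
split; first exact: Cc_sum.
rewrite Rint_sum // big1 // => k _.
apply: (Rint_derive (c0 k) (c1 k)) => p; have [Kp|Kp] := pselect (K p).
  by have [d _ _] := hJ p (KO p Kp) k; exact: is_derive_mul.
have nK : \forall q \near p, ~ K q.
  by apply: open_nbhs_nbhs; split => //; exact: closed_openC.
have [-> ->] := H0 p Kp; rewrite !mul0r addr0.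
apply: (@near_eq_is_derive _ _ _ (fun=> 0)).
by apply: filterS nK => q /H0[-> _]; rewrite mul0r.
Qed.

End CompactSupport.

(** The contribution of the null cone. The cut-off in [f / kap] varies only where [f <= 2 kap], with
    slope of order [1 / kap], while the flux is of order [f^2]: the product is of order [kap]. Here
    [u] and [v] are values of [step] and [step'], and [e2] is the correction term. *)
Lemma cone_term_bound (F : realFieldType) (u v kap f S1 e2 KJ C1 : F) :
  0 < kap -> 0 <= KJ -> 0 <= C1 -> 0 <= u <= 1 -> 0 <= v <= 2 -> 0 <= f <= 2 * kap ->
  S1 <= KJ * f ^+ 2 -> e2 <= C1 * kap ^+ 2 ->
  u * (v / kap / 2) * (S1 + e2) <= (4 * KJ + C1) * kap.
Proof.
move=> k0 KJ0 C10 /andP[u0 u1] /andP[v0 v2] /andP[f0 fk] hS he.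
have f2 : f ^+ 2 <= 4 * kap ^+ 2 by clear -f0 fk; nra.
have x1 : S1 + e2 <= (4 * KJ + C1) * kap ^+ 2.
  have y2 : KJ * f ^+ 2 <= KJ * (4 * kap ^+ 2) by rewrite ler_wpM2l.
  by clear -y2 hS he; rewrite mulrDl; lra.
have uv : 0 <= u * v by rewrite mulr_ge0.
have uv2 : u * v <= 2 by rewrite -[2]mul1r ler_pM.
rewrite (_ : u * (v / kap / 2) = u * v / 2 * kap^-1); last by field; rewrite lt0r_neq0.
apply: le_trans (_ : _ <= u * v / 2 * kap^-1 * ((4 * KJ + C1) * kap ^+ 2)) _.
  by rewrite ler_wpM2l // mulr_ge0 ?invr_ge0 ?(ltW k0) // divr_ge0.
rewrite (_ : _ * _ = u * v / 2 * ((4 * KJ + C1) * kap)); last by field; rewrite lt0r_neq0.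
rewrite ler_piMl ?mulr_ge0 ?addr_ge0 ?mulr_ge0 ?(ltW k0) //.
by clear -uv2; lra.
Qed.

(** * A divergence inequality on the part of the cylinder outside the cone *)

Section Divergence.
Variables (R : realType) (m n : nat).
Notation pt := 'rV[R]_(m + n).
Variables (Om : set 'rV[R]_n) (Rad : R).
Hypotheses (oOm : open Om) (Rad0 : 0 < Rad) (OmR : forall x, Om x -> enorm x < Rad).
Variables (rho : 'rV[R]_n -> R) (rho1 : 'I_n -> 'rV[R]_n -> R)
  (rho2 : 'I_n -> 'I_n -> 'rV[R]_n -> R).
Hypothesis hrho : C2d setT rho rho1 rho2.
Hypothesis rho_in : forall x, Om x -> rho x < 0.
Hypothesis rho_out : forall x, ~ Om x -> 0 <= rho x.
Hypothesis rho_bd : forall x, (closure Om `\` Om) x -> 0 < \sum_j rho1 j x ^+ 2.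
Let U := @cyl R m n Om.
Let D := @Dom R m n.
Let rh (p : pt) := rho (xcoord p).
Let rh1 := @pull1 R m n rho1.
Let rh2 := @pull2 R m n rho2.
Let hrh : C2d setT rh rh1 rh2. Proof. exact: C2d_pull. Qed.

(** The cylinder is unbounded in time, but [tau < rr] outside the cone; hence [U] and [D] meet in a
    bounded set. *)
Lemma rr_norm (p : pt) : D p -> `|p| <= rr p.
Proof.
move=> Dp; apply: norm_row_le; first exact: rr_ge0.
move=> k; case: (split_ordP k) => [i ->|j ->].
  apply: le_trans (ltW (Dom_tau Dp)); rewrite -sqrtr_sqr ler_wsqrtr //.
  by apply: le_trans (coord_sq_le_esq (tcoord p) i); rewrite mxE.
rewrite -sqrtr_sqr ler_wsqrtr //.
by apply: le_trans (coord_sq_le_esq (xcoord p) j); rewrite mxE.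
Qed.

Lemma closure_rr (p : pt) : closure U p -> rr p <= Rad.
Proof.
have cl : closed [set p : pt | rr p <= Rad].
  rewrite (_ : mkset _ = (@rr R m n) @^-1` [set t : R | t <= Rad]) //.
  apply: preimage_closed; last exact: closed_le.
  by move=> q _; apply/contwTP; exact: contw_rr.
by move=> cp; apply: (cl p); move: cp; apply: closure_subset => q /OmR /ltW.
Qed.

Lemma closed_ff_ge (kap : R) : closed [set p : pt | kap <= ff p].
Proof.
rewrite (_ : mkset _ = (@ff R m n) @^-1` [set t : R | kap <= t]) //.
apply: preimage_closed; last exact: closed_ge.
by move=> q _; apply/contwTP; exact: contw_ff.
Qed.

Lemma compact_slab (kap : R) : 0 < kap -> compact (closure U `&` [set p | kap <= ff p]).
Proof.
move=> k0; apply: bounded_closed_compact; last first.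
  by apply: closedI; [exact: closed_closure|exact: closed_ff_ge].
exists Rad; split; first exact: num_real.
move=> M RM p [cp /= fp]; apply: le_trans (ltW RM).
apply: le_trans (rr_norm _) (closure_rr cp).
exact: lt_le_trans fp.
Qed.

Variables (J J' : 'I_(m + n) -> pt -> R).
Hypothesis dJ : forall p k, U p -> D p -> is_derive p (evec R k) (J k) (J' k p).
Hypothesis cJ' : forall p k, U p -> D p -> contw setT p (J' k).
Hypothesis cJ : forall p k, closure U p -> D p -> contw (closure U) p (J k).
Hypothesis flux : forall p, (closure U `\` U) p -> D p -> 0 <= \sum_k rh1 k p * J k p.
Variable KJ : R.
Hypothesis KJ0 : 0 <= KJ.
Hypothesis boundJ : forall p, U p -> D p ->
  `|\sum_k sg R k * p ord0 k * J k p| <= KJ * ff p ^+ 2.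

Let oU : open U. Proof. exact: open_cyl. Qed.

Lemma contw_rh1 A p k : contw A p (rh1 k).
Proof. by apply: contwS (@subsetT _ _) _; have [_ + _ _ _] := hrh I (p := p). Qed.

(** The flux hypothesis is a weak inequality on the boundary only. The term [eps |grad rho|^2] makes
    it strict there, so it persists near each boundary point and, the slab [kap <= f] being compact,
    in a whole layer. *)
Lemma flux_shell (kap eps : R) : 0 < kap -> 0 < eps ->
  exists2 d0 : R, 0 < d0 & forall p, U p -> kap <= ff p -> - rh p <= d0 ->
    0 <= \sum_k rh1 k p * (J k p + eps * rh1 k p).
Proof.
move=> k0 e0.
have /compact_near_coveringP cK := compact_slab k0.
pose T p := \sum_k rh1 k p * (J k p + eps * rh1 k p).
have [|d /= d0 hd] := cK R (0 : R)^'+ (fun d p => closure U p -> - rh p <= d -> 0 <= T p) _.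
  move=> p [cp /= fp]; have Dp : D p by exact: lt_le_trans fp.
  (* Near a point with [rho < 0] the layer is empty as soon as it is thin enough. *)
  have [rp|rp] := ltP (rh p) 0.
    have crh : contw setT p rh by have [] := hrh I (p := p).
    have rp2 : rh p < rh p / 2 by lra.
    exists ([set q | rh q < rh p / 2], [set d | d < - rh p / 2]).
      split => /=; last by apply: nbhs_right_lt; lra.
      by have := contw_lt crh rp2; apply: filterS => q /(_ I).
    by move=> [q d] /= [h1 h2] _; lra.
  have Up : ~ U p by move=> /rho_in; rewrite -/(rh p); lra.
  have Tp : 0 < T p.
    rewrite /T (eq_bigr (fun k => rh1 k p * J k p + eps * rh1 k p ^+ 2)); last by move=> k _; ring.
    rewrite big_split /= -mulr_sumr; apply: ltr_wpDl; first exact: flux.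
    rewrite mulr_gt0 // big_split_ord /= big1 ?add0r; last by move=> i _; rewrite /rh1 pull1_l expr0n.
    rewrite (eq_bigr (fun j => rho1 j (xcoord p) ^+ 2)); last by move=> j _; rewrite /rh1 pull1_r.
    by apply: rho_bd; split; [exact/closure_cyl|exact: Up].
  have cT : contw (closure U) p T.
    apply: contw_sum => k; apply: contwM; first exact: contw_rh1.
    apply: contwD; first exact: cJ.
    by apply: contwM; [exact: contw_cst|exact: contw_rh1].
  exists ([set q | closure U q -> 0 < T q], setT).
    by split; [exact: (contw_gt cT Tp)|exact: filterT].
  by move=> [q d] /= [h _] /h /ltW.
exists (d / 2); first by rewrite divr_gt0.
move=> p Up fp rp; apply: (hd (d / 2)) => //=.
- by rewrite sub0r normrN gtr0_norm //; lra.
- by rewrite divr_gt0.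
- by split => //; exact: subset_closure.
- exact: subset_closure.
Qed.

Definition cut (kap del : R) (p : pt) : R := step (- rh p / del) * step (ff p / kap).
Definition cut1 (kap del : R) k (p : pt) : R :=
  step' (- rh p / del) * (- rh1 k p / del) * step (ff p / kap) +
  step (- rh p / del) * (step' (ff p / kap) * (sg R k * p ord0 k / 2 / kap)).

Lemma is_derive_cut kap del p k : is_derive p (evec R k) (cut kap del) (cut1 kap del k p).
Proof.
have [_ _ _ dr _] := hrh I (p := p).
apply: is_derive_mul.
  apply: (@is_derive_chain R _ (@step R) (fun q => - rh q / del)); first exact: is_derive_step.
  have := is_derive_mul (is_derive_opp (dr k)) (is_derive_fcst del^-1 p (evec R k)).
  by apply: is_derive_cast; rewrite mulr0 addr0.
apply: (@is_derive_chain R _ (@step R) (fun q => ff q / kap)); first exact: is_derive_step.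
have := is_derive_mul (is_derive_ff p k) (is_derive_fcst kap^-1 p (evec R k)).
by apply: is_derive_cast; rewrite mulr0 addr0.
Qed.

Let step_cont : continuous (@step R).
Proof. by move=> s; exact: is_derive_continuous1 (is_derive_step s). Qed.

Lemma contw_cut kap del p : contw setT p (cut kap del).
Proof.
have crh : contw setT p rh by have [] := hrh I (p := p).
apply: contwM; apply: contw_comp; try exact: step_cont.
  by apply: contwM; [exact: contwN|exact: contw_cst].
by apply: contwM; [exact: contw_ff|exact: contw_cst].
Qed.

Lemma contw_cut1 kap del p k : contw setT p (cut1 kap del k).
Proof.
have crh : contw setT p rh by have [] := hrh I (p := p).
have c1 : contw setT p (fun q => - rh q / del).
  by apply: contwM; [exact: contwN|exact: contw_cst].
have c2 : contw setT p (fun q => ff q / kap).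
  by apply: contwM; [exact: contw_ff|exact: contw_cst].
have c3 : contw setT p (fun q => step (- rh q / del)) by apply: contw_comp => //; exact: step_cont.
have c4 : contw setT p (fun q => step (ff q / kap)) by apply: contw_comp => //; exact: step_cont.
have c5 : contw setT p (fun q => step' (- rh q / del)).
  by apply: contw_comp => //; exact: step'_continuous.
have c6 : contw setT p (fun q => step' (ff q / kap)).
  by apply: contw_comp => //; exact: step'_continuous.
have c7 : contw setT p (rh1 k) by exact: contw_rh1.
have c8 : contw setT p (fun q : pt => q ord0 k) by exact: contw_coord.
have cc (c : R) : contw setT p (fun=> c) by exact: contw_cst.
apply: contwD.
  by apply: contwM => //; apply: contwM => //; apply: contwM => //; exact: contwN.
by apply: contwM => //; apply: contwM => //; apply: contwM => //; apply: contwM => //; apply: contwM.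
Qed.

Let Kset kap del := [set p : pt | rh p <= - del] `&` [set p | kap <= ff p].

Lemma Kset_sub kap del : 0 < kap -> 0 < del -> Kset kap del `<=` U `&` D.
Proof.
move=> k0 d0 p [/= rp fp]; split; last exact: lt_le_trans fp.
apply: contrapT => Up; have := rho_out Up; rewrite -/(rh p); lra.
Qed.

Lemma Kset_compact kap del : 0 < kap -> 0 < del -> compact (Kset kap del).
Proof.
move=> k0 d0; apply: subclosed_compact (compact_slab k0) _.
  apply: closedI; last exact: closed_ff_ge.
  rewrite (_ : mkset _ = rh @^-1` [set t : R | t <= - del]) //.
  apply: preimage_closed; last exact: closed_le.
  by move=> q _; apply/contwTP; have [] := hrh I (p := q).
move=> p Kp; have [Up _] := Kset_sub k0 d0 Kp.
by case: Kp => _ fp; split => //; exact: subset_closure.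
Qed.

Lemma cut_off kap del p : 0 < kap -> 0 < del -> ~ Kset kap del p ->
  cut kap del p = 0 /\ forall k, cut1 kap del k p = 0.
Proof.
move=> k0 d0 Kp.
have [h|h] := leP (kap) (ff p).
  have h1 : - rh p / del <= 1.
    rewrite ler_pdivrMr // mul1r leNgt; apply/negP => h1; apply: Kp; split => //=; lra.
  by split=> [|k]; rewrite ?/cut ?/cut1 ?(step_le1 h1) ?(step'_le1 h1) !mul0r ?addr0.
have h1 : ff p / kap <= 1 by rewrite ler_pdivrMr // mul1r ltW.
by split=> [|k]; rewrite ?/cut ?/cut1 ?(step_le1 h1) ?(step'_le1 h1) ?mul0r ?mulr0 ?addr0.
Qed.

Lemma cut_cutoff kap del : 0 < kap -> 0 < del -> cutoff (U `&` D) (cut kap del).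
Proof.
move=> k0 d0; split.
- exact: contw_cut.
- move=> p; have /andP[a1 a2] := step_itv (- rh p / del).
  have /andP[b1 b2] := step_itv (ff p / kap).
  by rewrite mulr_ge0 //= mulr_ile1.
- exists (Kset kap del); first exact: Kset_compact.
  by split; [exact: Kset_sub|move=> p /(cut_off k0 d0)[]].
Qed.

Lemma cut_div_lower : exists2 C : R, 0 < C & forall kap, 0 < kap -> kap <= 1 ->
  exists2 d0 : R, 0 < d0 & forall del, 0 < del -> del <= d0 ->
  - (C * kap) <= Rint (fun p => cut kap del p * \sum_k J' k p).
Proof.
have KJ0' := KJ0; have Rad0' := Rad0.
pose B := [set p : pt | `|p| <= Rad].
have cB : compact B by exact: closed_ball_rV_compact.
have [C1 C10 hC1] : exists2 M : R, 0 < M & forall p, B p -> `|\sum_k sg R k * p ord0 k * rh1 k p| <= M.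
  apply: compact_bound => // p _; apply: contw_sum => k.
  apply: contwM; last exact: contw_rh1.
  by apply: contwM; [exact: contw_cst|exact: contw_coord].
have [C2 C20 hC2] : exists2 M : R, 0 < M & forall p, B p -> `|\sum_k rh2 k k p| <= M.
  apply: compact_bound => // p _; apply: contw_sum => k.
  by apply: contwS (@subsetT _ _) _; have [_ _ + _ _] := hrh I (p := p).
have [c c00 cEq] : exists2 c : R, 0 <= c & c = 4 * KJ + C1 + C2.
  by exists (4 * KJ + C1 + C2) => //; lra.
exists (c * (2 * Rad) ^+ (m + n) + 1).
  have c0 : 0 <= c * (2 * Rad) ^+ (m + n).
    by rewrite mulr_ge0 // exprn_ge0 // mulr_ge0 // ltW.
  lra.
move=> kap k0 k1.
(* Of second order, because the correction meets the slope [1 / kap] of the cut-off at the cone. *)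
pose eps := kap ^+ 2.
have e0 : 0 < eps by rewrite exprn_gt0.
have [d0 d00 hd] := flux_shell k0 e0.
(* The derivative of the lateral step lives up to depth [2 del], which must remain inside the
   layer. *)
exists (d0 / 2); first by rewrite divr_gt0.
move=> del del0 deld.
pose Je k p := J k p + eps * rh1 k p.
pose Je' k p := J' k p + eps * rh2 k k p.
have hJe p : (U `&` D) p -> forall k, [/\ is_derive p (evec R k) (Je k) (Je' k p),
     contw setT p (Je k) & contw setT p (Je' k)].
  move=> [Up Dp] k; have [_ c1 c2 _ d2] := hrh I (p := p).
  have cJp : contw setT p (J k).
    apply: (@contw_nbhs _ _ (closure U)).
      by apply: filterS (open_nbhs_nbhs (conj oU Up)); exact: subset_closure.
    by apply: cJ => //; exact: subset_closure.
  split.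
  - exact: (is_derive_add (dJ k Up Dp) (is_derive_scale eps (d2 k k))).
  - by apply: contwD => //; apply: contwM; [exact: contw_cst|exact: c1].
  - by apply: contwD; [exact: cJ'|apply: contwM; [exact: contw_cst|exact: c2]].
have [cG G0] := Rint_div_cutoff (Kset_compact k0 del0) (Kset_sub k0 del0)
  (fun p => @cut_off kap del p k0 del0) (@is_derive_cut kap del) (@contw_cut kap del)
  (@contw_cut1 kap del) hJe.
set G := (fun p : pt => _) in cG G0.
have cH := cut_cutoff k0 del0.
pose F p := cut kap del p * \sum_k J' k p.
have cF : Cc F.
  by apply: (cutoff_Cc cH) => p [Up Dp]; apply: contw_sum => k; exact: cJ'.
(* Subtracting [G], of integral 0, turns the integrand into one with a pointwise lower bound. *)
pose E p := F p + (-1) * G p.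
have cE : Cc E by apply: CcD => //; exact: CcZ.
have -> : Rint F = Rint E.
  by have [hD hZ _ _ _] := @RintP R (m + n); rewrite hD ?hZ ?G0 ?mulr0 ?addr0 //; exact: CcZ.
have EE p : E p = - (step' (- rh p / del) / del * step (ff p / kap)) * (- \sum_k rh1 k p * Je k p)
    - step (- rh p / del) * (step' (ff p / kap) / kap / 2) *
      (\sum_k sg R k * p ord0 k * J k p + eps * \sum_k sg R k * p ord0 k * rh1 k p)
    - cut kap del p * (eps * \sum_k rh2 k k p).
  rewrite /E /F /G /Je' /Je !mulr_sumr -!sumrN !mulr_sumr -!big_split /= !mulr_sumr -!sumrN -!big_split /=.
  apply: eq_bigr => k _; rewrite /cut1; ring.
have Esupp p : ~ Kset kap del p -> E p = 0.
  move=> Kp; have [z z1] := cut_off k0 del0 Kp.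
  rewrite /E /F /G z mul0r big1 ?mulr0 ?addr0 // => k _.
  by rewrite z1 !mul0r addr0.
have KB p : Kset kap del p -> `|p| <= Rad.
  move=> /(Kset_sub k0 del0)[Up Dp]; apply: le_trans (rr_norm Dp) _.
  exact: closure_rr (subset_closure Up).
have low p : - (c * kap) <= E p.
  have ck0 : 0 <= c * kap by rewrite mulr_ge0 ?(ltW k0).
  have [Kp|/Esupp ->] := pselect (Kset kap del p); last by lra.
  have [Up Dp] := Kset_sub k0 del0 Kp; have Bp := KB p Kp.
  have /andP[a1 a2] := step_itv (- rh p / del).
  have /andP[b1 b2] := step_itv (ff p / kap).
  have /andP[a1' a2'] := step'_itv (- rh p / del).
  have /andP[b1' b2'] := step'_itv (ff p / kap).
  have := hC1 p Bp; have := hC2 p Bp; have := boundJ Up Dp; rewrite EE.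
  set S1 := \sum_k sg R k * _ * J k p; set S2 := \sum_k sg R k * _ * rh1 k p.
  set S3 := \sum_k rh2 k k p; set S4 := \sum_k rh1 k p * Je k p.
  rewrite !ler_norml => /andP[j1 j2] /andP[r1 r2] /andP[s1 s2].
  have fp : kap <= ff p by case: Kp.
  have t1 : 0 <= - (step' (- rh p / del) / del * step (ff p / kap)) * (- S4).
    rewrite mulrNN; have [h|h] := leP (- rh p / del) 2; last first.
      by rewrite (step'_ge2 (ltW h)) !mul0r.
    rewrite mulr_ge0 ?mulr_ge0 ?invr_ge0 ?(ltW del0) //.
    apply: hd => //; rewrite ler_pdivrMr // in h; lra.
  have t2 : step (- rh p / del) * (step' (ff p / kap) / kap / 2) * (S1 + eps * S2)
     <= (4 * KJ + C1) * kap.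
    have [h|h] := leP (ff p / kap) 2; last first.
      rewrite (step'_ge2 (ltW h)) !(mul0r, mulr0) mulr_ge0 ?(ltW k0) //.
      by rewrite addr_ge0 ?mulr_ge0 // ltW.
    rewrite ler_pdivrMr // in h.
    apply: (cone_term_bound (f := ff p)) => //; rewrite ?a1 ?a2 ?b1' ?b2' ?h ?(ltW C10) //.
      by rewrite andbT (le_trans (ltW k0)).
    by rewrite mulrC ler_wpM2r ?(ltW e0).
  have t3 : cut kap del p * (eps * S3) <= C2 * kap.
    have [_ /(_ p) /andP[h0 h1] _] := cH.
    apply: le_trans (_ : 1 * (C2 * kap) <= _); last by rewrite mul1r.
    have ek : eps <= kap by rewrite /eps expr2 ler_piMl // ltW.
    have C2k : 0 <= C2 * kap by rewrite mulr_ge0 // ltW.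
    have [S30|S30] := leP 0 S3.
      apply: ler_pM => //; first by rewrite mulr_ge0 // ltW.
      by rewrite mulrC; apply: ler_pM => //; exact: ltW.
    rewrite mul1r; apply: le_trans C2k; apply: mulr_ge0_le0 => //.
    by rewrite nmulr_lle0 // ltW.
  rewrite cEq; lra.
have ck0 : 0 <= c * kap by rewrite mulr_ge0 ?(ltW k0).
have hlow := @Rint_lower R (m + n) E (c * kap) Rad cE ck0 (ltW Rad0) low.
apply: le_trans (hlow _); last first.
  by move=> p pR; apply: Esupp => /KB; lra.
have : 0 <= (2 * Rad) ^+ (m + n) by rewrite exprn_ge0 //; lra.
rewrite mulrAC mulrDl mul1r; lra.
Qed.

(** Along [kap = 1 / (i + 1)] the cut-off equals 1 eventually at each point, and [H (B - div J)] is
    continuous and nonnegative. Fatou's lemma then bounds the integral of [A], which may be an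
    arbitrary function. *)
Theorem div_estimate (A B : pt -> R) (M : R) :
  (forall p, U p -> D p -> contw setT p B) ->
  (forall p, U p -> D p -> 0 <= A p <= B p - \sum_k J' k p) ->
  (forall H, cutoff (U `&` D) H -> Rint (fun p => H p * B p) <= M) ->
  (int_over (U `&` D) A <= M%:E)%E.
Proof.
move=> cB hA hM; have [C C0 hC] := cut_div_lower.
pose kap (i : nat) : R := i.+1%:R^-1.
have kap0 i : 0 < kap i by rewrite invr_gt0.
have kap1 i : kap i <= 1 by rewrite invf_le1 // ler1n.
have /choice[dl hdl] : forall i, exists d, [/\ 0 < d, d <= kap i &
    - (C * kap i) <= Rint (fun p => cut (kap i) d p * \sum_k J' k p)].
  move=> i; have [d0 d00 hd] := hC _ (kap0 i) (kap1 i).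
  exists (Num.min d0 (kap i)); split.
  - by rewrite lt_min d00 kap0.
  - by rewrite ge_min lexx orbT.
  - by apply: hd; rewrite ?lt_min ?d00 ?kap0 // ge_min lexx.
pose H i := cut (kap i) (dl i).
have cH i : cutoff (U `&` D) (H i) by have [d0 _ _] := hdl i; exact: cut_cutoff.
have cdiv p : (U `&` D) p -> contw setT p (fun q => \sum_k J' k q).
  by move=> [Up Dp]; apply: contw_sum => k; exact: cJ'.
pose F i p := H i p * (B p + (-1) * \sum_k J' k p).
have cF i : Cc (F i).
  apply: (cutoff_Cc (cH i)) => p UD; apply: contwD; first by case: UD; exact: cB.
  by apply: contwM; [exact: contw_cst|exact: cdiv].
have F0 i p : 0 <= F i p.
  have [_ /(_ p) /andP[h0 _] [K _ [KO hK]]] := cH i.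
  have [Kp|/hK] := pselect (K p); last by rewrite /F => ->; rewrite mul0r.
  have [Up Dp] := KO p Kp; have := hA p Up Dp.
  by move=> h; rewrite mulr_ge0 //; lra.
have kapcvg e : 0 < e -> exists k, forall i, (k <= i)%N -> kap i < e.
  move=> e0; exists (Num.truncn e^-1) => i ki.
  rewrite /kap invf_plt ?posrE //.
  apply: lt_le_trans (truncnS_gt _) _; by rewrite ler_nat ltnS.
apply: (@le_trans _ _ (limn_einf (fun i => (Rint (F i))%:E))).
  apply: lebint_fatou => //.
    move=> p; case: asboolP => // -[Up Dp]; rewrite lee_fin.
    by have /andP[] := hA p Up Dp.
  move=> p; case: asboolP => [[Up Dp]|_]; last first.
    by apply: (@limn_einf_ge R _ _ 0) => i _; rewrite lee_fin.
  have fp : 0 < ff p := Dp.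
  have rp : 0 < - rh p by rewrite oppr_gt0; exact: rho_in.
  have e0 : 0 < Num.min (ff p / 2) (- rh p / 2) by rewrite lt_min !divr_gt0.
  have [k hk] := kapcvg _ e0.
  apply: (@limn_einf_ge R _ _ k) => i /hk; rewrite lt_min => /andP[k1 k2].
  have [d0 dk _] := hdl i.
  rewrite lee_fin /F /H /cut !step_ge2 ?mul1r.
  - by have := hA p Up Dp; lra.
  - by rewrite ler_pdivlMr //; lra.
  - by rewrite ler_pdivlMr //; lra.
apply: limn_einf_le => e e0.
have [k hk] := kapcvg (e / C) (divr_gt0 e0 C0).
exists k => i /hk ki; rewrite lee_fin.
have [hD hZ _ _ _] := @RintP R (m + n).
have cHB : Cc (fun p => H i p * B p) by apply: (cutoff_Cc (cH i)) => p [Up Dp]; exact: cB.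
have cHJ : Cc (fun p => H i p * \sum_k J' k p) by exact: (cutoff_Cc (cH i)).
have -> : Rint (F i) = Rint (fun p => H i p * B p + (-1) * (H i p * \sum_k J' k p)).
  by apply: Rint_eq => p; rewrite /F; ring.
rewrite hD ?hZ //; last exact: CcZ.
have := hM _ (cH i); have [_ _] := hdl i; rewrite -/(H i).
have : C * kap i < e by rewrite mulrC -ltr_pdivlMr.
lra.
Qed.

End Divergence.

(** * The gradient on the boundary *)

Section SegmentMVT.
Variables (R : realType) (N : nat).
Notation pt := 'rV[R]_N.
Variable U : set pt.
Hypothesis oU : open U.
Variables (z : pt -> R) (z1 : 'I_N -> pt -> R).
Hypothesis hz : gradcont U z z1.
Hypothesis cz : forall p, closure U p -> contw (closure U) p z.

Lemma segment_mvt (p v : pt) (L : R) : 0 < L ->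
  (forall t : R, 0 < t -> t < L -> U (t *: v + p)) -> closure U p -> closure U (L *: v + p) ->
  exists t : R, [/\ 0 < t, t < L &
    z (L *: v + p) - z p = L * \sum_k v ord0 k * z1 k (t *: v + p)].
Proof.
move=> L0 hU c0 cL.
have clU (t : R) : 0 <= t -> t <= L -> closure U (t *: v + p).
  rewrite !le_eqVlt => /orP[/eqP <-|t0]; first by rewrite scale0r add0r.
  by move=> /orP[/eqP ->//|tL]; apply: subset_closure; exact: hU.
have [| |t /[!in_itv] /= /andP[t0 tL]] := @MVT R (fun t => z (t *: v + p))
    (fun t => \sum_k v ord0 k * z1 k (t *: v + p)) 0 L L0.
- move=> t /[!in_itv] /= /andP[t0 tL]; apply: is_derive_line.
  by apply: (gradcont_is_derive v oU hz); exact: hU.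
- apply/subspace_continuousP => t /=; rewrite in_itv /= => /andP[t0 tL].
  apply: (@contw_epsP R R^o `[0, L]%classic t (fun t : R => z (t *: v + p))).2 => e e0.
  have /contw_epsP /(_ e e0)[d d0 hd] := cz (clU t t0 tL).
  have v1 : 0 < `|v| + 1 by rewrite ltr_wpDl.
  exists (d / (`|v| + 1)); first by rewrite divr_gt0.
  move=> s /=; rewrite in_itv /= => /andP[s0 sL] ts; apply: hd; first exact: clU.
  rewrite opprD addrACA subrr addr0 -scalerBl normrZ.
  rewrite ltr_pdivlMr // in ts; apply: le_lt_trans ts.
  by rewrite ler_wpM2l // lerDl.
rewrite scale0r add0r subr0 mulrC => e; exists t; split => //.
Qed.

End SegmentMVT.

(** The boundary is not flattened. For tangential [v], go from [p] a length [s] along [ve], tilted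
    slightly inwards, to an interior point [q]; from there the direction [nn] of [grad rho] reaches
    the boundary within [2 e s]. Since [z] vanishes at both ends, [z q] is at most of order [e s],
    so the derivative along [ve] is of order [e]; then [e] tends to 0. *)
Lemma boundary_gradient (R : realType) (N : nat) (U D : set 'rV[R]_N) (rh : 'rV[R]_N -> R)
    (rh1 : 'I_N -> 'rV[R]_N -> R) :
  open U -> open D -> gradcont setT rh rh1 ->
  (forall p, U p -> rh p < 0) -> (forall p, ~ U p -> 0 <= rh p) ->
  forall (z : 'rV[R]_N -> R) (z1 : 'I_N -> 'rV[R]_N -> R),
  gradcont U z z1 -> (forall p, closure U p -> contw (closure U) p z) ->
  (forall p k, closure U p -> contw (closure U) p (z1 k)) ->
  (forall p, (closure U `\` U) p -> D p -> z p = 0) ->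
  forall p, (closure U `\` U) p -> D p -> rh p = 0 ->
  0 < \sum_k rh1 k p ^+ 2 -> exists c, forall k, z1 k p = c * rh1 k p.
Proof.
move=> oU oD hrh rh_in rh_out z z1 hz cz cz1 z0 p bp Dp rp; set g := \sum_k _ => g0.
have [cp nUp] := bp.
pose G : 'rV[R]_N := \row_k z1 k p; pose nn : 'rV[R]_N := \row_k rh1 k p.
pose dot (v : 'rV[R]_N) (w : 'I_N -> R) := \sum_k v ord0 k * w k.
have dotL (a b : R) (v w : 'rV[R]_N) (u : 'I_N -> R) : dot (a *: v + b *: w) u = a * dot v u + b * dot w u.
  by rewrite /dot !mulr_sumr -big_split /=; apply: eq_bigr => k _; rewrite !mxE; ring.
have gE : dot nn (rh1^~ p) = g.
  by apply: eq_bigr => k _; rewrite mxE expr2.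
suff tang : forall v, dot v (rh1^~ p) = 0 -> dot v (z1^~ p) = 0.
  (* The component of the gradient orthogonal to [nn] is itself tangential; tested against itself it
     must vanish. *)
  pose c := dot nn (z1^~ p) / g.
  exists c; pose v := 1 *: G + (- c) *: nn.
  have hv : dot v (rh1^~ p) = 0.
    rewrite dotL gE /c (_ : dot G _ = dot nn (z1^~ p)); last first.
      by apply: eq_bigr => k _; rewrite !mxE mulrC.
    by field; rewrite lt0r_neq0.
  have e0 : esq v = 0.
    have := tang v hv; have -> : esq v = dot v (z1^~ p) + (- c) * dot v (rh1^~ p).
      rewrite /dot mulr_sumr -big_split /=; apply: eq_bigr => k _.
      by rewrite !mxE; ring.
    by rewrite hv => ->; rewrite mulr0 addr0.
  by move=> k; have /rowP /(_ k) := esq_eq0 e0; rewrite !mxE; lra.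
move=> v vn; apply/eqP; rewrite -normr_le0; apply/ler_addgt0Pl => e' e'0.
pose Gn := dot nn (z1^~ p).
have Gn0 := normr_ge0 Gn.
pose e := e' / (3 * `|Gn| + 3).
have e0 : 0 < e by rewrite divr_gt0 //; lra.
suff key : `|dot v (z1^~ p)| <= e * `|Gn| + e + 2 * e * (`|Gn| + 1).
  apply: le_trans key _; rewrite addr0.
  have -> : e * `|Gn| + e + 2 * e * (`|Gn| + 1) = e * (3 * `|Gn| + 3) by ring.
  by rewrite /e divfK // lt0r_neq0 //; lra.
(* [ve] points inwards and [vp] outwards, and [s vp] is [s ve + 2 e s nn]: this is why the boundary
   is crossed within [2 e s]. *)
pose ve := 1 *: v + (- e) *: nn.
pose vp := 1 *: v + e *: nn.
have nve : dot ve (rh1^~ p) = - (e * g) by rewrite dotL vn gE; ring.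
have nvp : dot vp (rh1^~ p) = e * g by rewrite dotL vn gE; ring.
have eg0 : 0 < e * g / 2 by rewrite divr_gt0 ?mulr_gt0.
have [s1 s10 h1] := @dir_taylor R N setT rh rh1 p ve _ (@openT _) hrh I eg0.
have [s2 s20 h2] := @dir_taylor R N setT rh rh1 p vp _ (@openT _) hrh I eg0.
have veneg s : 0 < s -> s <= s1 -> rh (s *: ve + p) < 0.
  move=> s0 ss; have [_] := h1 s s0 ss; rewrite rp -/(dot ve _) nve ler_norml => /andP[_].
  have : 0 < e * g * s by rewrite !mulr_gt0.
  lra.
have vppos s : 0 < s -> s <= s2 -> 0 < rh (s *: vp + p).
  move=> s0 ss; have [_] := h2 s s0 ss; rewrite rp -/(dot vp _) nvp ler_norml => /andP[+ _].
  have : 0 < e * g * s by rewrite !mulr_gt0.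
  lra.
have inU q : rh q < 0 -> U q.
  by move=> rq; apply: contrapT => /rh_out; lra.
have cve : contw (closure U) p (fun q => dot ve (z1^~ q)).
  by apply: contw_sum => k; apply: contwM; [exact: contw_cst|exact: cz1].
have cnn : contw (closure U) p (fun q => dot nn (z1^~ q)).
  by apply: contw_sum => k; apply: contwM; [exact: contw_cst|exact: cz1].
have crn : contw setT p (fun q => dot nn (rh1^~ q)).
  apply: contw_sum => k; apply: contwM; first exact: contw_cst.
  by have [_] := hrh p I; apply.
have [r1 r10 hr1] := (contw_epsP _ _ _).1 cve e e0.
have [r2 r20 hr2] := (contw_epsP _ _ _).1 cnn 1 ltr01.
have [r3 r30 hr3] := (contw_epsP _ _ _).1 crn g g0.
have [r4 r40 hr4] := open_cball oD Dp.
pose r := Num.min (Num.min r1 r2) (Num.min r3 r4).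
have r0 : 0 < r by rewrite !lt_min r10 r20 r30 r40.
have [k1 [k2 [k3 k4]]] : r <= r1 /\ r <= r2 /\ r <= r3 /\ r <= r4.
  by rewrite /r !ge_min !lexx ?orbT.
pose K := `|ve| + 2 * e * `|nn| + 1.
have K0 : 0 < K.
  have := normr_ge0 ve; have := normr_ge0 nn => x1 x2.
  have : 0 <= e * `|nn| by rewrite mulr_ge0 // ltW.
  rewrite /K; clear -x1 x2; lra.
pose s := Num.min (Num.min s1 s2) (r / K / 2).
have s0 : 0 < s by rewrite !lt_min s10 s20 !divr_gt0.
have [j1 [j2 j3]] : s <= s1 /\ s <= s2 /\ s <= r / K / 2.
  by rewrite /s !ge_min !lexx ?orbT.
have sK : s * K < r.
  have : s * K <= r / 2.
    rewrite -ler_pdivlMr // mulrAC; apply: le_trans j3 _; clear; lra.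
  clear -r0; lra.
have cU q : U q -> closure U q by exact: subset_closure.
have pd (w : 'rV[R]_N) : p - (w + p) = - w by rewrite opprD addrC subrK.
have near1 (t : R) : 0 < t -> t <= s -> `|p - (t *: ve + p)| < r.
  move=> t0 ts; rewrite pd normrN normrZ gtr0_norm //.
  apply: le_lt_trans sK; apply: ler_pM => //; first exact: ltW.
  rewrite /K -addrA lerDl addr_ge0 // mulr_ge0 // mulr_ge0 // ltW //.
have near2 (t : R) : 0 <= t -> t <= 2 * e * s -> `|p - (t *: nn + (s *: ve + p))| < r.
  move=> t0 ts; rewrite addrA pd normrN; apply: le_lt_trans sK.
  apply: le_trans (ler_normD _ _) _; rewrite !normrZ (ger0_norm t0) (gtr0_norm s0).
  have : t * `|nn| <= 2 * e * s * `|nn| by rewrite ler_wpM2r.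
  have -> : s * K = s * `|ve| + 2 * e * s * `|nn| + s by rewrite /K; ring.
  clear -s0; lra.
have [t [t0 ts e1]] := segment_mvt oU hz cz s0 (fun t t0 ts => inU _ (veneg t t0 (le_trans (ltW ts) j1)))
   cp (cU _ (inU _ (veneg s s0 j1))).
rewrite (z0 _ bp Dp) subr0 in e1.
set q := s *: ve + p in e1 near2.
have Uq : U q by apply: inU; exact: veneg.
have es0 : 0 < 2 * e * s by rewrite !mulr_gt0.
have rq2 : 0 < rh (2 * e * s *: nn + q).
  rewrite (_ : _ *: _ + q = s *: vp + p); first exact: vppos.
  rewrite /q addrA; congr (_ + _); apply/rowP => k; rewrite !mxE; ring.
pose h (t : R) := rh (t *: nn + q).
have dh (x : R) : is_derive x 1 h (dot nn (rh1^~ (x *: nn + q))).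
  by apply: is_derive_line; exact: (gradcont_is_derive nn (@openT _) hrh I).
have ch : continuous h by move=> x; exact: is_derive_continuous1 (dh x).
have h00 : h 0 < 0 by rewrite /h scale0r add0r; exact: rh_in.
have [th /[!in_itv] /= /andP[th0 th1] hth] : exists2 c : R, c \in `[0, 2 * e * s] & h c = 0.
  apply: IVT; [exact: ltW|exact: continuous_subspaceT|].
  by rewrite ge_min le_max (ltW h00) (ltW rq2) orbT.
have thp : 0 < th.
  rewrite lt_neqAle th0 andbT; apply/eqP => e2; by have := h00; rewrite [X in h X]e2 hth ltxx.
(* Near [p] the derivative of [rho] along [nn] stays within [g] of its value [g] at [p], hence is
   positive. So the whole segment before the zero [th] lies in [U]. *)
have mono (x : R) : 0 <= x -> x < th -> h x < 0.
  move=> x0 xth.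
  have [|y /[!in_itv] /= /andP[y1 y2] e2] := @MVT R h (fun x => dot nn (rh1^~ (x *: nn + q))) x th xth.
    exact: continuous_subspaceT.
  have : 0 < dot nn (rh1^~ (y *: nn + q)).
    have := hr3 (y *: nn + q) I; rewrite gE => hh.
    have : `|g - dot nn (rh1^~ (y *: nn + q))| < g.
      apply: hh; apply: lt_le_trans (near2 y _ _) k3; clear -x0 y1 y2 th1; lra.
    by rewrite ltr_norml => /andP[]; clear; lra.
  move=> dp; have : 0 < h th - h x by rewrite e2 mulr_gt0 // subr_gt0.
  clear -hth; lra.
pose bq := th *: nn + q.
have Ubq (x : R) : 0 < x -> x < th -> U (x *: nn + q).
  by move=> x0 xt; apply: inU; apply: mono => //; exact: ltW.
have cbq : closure U bq.
  move=> B /nbhs_ballP[d /= d0 hB].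
  have n1 : 0 < `|nn| + 1 by rewrite ltr_wpDl.
  pose x := th - Num.min (th / 2) (d / (`|nn| + 1) / 2).
  have m0 : 0 < Num.min (th / 2) (d / (`|nn| + 1) / 2) by rewrite lt_min !divr_gt0.
  have m1 : Num.min (th / 2) (d / (`|nn| + 1) / 2) <= th / 2 by rewrite ge_min lexx.
  have m2 : Num.min (th / 2) (d / (`|nn| + 1) / 2) <= d / (`|nn| + 1) / 2.
    by rewrite ge_min lexx orbT.
  exists (x *: nn + q); split; first by apply: Ubq; rewrite /x; clear -thp m0 m1; lra.
  apply: hB; rewrite -ball_normE /= /bq opprD addrACA subrr addr0 -scalerBl normrZ.
  rewrite /x opprB addrCA subrr addr0 gtr0_norm //.
  have m3 : Num.min (th / 2) (d / (`|nn| + 1) / 2) * (`|nn| + 1) <= d / 2.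
    rewrite -ler_pdivlMr //; apply: le_trans m2 _.
    by rewrite [d / 2 / _]mulrAC.
  rewrite mulrDr mulr1 in m3; clear -m3 m0 d0; lra.
have bbq : (closure U `\` U) bq by split => // /rh_in; rewrite -/(h th) hth ltxx.
have Dbq : D bq.
  apply: hr4; rewrite distrC; apply: ltW; apply: lt_le_trans (near2 th _ _) k4 => //.
have [t' [t'0 t's e2]] := segment_mvt oU hz cz thp Ubq (cU _ Uq) cbq.
rewrite (z0 _ bbq Dbq) sub0r -/(dot nn _) in e2.
have b2 : `|dot nn (z1^~ (t' *: nn + q))| <= `|Gn| + 1.
  have Ut : U (t' *: nn + q) by exact: Ubq.
  have : `|Gn - dot nn (z1^~ (t' *: nn + q))| < 1.
    apply: hr2; first exact: cU.
    by apply: lt_le_trans (near2 t' _ _) k2; clear -t'0 t's th1; lra.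
  have := ler_normB Gn (Gn - dot nn (z1^~ (t' *: nn + q))); rewrite subKr; clear; lra.
have b1 : `|dot ve (z1^~ p) - dot ve (z1^~ (t *: ve + p))| < e.
  apply: hr1; first by apply: cU; apply: inU; apply: veneg => //; clear -ts j1; lra.
  by apply: lt_le_trans (near1 t _ _) k1 => //; exact: ltW.
have zq : `|z q| <= 2 * e * s * (`|Gn| + 1).
  by rewrite -normrN e2 normrM gtr0_norm // ler_pM // ltW.
have b3 : `|dot ve (z1^~ (t *: ve + p))| <= 2 * e * (`|Gn| + 1).
  rewrite -(ler_pM2l s0); move: zq; rewrite e1 normrM gtr0_norm // -/(dot ve _).
  by move=> H; apply: le_trans H _; rewrite le_eqVlt; apply/orP; left; apply/eqP; ring.
have -> : dot v (z1^~ p) = e * Gn + ((dot ve (z1^~ p) - dot ve (z1^~ (t *: ve + p))) + dot ve (z1^~ (t *: ve + p))).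
  by rewrite subrK dotL -/Gn; ring.
set x1 := dot ve (z1^~ p) - _ in b1 *; set x2 := dot ve _ in b3 *.
have := ler_normD (e * Gn) (x1 + x2); have := ler_normD x1 x2.
rewrite normrM (gtr0_norm e0); clear -b1 b3; lra.
Qed.

(** * The Carleman identity *)

(* The Carleman identity after contraction of all indices: [Ct], [Cx] stand for the
   terms with second derivatives of [psi], which cancel. *)
Lemma carleman_identity_scalar (F : realFieldType)
  (lam be f r tau2 m n Kx Kt X Tt psi Ct Cx bp : F) (f0 : f != 0) (r0 : r != 0) :
  tau2 = r ^+ 2 - 4 * f ->
  let A := lam / (2 * f) in let B := be * (r^-1 + 2) in
  let c := (m + n - 4) / 2 in let c0 := lam * c in let c1 := be * (n - 2) in
  let q := c0 / f + c1 / r + 2 * be * (n - 1) in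
  let p := be * (1 + 2 * r) in let p' := 2 * be in
  let S := X + Tt in let K := Kx - Kt in
  let M := 2 * A * S + 2 * B * X + q * psi in
  let V := (lam ^+ 2 - lam) / f + lam * r * p / f + p ^+ 2 - p / r in
  let Et := (K - V * psi ^+ 2) * A + c0 / (4 * f ^+ 2) * psi ^+ 2 in
  let Ex := (K - V * psi ^+ 2) * (A + B) + (c0 / (4 * f ^+ 2) - c1 / (2 * r ^+ 3)) * psi ^+ 2 in
  let T := S + c * psi in
  let Z := (lam ^+ 2 * r ^+ 2 * p' / 2 + lam * r * p / 2 - lam * r ^+ 2 * p ^+ 2 / 2) / f ^+ 2
    + (2 * lam * r * p * p' + 3 * lam * p ^+ 2 - lam * p' / 2 + (lam ^+ 2 - 3 * lam / 2) * p / r) / f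
    + 2 * p ^+ 2 * p' - p * p' / r + p ^+ 3 / r + c1 * (n - 3) / (2 * r ^+ 3) in
  let dA (df : F) := - lam / (2 * f ^+ 2) * df in
  let dB (dr : F) := - be / r ^+ 2 * dr in
  let dq (df dr : F) := - c0 / f ^+ 2 * df - c1 / r ^+ 2 * dr in
  let dV (df dr : F) := - (lam ^+ 2 - lam) / f ^+ 2 * df
    + lam * ((be + 4 * be * r) * dr / f - r * p / f ^+ 2 * df) + 2 * p * p' * dr
    - (p' / r - p / r ^+ 2) * dr in
  let DM := 2 * (dA (S / 2) * S + A * (K + Ct + Cx)) + 2 * (dB (X / r) * X + B * (Kx + Cx))
    + (dq (S / 2) (X / r) * psi + q * K) in
  let dEt (df dr dpsi dK : F) := (dK - (dV df dr * psi ^+ 2 + V * (2 * psi * dpsi))) * A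
    + (K - V * psi ^+ 2) * dA df
    + (- c0 / (2 * f ^+ 3) * df * psi ^+ 2 + c0 / (4 * f ^+ 2) * (2 * psi * dpsi)) in
  let dEx (df dr dpsi dK : F) := (dK - (dV df dr * psi ^+ 2 + V * (2 * psi * dpsi))) * (A + B)
    + (K - V * psi ^+ 2) * (dA df + dB dr)
    + ((- c0 / (2 * f ^+ 3) * df + 3 * c1 / (2 * r ^+ 4) * dr) * psi ^+ 2
       + (c0 / (4 * f ^+ 2) - c1 / (2 * r ^+ 3)) * (2 * psi * dpsi)) in
  let divJ := - DM - M * bp + m * Et + n * Ex + dEt (- tau2 / 2) 0 Tt (2 * Ct)
    + dEx (r ^+ 2 / 2) r X (2 * Cx) in
  - (bp - 2 * (A * S + B * X) + (V - q) * psi) * M =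
   M ^+ 2 - lam / (2 * f ^+ 2) * T ^+ 2 + B * (Kx + Kt) - 2 * be / r ^+ 3 * X ^+ 2
     + Z * psi ^+ 2 + divJ.
Proof. by move=> -> /=; field; rewrite f0 r0. Qed.

(** * The coefficients of the weight, the multiplier and the current *)

Section Flux.
Variables (R : realType) (m n : nat).
Notation pt := 'rV[R]_(m + n).
Notation al := ('I_(m + n)).
Variables (lam be : R).
Let D := @Dom R m n.

Definition wA (p : pt) : R := lam / (2 * ff p).
Definition wB (p : pt) : R := be * ((rr p)^-1 + 2).
Definition cc0 : R := lam * (((m%:R + n%:R) - 4) / 2).
Definition cc1 : R := be * (n%:R - 2).
(** Together with [wV] this splits the zero-order coefficient of the conjugated operator,
    [|grad ln W|^2 - box (ln W) = wV - wq]. The conjugated operator is then [box psi + wV psi - M],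
    and its product with [- M] starts with the square [M^2]. *)
Definition wq (p : pt) : R := cc0 / ff p + cc1 / rr p + 2 * be * (n%:R - 1).
Definition wp (p : pt) : R := be * (1 + 2 * rr p).
Definition wV (p : pt) : R :=
  (lam ^+ 2 - lam) / ff p + lam * rr p * wp p / ff p + wp p ^+ 2 - wp p / rr p.
(** Coefficients of [psi^2] in the current. Half the gradient of [wq] would contribute
    [- cc0 / (4 f^2)]; the sign is reversed because the square [(S + c psi)^2] takes up twice the
    cross term. *)
Definition wCt (p : pt) : R := cc0 / (4 * ff p ^+ 2).
Definition wCx (p : pt) : R := cc0 / (4 * ff p ^+ 2) - cc1 / (2 * rr p ^+ 3).

Definition fk (k : al) (p : pt) : R := sg R k * p ord0 k / 2.
Definition rk (k : al) (p : pt) : R := isx R k * p ord0 k / rr p.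

Section At.
Variables (p : pt) (k : al).
Hypothesis Dp : D p.
Let f0 : ff p != 0. Proof. by rewrite lt0r_neq0. Qed.
Let r0 : rr p != 0. Proof. by rewrite lt0r_neq0 // Dom_rr. Qed.
Let df := is_derive_ff p k.
Let dr := is_derive_rr k Dp.

Lemma is_derive_iff : is_derive p (evec R k) (fun q : pt => (ff q)^-1) (- fk k p / ff p ^+ 2).
Proof. exact: is_derive_inv. Qed.

Lemma is_derive_irr : is_derive p (evec R k) (fun q : pt => (rr q)^-1) (- rk k p / rr p ^+ 2).
Proof. exact: is_derive_inv. Qed.

Lemma is_derive_wA : is_derive p (evec R k) wA (- lam / (2 * ff p ^+ 2) * fk k p).
Proof.
rewrite (_ : wA = fun q => lam / 2 * (ff q)^-1); last first.
  by apply/funext => q; rewrite /wA invfM mulrA.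
have := is_derive_scale (lam / 2) is_derive_iff.
by apply: is_derive_cast; field.
Qed.

Lemma is_derive_wB : is_derive p (evec R k) wB (- be / rr p ^+ 2 * rk k p).
Proof.
have := is_derive_scale be (is_derive_add is_derive_irr (is_derive_fcst 2 p (evec R k))).
by apply: is_derive_cast; ring.
Qed.

Lemma is_derive_wq : is_derive p (evec R k) wq
  (- cc0 / ff p ^+ 2 * fk k p - cc1 / rr p ^+ 2 * rk k p).
Proof.
have := is_derive_add (is_derive_add (is_derive_scale cc0 is_derive_iff)
  (is_derive_scale cc1 is_derive_irr)) (is_derive_fcst (2 * be * (n%:R - 1)) p (evec R k)).
by apply: is_derive_cast; ring.
Qed.

Lemma is_derive_wp : is_derive p (evec R k) wp (2 * be * rk k p).
Proof.
have := is_derive_scale be (is_derive_add (is_derive_fcst 1 p (evec R k)) (is_derive_scale 2 dr)).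
by apply: is_derive_cast; rewrite /rk; ring.
Qed.

Lemma is_derive_wV : is_derive p (evec R k) wV
  (- (lam ^+ 2 - lam) / ff p ^+ 2 * fk k p
    + lam * ((be + 4 * be * rr p) * rk k p / ff p - rr p * wp p / ff p ^+ 2 * fk k p)
    + 2 * wp p * (2 * be) * rk k p - (2 * be / rr p - wp p / rr p ^+ 2) * rk k p).
Proof.
have dwp := is_derive_wp.
have := is_derive_add (is_derive_add (is_derive_add
  (is_derive_scale (lam ^+ 2 - lam) is_derive_iff)
  (is_derive_mul (is_derive_mul (is_derive_scale lam dr) dwp) is_derive_iff))
  (is_derive_mul dwp dwp)) (is_derive_opp (is_derive_mul dwp is_derive_irr)).
rewrite (_ : (fun q => _) = wV); last by apply/funext => q; rewrite /wV expr2.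
by apply: is_derive_cast; rewrite -/(rk k p) /wp; field; rewrite f0 r0.
Qed.

Lemma is_derive_wCt : is_derive p (evec R k) wCt (- cc0 / (2 * ff p ^+ 3) * fk k p).
Proof.
have := is_derive_scale (cc0 / 4) (is_derive_mul is_derive_iff is_derive_iff).
rewrite (_ : (fun q => _) = wCt); last first.
  by apply/funext => q; rewrite /wCt expr2 !invfM; ring.
by apply: is_derive_cast; field.
Qed.

Lemma is_derive_wCx : is_derive p (evec R k) wCx
  (- cc0 / (2 * ff p ^+ 3) * fk k p + 3 * cc1 / (2 * rr p ^+ 4) * rk k p).
Proof.
have i3 := is_derive_mul is_derive_irr (is_derive_mul is_derive_irr is_derive_irr).
have := is_derive_add is_derive_wCt (is_derive_scale (- (cc1 / 2)) i3).
rewrite (_ : (fun q => _) = wCx); last first.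
  apply/funext => q; rewrite /wCx -/(wCt q) mulNr; congr (_ - _).
  rewrite -!mulrA; congr (_ * _); rewrite invfM; congr (_ * _).
  by rewrite !exprS expr0 mulr1 !invfM.
by apply: is_derive_cast; field; rewrite f0 r0.
Qed.

End At.

Lemma contw_wA A (p : pt) : D p -> contw A p wA.
Proof.
move=> Dp; rewrite /wA; apply: contwM; first exact: contw_cst.
apply: contwV; first by rewrite mulf_neq0 // lt0r_neq0.
by apply: contwM; [exact: contw_cst|exact: contw_ff].
Qed.

Lemma contw_wB A (p : pt) : D p -> contw A p wB.
Proof.
move=> Dp; apply: contwM; first exact: contw_cst.
by apply: contwD; [exact: contw_irr|exact: contw_cst].
Qed.

Lemma contw_wq A (p : pt) : D p -> contw A p wq.
Proof.
move=> Dp; apply: contwD; last exact: contw_cst.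
apply: contwD; (apply: contwM; first exact: contw_cst).
  exact: contw_iff.
exact: contw_irr.
Qed.

Lemma contw_wp A (p : pt) : contw A p wp.
Proof.
apply: contwM; first exact: contw_cst.
apply: contwD; first exact: contw_cst.
by apply: contwM; [exact: contw_cst|exact: contw_rr].
Qed.

Lemma contw_wV A (p : pt) : D p -> contw A p wV.
Proof.
move=> Dp; have cp := @contw_wp A p; have ci := contw_iff A Dp; have cr := contw_irr A Dp.
apply: contwB; last exact: contwM.
apply: contwD; last exact: contwX.
apply: contwD; apply: contwM => //; first exact: contw_cst.
apply: contwM => //; apply: contwM; [exact: contw_cst|exact: contw_rr].
Qed.

Lemma contw_wCt A (p : pt) : D p -> contw A p wCt.
Proof.
move=> Dp; apply: contwM; first exact: contw_cst.
apply: contwV; first by rewrite mulf_neq0 // expf_neq0 // lt0r_neq0.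
by apply: contwM; [exact: contw_cst|apply: contwX; exact: contw_ff].
Qed.

Lemma contw_wCx A (p : pt) : D p -> contw A p wCx.
Proof.
move=> Dp; apply: contwB; first exact: contw_wCt.
apply: contwM; first exact: contw_cst.
apply: contwV; first by rewrite mulf_neq0 // expf_neq0 // lt0r_neq0 // Dom_rr.
by apply: contwM; [exact: contw_cst|apply: contwX; exact: contw_rr].
Qed.

Section Psi.
Variables (psi : pt -> R) (psi1 : al -> pt -> R).

Definition sX (p : pt) : R := \sum_k isx R k * (p ord0 k * psi1 k p).
Definition sT (p : pt) : R := \sum_k (1 - isx R k) * (p ord0 k * psi1 k p).
Definition sKx (p : pt) : R := \sum_k isx R k * psi1 k p ^+ 2.
Definition sKt (p : pt) : R := \sum_k (1 - isx R k) * psi1 k p ^+ 2.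
Definition sK (p : pt) : R := \sum_k sg R k * (psi1 k p * psi1 k p).
Definition sM (p : pt) : R :=
  2 * (wA p * (sX p + sT p)) + 2 * (wB p * sX p) + wq p * psi p.
Definition sEt (p : pt) : R :=
  (sK p - wV p * (psi p * psi p)) * wA p + wCt p * (psi p * psi p).
Definition sEx (p : pt) : R :=
  (sK p - wV p * (psi p * psi p)) * (wA p + wB p) + wCx p * (psi p * psi p).
(** The current with raised index, so that its divergence is the plain sum of the [d_k J^k]:
    [- M grad psi], plus [K - V psi^2] times the vector field [A (t, x) + B (0, x)], plus the
    zero-order terms. *)
Definition sJ (k : al) (p : pt) : R :=
  - (sM p * (sg R k * psi1 k p)) + p ord0 k * ((1 - isx R k) * sEt p + isx R k * sEx p).

Lemma sKE p : sK p = sKx p - sKt p.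
Proof.
rewrite /sK /sKx /sKt -sumrB; apply: eq_bigr => k _.
by rewrite /sg expr2; ring.
Qed.

Lemma contw_sJ A p k : D p -> contw A p psi -> (forall k, contw A p (psi1 k)) ->
  contw A p (sJ k).
Proof.
move=> Dp c0 c1.
have cX : contw A p sX.
  apply: contw_sum => l; apply: contwM; first exact: contw_cst.
  by apply: contwM => //; exact: contw_coord.
have cT : contw A p sT.
  apply: contw_sum => l; apply: contwM; first exact: contw_cst.
  by apply: contwM => //; exact: contw_coord.
have cK : contw A p sK.
  apply: contw_sum => l; apply: contwM; first exact: contw_cst.
  exact: contwM.
have cA := contw_wA A Dp; have cB := contw_wB A Dp; have cq := contw_wq A Dp.
have cV := contw_wV A Dp; have cCt := contw_wCt A Dp; have cCx := contw_wCx A Dp.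
have cM : contw A p sM.
  apply: contwD; last exact: contwM.
  apply: contwD; (apply: contwM; first exact: contw_cst); apply: contwM => //.
  exact: contwD.
have cE : contw A p (fun q => sK q - wV q * (psi q * psi q)).
  by apply: contwB => //; apply: contwM => //; exact: contwM.
apply: contwD.
  apply: contwN; apply: contwM => //; apply: contwM => //; exact: contw_cst.
apply: contwM; first exact: contw_coord.
apply: contwD; (apply: contwM; first exact: contw_cst); apply: contwD; apply: contwM => //;
  by [exact: contwM|exact: contwD].
Qed.

End Psi.

Section PsiD.
Variables (psi : pt -> R) (psi1 : al -> pt -> R) (psi2 : al -> al -> pt -> R).
Notation sX := (sX psi1). Notation sT := (sT psi1). Notation sKx := (sKx psi1).
Notation sKt := (sKt psi1). Notation sK := (sK psi1).
Notation sM := (sM psi psi1). Notation sEt := (sEt psi psi1). Notation sEx := (sEx psi psi1).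

Definition sX' k (p : pt) : R := isx R k * psi1 k p + \sum_l isx R l * (p ord0 l * psi2 l k p).
Definition sT' k (p : pt) : R := (1 - isx R k) * psi1 k p + \sum_l (1 - isx R l) * (p ord0 l * psi2 l k p).
Definition sK' k (p : pt) : R := 2 * \sum_l sg R l * (psi1 l p * psi2 l k p).
Definition wA' k (p : pt) := - lam / (2 * ff p ^+ 2) * fk k p.
Definition wB' k (p : pt) := - be / rr p ^+ 2 * rk k p.
Definition wq' k (p : pt) := - cc0 / ff p ^+ 2 * fk k p - cc1 / rr p ^+ 2 * rk k p.
Definition wV' k (p : pt) := - (lam ^+ 2 - lam) / ff p ^+ 2 * fk k p
    + lam * ((be + 4 * be * rr p) * rk k p / ff p - rr p * wp p / ff p ^+ 2 * fk k p)
    + 2 * wp p * (2 * be) * rk k p - (2 * be / rr p - wp p / rr p ^+ 2) * rk k p.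
Definition wCt' k (p : pt) := - cc0 / (2 * ff p ^+ 3) * fk k p.
Definition wCx' k (p : pt) := - cc0 / (2 * ff p ^+ 3) * fk k p + 3 * cc1 / (2 * rr p ^+ 4) * rk k p.
Definition sM' k (p : pt) : R :=
  2 * (wA' k p * (sX p + sT p) + wA p * (sX' k p + sT' k p))
  + 2 * (wB' k p * sX p + wB p * sX' k p) + (wq' k p * psi p + wq p * psi1 k p).
Definition sN' k (p : pt) : R :=
  sK' k p - (wV' k p * (psi p * psi p) + wV p * (2 * (psi p * psi1 k p))).
Definition sEt' k (p : pt) : R :=
  sN' k p * wA p + (sK p - wV p * (psi p * psi p)) * wA' k p
  + (wCt' k p * (psi p * psi p) + wCt p * (2 * (psi p * psi1 k p))).
Definition sEx' k (p : pt) : R :=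
  sN' k p * (wA p + wB p) + (sK p - wV p * (psi p * psi p)) * (wA' k p + wB' k p)
  + (wCx' k p * (psi p * psi p) + wCx p * (2 * (psi p * psi1 k p))).
Definition sJ' (k : al) (p : pt) : R :=
  - (sM' k p * (sg R k * psi1 k p) + sM p * (sg R k * psi2 k k p))
  + (((1 - isx R k) * sEt p + isx R k * sEx p)
     + p ord0 k * ((1 - isx R k) * sEt' k p + isx R k * sEx' k p)).

Lemma is_derive_sJ O p k : C2d O psi psi1 psi2 -> O p -> D p ->
  is_derive p (evec R k) (sJ psi psi1 k) (sJ' k p).
Proof.
move=> h Op Dp; have [_ _ _ d1 d2] := h p Op.
have dc l : is_derive p (evec R k) (fun q : pt => q ord0 l) (k == l)%:R := is_derive_coord p k l.
have dX : is_derive p (evec R k) sX (sX' k p).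
  have := @is_derive_bigsum R _ _ (index_enum _) _ p (evec R k) _
     (fun l => is_derive_scale (isx R l) (is_derive_mul (dc l) (d2 l k))).
  apply: is_derive_cast; rewrite /sX'.
  rewrite -(sum_delta k (fun l => isx R l * psi1 l p)) -big_split /=.
  by apply: eq_bigr => l _; ring.
have dT : is_derive p (evec R k) sT (sT' k p).
  have := @is_derive_bigsum R _ _ (index_enum _) _ p (evec R k) _
     (fun l => is_derive_scale (1 - isx R l) (is_derive_mul (dc l) (d2 l k))).
  apply: is_derive_cast; rewrite /sT'.
  rewrite -(sum_delta k (fun l => (1 - isx R l) * psi1 l p)) -big_split /=.
  by apply: eq_bigr => l _; ring.
have dK : is_derive p (evec R k) sK (sK' k p).
  have := @is_derive_bigsum R _ _ (index_enum _) _ p (evec R k) _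
     (fun l => is_derive_scale (sg R l) (is_derive_mul (d2 l k) (d2 l k))).
  apply: is_derive_cast; rewrite /sK' mulr_sumr.
  by apply: eq_bigr => l _; ring.
have dA := is_derive_wA k Dp; have dB := is_derive_wB k Dp; have dq := is_derive_wq k Dp.
have dV := is_derive_wV k Dp; have dCt := is_derive_wCt k Dp; have dCx := is_derive_wCx k Dp.
have dpp : is_derive p (evec R k) (fun q => psi q * psi q) (2 * (psi p * psi1 k p)).
  by have := is_derive_mul (d1 k) (d1 k); apply: is_derive_cast; ring.
have dM : is_derive p (evec R k) sM (sM' k p).
  exact: (is_derive_add (is_derive_add
    (is_derive_scale 2 (is_derive_mul dA (is_derive_add dX dT)))
    (is_derive_scale 2 (is_derive_mul dB dX))) (is_derive_mul dq (d1 k))).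
have dN := is_derive_add dK (is_derive_opp (is_derive_mul dV dpp)).
have dEt : is_derive p (evec R k) sEt (sEt' k p).
  exact: (is_derive_add (is_derive_mul dN dA) (is_derive_mul dCt dpp)).
have dEx : is_derive p (evec R k) sEx (sEx' k p).
  exact: (is_derive_add (is_derive_mul dN (is_derive_add dA dB)) (is_derive_mul dCx dpp)).
have := is_derive_add
  (is_derive_opp (is_derive_mul dM (is_derive_scale (sg R k) (d2 k k))))
  (is_derive_mul (dc k) (is_derive_add (is_derive_scale (1 - isx R k) dEt)
     (is_derive_scale (isx R k) dEx))).
by apply: is_derive_cast; rewrite /sJ' eqxx mul1r.
Qed.

End PsiD.
End Flux.

(** * From the indexed expressions to the scalar identity *)

Section Contraction.
Variables (R : realType) (m n : nat).
Notation pt := 'rV[R]_(m + n).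
Notation al := ('I_(m + n)).
Variables (lam be : R).
Variables (psi : pt -> R) (psi1 : al -> pt -> R) (psi2 : al -> al -> pt -> R).
Notation sX := (sX psi1). Notation sT := (sT psi1). Notation sKx := (sKx psi1).
Notation sKt := (sKt psi1). Notation sK := (sK psi1).

Lemma sum_linear5 (G F1 F2 F3 F4 F5 : al -> R) (a1 a2 a3 a4 a5 : R) :
  (forall k, G k = a1 * F1 k + a2 * F2 k + a3 * F3 k + a4 * F4 k + a5 * F5 k) ->
  \sum_k G k = a1 * (\sum_k F1 k) + a2 * (\sum_k F2 k) + a3 * (\sum_k F3 k)
    + a4 * (\sum_k F4 k) + a5 * (\sum_k F5 k).
Proof. by move=> h; rewrite !mulr_sumr -!big_split; apply: eq_bigr => k _; rewrite h. Qed.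

Lemma isx01 (k : al) : isx R k = 0 \/ isx R k = 1.
Proof. by rewrite /isx; case: (m <= k)%N; [right|left]. Qed.

Definition sboxw (w2 : al -> al -> pt -> R) (p : pt) : R := \sum_k sg R k * w2 k k p.

Variable p : pt.
Hypothesis Dp : Dom p.
Hypothesis sym : forall k l, psi2 k l p = psi2 l k p.

Let Cx := \sum_k sg R k * psi1 k p * (\sum_l isx R l * (p ord0 l * psi2 l k p)).
Let Ct := \sum_k sg R k * psi1 k p * (\sum_l (1 - isx R l) * (p ord0 l * psi2 l k p)).
Let f0 : ff p != 0. Proof. by rewrite lt0r_neq0. Qed.
Let r0 : rr p != 0. Proof. by rewrite lt0r_neq0 // Dom_rr. Qed.

(** The contractions below are named by their left factor: [c_] for the raised gradient of [psi],
    [t_] for the time coordinates, [x_] for the space coordinates. They are what remains of the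
    coefficients once all indices are summed. *)
Let c_f : \sum_k sg R k * psi1 k p * fk k p = (sX p + sT p) / 2.
Proof.
rewrite /sX /sT -big_split /= mulr_suml; apply: eq_bigr => k _.
by rewrite /fk /sg; case: (isx01 k) => ->; field.
Qed.

Let c_r : \sum_k sg R k * psi1 k p * rk k p = sX p / rr p.
Proof.
rewrite /sX mulr_suml; apply: eq_bigr => k _.
by rewrite /rk /sg; case: (isx01 k) => ->; ring.
Qed.

Let c_p : \sum_k sg R k * psi1 k p * psi1 k p = sK p.
Proof. by apply: eq_bigr => k _; rewrite mulrA. Qed.

Let c_X : \sum_k sg R k * psi1 k p * sX' psi1 psi2 k p = sKx p + Cx.
Proof.
rewrite /sKx /Cx -big_split /=; apply: eq_bigr => k _.
by rewrite /sX' /sg; case: (isx01 k) => ->; ring.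
Qed.

Let c_T : \sum_k sg R k * psi1 k p * sT' psi1 psi2 k p = - sKt p + Ct.
Proof.
rewrite /sKt /Ct -sumrN -big_split /=; apply: eq_bigr => k _.
by rewrite /sT' /sg; case: (isx01 k) => ->; ring.
Qed.

Let t_f : \sum_k (1 - isx R k) * p ord0 k * fk k p = - tau p ^+ 2 / 2.
Proof.
rewrite tau_sq esq_tcoord mulNr mulr_suml -sumrN; apply: eq_bigr => k _.
by rewrite /fk /sg; case: (isx01 k) => ->; field.
Qed.

Let t_r : \sum_k (1 - isx R k) * p ord0 k * rk k p = 0.
Proof.
by rewrite big1 // => k _; rewrite /rk; case: (isx01 k) => ->; ring.
Qed.

Let t_p : \sum_k (1 - isx R k) * p ord0 k * psi1 k p = sT p.
Proof. by apply: eq_bigr => k _; rewrite mulrA. Qed.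

(** Symmetry of the Hessian identifies this contraction with twice the one that arises from
    differentiating the multiplier; the two cancel in the identity. *)
Let t_K : \sum_k (1 - isx R k) * p ord0 k * sK' psi1 psi2 k p = 2 * Ct.
Proof.
rewrite /Ct /sK' mulr_sumr.
under eq_bigr do rewrite mulrCA mulr_sumr.
under [RHS]eq_bigr do rewrite mulr_sumr.
rewrite -!mulr_sumr exchange_big /=; congr (_ * _).
by apply: eq_bigr => k _; apply: eq_bigr => l _; rewrite (sym k l); ring.
Qed.

Let x_f : \sum_k isx R k * p ord0 k * fk k p = rr p ^+ 2 / 2.
Proof.
rewrite rr_sq esq_xcoord mulr_suml; apply: eq_bigr => k _.
by rewrite /fk /sg; case: (isx01 k) => ->; field.
Qed.

Let x_r : \sum_k isx R k * p ord0 k * rk k p = rr p.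
Proof.
rewrite -[RHS](mulfK r0) -expr2 rr_sq esq_xcoord mulr_suml; apply: eq_bigr => k _.
by rewrite /rk; case: (isx01 k) => ->; ring.
Qed.

Let x_p : \sum_k isx R k * p ord0 k * psi1 k p = sX p.
Proof. by apply: eq_bigr => k _; rewrite mulrA. Qed.

Let x_K : \sum_k isx R k * p ord0 k * sK' psi1 psi2 k p = 2 * Cx.
Proof.
rewrite /Cx /sK' mulr_sumr.
under eq_bigr do rewrite mulrCA mulr_sumr.
under [RHS]eq_bigr do rewrite mulr_sumr.
rewrite -!mulr_sumr exchange_big /=; congr (_ * _).
by apply: eq_bigr => k _; apply: eq_bigr => l _; rewrite (sym k l); ring.
Qed.

Notation f := (ff p). Notation r := (rr p).
Let c0 := cc0 m n lam. Let c1 := cc1 n be.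
Let dA (df : R) := - lam / (2 * f ^+ 2) * df.
Let dB (dr : R) := - be / r ^+ 2 * dr.
Let dq (df dr : R) := - c0 / f ^+ 2 * df - c1 / r ^+ 2 * dr.
Let dV (df dr : R) := - (lam ^+ 2 - lam) / f ^+ 2 * df
    + lam * ((be + 4 * be * r) * dr / f - r * wp be p / f ^+ 2 * df) + 2 * wp be p * (2 * be) * dr
    - (2 * be / r - wp be p / r ^+ 2) * dr.
Notation A := (wA lam p). Notation B := (wB be p). Notation q := (wq lam be p).
Notation V := (wV lam be p). Notation Psi := (psi p).
Notation S := (sX p + sT p).

Let DM : \sum_k sM' lam be psi psi1 psi2 k p * (sg R k * psi1 k p) =
  2 * (dA (S / 2) * S + A * (sK p + Ct + Cx)) + 2 * (dB (sX p / r) * sX p + B * (sKx p + Cx))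
    + (dq (S / 2) (sX p / r) * Psi + q * sK p).
Proof.
rewrite (@sum_linear5 _ (fun k => sg R k * psi1 k p * fk k p) (fun k => sg R k * psi1 k p * rk k p)
  (fun k => sg R k * psi1 k p * sX' psi1 psi2 k p) (fun k => sg R k * psi1 k p * sT' psi1 psi2 k p)
  (fun k => sg R k * psi1 k p * psi1 k p)
  (2 * (- lam / (2 * f ^+ 2)) * S - c0 / f ^+ 2 * Psi)
  (2 * (- be / r ^+ 2) * sX p - c1 / r ^+ 2 * Psi)
  (2 * A + 2 * B) (2 * A) q).
  by rewrite c_f c_r c_p c_X c_T sKE /dA /dB /dq; ring.
by move=> k; rewrite /sM' /wA' /wB' /wq' -/c0 -/c1; field; rewrite f0 r0.
Qed.

Let dEt : \sum_k (1 - isx R k) * p ord0 k * sEt' lam be psi psi1 psi2 k p =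
  (2 * Ct - (dV (- tau p ^+ 2 / 2) 0 * Psi ^+ 2 + V * (2 * Psi * sT p))) * A
    + (sK p - V * Psi ^+ 2) * dA (- tau p ^+ 2 / 2)
    + (- c0 / (2 * f ^+ 3) * (- tau p ^+ 2 / 2) * Psi ^+ 2 + c0 / (4 * f ^+ 2) * (2 * Psi * sT p)).
Proof.
rewrite (@sum_linear5 _ (fun k => (1 - isx R k) * p ord0 k * fk k p)
  (fun k => (1 - isx R k) * p ord0 k * rk k p)
  (fun k => (1 - isx R k) * p ord0 k * psi1 k p)
  (fun k => (1 - isx R k) * p ord0 k * sK' psi1 psi2 k p) (fun=> 0)
  ((- ((- (lam ^+ 2 - lam) / f ^+ 2 - lam * (r * wp be p / f ^+ 2)) * Psi ^+ 2)) * A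
    + (sK p - V * Psi ^+ 2) * (- lam / (2 * f ^+ 2)) - c0 / (2 * f ^+ 3) * Psi ^+ 2)
  (- ((lam * ((be + 4 * be * r) / f) + 2 * wp be p * (2 * be)
    - (2 * be / r - wp be p / r ^+ 2)) * Psi ^+ 2) * A)
  (- (V * (2 * Psi)) * A + c0 / (4 * f ^+ 2) * (2 * Psi)) A 0).
  by rewrite t_f t_r t_p t_K /dA /dV; ring.
by move=> k; rewrite /sEt' /sN' /wV' /wA' /wCt' /wCt -/c0 -/c1; ring.
Qed.

Let dEx : \sum_k isx R k * p ord0 k * sEx' lam be psi psi1 psi2 k p =
  (2 * Cx - (dV (r ^+ 2 / 2) r * Psi ^+ 2 + V * (2 * Psi * sX p))) * (A + B)
    + (sK p - V * Psi ^+ 2) * (dA (r ^+ 2 / 2) + dB r)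
    + ((- c0 / (2 * f ^+ 3) * (r ^+ 2 / 2) + 3 * c1 / (2 * r ^+ 4) * r) * Psi ^+ 2
       + (c0 / (4 * f ^+ 2) - c1 / (2 * r ^+ 3)) * (2 * Psi * sX p)).
Proof.
rewrite (@sum_linear5 _ (fun k => isx R k * p ord0 k * fk k p)
  (fun k => isx R k * p ord0 k * rk k p)
  (fun k => isx R k * p ord0 k * psi1 k p)
  (fun k => isx R k * p ord0 k * sK' psi1 psi2 k p) (fun=> 0)
  ((- ((- (lam ^+ 2 - lam) / f ^+ 2 - lam * (r * wp be p / f ^+ 2)) * Psi ^+ 2)) * (A + B)
    + (sK p - V * Psi ^+ 2) * (- lam / (2 * f ^+ 2)) - c0 / (2 * f ^+ 3) * Psi ^+ 2)
  (- ((lam * ((be + 4 * be * r) / f) + 2 * wp be p * (2 * be)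
    - (2 * be / r - wp be p / r ^+ 2)) * Psi ^+ 2) * (A + B) + (sK p - V * Psi ^+ 2) * (- be / r ^+ 2)
     + 3 * c1 / (2 * r ^+ 4) * Psi ^+ 2)
  (- (V * (2 * Psi)) * (A + B) + (c0 / (4 * f ^+ 2) - c1 / (2 * r ^+ 3)) * (2 * Psi)) (A + B) 0).
  by rewrite x_f x_r x_p x_K /dA /dV /dB; ring.
by move=> k; rewrite /sEx' /sN' /wV' /wA' /wB' /wCx' /wCx -/c0 -/c1; ring.
Qed.

Let sum_ist1 : \sum_(k : al) (1 - isx R k) = m%:R :> R.
Proof.
rewrite -[RHS]/(m%:R) (eq_bigr (fun k => (1 - isx R k) * 1)); last by move=> k _; rewrite mulr1.
by rewrite sum_ist sumr_const card_ord.
Qed.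

Let sum_isx1 : \sum_(k : al) isx R k = n%:R :> R.
Proof.
rewrite (eq_bigr (fun k => isx R k * 1)); last by move=> k _; rewrite mulr1.
by rewrite sum_isx sumr_const card_ord.
Qed.

(** Summing over indices leaves only the scalars of [carleman_identity_scalar], in which the
    dimensions enter through the divergences [m] and [n] of the time and space position fields. *)
Lemma carleman_identity :
  let p1 := wp be p in let p' := 2 * be in
  let c := (m%:R + n%:R - 4) / 2 in
  let T := S + c * Psi in
  let Z := (lam ^+ 2 * r ^+ 2 * p' / 2 + lam * r * p1 / 2 - lam * r ^+ 2 * p1 ^+ 2 / 2) / f ^+ 2
    + (2 * lam * r * p1 * p' + 3 * lam * p1 ^+ 2 - lam * p' / 2 + (lam ^+ 2 - 3 * lam / 2) * p1 / r) / f
    + 2 * p1 ^+ 2 * p' - p1 * p' / r + p1 ^+ 3 / r + c1 * (n%:R - 3) / (2 * r ^+ 3) in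
  let M := 2 * A * S + 2 * B * sX p + q * Psi in
  - (sboxw psi2 p - 2 * (A * S + B * sX p) + (V - q) * Psi) * M =
   M ^+ 2 - lam / (2 * f ^+ 2) * T ^+ 2 + B * (sKx p + sKt p) - 2 * be / r ^+ 3 * sX p ^+ 2
     + Z * Psi ^+ 2 + \sum_k sJ' lam be psi psi1 psi2 k p.
Proof.
move=> p1 p' c T Z M.
have tE : tau p ^+ 2 = r ^+ 2 - 4 * f by rewrite ffE; ring.
have := @carleman_identity_scalar R lam be f r _ m%:R n%:R (sKx p) (sKt p) (sX p) (sT p) Psi Ct Cx
  (sboxw psi2 p) f0 r0 tE.
cbv zeta => id.
rewrite /M /wq /wV /wA /wB /cc0 /wp in id *.
rewrite [LHS]id; congr (_ + _).
have -> : \sum_k sJ' lam be psi psi1 psi2 k p =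
   - (\sum_k sM' lam be psi psi1 psi2 k p * (sg R k * psi1 k p)) - M * sboxw psi2 p
   + m%:R * sEt lam be psi psi1 p + n%:R * sEx lam be psi psi1 p
   + \sum_k (1 - isx R k) * p ord0 k * sEt' lam be psi psi1 psi2 k p
   + \sum_k isx R k * p ord0 k * sEx' lam be psi psi1 psi2 k p.
  rewrite /sboxw -sum_ist1 -sum_isx1 !mulr_suml mulr_sumr -!sumrN -!big_split /=.
  apply: eq_bigr => k _; rewrite /sJ' (_ : sM lam be psi psi1 p = M); first by ring.
  by rewrite /sM /M; ring.
rewrite DM dEt dEx /dA /dB /dq /dV /sEt /sEx sKE /wCt /wCx /M /c0 /c1 /cc0 /cc1.
by rewrite /wq /wV /wA /wB /cc0 /cc1 /wp; ring.
Qed.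

End Contraction.

(** * The pointwise Carleman estimate *)

Ltac nneg := first [assumption | apply: ltW; assumption | match goal with
  | |- is_true (0 <= _ ^+ 2) => exact: sqr_ge0
  | |- is_true (0 <= _ ^+ _) => apply: exprn_ge0; nneg
  | |- is_true (0 <= _ + _) => apply: addr_ge0; nneg
  | |- is_true (0 <= _ * _) => apply: mulr_ge0; nneg
  | |- is_true (0 <= _^-1) => rewrite invr_ge0; nneg
  | |- _ => first [done | lra]
  end].

(** With [y = 1 + 2 r] one has [y >= 1] and [r <= y / 2], so everything reduces to [be y^3 <= 1/4];
    the cube is needed for the third and higher combined powers of [r] and [y]. *)
Lemma weight_small (F : realFieldType) (be r Rad : F) :
  0 < r -> r <= Rad -> 0 < be -> be * (1 + 2 * Rad) ^+ 3 <= 4^-1 ->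
  [/\ be * (1 + 2 * r) ^+ 3 <= 4^-1, be * (1 + 2 * r) ^+ 2 <= 4^-1,
      r * (be * (1 + 2 * r)) <= 8^-1, r ^+ 2 * (be * (1 + 2 * r)) <= 16^-1 &
      r * (be * (1 + 2 * r) ^+ 2) <= 8^-1].
Proof.
move=> r0 rR be0 hbe.
have h3 : be * (1 + 2 * r) ^+ 3 <= 4^-1.
  by apply: le_trans hbe; rewrite ler_pM2l // lerXn2r ?nnegrE //; lra.
move: h3; set y := 1 + 2 * r => h3.
have y1 : 1 <= y by rewrite /y; lra.
have ry : r <= y / 2 by rewrite /y; lra.
have b1 : be * y <= be * y ^+ 2 by rewrite ler_pM2l // -[leLHS]expr1 ler_weXn2l.
have b2 : be * y ^+ 2 <= be * y ^+ 3 by rewrite ler_pM2l // ler_weXn2l.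
have by0 : 0 < be * y by rewrite mulr_gt0 //; lra.
have by20 : 0 < be * y ^+ 2 by rewrite mulr_gt0 // exprn_gt0 //; lra.
have r1 : r * (be * y) <= y / 2 * (be * y) by rewrite ler_pM2r.
have r2 : r * (be * y ^+ 2) <= y / 2 * (be * y ^+ 2) by rewrite ler_pM2r.
have e1 : y / 2 * (be * y) = be * y ^+ 2 / 2 by ring.
have e2 : y / 2 * (be * y ^+ 2) = be * y ^+ 3 / 2 by ring.
have r3 : r ^+ 2 * (be * y) <= (y / 2) ^+ 2 * (be * y).
  by rewrite ler_pM2r // lerXn2r ?nnegrE ?(ltW r0) //; lra.
have e3 : (y / 2) ^+ 2 * (be * y) = be * y ^+ 3 / 4 by field.
by split; lra.
Qed.

(** The negative terms are few: [r p] small handles the one in [r^2 p^2], the term in [p'] is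
    absorbed since [p / r = be / r + 2 be], and [p p' / r] costs only [be / (32 r f)] because
    [4 f <= r^2]. The last term has the sign of [(n - 2) (n - 3)]. *)
Lemma carleman_zero_order (F : realFieldType) (lam be f r Rad n p p' c1 : F) :
  0 < f -> 0 < r -> 4 * f <= r ^+ 2 -> r <= Rad -> 0 < be ->
  be * (1 + 2 * Rad) ^+ 3 <= 4^-1 -> 4 <= lam -> 0 <= (n - 2) * (n - 3) ->
  p = be * (1 + 2 * r) -> p' = 2 * be -> c1 = be * (n - 2) ->
  lam * be * r / (4 * f ^+ 2) + be / (r * f) * (lam ^+ 2 - 3 * lam / 2 - 32^-1) <=
  (lam ^+ 2 * r ^+ 2 * p' / 2 + lam * r * p / 2 - lam * r ^+ 2 * p ^+ 2 / 2) / f ^+ 2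
    + (2 * lam * r * p * p' + 3 * lam * p ^+ 2 - lam * p' / 2 + (lam ^+ 2 - 3 * lam / 2) * p / r) / f
    + 2 * p ^+ 2 * p' - p * p' / r + p ^+ 3 / r + c1 * (n - 3) / (2 * r ^+ 3).
Proof.
move=> f0 r0 fr rR be0 hbe lam4 hn pE p'E c1E.
have [h3 h2 rp r2p _] := weight_small r0 rR be0 hbe.
rewrite -pE in rp r2p.
have pbe : be <= p by rewrite pE; nra.
have p0 : 0 < p by lra.
have p'0 : 0 < p' by rewrite p'E; lra.
have b1 : 0 <= lam ^+ 2 * r ^+ 2 * p' / 2 + lam * r * p / 2 * (1 - r * p) - lam * be * r / 4.
  have x1 : 0 <= lam ^+ 2 * r ^+ 2 * p' / 2.
    by nneg.
  have lr0 : 0 < lam * r by rewrite mulr_gt0 //; lra.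
  have x2 : lam * r * p / 2 * 2^-1 <= lam * r * p / 2 * (1 - r * p).
    by rewrite ler_pM2l ?divr_gt0 ?mulr_gt0 //; lra.
  have x3 : lam * r * be <= lam * r * p by rewrite ler_pM2l.
  have -> : lam * be * r / 4 = lam * r * be / 4 by ring.
  lra.
have b2 : 0 <= 2 * lam * r * p * p' + 3 * lam * p ^+ 2 + 2 * be * lam * (lam - 2).
  have lam0 : 0 < lam by lra.
  have lam2 : 0 <= lam - 2 by lra.
  by nneg.
have b5 : 0 <= be / 32 - f * (p * p').
  have : f * (p * p') <= r ^+ 2 / 4 * (p * p').
    by rewrite ler_wpM2r ?mulr_ge0 ?(ltW p0) ?(ltW p'0) //; lra.
  have -> : r ^+ 2 / 4 * (p * p') = be / 2 * (r ^+ 2 * p) by rewrite p'E; field.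
  have : be / 2 * (r ^+ 2 * p) <= be / 2 * 16^-1 by rewrite ler_pM2l //; lra.
  lra.
rewrite -subr_ge0.
have -> : (lam ^+ 2 * r ^+ 2 * p' / 2 + lam * r * p / 2 - lam * r ^+ 2 * p ^+ 2 / 2) / f ^+ 2
    + (2 * lam * r * p * p' + 3 * lam * p ^+ 2 - lam * p' / 2 + (lam ^+ 2 - 3 * lam / 2) * p / r) / f
    + 2 * p ^+ 2 * p' - p * p' / r + p ^+ 3 / r + c1 * (n - 3) / (2 * r ^+ 3)
    - (lam * be * r / (4 * f ^+ 2) + be / (r * f) * (lam ^+ 2 - 3 * lam / 2 - 32^-1))
  = (lam ^+ 2 * r ^+ 2 * p' / 2 + lam * r * p / 2 * (1 - r * p) - lam * be * r / 4) / f ^+ 2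
    + (2 * lam * r * p * p' + 3 * lam * p ^+ 2 + 2 * be * lam * (lam - 2)) / f
    + (be / 32 - f * (p * p')) / (r * f) + 2 * p ^+ 2 * p' + p ^+ 3 / r
    + be * ((n - 2) * (n - 3)) / (2 * r ^+ 3).
  by rewrite pE p'E c1E; field; rewrite !lt0r_neq0.
by nneg.
Qed.

(** Half of [M^2] outweighs the bad square of [T], since [M] is [lam T / f] up to a lower-order part
    [N1]; the other half is spent on the product with [P]. The remaining errors are absorbed by the
    gradient terms coming from [B] and by [Z psi^2]. *)
Lemma carleman_lower (F : realFieldType) (lam be f r tau Rad m n Kx Kt X Dt psi P divJ : F) :
  0 < f -> 0 < r -> 4 * f = r ^+ 2 - tau ^+ 2 -> r <= Rad -> 0 < be ->
  be * (1 + 2 * Rad) ^+ 3 <= 4^-1 -> 4 <= lam ->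
  0 <= (n - 2) * (n - 3) -> 1 <= m -> 1 <= n -> (m + n) ^+ 2 <= lam ->
  X ^+ 2 <= r ^+ 2 * Kx -> Dt ^+ 2 <= Kt ->
  let Tt := tau * Dt in
  let A := lam / (2 * f) in let B := be * (r^-1 + 2) in
  let c := (m + n - 4) / 2 in let c0 := lam * c in let c1 := be * (n - 2) in
  let q := c0 / f + c1 / r + 2 * be * (n - 1) in
  let p := be * (1 + 2 * r) in let p' := 2 * be in
  let S := X + Tt in
  let M := 2 * A * S + 2 * B * X + q * psi in
  let T := S + c * psi in
  let Z := (lam ^+ 2 * r ^+ 2 * p' / 2 + lam * r * p / 2 - lam * r ^+ 2 * p ^+ 2 / 2) / f ^+ 2
    + (2 * lam * r * p * p' + 3 * lam * p ^+ 2 - lam * p' / 2 + (lam ^+ 2 - 3 * lam / 2) * p / r) / f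
    + 2 * p ^+ 2 * p' - p * p' / r + p ^+ 3 / r + c1 * (n - 3) / (2 * r ^+ 3) in
  - P * M = M ^+ 2 - lam / (2 * f ^+ 2) * T ^+ 2 + B * (Kx + Kt) - 2 * be / r ^+ 3 * X ^+ 2
     + Z * psi ^+ 2 + divJ ->
  lam ^+ 2 / 16 * (T / f) ^+ 2 + be / r * ((Kx - X ^+ 2 / r ^+ 2) + (Kt - Dt ^+ 2))
    + 2 * be * f / r ^+ 3 * Dt ^+ 2 + lam * be * r / (4 * f ^+ 2) * psi ^+ 2
    + be * lam / (r * f) * psi ^+ 2 <= P ^+ 2 / 2 - divJ.
Proof.
move=> f0 r0 fE rR be0 hbe lam4 hn m1 n1 Nlam XK DK Tt A B c c0 c1 q p p' S M T Z.
have [TtE AE BE cE] : [/\ Tt = tau * Dt, A = lam / (2 * f), B = be * (r^-1 + 2) &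
  c = (m + n - 4) / 2] by [].
have [c0E c1E qE pE] : [/\ c0 = lam * c, c1 = be * (n - 2),
  q = c0 / f + c1 / r + 2 * be * (n - 1) & p = be * (1 + 2 * r)] by [].
have [SE ME TE] : [/\ S = X + Tt, M = 2 * A * S + 2 * B * X + q * psi & T = S + c * psi] by [].
have fr : 4 * f <= r ^+ 2 by have := sqr_ge0 tau; lra.
have hZ : lam * be * r / (4 * f ^+ 2) + be / (r * f) * (lam ^+ 2 - 3 * lam / 2 - 32^-1) <= Z.
  exact: (carleman_zero_order f0 r0 fr rR be0 hbe lam4 hn (erefl p) (erefl p') (erefl c1)).
clearbody Z T M S p' p q c1 c0 c B A Tt => id.
have [h3 h2 rp r2p r2] := weight_small r0 rR be0 hbe.
have [y yE] : exists y, y = 1 + 2 * r by eexists.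
rewrite -yE in h3 h2 rp r2p r2.
have y1 : 1 <= y by rewrite yE; lra.
have psi0 := sqr_ge0 psi.
have Kx0 : 0 <= Kx by have := le_trans (sqr_ge0 X) XK; rewrite pmulr_rge0 // exprn_gt0.
have Kt0 : 0 <= Kt := le_trans (sqr_ge0 Dt) DK.
have [q1 q1E] : exists q1, q1 = c1 / r + 2 * be * (n - 1) by eexists.
have [t tE] : exists t, t = T / f by eexists.
have [N1 N1E] : exists N1, N1 = 2 * B * X + q1 * psi by eexists.
rewrite -tE.
(* The constant [c] in [T] is exactly what absorbs the part [c0 / f] of [q]. *)
have hM : M = lam * t + N1.
  by rewrite ME N1E tE TE qE q1E AE c0E; field; rewrite !lt0r_neq0.
have s2 : lam / (2 * f ^+ 2) * T ^+ 2 = lam / 2 * t ^+ 2.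
  by rewrite tE; field; rewrite lt0r_neq0.
have s3 : lam ^+ 2 / 8 * t ^+ 2 - N1 ^+ 2 / 2 <= M ^+ 2 / 2 - lam / 2 * t ^+ 2.
  rewrite -subr_ge0 hM.
  have -> : (lam * t + N1) ^+ 2 / 2 - lam / 2 * t ^+ 2 - (lam ^+ 2 / 8 * t ^+ 2 - N1 ^+ 2 / 2)
    = (N1 + lam * t / 2) ^+ 2 + lam * (lam - 4) / 8 * t ^+ 2 by field.
  by rewrite addr_ge0 ?sqr_ge0 // mulr_ge0 ?sqr_ge0 // divr_ge0 // mulr_ge0 //; clear -lam4; lra.
have s4 : N1 ^+ 2 / 2 <= 4 * (B ^+ 2 * X ^+ 2) + q1 ^+ 2 * psi ^+ 2.
  rewrite -subr_ge0 (_ : _ - _ = (2 * B * X - q1 * psi) ^+ 2 / 2); last by rewrite N1E; field.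
  by rewrite divr_ge0 ?sqr_ge0.
have Bp : B = be * y / r by rewrite BE yE; field; rewrite lt0r_neq0.
have s5 : 4 * (B ^+ 2 * X ^+ 2) <= be * Kx.
  have x1 : X ^+ 2 / r ^+ 2 <= Kx by rewrite ler_pdivrMr ?exprn_gt0 // mulrC.
  have -> : 4 * (B ^+ 2 * X ^+ 2) = be * (4 * (be * y ^+ 2)) * (X ^+ 2 / r ^+ 2).
    by rewrite Bp; field; rewrite lt0r_neq0.
  have x2 : be * (4 * (be * y ^+ 2)) <= be by rewrite ger_pMr //; clear -h2; lra.
  have x0 : 0 <= X ^+ 2 / r ^+ 2 by rewrite divr_ge0 ?sqr_ge0.
  have x3 : 0 <= be * (4 * (be * y ^+ 2)).
    by rewrite mulr_ge0 ?(ltW be0) // mulr_ge0 // mulr_ge0 ?(ltW be0) ?sqr_ge0.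
  exact: ler_pM.
have s6 : q1 ^+ 2 <= be / (r * f) * (n ^+ 2 / 32).
  pose e := (n - 2) + 2 * (n - 1) * r.
  have -> : q1 = be * e / r by rewrite q1E c1E /e; field; rewrite lt0r_neq0.
  have nr : 0 <= (n - 1) * r by rewrite mulr_ge0 ?(ltW r0) //; clear -n1; lra.
  have ee : e ^+ 2 <= (n * y) ^+ 2.
    have nr0 : 0 <= n * r by rewrite mulr_ge0 ?(ltW r0) //; clear -n1; lra.
    rewrite -subr_ge0 subr_sqr mulr_ge0 // /e yE; clear -nr nr0 n1 r0; lra.
  rewrite -subr_ge0.
  have -> : be / (r * f) * (n ^+ 2 / 32) - (be * e / r) ^+ 2 =
     be / (r ^+ 2 * f) * (n ^+ 2 * (r / 32) - be * f * e ^+ 2).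
    by field; rewrite !lt0r_neq0.
  apply: mulr_ge0; first by nneg.
  rewrite subr_ge0.
  have z1 : be * f * e ^+ 2 <= be * (r ^+ 2 / 4) * (n * y) ^+ 2.
    apply: ler_pM => //; [by nneg|by nneg|].
    by rewrite ler_pM2l //; clear -fr; lra.
  apply: le_trans z1 _.
  have -> : be * (r ^+ 2 / 4) * (n * y) ^+ 2 = n ^+ 2 * (r / 4 * (r * (be * y ^+ 2))) by ring.
  rewrite ler_wpM2l ?sqr_ge0 //.
  have : r / 4 * (r * (be * y ^+ 2)) <= r / 4 * 8^-1 by rewrite ler_pM2l // divr_gt0.
  clear; lra.
(* The difference of the radial squares. If [T - c psi = X + tau Dt] were 0, it would equal
   [(1 - tau^2 / r^2) Dt^2 = 4 f / r^2 Dt^2]; half of that is kept and the other half pays for the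
   deviation. *)
have s7 : 2 * f / r ^+ 2 * Dt ^+ 2 - 3 / (4 * f) * (T - c * psi) ^+ 2 <= Dt ^+ 2 - X ^+ 2 / r ^+ 2.
  pose e := T - c * psi.
  have XE : X = e - tau * Dt by rewrite /e TE SE TtE; ring.
  rewrite -/e -subr_ge0.
  have -> : Dt ^+ 2 - X ^+ 2 / r ^+ 2 - (2 * f / r ^+ 2 * Dt ^+ 2 - 3 / (4 * f) * e ^+ 2)
     = (r ^+ 2)^-1 * ((r ^+ 2 - tau ^+ 2 - 2 * f) * Dt ^+ 2 + 2 * e * tau * Dt + e ^+ 2 * (3 * r ^+ 2 / (4 * f) - 1)).
    by rewrite XE; field; rewrite !lt0r_neq0.
  rewrite -fE (_ : (4 * f - 2 * f) * Dt ^+ 2 + _ + _ = 2 * f * (Dt + e * tau / (2 * f)) ^+ 2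
     + e ^+ 2 * ((3 * r ^+ 2 - 4 * f - 2 * tau ^+ 2) / (4 * f))); last by field; rewrite lt0r_neq0.
  rewrite mulr_ge0 ?invr_ge0 ?sqr_ge0 // addr_ge0 //.
    by rewrite mulr_ge0 ?sqr_ge0 // mulr_ge0 // ltW.
  rewrite mulr_ge0 ?sqr_ge0 // divr_ge0 //; last by rewrite mulr_ge0 // ltW.
  by have := sqr_ge0 r; clear -fE f0; lra.
have s8 : (T - c * psi) ^+ 2 <= 2 * T ^+ 2 + 2 * (c ^+ 2 * psi ^+ 2).
  by rewrite -subr_ge0 (_ : _ - _ = (T + c * psi) ^+ 2) ?sqr_ge0 //; ring.
have brf : 0 < be / (r * f) by rewrite divr_gt0 ?mulr_gt0.
have s9 : 3 / 2 * (be / (r * f)) * T ^+ 2 <= lam ^+ 2 / 16 * t ^+ 2.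
  have -> : 3 / 2 * (be / (r * f)) * T ^+ 2 = 3 / 2 * (be * f / r) * t ^+ 2.
    by rewrite tE; field; rewrite !lt0r_neq0.
  rewrite ler_wpM2r ?sqr_ge0 //.
  have x1 : be * f / r <= 8^-1.
    rewrite ler_pdivrMr //; have : be * f <= be * (r ^+ 2 / 4) by rewrite ler_pM2l //; clear -fr; lra.
    have : be * r <= be * r * y by rewrite ler_peMr ?mulr_ge0 ?(ltW be0) ?(ltW r0).
    have -> : be * (r ^+ 2 / 4) = be * r / 4 * r by ring.
    move=> x2 x3; apply: le_trans x3 _; rewrite ler_pM2r //.
    have : be * r * y <= 8^-1 by rewrite mulrAC mulrC.
    clear -x2; lra.
  have : 16 <= lam ^+ 2 by clear -lam4; nra.
  clear -x1; lra.
(* The hypothesis [(m + n)^2 <= lam] acts here and in [n2], making the dimensional constants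
   negligible against [lam^2]. *)
have c2 : c ^+ 2 <= lam / 4.
  have : c ^+ 2 <= (m + n) ^+ 2 / 4.
    rewrite -subr_ge0 (_ : _ - _ = 2 * (m + n) - 4); last by rewrite cE; field.
    clear -m1 n1; lra.
  clear -Nlam; lra.
have n2 : n ^+ 2 <= lam.
  by clear -Nlam m1 n1; apply: le_trans Nlam; rewrite lerXn2r ?nnegrE //; lra.
(* Completing the square in [P + M] trades the product [- P M] for [P^2 / 2] and half of [M^2]. *)
have Q1 : P ^+ 2 / 2 - divJ = (P + M) ^+ 2 / 2 + (M ^+ 2 / 2 - lam / 2 * t ^+ 2) + B * (Kx + Kt)
   - 2 * be / r ^+ 3 * X ^+ 2 + Z * psi ^+ 2.
  rewrite -s2.
  have -> : divJ = - P * M - (M ^+ 2 - lam / (2 * f ^+ 2) * T ^+ 2 + B * (Kx + Kt) - 2 * be / r ^+ 3 * X ^+ 2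
     + Z * psi ^+ 2) by rewrite id; ring.
  by field; rewrite !lt0r_neq0.
rewrite Q1.
(* The part [be / r] of [B] comes from [r] in the exponent of the weight and is split into angular
   and radial derivatives. The part [2 be] comes from [r^2] and absorbs the derivative term of [N1]
   bounded in [s5]. *)
have K1 : B * (Kx + Kt) - 2 * be / r ^+ 3 * X ^+ 2 =
   be / r * ((Kx - X ^+ 2 / r ^+ 2) + (Kt - Dt ^+ 2)) + be / r * (Dt ^+ 2 - X ^+ 2 / r ^+ 2) + 2 * be * (Kx + Kt).
  by rewrite BE; field; rewrite lt0r_neq0.
have br : 0 < be / r by rewrite divr_gt0.
have K2 := ler_wpM2l (ltW br) s7.
have K3 : be / r * (3 / (4 * f) * (T - c * psi) ^+ 2) <=
    3 / 2 * (be / (r * f)) * T ^+ 2 + 3 / 2 * (be / (r * f)) * (c ^+ 2 * psi ^+ 2).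
  have -> : be / r * (3 / (4 * f) * (T - c * psi) ^+ 2) = 3 / 4 * (be / (r * f)) * (T - c * psi) ^+ 2.
    by field; rewrite !lt0r_neq0.
  have : 0 <= 3 / 4 * (be / (r * f)) by nneg.
  by move=> /ler_wpM2l /(_ _ _ s8); clear; lra.
have K4 := ler_wpM2r psi0 hZ.
have K5 := ler_wpM2r psi0 s6.
have E1 : be * lam / (r * f) * psi ^+ 2 = be / (r * f) * psi ^+ 2 * lam by ring.
have E2 : 2 * be * f / r ^+ 3 * Dt ^+ 2 = be / r * (2 * f / r ^+ 2 * Dt ^+ 2).
  by field; rewrite lt0r_neq0.
have b0 : 0 <= be / (r * f) * psi ^+ 2 by rewrite mulr_ge0 // ltW.
have coef : be / (r * f) * psi ^+ 2 * lam <= be / (r * f) * psi ^+ 2 *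
    ((lam ^+ 2 - 3 * lam / 2 - 32^-1) - n ^+ 2 / 32 - 3 / 2 * c ^+ 2).
  rewrite ler_wpM2l //.
  have : 4 * lam <= lam ^+ 2 by clear -lam4; rewrite expr2 ler_wpM2r //; lra.
  clear -n2 c2 lam4; lra.
have bK : 0 <= be * Kt by rewrite mulr_ge0 // ltW.
have bKx : 0 <= be * Kx by rewrite mulr_ge0 // ltW.
have := sqr_ge0 (P + M).
move: K1 K2 K3 K4 K5 coef s3 s4 s5 s9.
rewrite E1 E2 mulrBr => K1 K2 K3 K4 K5 coef s3 s4 s5 s9 PM.
clear -K1 K2 K3 K4 K5 coef s3 s4 s5 s9 PM b0 bK bKx; lra.
Qed.

Lemma weighted_cauchy_schwarz (F : realFieldType) (I : finType) (c a b : I -> F) :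
  (forall k, 0 <= c k) ->
  (\sum_k c k * (a k * b k)) ^+ 2 <= (\sum_k c k * a k ^+ 2) * (\sum_k c k * b k ^+ 2).
Proof.
move=> c0; set X := \sum_k _; set A := \sum_k _; set B := \sum_k _.
have A0 : 0 <= A by apply: sumr_ge0 => k _; rewrite mulr_ge0 ?sqr_ge0.
have [Az|Ap] := eqVneq A 0.
  suff -> : X = 0 by rewrite Az expr0n mul0r.
  rewrite /X big1 // => k _; have /eqP := Az.
  rewrite psumr_eq0; last by move=> l _; rewrite mulr_ge0 ?sqr_ge0.
  move=> /allP /(_ k (mem_index_enum k)) /=; rewrite mulf_eq0 sqrf_eq0.
  by move=> /orP[/eqP->|/eqP->]; rewrite ?mul0r ?mulr0.
have {}Ap : 0 < A by rewrite lt_neqAle eq_sym Ap.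
have : 0 <= \sum_k c k * (A * b k - X * a k) ^+ 2.
  by apply: sumr_ge0 => k _; rewrite mulr_ge0 ?sqr_ge0.
rewrite (_ : \sum_k _ = A * (A * B - X ^+ 2)); first by rewrite pmulr_rge0 // subr_ge0.
rewrite (_ : \sum_k _ = A ^+ 2 * B - 2 * A * X * X + X ^+ 2 * A); first by ring.
rewrite (eq_bigr (fun k => A ^+ 2 * (c k * b k ^+ 2) - 2 * A * X * (c k * (a k * b k))
  + X ^+ 2 * (c k * a k ^+ 2))); last by move=> k _; ring.
by rewrite big_split sumrB /= -!mulr_sumr.
Qed.

(** * The weight W and conjugation by it *)

Section Weight.
Variables (R : realType) (m n : nat).
Notation pt := 'rV[R]_(m + n).
Notation al := ('I_(m + n)).
Variables (lam be : R).
Notation D := (@Dom R m n).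

Definition wgt (p : pt) : R := expR (lam * ln (ff p) + be * (rr p + rr p ^+ 2)).
(** The differential of [ln W], with [ph2] its Hessian; [A] acts with the sign of the metric on all
    coordinates, [B] on the spatial ones only. *)
Definition ph1 (k : al) (p : pt) : R := p ord0 k * (sg R k * wA lam p + isx R k * wB be p).
Definition ph2 (k l : al) (p : pt) : R :=
  (l == k)%:R * (sg R k * wA lam p + isx R k * wB be p)
  + p ord0 k * (sg R k * wA' lam l p + isx R k * wB' be l p).
Definition wgt1 (k : al) (p : pt) : R := wgt p * ph1 k p.
Definition wgt2 (k l : al) (p : pt) : R := wgt p * ph1 l p * ph1 k p + wgt p * ph2 k l p.

Lemma wgt_gt0 p : 0 < wgt p. Proof. exact: expR_gt0. Qed.

Lemma is_derive_wgt p k : D p -> is_derive p (evec R k) wgt (wgt1 k p).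
Proof.
move=> Dp; have f0 : 0 < ff p := Dp; have r0 := Dom_rr Dp.
have dl := is_derive_chain (is_derive1_ln f0) (is_derive_ff p k).
have dr := is_derive_rr k Dp.
have de := is_derive_add (is_derive_scale lam dl)
  (is_derive_scale be (is_derive_add dr (is_derive_mul dr dr))).
have := is_derive_chain (is_derive_expR _) de.
apply: is_derive_cast; rewrite /wgt1 /wgt expr2; congr (_ * _).
by rewrite /ph1 /wA /wB; field; rewrite !lt0r_neq0.
Qed.

Lemma is_derive_ph1 p k l : D p -> is_derive p (evec R l) (ph1 k) (ph2 k l p).
Proof.
move=> Dp.
have := is_derive_mul (is_derive_coord p l k)
  (is_derive_add (is_derive_scale (sg R k) (is_derive_wA lam l Dp))
                 (is_derive_scale (isx R k) (is_derive_wB be l Dp))).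
by apply: is_derive_cast.
Qed.

Lemma contw_wgt A p : D p -> contw A p wgt.
Proof.
move=> Dp; rewrite /wgt; apply: contw_comp; first exact: continuous_expR.
apply: contwD; (apply: contwM; first exact: contw_cst).
  apply: contw_comp; last exact: contw_ff.
  exact: continuous_ln.
by apply: contwD; [exact: contw_rr|apply: contwX; exact: contw_rr].
Qed.

Lemma contw_fk A p k : contw A p (fk (R := R) (m := m) (n := n) k).
Proof.
apply: contwM; last exact: contw_cst.
by apply: contwM; [exact: contw_cst|exact: contw_coord].
Qed.

Lemma contw_rk A p k : D p -> contw A p (rk (R := R) (m := m) (n := n) k).
Proof.
move=> Dp; apply: contwM; last exact: contw_irr.
by apply: contwM; [exact: contw_cst|exact: contw_coord].
Qed.

Lemma contw_ifX A p (c : R) i : D p -> contw A p (fun q : pt => c / (2 * ff q ^+ i)).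
Proof.
move=> Dp; apply: contwM; first exact: contw_cst.
apply: contwV; first by rewrite mulf_neq0 // expf_neq0 // lt0r_neq0.
by apply: contwM; [exact: contw_cst|apply: contwX; exact: contw_ff].
Qed.

Lemma contw_irX A p (c : R) i : D p -> contw A p (fun q : pt => c / rr q ^+ i).
Proof.
move=> Dp; apply: contwM; first exact: contw_cst.
apply: contwV; first by rewrite expf_neq0 // lt0r_neq0 // Dom_rr.
by apply: contwX; exact: contw_rr.
Qed.

Lemma contw_wA' A p l : D p -> contw A p (wA' lam (m := m) (n := n) l).
Proof. by move=> Dp; apply: contwM; [exact: contw_ifX|exact: contw_fk]. Qed.

Lemma contw_wB' A p l : D p -> contw A p (wB' be (m := m) (n := n) l).
Proof. by move=> Dp; apply: contwM; [exact: contw_irX|exact: contw_rk]. Qed.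

Lemma contw_ph1 A p k : D p -> contw A p (ph1 k).
Proof.
move=> Dp; apply: contwM; first exact: contw_coord.
apply: contwD; (apply: contwM; first exact: contw_cst);
  [exact: contw_wA|exact: contw_wB].
Qed.

Lemma contw_ph2 A p k l : D p -> contw A p (ph2 k l).
Proof.
move=> Dp; apply: contwD.
  apply: contwM; first exact: contw_cst.
  apply: contwD; (apply: contwM; first exact: contw_cst); [exact: contw_wA|exact: contw_wB].
apply: contwM; first exact: contw_coord.
apply: contwD; (apply: contwM; first exact: contw_cst); [exact: contw_wA'|exact: contw_wB'].
Qed.

Lemma C2d_wgt : C2d D wgt wgt1 wgt2.
Proof.
move=> p Dp; split.
- exact: contw_wgt.
- by move=> k; apply: contwM; [exact: contw_wgt|exact: contw_ph1].
- move=> k l; apply: contwD; apply: contwM; try exact: contw_ph1; try exact: contw_ph2;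
    try exact: contw_wgt.
  by apply: contwM; [exact: contw_wgt|exact: contw_ph1].
- by move=> k; exact: is_derive_wgt.
- move=> k l; have := is_derive_mul (is_derive_wgt l Dp) (is_derive_ph1 k l Dp).
  by apply: is_derive_cast.
Qed.

Section Conj.
Variables (w : pt -> R) (w1 : al -> pt -> R) (w2 : al -> al -> pt -> R).
Definition cpsi p := wgt p * w p.
Definition cpsi1 k p := wgt1 k p * w p + wgt p * w1 k p.
Definition cpsi2 k l p :=
  wgt2 k l p * w p + wgt1 k p * w1 l p + (wgt1 l p * w1 k p + wgt p * w2 k l p).

Lemma C2d_cpsi O : O `<=` D -> C2d O w w1 w2 -> C2d O cpsi cpsi1 cpsi2.
Proof. by move=> OD hw; apply: C2dM => //; apply: C2dS C2d_wgt. Qed.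

Variable p : pt.
Hypothesis Dp : D p.
Let f0 : ff p != 0. Proof. by rewrite lt0r_neq0. Qed.
Let r0 : rr p != 0. Proof. by rewrite lt0r_neq0 // Dom_rr. Qed.
Notation W := (wgt p). Notation A := (wA lam p). Notation B := (wB be p).

Lemma sX_cpsi : sX cpsi1 p = W * (sX w1 p + rr p ^+ 2 * (A + B) * w p).
Proof.
rewrite rr_sq esq_xcoord -mulrA mulr_suml /sX -big_split /= mulr_sumr; apply: eq_bigr => k _.
by rewrite /cpsi1 /wgt1 /ph1 /sg; case: (isx01 R k) => ->; ring.
Qed.

Lemma sT_cpsi : sT cpsi1 p = W * (sT w1 p - tau p ^+ 2 * A * w p).
Proof.
rewrite tau_sq esq_tcoord -mulrA mulr_suml /sT -sumrB /= mulr_sumr; apply: eq_bigr => k _.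
by rewrite /cpsi1 /wgt1 /ph1 /sg; case: (isx01 R k) => ->; ring.
Qed.

Lemma sKx_cpsi : sKx cpsi1 p = W ^+ 2 * (sKx w1 p + 2 * (A + B) * w p * sX w1 p
  + rr p ^+ 2 * ((A + B) * w p) ^+ 2).
Proof.
rewrite rr_sq esq_xcoord mulr_suml /sKx /sX mulr_sumr -!big_split /= mulr_sumr.
apply: eq_bigr => k _.
by rewrite /cpsi1 /wgt1 /ph1 /sg; case: (isx01 R k) => ->; ring.
Qed.

Lemma sKt_cpsi : sKt cpsi1 p = W ^+ 2 * (sKt w1 p - 2 * A * w p * sT w1 p
  + tau p ^+ 2 * (A * w p) ^+ 2).
Proof.
rewrite tau_sq esq_tcoord mulr_suml /sKt /sT mulr_sumr -sumrB -!big_split /= mulr_sumr.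
apply: eq_bigr => k _.
by rewrite /cpsi1 /wgt1 /ph1 /sg; case: (isx01 R k) => ->; ring.
Qed.

Lemma sum_natx : \sum_(k : al) isx R k = n%:R :> R.
Proof.
rewrite (eq_bigr (fun k => isx R k * 1)); last by move=> k _; rewrite mulr1.
by rewrite sum_isx sumr_const card_ord.
Qed.

Lemma sum_natt : \sum_(k : al) (1 - isx R k) = m%:R :> R.
Proof.
rewrite (eq_bigr (fun k => (1 - isx R k) * 1)); last by move=> k _; rewrite mulr1.
by rewrite sum_ist sumr_const card_ord.
Qed.

(* [W box (psi / W)], the operator whose product with the multiplier is integrated by parts. *)
Lemma weight_conjugation :
  sboxw cpsi2 p - 2 * (A * (sX cpsi1 p + sT cpsi1 p) + B * sX cpsi1 p)
    + (wV lam be p - wq lam be p) * cpsi p = W * sboxw w2 p.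
Proof.
have e1 : sboxw cpsi2 p = W * ((4 * ff p * A ^+ 2 + (2 * A * B + B ^+ 2) * rr p ^+ 2
   + (m%:R * A + n%:R * (A + B) - lam / ff p - be / rr p)) * w p
   + 2 * (A * (sX w1 p + sT w1 p) + B * sX w1 p) + sboxw w2 p).
  have -> : lam / ff p = lam / (2 * ff p ^+ 2) * (rr p ^+ 2 / 2 - tau p ^+ 2 / 2).
    by have := ffE p; rewrite -mulrBl => <-; field.
  have -> : be / rr p = be / rr p ^+ 3 * rr p ^+ 2 by field.
  have -> : 4 * ff p * A ^+ 2 = A ^+ 2 * (rr p ^+ 2 - tau p ^+ 2) by rewrite -ffE; ring.
  rewrite rr_sq tau_sq esq_xcoord esq_tcoord -sum_natx -sum_natt /sX /sT /sboxw.
  transitivity (W * ((\sum_k (A ^+ 2 * (isx R k * p ord0 k ^+ 2) - A ^+ 2 * ((1 - isx R k) * p ord0 k ^+ 2)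
    + (2 * A * B + B ^+ 2) * (isx R k * p ord0 k ^+ 2) + (1 - isx R k) * A + isx R k * (A + B)
    - lam / (2 * ff p ^+ 2) * (isx R k * p ord0 k ^+ 2 / 2 - (1 - isx R k) * p ord0 k ^+ 2 / 2)
    - be / rr p ^+ 3 * (isx R k * p ord0 k ^+ 2))) * w p
    + \sum_k (2 * (A * (isx R k * (p ord0 k * w1 k p) + (1 - isx R k) * (p ord0 k * w1 k p))
       + B * (isx R k * (p ord0 k * w1 k p)))) + \sum_k sg R k * w2 k k p)).
    rewrite mulr_suml -!big_split /= mulr_sumr; apply: eq_bigr => k _.
    rewrite /cpsi2 /wgt2 /wgt1 /ph2 /ph1 /wA' /wB' /fk /rk eqxx mulr1n /sg.
    by case: (isx01 R k) => ->; field; rewrite f0 r0.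
  congr (W * (_ * _ + _ + _)).
    rewrite (@sum_linear5 R m n _ (fun k => isx R k * p ord0 k ^+ 2)
      (fun k => (1 - isx R k) * p ord0 k ^+ 2) (fun k => 1 - isx R k) (fun k => isx R k) (fun=> 0)
      (A ^+ 2 + (2 * A * B + B ^+ 2) - lam / (2 * ff p ^+ 2) / 2 - be / rr p ^+ 3)
      (- A ^+ 2 + lam / (2 * ff p ^+ 2) / 2) A (A + B) 0); first by ring.
    by move=> k; ring.
  by rewrite -mulr_sumr big_split /= -!mulr_sumr -big_split.
rewrite e1 sX_cpsi sT_cpsi /cpsi /wV /wq /wA /wB /cc0 /cc1 /wp.
have -> : tau p ^+ 2 = rr p ^+ 2 - 4 * ff p by rewrite ffE; ring.
by field; rewrite f0 r0.
Qed.

End Conj.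
End Weight.

(** Undoes the conjugation. A derivative of [W] only adds a multiple of [psi], of order at most
    [1 / f] in the time derivative and bounded in the scaling one, and the two zero-order terms of
    the lower bound pay for it. *)
Lemma carleman_target (F : realFieldType) (lam be f r tau Rad C0 e Tc Dp WD WS AA psi E : F) :
  0 < f -> 0 < r -> 4 * f = r ^+ 2 - tau ^+ 2 -> r <= Rad -> 0 < be -> 4 <= lam ->
  0 <= AA -> e ^+ 2 <= C0 ->
  WD = Dp + tau * (lam / (2 * f)) * psi -> WS = Tc - e * psi ->
  lam ^+ 2 / 16 * (Tc / f) ^+ 2 + be / r * AA + 2 * be * f / r ^+ 3 * Dp ^+ 2
    + lam * be * r / (4 * f ^+ 2) * psi ^+ 2 + be * lam / (r * f) * psi ^+ 2 <= E ->
  0 <= E /\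
  f / r ^+ 3 * WD ^+ 2 + WS ^+ 2 / (r * f) + AA / r + r / f ^+ 2 * psi ^+ 2
    <= (Rad + be^-1 * (1 + lam + C0)) * E.
Proof.
move=> f0 r0 fE rR be0 lam4 AA0 eC -> -> hE.
have C00 : 0 <= C0 := le_trans (sqr_ge0 e) eC.
have t0 := sqr_ge0 tau.
have [t tE] : exists t, t = (Tc / f) ^+ 2 by eexists.
have [d dE] : exists d, d = f / r ^+ 3 * Dp ^+ 2 by eexists.
have [g gE] : exists g, g = (r * f)^-1 * psi ^+ 2 by eexists.
have [h hE'] : exists h, h = r / f ^+ 2 * psi ^+ 2 by eexists.
have [a aE] : exists a, a = AA / r by eexists.
have tp : 0 <= t by rewrite tE sqr_ge0.
have dp : 0 <= d by rewrite dE; nneg.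
have gp : 0 <= g by rewrite gE; nneg.
have hp : 0 <= h by rewrite hE'; nneg.
have ap : 0 <= a by rewrite aE; nneg.
have hE1 : lam ^+ 2 / 16 * t + be * a + 2 * be * d + lam * be / 4 * h + be * lam * g <= E.
  apply: le_trans hE; rewrite le_eqVlt; apply/orP; left; apply/eqP.
  by rewrite tE dE gE hE' aE; field; rewrite !lt0r_neq0.
have k1 : f / r ^+ 3 * (Dp + tau * (lam / (2 * f)) * psi) ^+ 2 <= 2 * d + lam ^+ 2 / 2 * g.
  have -> : 2 * d + lam ^+ 2 / 2 * g = f / r ^+ 3 * (2 * Dp ^+ 2 + (r * (lam / f) * psi) ^+ 2 / 2).
    by rewrite dE gE; field; rewrite !lt0r_neq0.
  rewrite ler_wpM2l //; first by nneg.
  have : tau ^+ 2 * (lam / f * psi) ^+ 2 <= r ^+ 2 * (lam / f * psi) ^+ 2.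
    by rewrite ler_wpM2r ?sqr_ge0 //; lra.
  have -> : (r * (lam / f) * psi) ^+ 2 = r ^+ 2 * (lam / f * psi) ^+ 2 by ring.
  have -> : tau * (lam / (2 * f)) * psi = tau * (lam / f * psi) / 2 by field; rewrite lt0r_neq0.
  have := sqr_ge0 (Dp - tau * (lam / f * psi) / 2).
  have -> : tau ^+ 2 * (lam / f * psi) ^+ 2 = (tau * (lam / f * psi)) ^+ 2 by ring.
  move: (tau * _) => y; move: (r ^+ 2 * _) => x; rewrite !expr2; lra.
have k2 : (Tc - e * psi) ^+ 2 / (r * f) <= Rad / 2 * t + 2 * C0 * g.
  have -> : 2 * C0 * g = 2 * C0 * psi ^+ 2 / (r * f) by rewrite gE; field; rewrite !lt0r_neq0.
  have x1 : (Tc - e * psi) ^+ 2 <= 2 * Tc ^+ 2 + 2 * C0 * psi ^+ 2.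
    have y1 : e ^+ 2 * psi ^+ 2 <= C0 * psi ^+ 2 by rewrite ler_wpM2r ?sqr_ge0.
    have y2 := sqr_ge0 (Tc + e * psi).
    have y3 : (Tc - e * psi) ^+ 2 + (Tc + e * psi) ^+ 2 = 2 * Tc ^+ 2 + 2 * (e ^+ 2 * psi ^+ 2) by ring.
    lra.
  have x2 : 2 * Tc ^+ 2 / (r * f) <= Rad / 2 * t.
    have -> : 2 * Tc ^+ 2 / (r * f) = 2 * (f / r) * t by rewrite tE; field; rewrite !lt0r_neq0.
    rewrite ler_wpM2r //.
    have : f / r <= r / 4 by rewrite ler_pdivrMr // mulrAC -expr2; lra.
    lra.
  apply: le_trans (_ : _ <= (2 * Tc ^+ 2 + 2 * C0 * psi ^+ 2) / (r * f)) _.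
    by rewrite ler_wpM2r // invr_ge0 mulr_ge0 // ltW.
  by rewrite mulrDl lerD2r.
have E0 : 0 <= E.
  by apply: le_trans hE1; nneg.
split => //.
rewrite -aE -hE'.
have R0 : 0 < Rad by lra.
(* [Rad <= K] serves the term in [Tc], and [be K >= 1 + lam + C0] serves the terms that carry a
   factor [be]. *)
have [K KE] : exists K, K = Rad + be^-1 * (1 + lam + C0) by eexists.
have ib : 0 <= be^-1 by rewrite invr_ge0 ltW.
have K1 : Rad <= K by rewrite KE lerDl; apply: mulr_ge0 => //; lra.
have K2 : 1 + lam + C0 <= be * K.
  rewrite KE mulrDr mulrA divff ?lt0r_neq0 // mul1r lerDr mulr_ge0 //; exact: ltW.
rewrite -KE; apply: le_trans (ler_wpM2l (_ : 0 <= K) hE1); last by lra.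
have [bK bKE] : exists bK, bK = be * K by eexists.
have -> : K * (lam ^+ 2 / 16 * t + be * a + 2 * be * d + lam * be / 4 * h + be * lam * g)
  = lam ^+ 2 / 16 * (K * t) + bK * a + 2 * (bK * d) + lam / 4 * (bK * h) + lam * bK * g.
  by rewrite bKE; ring.
rewrite -bKE in K2.
have lam16 : 16 <= lam ^+ 2 by rewrite (_ : 16 = 4 ^+ 2) ?lerXn2r ?nnegrE //; [lra|ring].
have z1 : Rad * t <= lam ^+ 2 / 16 * (K * t).
  have : Rad * t <= K * t by rewrite ler_wpM2r.
  have : 1 * (K * t) <= lam ^+ 2 / 16 * (K * t).
    by rewrite ler_wpM2r //; [apply: mulr_ge0 => //; lra|lra].
  lra.
have bK1 : 1 <= bK by lra.
have z2 : a <= bK * a by rewrite ler_peMl.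
have z3 : d <= bK * d by rewrite ler_peMl.
have z4 : h <= lam / 4 * (bK * h).
  have : h <= bK * h by rewrite ler_peMl.
  have : 1 * (bK * h) <= lam / 4 * (bK * h).
    by rewrite ler_wpM2r //; [apply: mulr_ge0 => //; lra|lra].
  lra.
have z5 : (lam ^+ 2 / 2 + 2 * C0) * g <= lam * bK * g.
  rewrite ler_wpM2r //.
  have : lam * (1 + lam + C0) <= lam * bK by rewrite ler_wpM2l //; lra.
  have : 4 * C0 <= lam * C0 by rewrite ler_wpM2r.
  rewrite !mulrDr -expr2 mulr1; lra.
have Rt : 0 <= Rad * t by rewrite mulr_ge0 // ltW.
lra.
Qed.

(** * The pointwise Carleman inequality for the unconjugated function *)

Section Pointwise.
Variables (R : realType) (m n : nat).
Notation pt := 'rV[R]_(m + n).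
Notation al := ('I_(m + n)).
Variables (lam be Rad : R).
Notation D := (@Dom R m n).

(** At [tau = 0] this is 0 by the convention on division, in agreement with [d_tau]. *)
Definition sD (w1 : al -> pt -> R) (p : pt) := sT w1 p / tau p.
Definition angx (w1 : al -> pt -> R) (p : pt) := sKx w1 p - sX w1 p ^+ 2 / rr p ^+ 2.
Definition angt (w1 : al -> pt -> R) (p : pt) := sKt w1 p - sD w1 p ^+ 2.
(** A quantity dominating both integrands on the left, with [W^2 / f] in the role of [zeta]. The
    null derivatives are represented by the time-radial and the scaling derivative, of which they
    are combinations. *)
Definition Qw (w : pt -> R) (w1 : al -> pt -> R) (p : pt) : R :=
  wgt lam be p ^+ 2 * (ff p / rr p ^+ 3 * sD w1 p ^+ 2
  + (sX w1 p + sT w1 p) ^+ 2 / (rr p * ff p)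
  + (angx w1 p + angt w1 p) / rr p + rr p / ff p ^+ 2 * w p ^+ 2).

Lemma isx_ge0 (k : al) : 0 <= isx R k.
Proof. by case: (isx01 R k) => ->. Qed.

Lemma isx_le1 (k : al) : 0 <= 1 - isx R k.
Proof. by case: (isx01 R k) => ->; lra. Qed.

Lemma sX_le (w1 : al -> pt -> R) (p : pt) : sX w1 p ^+ 2 <= rr p ^+ 2 * sKx w1 p.
Proof.
rewrite rr_sq esq_xcoord.
exact: (@weighted_cauchy_schwarz R _ (fun k : al => isx R k) (fun k => p ord0 k)
  (fun k => w1 k p) (@isx_ge0)).
Qed.

Lemma sT_le (w1 : al -> pt -> R) (p : pt) : sT w1 p ^+ 2 <= tau p ^+ 2 * sKt w1 p.
Proof.
rewrite tau_sq esq_tcoord; apply: (@weighted_cauchy_schwarz R _ (fun k => 1 - isx R k)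
  (fun k => p ord0 k) (fun k => w1 k p)) => k; exact: isx_le1.
Qed.

Lemma sKx_ge0 (w1 : al -> pt -> R) (p : pt) : 0 <= sKx w1 p.
Proof. by apply: sumr_ge0 => k _; rewrite mulr_ge0 ?sqr_ge0 ?isx_ge0. Qed.

Lemma sKt_ge0 (w1 : al -> pt -> R) (p : pt) : 0 <= sKt w1 p.
Proof. by apply: sumr_ge0 => k _; rewrite mulr_ge0 ?sqr_ge0 ?isx_le1. Qed.

Lemma sT_sD (w1 : al -> pt -> R) (p : pt) : sT w1 p = tau p * sD w1 p.
Proof.
rewrite /sD; have [t0|t0] := eqVneq (tau p) 0; last by field.
rewrite t0 mul0r; have := sT_le w1 p; rewrite t0 expr0n mul0r => h.
by apply/eqP; rewrite -sqrf_eq0 eq_le h sqr_ge0.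
Qed.

Lemma sD_le (w1 : al -> pt -> R) (p : pt) : sD w1 p ^+ 2 <= sKt w1 p.
Proof.
have [t0|t0] := eqVneq (tau p) 0.
  by rewrite /sD t0 invr0 mulr0 expr0n sKt_ge0.
have t2 : 0 < tau p ^+ 2 by rewrite exprn_gt0 // lt_neqAle eq_sym t0 tau_ge0.
by have := sT_le w1 p; rewrite sT_sD exprMn ler_pM2l.
Qed.

Lemma angx_ge0 (w1 : al -> pt -> R) (p : pt) : D p -> 0 <= angx w1 p.
Proof.
move=> /Dom_rr r0; rewrite subr_ge0 ler_pdivrMr ?exprn_gt0 // mulrC; exact: sX_le.
Qed.

Lemma angt_ge0 (w1 : al -> pt -> R) (p : pt) : 0 <= angt w1 p.
Proof. by rewrite subr_ge0 sD_le. Qed.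

Hypothesis Rad0 : 0 < Rad.
Hypothesis be0 : 0 < be.
Hypothesis hbe : be * (1 + 2 * Rad) ^+ 3 <= 4^-1.
Hypothesis lam4 : 4 <= lam.
Hypothesis m0 : (0 < m)%N.
Hypothesis n0 : (0 < n)%N.
Hypothesis Nlam : (m%:R + n%:R) ^+ 2 <= lam.

Notation divJc w w1 w2 p :=
  (\sum_k sJ' lam be (cpsi lam be w) (cpsi1 lam be w w1) (cpsi2 lam be w w1 w2) k p).

(** The nonnegativity is recorded separately: it is needed where [chi] is not 1 and the bound on
    [Qw] for the truncated function says nothing about the original one. *)
Lemma carleman_pointwise : exists2 CQ : R, 0 < CQ &
  forall (O : set pt) w w1 w2 (p : pt), open O -> O `<=` D -> C2d O w w1 w2 -> O p -> rr p <= Rad ->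
  0 <= (wgt lam be p * sboxw w2 p) ^+ 2 / 2 - divJc w w1 w2 p /\
  Qw w w1 p <= CQ * ((wgt lam be p * sboxw w2 p) ^+ 2 / 2 - divJc w w1 w2 p).
Proof.
have be0' := be0; have hbe' := hbe; have lam4' := lam4; have Rad0' := Rad0.
pose c : R := (m%:R + n%:R - 4) / 2.
pose C0 := (`|c| + 2 * lam + be * (Rad + 2 * Rad ^+ 2)) ^+ 2.
exists (Rad + be^-1 * (1 + lam + C0)).
  apply: ltr_wpDr => //; apply: mulr_ge0; first by rewrite invr_ge0 ltW.
  by have := sqr_ge0 (`|c| + 2 * lam + be * (Rad + 2 * Rad ^+ 2)); rewrite -/C0; lra.
move=> O w w1 w2 p oO OD hw Op rR.
have Dp : D p by exact: OD.
have f0 : 0 < ff p := Dp; have r0 := Dom_rr Dp.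
have hpsi := C2d_cpsi lam be OD hw.
have sym k l := C2d_sym oO hpsi k l Op.
have id := @carleman_identity R m n lam be (cpsi lam be w) (cpsi1 lam be w w1) _ p Dp sym.
cbv zeta in id.
rewrite (weight_conjugation lam be w w1 w2 Dp) in id.
set psi1 := cpsi1 lam be w w1 in id *.
have m1 : 1 <= m%:R :> R by rewrite ler1n.
have n1 : 1 <= n%:R :> R by rewrite ler1n.
(* True because [n] is an integer: the product is negative only strictly between 2 and 3. *)
have hn : 0 <= (n%:R - 2) * (n%:R - 3) :> R.
  by clear -n0; move: n0; case: n => [|[|[|k]]] // _; nra.
have low := @carleman_lower R lam be (ff p) (rr p) (tau p) Rad m%:R n%:R (sKx psi1 p) (sKt psi1 p)
  (sX psi1 p) (sD psi1 p) (cpsi lam be w p) (wgt lam be p * sboxw w2 p) (divJc w w1 w2 p)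
  f0 r0 (ffE p) rR be0 hbe lam4 hn m1 n1 Nlam (sX_le _ _) (sD_le _ _).
rewrite -sT_sD in low.
have {low id} low := low id.
rewrite -/(angx psi1 p) -/(angt psi1 p) in low.
(* The scaling derivative of [ln W] is [2 lam + B r^2]; adding the [c] contained in [T] gives the
   coefficient relating [W S w] to [T]. *)
pose e := c + 2 * lam + wB be p * rr p ^+ 2.
have eC : e ^+ 2 <= C0.
  have x0 : 0 <= wB be p * rr p ^+ 2 by apply: mulr_ge0; [rewrite /wB; nneg|exact: sqr_ge0].
  have x1 : wB be p * rr p ^+ 2 <= be * (Rad + 2 * Rad ^+ 2).
    rewrite (_ : _ * _ = be * (rr p + 2 * rr p ^+ 2)); last by rewrite /wB; field; rewrite lt0r_neq0.
    rewrite ler_pM2l // lerD // ler_pM2l // lerXn2r ?nnegrE //; exact: ltW.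
  have x2 := ler_norm c; have := ler_norm (- c); rewrite normrN => x3.
  have x4 : 0 <= be * (Rad + 2 * Rad ^+ 2) by lra.
  have : `|e| <= `| `|c| + 2 * lam + be * (Rad + 2 * Rad ^+ 2)|.
    rewrite [leRHS]ger0_norm; last by rewrite !addr_ge0 //; lra.
    by rewrite ler_norml; apply/andP; split; rewrite /e; lra.
  by rewrite -ler_sqr ?nnegrE // !real_normK ?num_real.
have W0 := wgt_gt0 lam be p.
have WD : wgt lam be p * sD w1 p = sD psi1 p + tau p * (lam / (2 * ff p)) * cpsi lam be w p.
  rewrite /sD (sT_cpsi lam be w w1 p) sT_sD /cpsi /wA.
  have [->|t0] := eqVneq (tau p) 0; first by rewrite invr0; ring.
  by field; rewrite t0 lt0r_neq0.
have WS : wgt lam be p * (sX w1 p + sT w1 p) =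
    (sX psi1 p + sT psi1 p + c * cpsi lam be w p) - e * cpsi lam be w p.
  rewrite (sT_cpsi lam be w w1 p) (sX_cpsi lam be w w1 p) /cpsi /e.
  have -> : tau p ^+ 2 = rr p ^+ 2 - 4 * ff p by rewrite ffE; ring.
  by rewrite /wA; field; rewrite lt0r_neq0.
have ax : angx psi1 p = wgt lam be p ^+ 2 * angx w1 p.
  rewrite /angx (sKx_cpsi lam be w w1 p) (sX_cpsi lam be w w1 p).
  by field; rewrite lt0r_neq0.
have at_ : angt psi1 p = wgt lam be p ^+ 2 * angt w1 p.
  rewrite /angt (sKt_cpsi lam be w w1 p).
  have -> : sD psi1 p = wgt lam be p * (sD w1 p - tau p * wA lam p * w p).
    by move: WD; rewrite /cpsi /wA; lra.
  by rewrite sT_sD; ring.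
have AA0 : 0 <= angx psi1 p + angt psi1 p by rewrite addr_ge0 ?angx_ge0 ?angt_ge0.
have [E0 hQ] := carleman_target f0 r0 (ffE p) rR be0 lam4 AA0 eC WD WS low.
split => //; apply: le_trans hQ; rewrite le_eqVlt; apply/orP; left; apply/eqP.
by rewrite ax at_ /Qw /cpsi; ring.
Qed.

End Pointwise.

(** * The energy flux *)

Section Energy.
Variables (R : realType) (m n : nat).
Notation pt := 'rV[R]_(m + n).
Notation al := ('I_(m + n)).
Variables (lam be Rad : R).
Notation D := (@Dom R m n).
Notation wgt := (@wgt R m n lam be).

Definition Gw (p : pt) : R := wgt p * wgt p * (ff p)^-1.
(** The logarithmic derivative of the energy weight [Gw = W^2 / f], a weight comparable to
    [zeta]. *)
Definition gk (k : al) (p : pt) : R := 2 * ph1 lam be k p - fk k p / ff p.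

Lemma Gw_gt0 p : D p -> 0 < Gw p.
Proof. by move=> Dp; rewrite /Gw divr_gt0 // mulr_gt0 ?wgt_gt0. Qed.

Lemma is_derive_Gw p k : D p -> is_derive p (evec R k) Gw (Gw p * gk k p).
Proof.
move=> Dp; have dW := is_derive_wgt lam be k Dp.
have := is_derive_mul (is_derive_mul dW dW) (is_derive_iff k Dp).
apply: is_derive_cast; rewrite /Gw /gk /wgt1.
by have f0 : ff p != 0 by [rewrite lt0r_neq0]; field.
Qed.

Lemma contw_Gw A p : D p -> contw A p Gw.
Proof.
move=> Dp; apply: contwM; last exact: contw_iff.
by apply: contwM; exact: contw_wgt.
Qed.

Lemma contw_gk A p k : D p -> contw A p (gk k).
Proof.
move=> Dp; apply: contwB.
  by apply: contwM; [exact: contw_cst|exact: contw_ph1].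
by apply: contwM; [exact: contw_fk|exact: contw_iff].
Qed.

Section Fields.
Variables (e : pt -> R) (e1 : al -> pt -> R).
Variables (z : pt -> R) (z1 : al -> pt -> R) (z2 : al -> al -> pt -> R).

(** The field [- e^2 G z grad z] with raised index. It vanishes with [z], so it has no flux through
    the lateral boundary. *)
Definition sE (k : al) (p : pt) : R := - (e p * e p * Gw p * z p * (sg R k * z1 k p)).
Definition sE' (k : al) (p : pt) : R :=
  - ((2 * (e p * e1 k p) * Gw p + e p * e p * (Gw p * gk k p)) * z p * (sg R k * z1 k p)
     + e p * e p * Gw p * (z1 k p * (sg R k * z1 k p) + z p * (sg R k * z2 k k p))).

Lemma is_derive_sE p k : D p -> (forall k, is_derive p (evec R k) e (e1 k p)) ->
  (forall k, is_derive p (evec R k) z (z1 k p)) ->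
  (forall k, is_derive p (evec R k) (z1 k) (z2 k k p)) ->
  is_derive p (evec R k) (sE k) (sE' k p).
Proof.
move=> Dp de dz dz1.
have := is_derive_opp (is_derive_mul (is_derive_mul (is_derive_mul (is_derive_mul (de k) (de k))
  (is_derive_Gw k Dp)) (dz k)) (is_derive_scale (sg R k) (dz1 k))).
by apply: is_derive_cast; rewrite /sE'; ring.
Qed.

Lemma contw_sE A p k : D p -> contw A p e -> contw A p z -> contw A p (z1 k) ->
  contw A p (sE k).
Proof.
move=> Dp ce cz cz1; apply: contwN; apply: contwM.
  apply: contwM => //; apply: contwM; first exact: contwM.
  exact: contw_Gw.
by apply: contwM => //; exact: contw_cst.
Qed.

Lemma contw_sE' A p k : D p -> contw A p e -> contw A p (e1 k) -> contw A p z ->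
  contw A p (z1 k) -> contw A p (z2 k k) -> contw A p (sE' k).
Proof.
move=> Dp ce ce1 cz cz1 cz2; have cG := contw_Gw A Dp; have cg := @contw_gk A p k Dp.
have cc (c : R) : contw A p (fun=> c) by exact: contw_cst.
have cs : contw A p (fun q => sg R k * z1 k q) by apply: contwM.
have cs2 : contw A p (fun q => sg R k * z2 k k q) by apply: contwM.
apply: contwN; apply: contwD.
  apply: contwM => //; apply: contwM => //; apply: contwD.
    by apply: contwM => //; apply: contwM => //; apply: contwM.
  by apply: contwM; apply: contwM.
by apply: contwM; [apply: contwM => //; apply: contwM|apply: contwD; apply: contwM].
Qed.

(** The divergence of [e^2 G z grad z] contains [e^2 G (Kx - Kt)]. The metric being indefinite, this
    controls the spatial gradient only at the price of the temporal one, which is why [grad_t z] is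
    observed on [omega]. *)
Lemma energy_pointwise p : D p ->
  e p ^+ 2 * Gw p / 2 * sKx z1 p <= - (\sum_k sE' k p) + 3 / 2 * (e p ^+ 2 * Gw p) * sKt z1 p
    + e p ^+ 2 * wgt p ^+ 2 * sboxw z2 p ^+ 2 / 2
    + (e p ^+ 2 / (2 * ff p) + 4 * (\sum_k e1 k p ^+ 2) + e p ^+ 2 * (\sum_k gk k p ^+ 2))
      * (Gw p * z p ^+ 2).
Proof.
move=> Dp; have f0 : 0 < ff p := Dp; have G0 := Gw_gt0 Dp.
have GW : wgt p ^+ 2 = Gw p * ff p by rewrite /Gw expr2 divfK // lt0r_neq0.
have h1 : \sum_k (e p ^+ 2 * Gw p / 2 * (isx R k * z1 k p ^+ 2)) <= \sum_k (- sE' k p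
    + 3 / 2 * (e p ^+ 2 * Gw p) * ((1 - isx R k) * z1 k p ^+ 2)
    - e p ^+ 2 * Gw p * z p * (sg R k * z2 k k p)
    + 4 * (Gw p * z p ^+ 2) * e1 k p ^+ 2 + e p ^+ 2 * (Gw p * z p ^+ 2) * gk k p ^+ 2).
  apply: ler_sum => k _; rewrite -subr_ge0.
  (* Two completed squares, each using a quarter of the gradient, for the cross terms with the
     derivatives of [e] and of [G]; half of the spatial gradient is left. *)
  have k0 : 0 <= Gw p * ((e p * z1 k p / 2 + sg R k * (2 * e1 k p * z p)) ^+ 2
     + (e p * z1 k p / 2 + sg R k * (e p * gk k p * z p)) ^+ 2).
    by apply: mulr_ge0; [exact: ltW|apply: addr_ge0; exact: sqr_ge0].
  apply: le_trans k0 _; rewrite le_eqVlt; apply/orP; left; apply/eqP.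
  by rewrite /sE' /sg; case: (isx01 R k) => ->; field.
rewrite -mulr_sumr in h1; apply: le_trans h1 _.
rewrite !big_split /= !sumrN -!mulr_sumr -/(sKt z1 p) -/(sboxw z2 p).
have h2 : - (e p ^+ 2 * Gw p * z p * sboxw z2 p) <=
   e p ^+ 2 * wgt p ^+ 2 * sboxw z2 p ^+ 2 / 2 + e p ^+ 2 / (2 * ff p) * (Gw p * z p ^+ 2).
  rewrite -subr_ge0 GW.
  rewrite (_ : _ - _ = e p ^+ 2 * Gw p / (2 * ff p) * (ff p * sboxw z2 p + z p) ^+ 2).
    by apply: mulr_ge0; [nneg|exact: sqr_ge0].
  by field; rewrite lt0r_neq0.
move: (\sum_k sE' k p) (sKt z1 p) (\sum_k _ ^+ 2) (\sum_k _ ^+ 2) h2 => a b c d.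
move: (Gw p * z p ^+ 2) => y; rewrite !mulrDl; lra.
Qed.

End Fields.

Lemma gk_bound p : D p -> rr p <= Rad -> 0 < be -> 4 <= lam ->
  \sum_k gk k p ^+ 2 <= (Rad ^+ 2 * lam ^+ 2 + (Rad * lam + Rad ^+ 2 * be * (1 + 2 * Rad)) ^+ 2) / ff p ^+ 2.
Proof.
move=> Dp rR be0 lam4; have f0 : 0 < ff p := Dp; have r0 := Dom_rr Dp.
have t0 := tau_ge0 p; have tr := Dom_tau Dp.
have -> : \sum_k gk k p ^+ 2 = ((tau p * (lam - 2^-1)) ^+ 2
    + (rr p * (lam - 2^-1) + 2 * ff p * be * (1 + 2 * rr p)) ^+ 2) / ff p ^+ 2.
  pose a := (lam - 2^-1) / ff p.
  transitivity (a ^+ 2 * tau p ^+ 2 + (a + 2 * wB be p) ^+ 2 * rr p ^+ 2); last first.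
    by rewrite /a /wB; field; rewrite !lt0r_neq0.
  rewrite tau_sq rr_sq esq_tcoord esq_xcoord !mulr_sumr -big_split /=; apply: eq_bigr => k _.
  rewrite /gk /ph1 /fk /wA /a /sg.
  by case: (isx01 R k) => ->; field; rewrite !lt0r_neq0.
rewrite ler_wpM2r // ?invr_ge0 ?sqr_ge0 //.
have fr : 4 * ff p <= rr p ^+ 2 by rewrite ffE; have := sqr_ge0 (tau p); lra.
have R2 : rr p ^+ 2 <= Rad ^+ 2 by rewrite lerXn2r ?nnegrE //; lra.
rewrite -exprMn; apply: lerD; rewrite lerXn2r ?nnegrE //.
- by apply: mulr_ge0 => //; lra.
- by apply: mulr_ge0; lra.
- by apply: ler_pM => //; lra.
- have := ltW r0; have := ltW f0; have := ltW be0 => ? ? ?.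
  have : 0 <= lam - 2^-1 by lra.
  move=> ?; nneg.
- have R0 : 0 <= Rad by lra.
  have l0 : 0 <= lam by lra.
  have be0' := ltW be0; nneg.
apply: lerD; first by apply: ler_pM => //; lra.
apply: ler_pM; [by nneg|lra| |lra].
by rewrite ler_pM2r //; have := ltW f0; lra.
Qed.

End Energy.

(** As [f] is bounded, lower powers of [1 / f] may be raised to those of the observation terms,
    [W^2 / f^3] for the time gradient and [W^2 / f^4] for [z], that is [zeta f^-2] and
    [zeta f^-3]. *)
Lemma power_bound (F : realFieldType) (f F0 : F) (i j : nat) :
  0 < f -> f <= F0 -> f ^- i <= F0 ^+ j / f ^+ (i + j).
Proof.
move=> f0 fF; rewrite ler_pdivlMr ?exprn_gt0 // exprD mulrA mulVf ?expf_neq0 ?lt0r_neq0 //.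
by rewrite mul1r lerXn2r ?nnegrE //; lra.
Qed.

Lemma combine_energy (F : realFieldType) (W2 f F0 kx kt zz b Xi e2 s1 Sg EM Cg Je : F) :
  0 <= W2 -> 0 < f -> f <= F0 -> 0 <= kt -> 0 <= zz -> 0 <= b ->
  0 <= e2 -> e2 <= Xi -> 0 <= s1 -> s1 <= Xi -> e2 <= EM -> Sg <= Cg / f ^+ 2 -> 0 <= Cg ->
  e2 * (W2 / f) / 2 * kx <= - Je + 3 / 2 * (e2 * (W2 / f)) * kt + e2 * W2 * b / 2
    + (e2 / (2 * f) + 4 * s1 + e2 * Sg) * (W2 / f * zz) ->
  e2 / 2 * (W2 * kx / f) <= - Je + (3 / 2 * F0 ^+ 2 * (W2 * (Xi / f ^+ 3 * kt)) + EM / 2 * (W2 * b)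
    + (F0 ^+ 2 / 2 + 4 * F0 ^+ 3 + Cg * F0) * (W2 * (Xi / f ^+ 4 * zz))).
Proof.
move=> W0 f0 fF kt0 zz0 b0 e0 eX s0 sX eM Sb Cg0 h.
have F00 : 0 < F0 by lra.
have X0 : 0 <= Xi by lra.
have p1 := power_bound 1 2 f0 fF; have p2 := power_bound 2 2 f0 fF.
have p3 := power_bound 1 3 f0 fF; have p4 := power_bound 3 1 f0 fF.
rewrite !expr1 in p1 p3; rewrite ?addn1 ?addn2 ?addn3 ?addnS ?addn0 ?expr1 in p1 p2 p3 p4.
have i1 : 0 <= f^-1 by rewrite invr_ge0 ltW.
have a1 : e2 * (W2 / f) * kt <= F0 ^+ 2 * (W2 * (Xi / f ^+ 3 * kt)).
  have -> : F0 ^+ 2 * (W2 * (Xi / f ^+ 3 * kt)) = Xi * (W2 * (F0 ^+ 2 / f ^+ 3)) * kt by ring.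
  rewrite ler_wpM2r // ler_pM // ?mulr_ge0 // ler_wpM2l //.
have a2 : e2 * W2 * b <= EM * (W2 * b) by rewrite -mulrA ler_wpM2r // mulr_ge0.
have a3 : (e2 / (2 * f) + 4 * s1 + e2 * Sg) * (W2 / f * zz) <=
    (F0 ^+ 2 / 2 + 4 * F0 ^+ 3 + Cg * F0) * (W2 * (Xi / f ^+ 4 * zz)).
  have -> : (F0 ^+ 2 / 2 + 4 * F0 ^+ 3 + Cg * F0) * (W2 * (Xi / f ^+ 4 * zz)) =
     Xi * (F0 ^+ 2 / f ^+ 4 / 2 + 4 * (F0 ^+ 3 / f ^+ 4) + Cg * (F0 / f ^+ 4)) * (W2 * zz) by ring.
  have -> : (e2 / (2 * f) + 4 * s1 + e2 * Sg) * (W2 / f * zz) =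
     (e2 * (f ^- 2 / 2) + s1 * (4 * f^-1) + e2 * (Sg / f)) * (W2 * zz).
    by field; rewrite lt0r_neq0.
  rewrite ler_wpM2r ?mulr_ge0 // !mulrDr; apply: lerD; first apply: lerD.
  - apply: ler_pM => //; first by rewrite divr_ge0 // invr_ge0 sqr_ge0.
    by rewrite ler_wpM2r.
  - by apply: ler_pM => //; [rewrite mulr_ge0|rewrite ler_wpM2l].
  - have c1 : Sg / f <= Cg * f ^- 3.
      have -> : Cg * f ^- 3 = Cg / f ^+ 2 / f by field; rewrite lt0r_neq0.
      by rewrite ler_wpM2r.
    have c2 : Cg * f ^- 3 <= Cg * (F0 / f ^+ 4) by rewrite ler_wpM2l.
    have c3 : 0 <= Cg * (F0 / f ^+ 4).
      by rewrite mulr_ge0 // divr_ge0 ?exprn_ge0 // ltW.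
    apply: le_trans (_ : e2 * (Cg * (F0 / f ^+ 4)) <= _); last by rewrite ler_wpM2r.
    by rewrite ler_wpM2l // (le_trans c1).
have -> : e2 / 2 * (W2 * kx / f) = e2 * (W2 / f) / 2 * kx by ring.
apply: le_trans h _; rewrite -!mulrA in a1 a2 a3 *; lra.
Qed.

(** The region where [chi] may differ from 1. There [Q] is bounded crudely by the full gradient, and
    [box (chi z)] produces spatial derivatives of [z]; all of these are paid by the energy
    inequality. The sign hypothesis on [W2 * bw2 / 2 - Jc] allows the same divergence to be carried
    as in the other region. *)
Lemma combine_case_b (F : realFieldType) (W2 f F0 Q Jc ES kx kt zz b Xi e2 CQ Cw CR bw2 : F) :
  0 <= W2 -> 0 < f -> f <= F0 -> 0 <= kx -> 0 <= kt -> 0 <= zz -> 0 <= b ->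
  0 < CQ -> 0 < Cw -> 0 < CR -> 1 <= e2 -> 1 <= Xi ->
  e2 / 2 * (W2 * kx / f) <= ES ->
  0 <= W2 * bw2 / 2 - Jc -> bw2 <= Cw * (b + kx + zz) ->
  Q <= CR * W2 * ((kx + kt) / f + zz / f ^+ 2) ->
  Q <= - CQ * Jc + (2 * CR + CQ * Cw * F0) * ES + CR * F0 ^+ 2 * (W2 * (Xi / f ^+ 3 * kt))
    + CR * F0 ^+ 2 * (W2 * (Xi / f ^+ 4 * zz))
    + CQ * Cw / 2 * (W2 * b + F0 ^+ 4 * (W2 * (Xi / f ^+ 4 * zz))).
Proof.
move=> W0 f0 fF kx0 kt0 zz0 b0 CQ0 Cw0 CR0 e1 X1 hE hc hb hQ.
have F00 : 0 < F0 by lra.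
have p1 := power_bound 1 2 f0 fF; have p2 := power_bound 2 2 f0 fF.
have p3 := power_bound 0 4 f0 fF.
rewrite ?expr0 ?invr1 ?addn2 ?addn3 ?addn4 ?addnS ?addn0 ?add0n ?expr1 in p1 p2 p3.
have i1 : 0 <= f^-1 by rewrite invr_ge0 ltW.
have q3 : 0 <= F0 ^+ 2 / f ^+ 3 by rewrite divr_ge0 // exprn_ge0 // ltW.
have q4 : 0 <= F0 ^+ 2 / f ^+ 4 by rewrite divr_ge0 // exprn_ge0 // ltW.
have q5 : 0 <= F0 ^+ 4 / f ^+ 4 by rewrite divr_ge0 // exprn_ge0 // ltW.
have [k kE] : exists k, k = W2 * kx / f by eexists.
have k0 : 0 <= k by rewrite kE !mulr_ge0.
have h1 : k <= 2 * ES.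
  have : 1 * k <= e2 * k by rewrite ler_wpM2r.
  rewrite -kE in hE; move: hE; rewrite mulrAC; lra.
have x1 : W2 * kt / f <= F0 ^+ 2 * (W2 * (Xi / f ^+ 3 * kt)).
  have -> : F0 ^+ 2 * (W2 * (Xi / f ^+ 3 * kt)) = W2 * kt * (Xi * (F0 ^+ 2 / f ^+ 3)) by ring.
  rewrite ler_wpM2l ?mulr_ge0 // (le_trans p1) // ler_peMl //.
have x2 : W2 * zz / f ^+ 2 <= F0 ^+ 2 * (W2 * (Xi / f ^+ 4 * zz)).
  have -> : F0 ^+ 2 * (W2 * (Xi / f ^+ 4 * zz)) = W2 * zz * (Xi * (F0 ^+ 2 / f ^+ 4)) by ring.
  rewrite ler_wpM2l ?mulr_ge0 // (le_trans p2) // ler_peMl //.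
have x3 : W2 * zz <= F0 ^+ 4 * (W2 * (Xi / f ^+ 4 * zz)).
  have -> : F0 ^+ 4 * (W2 * (Xi / f ^+ 4 * zz)) = W2 * zz * (Xi * (F0 ^+ 4 / f ^+ 4)) by ring.
  by rewrite ler_peMr ?mulr_ge0 // (le_trans p3) // ler_peMl //.
have x4 : W2 * kx <= F0 * k.
  have -> : W2 * kx = f * k by rewrite kE; field; rewrite lt0r_neq0.
  by rewrite ler_wpM2r.
have y1 : Q <= CR * (k + W2 * kt / f + W2 * zz / f ^+ 2).
  by apply: le_trans hQ _; rewrite kE le_eqVlt; apply/orP; left; apply/eqP; ring.
have y2 : CR * (W2 * kt / f) <= CR * (F0 ^+ 2 * (W2 * (Xi / f ^+ 3 * kt))) by rewrite ler_pM2l.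
have y3 : CR * (W2 * zz / f ^+ 2) <= CR * (F0 ^+ 2 * (W2 * (Xi / f ^+ 4 * zz))) by rewrite ler_pM2l.
have y4 : CR * k <= CR * (2 * ES) by rewrite ler_pM2l.
have z1 : W2 * bw2 <= Cw * (W2 * b + F0 * k + W2 * zz).
  have : W2 * bw2 <= W2 * (Cw * (b + kx + zz)) by rewrite ler_wpM2l.
  have : Cw * (W2 * kx) <= Cw * (F0 * k) by rewrite ler_pM2l.
  rewrite !mulrDr !(mulrCA W2 Cw); lra.
have z2 : 0 <= CQ * (W2 * bw2 / 2 - Jc) by apply: mulr_ge0 => //; exact: ltW.
have z3 : CQ * (W2 * bw2) <= CQ * (Cw * (W2 * b + F0 * k + W2 * zz)) by rewrite ler_pM2l.
have z4 : CQ * Cw * (W2 * zz) <= CQ * Cw * (F0 ^+ 4 * (W2 * (Xi / f ^+ 4 * zz))).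
  by rewrite ler_pM2l // mulr_gt0.
have z5 : CQ * Cw * F0 * k <= CQ * Cw * F0 * (2 * ES) by rewrite ler_pM2l // !mulr_gt0.
clear -y1 y2 y3 y4 z2 z3 z4 z5.
move: (W2 * (Xi / f ^+ 3 * kt)) (W2 * (Xi / f ^+ 4 * zz)) y2 y3 z4 => P1 P2.
move: (W2 * kt / f) (W2 * zz / f ^+ 2) y1 => P3 P4.
move: (W2 * bw2) z2 z3 => P5; move: (W2 * b) (W2 * zz) => P6 P7.
rewrite !mulrDr !mulrA; lra.
Qed.

(** The same two divergences with the same factors must appear at every point, since only then can
    they be integrated. In [k2], the part [2 CR] pays for the gradient in the crude bound of [Q],
    the part [CQ * Cw * F0] for the one in [box (chi z)]; where [chi = 1] the energy inequality is
    added for free. *)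
Lemma combine_scalar (F : realFieldType)
    (W2 f F0 Q Jc Je kx kt zz b Xi e2 s1 Sg EM Cg CQ Cw CR bw2 k2 : F) :
  k2 = 2 * CR + CQ * Cw * F0 ->
  0 <= W2 -> 0 < f -> f <= F0 -> 0 <= kx -> 0 <= kt -> 0 <= zz -> 0 <= b ->
  0 <= e2 -> e2 <= Xi -> 0 <= s1 -> s1 <= Xi -> e2 <= EM -> Sg <= Cg / f ^+ 2 -> 0 <= Cg ->
  0 < CQ -> 0 < Cw -> 0 < CR ->
  e2 * (W2 / f) / 2 * kx <= - Je + 3 / 2 * (e2 * (W2 / f)) * kt + e2 * W2 * b / 2
    + (e2 / (2 * f) + 4 * s1 + e2 * Sg) * (W2 / f * zz) ->
  Q <= CQ * (W2 * b / 2 - Jc) \/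
  [/\ 1 <= e2, 0 <= W2 * bw2 / 2 - Jc, bw2 <= Cw * (b + kx + zz) &
      Q <= CR * W2 * ((kx + kt) / f + zz / f ^+ 2)] ->
  Q <= (CQ / 2 + CQ * Cw / 2 * (1 + F0 ^+ 4) + CR * F0 ^+ 2
        + k2 * (EM / 2 + 3 / 2 * F0 ^+ 2 + (F0 ^+ 2 / 2 + 4 * F0 ^+ 3 + Cg * F0)))
      * (W2 * b + W2 * (Xi / f ^+ 3 * kt) + W2 * (Xi / f ^+ 4 * zz)) - (CQ * Jc + k2 * Je).
Proof.
move=> k2E W0 f0 fF kx0 kt0 zz0 b0 e0 eX s0 sX eM Sb Cg0 CQ0 Cw0 CR0 hE hQ.
have hE' := combine_energy W0 f0 fF kt0 zz0 b0 e0 eX s0 sX eM Sb Cg0 hE.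
have F00 : 0 < F0 by lra.
have X0 : 0 <= Xi by lra.
have [c3 c3E] : exists c3, c3 = F0 ^+ 2 / 2 + 4 * F0 ^+ 3 + Cg * F0 by eexists.
have c30 : 0 <= c3.
  by rewrite c3E; have F0' := ltW F00; nneg.
have k20 : 0 <= k2 by rewrite k2E; have := ltW F00; have := ltW CQ0; have := ltW Cw0 => *; nneg.
have [ES ESE] : exists ES, ES = - Je + (3 / 2 * F0 ^+ 2 * (W2 * (Xi / f ^+ 3 * kt)) + EM / 2 * (W2 * b)
    + c3 * (W2 * (Xi / f ^+ 4 * zz))) by eexists.
rewrite -c3E -ESE in hE' *.
have [y1 y1E] : exists y, y = W2 * b by eexists.
have [y2 y2E] : exists y, y = W2 * (Xi / f ^+ 3 * kt) by eexists.
have [y3 y3E] : exists y, y = W2 * (Xi / f ^+ 4 * zz) by eexists.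
have y10 : 0 <= y1 by rewrite y1E mulr_ge0.
have y20 : 0 <= y2 by rewrite y2E; nneg.
have y30 : 0 <= y3 by rewrite y3E; nneg.
have EM0 : 0 <= EM by lra.
have F20 : 0 <= F0 ^+ 2 by exact: sqr_ge0.
have F40 : 0 <= F0 ^+ 4 by rewrite exprn_ge0 // ltW.
have u1 : 0 <= CQ * Cw / 2 * (1 + F0 ^+ 4) by have := ltW CQ0; have := ltW Cw0 => *; nneg.
have u2 : 0 <= CR * F0 ^+ 2 by have := ltW CR0 => *; nneg.
have key : Q <= - CQ * Jc + k2 * ES + (CQ / 2 + CQ * Cw / 2 * (1 + F0 ^+ 4) + CR * F0 ^+ 2) * (y1 + y2 + y3).
  have v1 : 0 <= CQ / 2 * (y1 + y2 + y3) by have := ltW CQ0 => *; nneg.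
  have v2 : 0 <= CQ * Cw / 2 * (1 + F0 ^+ 4) * (y1 + y2 + y3) by nneg.
  have v3 : 0 <= CR * F0 ^+ 2 * (y1 + y2 + y3) by nneg.
  case: hQ => [hA|[e1 hc hb hQ]].
    have kE : 0 <= k2 * ES.
      apply: mulr_ge0 => //; apply: le_trans hE'.
      by have i1 : 0 <= f^-1 by [rewrite invr_ge0 ltW]; nneg.
    have w1 : 0 <= CQ / 2 * y2 by have := ltW CQ0 => *; nneg.
    have w2 : 0 <= CQ / 2 * y3 by have := ltW CQ0 => *; nneg.
    rewrite -y1E in hA; lra.
  have X1 : 1 <= Xi by lra.
  have := combine_case_b W0 f0 fF kx0 kt0 zz0 b0 CQ0 Cw0 CR0 e1 X1 hE' hc hb hQ.
  rewrite -k2E -y1E -y2E -y3E => hh; apply: le_trans hh _.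
  have w1 : 0 <= CR * F0 ^+ 2 * y1 by nneg.
  have w2 : 0 <= CQ * Cw / 2 * y2 by have := ltW CQ0; have := ltW Cw0 => *; nneg.
  have w3 : 0 <= CQ * Cw / 2 * y3 by have := ltW CQ0; have := ltW Cw0 => *; nneg.
  have w4 : 0 <= CQ * Cw / 2 * F0 ^+ 4 * (y1 + y2) by have := ltW CQ0; have := ltW Cw0 => *; nneg.
  clear -v1 w1 w2 w3 w4; lra.
apply: le_trans key _; rewrite -y1E -y2E -y3E ESE -y1E -y2E -y3E.
have t1 : 0 <= k2 * (EM / 2 * (y2 + y3)) by nneg.
have t2 : 0 <= k2 * (3 / 2 * F0 ^+ 2 * (y1 + y3)) by nneg.
have t3 : 0 <= k2 * (c3 * (y1 + y2)) by nneg.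
clear -t1 t2 t3; lra.
Qed.

(** * A crude bound by the full gradient *)

Section Qbound.
Variables (R : realType) (m n : nat).
Notation pt := 'rV[R]_(m + n).
Notation al := ('I_(m + n)).
Variables (lam be Rad : R).
Notation D := (@Dom R m n).

Lemma Qw_eq w w1 z z1 (p : pt) : w p = z p -> (forall k, w1 k p = z1 k p) ->
  Qw lam be w w1 p = Qw lam be z z1 p.
Proof.
move=> w0 e1; rewrite /Qw /angx /angt /sD /sX /sT /sKx /sKt w0.
by congr (_ * (_ * (_ / _) ^+ 2 + (_ + _) ^+ 2 / _ + (_ - _ ^+ 2 / _ + (_ - (_ / _) ^+ 2)) / _ + _));
  apply: eq_bigr => k _; rewrite e1.
Qed.

Lemma Qw_bound z z1 (p : pt) : D p -> rr p <= Rad ->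
  Qw lam be z z1 p <= 3 * Rad * wgt lam be p ^+ 2 *
    ((sKx z1 p + sKt z1 p) / ff p + z p ^+ 2 / ff p ^+ 2).
Proof.
move=> Dp rR; have f0 : 0 < ff p := Dp; have r0 := Dom_rr Dp.
have fr : 4 * ff p <= rr p ^+ 2 by rewrite ffE; have := sqr_ge0 (tau p); lra.
rewrite /Qw (_ : 3 * Rad * _ * _ = wgt lam be p ^+ 2 * (3 * Rad * ((sKx z1 p + sKt z1 p) / ff p
  + z p ^+ 2 / ff p ^+ 2))); last by ring.
rewrite ler_wpM2l ?sqr_ge0 //.
have kx0 := sKx_ge0 z1 p; have kt0 := sKt_ge0 z1 p.
have hD := sD_le z1 p; have hX := sX_le z1 p.
have hT : sT z1 p ^+ 2 <= rr p ^+ 2 * sKt z1 p.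
  apply: le_trans (sT_le _ _) _; rewrite ler_wpM2r // lerXn2r ?nnegrE ?tau_ge0 ?rr_ge0 //.
  exact: ltW (Dom_tau Dp).
have hax : angx z1 p <= sKx z1 p by rewrite gerBl divr_ge0 ?sqr_ge0.
have hat : angt z1 p <= sKt z1 p by rewrite gerBl sqr_ge0.
have D0 := sqr_ge0 (sD z1 p).
move: (sKx z1 p) (sKt z1 p) (sX z1 p) (sT z1 p) (sD z1 p) (angx z1 p) (angt z1 p) (z p)
  kx0 kt0 hD hX hT hax hat D0 => kx kt X T d ax at_ zp kx0 kt0 hD hX hT hax hat D0.
move: (ff p) (rr p) f0 r0 fr rR hX hT => f r f0 r0 fr rR hX hT.
have K0 : 0 <= (kx + kt) / f by apply: divr_ge0; [exact: addr_ge0|exact: ltW].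
have a1 : f / r ^+ 3 * d ^+ 2 <= r / 4 * ((kx + kt) / f).
  have -> : r / 4 * ((kx + kt) / f) = (r / (4 * f)) * (kx + kt) by field; rewrite lt0r_neq0.
  apply: ler_pM => //; [by nneg| |lra].
  rewrite ler_pdivrMr ?exprn_gt0 //.
  have -> : r / (4 * f) * r ^+ 3 = (r ^+ 2 / 4) * (r ^+ 2 / f) by field; rewrite lt0r_neq0.
  rewrite -[leLHS]mulr1; apply: ler_pM => //; [lra|lra|].
  rewrite ler_pdivlMr // mul1r; lra.
have a2 : (X + T) ^+ 2 / (r * f) <= 2 * r * ((kx + kt) / f).
  rewrite ler_pdivrMr ?mulr_gt0 //.
  have -> : 2 * r * ((kx + kt) / f) * (r * f) = 2 * (r ^+ 2 * kx) + 2 * (r ^+ 2 * kt).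
    by field; rewrite lt0r_neq0.
  have := sqr_ge0 (X - T); rewrite sqrrB sqrrD; lra.
have a3 : (ax + at_) / r <= r / 4 * ((kx + kt) / f).
  have -> : r / 4 * ((kx + kt) / f) = (kx + kt) * (r / (4 * f)) by field; rewrite lt0r_neq0.
  apply: le_trans (_ : (kx + kt) / r <= _).
    by rewrite ler_wpM2r ?invr_ge0 ?(ltW r0) //; lra.
  rewrite ler_wpM2l ?addr_ge0 // ler_pdivlMr ?mulr_gt0 // mulrC ler_pdivrMr // -expr2; lra.
have a4 : r / f ^+ 2 * zp ^+ 2 <= Rad * (zp ^+ 2 / f ^+ 2).
  rewrite -mulrA ler_pM //; [lra|by rewrite mulr_ge0 ?invr_ge0 ?sqr_ge0|by rewrite mulrC].
have a5 : r * ((kx + kt) / f) <= Rad * ((kx + kt) / f) by rewrite ler_wpM2r.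
have a6 : 0 <= Rad * (zp ^+ 2 / f ^+ 2) by apply: mulr_ge0; [lra|rewrite divr_ge0 ?sqr_ge0].
have a7 : 0 <= Rad * ((kx + kt) / f) by apply: mulr_ge0 => //; lra.
clear -a1 a2 a3 a4 a5 a6 a7; move: ((kx + kt) / f) a1 a2 a3 a5 a7 => K *.
lra.
Qed.

End Qbound.

(** * Localisation by chi and xi *)

Section Combined.
Variables (R : realType) (m n : nat).
Notation pt := 'rV[R]_(m + n).
Notation al := ('I_(m + n)).
Variables (lam be Rad : R) (Om : set 'rV[R]_n).
Variables (chi : 'rV[R]_n -> R) (chi1 : 'I_n -> 'rV[R]_n -> R)
  (chi2 : 'I_n -> 'I_n -> 'rV[R]_n -> R).
Variables (xi : 'rV[R]_n -> R) (xi1 : 'I_n -> 'rV[R]_n -> R)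
  (xi2 : 'I_n -> 'I_n -> 'rV[R]_n -> R).
Notation D := (@Dom R m n).
Let U := @cyl R m n Om.

Section Local.
Variables (z : pt -> R) (z1 : al -> pt -> R) (z2 : al -> al -> pt -> R).
Definition cw (p : pt) : R := chi (xcoord p) * z p.
Definition cw1 (k : al) (p : pt) : R := pull1 chi1 k p * z p + chi (xcoord p) * z1 k p.
Definition cw2 (k l : al) (p : pt) : R := pull2 chi2 k l p * z p + pull1 chi1 k p * z1 l p
  + (pull1 chi1 l p * z1 k p + chi (xcoord p) * z2 k l p).

Lemma C2d_cw O : C2d setT chi chi1 chi2 -> C2d O z z1 z2 -> C2d O cw cw1 cw2.
Proof.
move=> hchi hz; apply: C2dM => //.
by apply: C2dS (C2d_pull hchi) => p _.
Qed.

Lemma sg_pull1 F k (p : pt) : sg R k * pull1 F k p = isx R k * pull1 F k p.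
Proof.
by case: (split_ordP k) => [i ->|j ->]; rewrite ?pull1_l ?mulr0 // sg_r isx_r.
Qed.

Lemma sboxw_cw p : sboxw cw2 p = chi (xcoord p) * sboxw z2 p
  + 2 * (\sum_k isx R k * (pull1 chi1 k p * z1 k p)) + (\sum_j chi2 j j (xcoord p)) * z p.
Proof.
have -> : \sum_j chi2 j j (xcoord p) = \sum_k sg R k * pull2 chi2 k k p.
  rewrite [RHS]big_split_ord /= [X in _ = X + _]big1 ?add0r; last by move=> i _; rewrite pull2_l mulr0.
  by apply: eq_bigr => j _; rewrite pull2_r sg_r mul1r.
rewrite /sboxw !mulr_sumr mulr_suml -!big_split /=; apply: eq_bigr => k _.
by have := sg_pull1 chi1 k p; rewrite /cw2 !mulrDr !mulrA => ->; ring.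
Qed.

Lemma sum_pull1 F (p : pt) : \sum_k isx R k * pull1 F k p ^+ 2 = \sum_j F j (xcoord p) ^+ 2.
Proof. by rewrite sum_isx; apply: eq_bigr => j _; rewrite pull1_r. Qed.

Lemma sboxw_cw_bound p M :
  chi (xcoord p) ^+ 2 + \sum_j chi1 j (xcoord p) ^+ 2 + (\sum_j chi2 j j (xcoord p)) ^+ 2 <= M ->
  sboxw cw2 p ^+ 2 <= 12 * M * (sboxw z2 p ^+ 2 + sKx z1 p + z p ^+ 2).
Proof.
move=> hM; rewrite sboxw_cw.
have h1 := @weighted_cauchy_schwarz R _ (fun k : al => isx R k) (fun k => pull1 chi1 k p)
  (fun k => z1 k p) (@isx_ge0 R m n).
rewrite sum_pull1 in h1; rewrite -/(sKx z1 p) in h1.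
have kx0 := sKx_ge0 z1 p.
have g0 := sqr_ge0 (chi (xcoord p)).
have g1 : 0 <= \sum_j chi1 j (xcoord p) ^+ 2 by apply: sumr_ge0 => j _; exact: sqr_ge0.
have g2 := sqr_ge0 (\sum_j chi2 j j (xcoord p)).
move: (\sum_k isx R k * _) (\sum_j chi1 j _ ^+ 2) (\sum_j chi2 j j _) h1 g1 g2 hM => s q t h1 g1 g2.
move: (chi _) g0 (sboxw z2 p) (sKx z1 p) kx0 h1 (z p) => c g0 b kx kx0 h1 zp hM.
have M0 : 0 <= M by lra.
have a1 : c ^+ 2 * b ^+ 2 <= M * b ^+ 2 by rewrite ler_wpM2r ?sqr_ge0 //; lra.
have a2 : q * kx <= M * kx by rewrite ler_wpM2r //; lra.
have a3 : t ^+ 2 * zp ^+ 2 <= M * zp ^+ 2 by rewrite ler_wpM2r ?sqr_ge0 //; lra.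
have b1 : 0 <= M * b ^+ 2 by rewrite mulr_ge0 ?sqr_ge0.
have b2 : 0 <= M * zp ^+ 2 by rewrite mulr_ge0 ?sqr_ge0.
have s1 := sqr_ge0 (c * b - 2 * s); have s2 := sqr_ge0 (c * b - t * zp).
have s3 := sqr_ge0 (2 * s - t * zp).
have e : (c * b + 2 * s + t * zp) ^+ 2 = 3 * (c ^+ 2 * b ^+ 2) + 12 * s ^+ 2 + 3 * (t ^+ 2 * zp ^+ 2)
  - (c * b - 2 * s) ^+ 2 - (c * b - t * zp) ^+ 2 - (2 * s - t * zp) ^+ 2 by ring.
rewrite e; move: a1 a2 a3 h1 s1 s2 s3 b1 b2.
move: ((c * b - 2 * s) ^+ 2) ((c * b - t * zp) ^+ 2) ((2 * s - t * zp) ^+ 2) => x1 x2 x3.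
move: (c ^+ 2 * b ^+ 2) (t ^+ 2 * zp ^+ 2) (s ^+ 2) => x4 x5 x6.
lra.
Qed.

End Local.

(** One majorant for [xi^2] and [|grad xi|^2], the two localisers of the error terms; it vanishes
    off the neighbourhood of [Gamma_+]. *)
Definition Xi (p : pt) : R := xi (xcoord p) ^+ 2 + \sum_k pull1 xi1 k p ^+ 2.

Hypothesis Rad0 : 0 < Rad.
Hypothesis be0 : 0 < be.
Hypothesis hbe : be * (1 + 2 * Rad) ^+ 3 <= 4^-1.
Hypothesis lam4 : 4 <= lam.
Hypothesis m0 : (0 < m)%N.
Hypothesis n0 : (0 < n)%N.
Hypothesis Nlam : (m%:R + n%:R) ^+ 2 <= lam.
Hypothesis oOm : open Om.
Hypothesis bOm : bounded_set Om.
Hypothesis OmR : forall x, Om x -> enorm x < Rad.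
Hypothesis hchi : C2d setT chi chi1 chi2.
Hypothesis hxi : C2d setT xi xi1 xi2.
Hypothesis hcase : forall x,
  [/\ chi x = 1, forall i, chi1 i x = 0 & forall i j, chi2 i j x = 0] \/ 1 <= xi x.

Lemma bounded_on_Om (F : 'rV[R]_n -> R) : (forall x, contw setT x F) ->
  exists2 M : R, 0 < M & forall x, Om x -> F x <= M.
Proof.
move=> cF; have [x _|M M0 hM] := @compact_bound R n _ F (bounded_closure_compact bOm).
  by apply: contwS (@subsetT _ _) _.
exists M => // x Ox; apply: le_trans (ler_norm _) _; apply: hM; exact: subset_closure.
Qed.

Notation divJc z z1 z2 k p := (sJ' lam be (cpsi lam be (cw z))
  (cpsi1 lam be (cw z) (cw1 z z1)) (cpsi2 lam be (cw z) (cw1 z z1) (cw2 z z1 z2)) k p).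
Notation divJe z z1 z2 k p :=
  (sE' lam be (fun q : pt => xi (xcoord q)) (pull1 xi1) z z1 z2 k p).

(** The constants are chosen before [z], being bounds of the cut-offs over the compact closure of
    [Om]. At each point either [chi] is 1 to second order, and the Carleman inequality for [chi z]
    is one for [z], or [xi >= 1] and the energy inequality is effective. *)
Lemma combined_pointwise : exists CQ k2 KB : R, [/\ 0 < CQ, 0 < k2, 0 < KB &
  forall z z1 z2 (p : pt), C2d (U `&` D) z z1 z2 -> U p -> D p ->
  Qw lam be z z1 p <= KB * (wgt lam be p ^+ 2 * sboxw z2 p ^+ 2
     + wgt lam be p ^+ 2 * (Xi p / ff p ^+ 3 * sKt z1 p)
     + wgt lam be p ^+ 2 * (Xi p / ff p ^+ 4 * z p ^+ 2))
   - (CQ * (\sum_k divJc z z1 z2 k p) + k2 * (\sum_k divJe z z1 z2 k p))].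
Proof.
have [CQ CQ0 hCQ] := @carleman_pointwise R m n lam be Rad Rad0 be0 hbe lam4 m0 n0 Nlam.
have [M M0 hM] : exists2 M : R, 0 < M & forall x, Om x ->
    chi x ^+ 2 + \sum_j chi1 j x ^+ 2 + (\sum_j chi2 j j x) ^+ 2 <= M.
  apply: bounded_on_Om => x; have [c0 c1 c2 _ _] := hchi I (p := x).
  apply: contwD; first apply: contwD.
  - exact: contwX.
  - by apply: contw_sum => j; exact: contwX.
  - by apply: contwX; apply: contw_sum => j.
have [EM EM0 hEM] : exists2 M : R, 0 < M & forall x, Om x -> xi x ^+ 2 <= M.
  by apply: bounded_on_Om => x; have [c0 _ _ _ _] := hxi I (p := x); exact: contwX.
have Rad0' := Rad0; have be0' := be0; have lam4' := lam4.
(* An upper bound of [f], as [4 f <= r^2]. *)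
pose F0 := Rad ^+ 2 / 4.
have F00 : 0 < F0 by rewrite divr_gt0 ?exprn_gt0.
pose Cw := 12 * M; pose CR := 3 * Rad.
have Cw0 : 0 < Cw by rewrite /Cw; lra.
have CR0 : 0 < CR by rewrite /CR; lra.
pose k2 := 2 * CR + CQ * Cw * F0.
have k20 : 0 < k2 by rewrite /k2 addr_gt0 ?mulr_gt0.
pose Cg := Rad ^+ 2 * lam ^+ 2 + (Rad * lam + Rad ^+ 2 * be * (1 + 2 * Rad)) ^+ 2.
have Cg0 : 0 <= Cg by rewrite /Cg; nneg.
exists CQ, k2, (CQ / 2 + CQ * Cw / 2 * (1 + F0 ^+ 4) + CR * F0 ^+ 2
  + k2 * (EM / 2 + 3 / 2 * F0 ^+ 2 + (F0 ^+ 2 / 2 + 4 * F0 ^+ 3 + Cg * F0))); split=> //; last first.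
  move=> z z1 z2 p hz Up Dp.
  have rR : rr p <= Rad by apply/ltW; exact: OmR.
  have f0 : 0 < ff p := Dp.
  have fF : ff p <= F0.
    rewrite /F0; have := ffE p; have := sqr_ge0 (tau p).
    have : rr p ^+ 2 <= Rad ^+ 2 by rewrite lerXn2r ?nnegrE ?rr_ge0 // ltW.
    lra.
  have oUD : open (U `&` D) by apply: openI; [exact: open_cyl|exact: open_Dom].
  have hw := C2d_cw hchi hz.
  have [hc0 hc] := hCQ _ _ _ _ p oUD (@subIsetr _ _ _) hw (conj Up Dp) rR.
  have hE := @energy_pointwise R m n lam be (fun q : pt => xi (xcoord q)) (pull1 xi1) z z1 z2 p Dp.
  have hg := @gk_bound R m n lam be Rad p Dp rR be0 lam4.
  have GE : Gw lam be p = wgt lam be p ^+ 2 / ff p by rewrite /Gw expr2.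
  rewrite GE in hE.
  have s10 : 0 <= \sum_k pull1 xi1 k p ^+ 2 by apply: sumr_ge0 => k _; exact: sqr_ge0.
  have e20 := sqr_ge0 (xi (xcoord p)).
  apply: (@combine_scalar R _ _ F0 _ _ _ (sKx z1 p) (sKt z1 p) (z p ^+ 2) (sboxw z2 p ^+ 2) (Xi p)
    (xi (xcoord p) ^+ 2) (\sum_k pull1 xi1 k p ^+ 2) (\sum_k gk lam be k p ^+ 2) EM Cg
    CQ Cw CR (sboxw (cw2 z z1 z2) p ^+ 2)) => //;
    rewrite ?sqr_ge0 ?sKx_ge0 ?sKt_ge0 //.
  - by rewrite /Xi lerDl.
  - by rewrite /Xi lerDr.
  - exact: hEM.
  rewrite exprMn in hc0 hc.
  case: (hcase (xcoord p)) => [[c1 c2 c3]|x1]; [left|right].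
    have p1 k : pull1 chi1 k p = 0.
      by case: (split_ordP k) => [i ->|j ->]; rewrite ?pull1_l ?pull1_r.
    rewrite -(@Qw_eq R m n lam be (cw z) (cw1 z z1)).
    + move: hc; rewrite sboxw_cw c1 mul1r big1 ?mulr0; last by move=> k _; rewrite p1 mul0r mulr0.
      by rewrite big1 ?mul0r ?addr0 // => j _; rewrite c3.
    + by rewrite /cw c1 mul1r.
    + by move=> k; rewrite /cw1 c1 p1 mul1r mul0r add0r.
  split=> //.
  - by rewrite -[1](expr1n _ 2) lerXn2r ?nnegrE //; lra.
  - exact: sboxw_cw_bound (hM _ Up).
  - exact: Qw_bound.
have F0' := ltW F00; have c1 := ltW CQ0; have c2 := ltW Cw0; have c3 := ltW CR0.
have c4 := ltW k20; have c5 := ltW EM0.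
apply: ltr_wpDr; last apply: ltr_wpDr; last apply: ltr_wpDr; last by rewrite divr_gt0.
- nneg.
- nneg.
- nneg.
Qed.

End Combined.

(** * Decay and sign of the total flux *)

Section FluxDerivative.
Variables (R : realType) (m n : nat).
Notation pt := 'rV[R]_(m + n).
Notation al := ('I_(m + n)).
Variables (lam be : R).
Notation D := (@Dom R m n).

Lemma contw_sJ' A (p : pt) psi psi1 psi2 (k : al) : D p -> contw A p psi ->
  (forall k, contw A p (psi1 k)) -> (forall k l, contw A p (psi2 k l)) ->
  contw A p (sJ' lam be psi psi1 psi2 k).
Proof.
move=> Dp c0 c1 c2.
have cc (c : R) : contw A p (fun=> c) by exact: contw_cst.
have cx l : contw A p (fun q : pt => q ord0 l) by exact: contw_coord.
have cff := @contw_ff R m n A p; have crr := @contw_rr R m n A p.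
have ciff := contw_iff A Dp; have cirr := contw_irr A Dp.
have cX : contw A p (sX psi1) by apply: contw_sum => l; apply: contwM => //; apply: contwM.
have cT : contw A p (sT psi1) by apply: contw_sum => l; apply: contwM => //; apply: contwM.
have cK : contw A p (sK psi1) by apply: contw_sum => l; apply: contwM => //; apply: contwM.
have cX' l : contw A p (sX' psi1 psi2 l).
  by apply: contwD; [apply: contwM|apply: contw_sum => j; apply: contwM => //; apply: contwM].
have cT' l : contw A p (sT' psi1 psi2 l).
  by apply: contwD; [apply: contwM|apply: contw_sum => j; apply: contwM => //; apply: contwM].
have cK' l : contw A p (sK' psi1 psi2 l).
  by apply: contwM => //; apply: contw_sum => j; apply: contwM => //; apply: contwM.
have cfk l : contw A p (fk (R := R) (m := m) (n := n) l) by exact: contw_fk.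
have crk l : contw A p (rk (R := R) (m := m) (n := n) l) by exact: contw_rk.
have cwA := @contw_wA R m n lam A p Dp; have cwB := @contw_wB R m n be A p Dp.
have cwq := @contw_wq R m n lam be A p Dp; have cwp := @contw_wp R m n be A p.
have cwV := @contw_wV R m n lam be A p Dp; have cwCt := @contw_wCt R m n lam A p Dp.
have cwCx := @contw_wCx R m n lam be A p Dp.
have cwA' l := @contw_wA' R m n lam A p l Dp; have cwB' l := @contw_wB' R m n be A p l Dp.
have cfX (c : R) i : contw A p (fun q : pt => c / ff q ^+ i).
  apply: contwM => //; apply: contwV; last exact: contwX.
  by rewrite expf_neq0 // lt0r_neq0.
have crX (c : R) i : contw A p (fun q : pt => c / rr q ^+ i) by exact: contw_irX.
have cwq' l : contw A p (wq' lam be l).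
  by apply: contwB; apply: contwM.
have cwV' l : contw A p (wV' lam be l).
  apply: contwB.
    apply: contwD.
      apply: contwD; first by apply: contwM.
      apply: contwM => //; apply: contwB.
        apply: contwM => //; apply: contwM => //; apply: contwD => //.
        by apply: contwM.
      apply: contwM => //; apply: contwM; first by apply: contwM.
      apply: contwV; last exact: contwX.
      by rewrite expf_neq0 // lt0r_neq0.
    by apply: contwM => //; apply: contwM => //; apply: contwM.
  apply: contwM => //; apply: contwB; first by apply: contwM.
  apply: contwM => //; apply: contwV; last exact: contwX.
  by rewrite expf_neq0 // lt0r_neq0 // Dom_rr.
have cwCt' l : contw A p (wCt' lam l).
  by apply: contwM => //; exact: contw_ifX.
have cwCx' l : contw A p (wCx' lam be l).
  apply: contwD; first exact: cwCt'.
  apply: contwM => //; apply: contwM => //; apply: contwV.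
    by rewrite mulf_neq0 // expf_neq0 // lt0r_neq0 // Dom_rr.
  by apply: contwM => //; exact: contwX.
have cpp : contw A p (fun q => psi q * psi q) by apply: contwM.
have cpp1 l : contw A p (fun q => 2 * (psi q * psi1 l q)) by apply: contwM => //; apply: contwM.
have cXT : contw A p (fun q => sX psi1 q + sT psi1 q) by apply: contwD.
have cM : contw A p (sM lam be psi psi1).
  by apply: contwD; [apply: contwD; apply: contwM => //; apply: contwM|apply: contwM].
have cM' l : contw A p (sM' lam be psi psi1 psi2 l).
  apply: contwD; last by apply: contwD; apply: contwM.
  apply: contwD; apply: contwM => //; apply: contwD; apply: contwM => //.
  by apply: contwD.
have cN : contw A p (fun q => sK psi1 q - wV lam be q * (psi q * psi q)).
  by apply: contwB => //; apply: contwM.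
have cN' l : contw A p (sN' lam be psi psi1 psi2 l).
  by apply: contwB => //; apply: contwD; apply: contwM.
have cEt : contw A p (sEt lam be psi psi1) by apply: contwD; apply: contwM.
have cAB : contw A p (fun q => wA lam q + wB be q) by apply: contwD.
have cAB' l : contw A p (fun q => wA' lam l q + wB' be l q) by apply: contwD.
have cEx : contw A p (sEx lam be psi psi1) by apply: contwD; apply: contwM.
have cEt' l : contw A p (sEt' lam be psi psi1 psi2 l).
  by apply: contwD; apply: contwD; apply: contwM.
have cEx' l : contw A p (sEx' lam be psi psi1 psi2 l).
  by apply: contwD; apply: contwD; apply: contwM.
apply: contwD.
  by apply: contwN; apply: contwD; apply: contwM => //; apply: contwM.
apply: contwD; first by apply: contwD; apply: contwM.
by apply: contwM => //; apply: contwD; apply: contwM.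
Qed.

End FluxDerivative.

Section Order.
Variables (R : realType) (m n : nat).
Notation pt := 'rV[R]_(m + n).
Notation al := ('I_(m + n)).
Variables (lam be Rad : R) (S : set pt).
Notation D := (@Dom R m n).
Hypothesis SD : S `<=` D.
Hypothesis SR : forall p, S p -> rr p <= Rad.
Hypothesis Rad0 : 0 < Rad.
Hypothesis be0 : 0 < be.
Hypothesis lam4 : 4 <= lam.
Notation W := (@wgt R m n lam be).

(* Bookkeeping for the decay of the flux at the null cone. *)
Definition ordW (i j : nat) (F : pt -> R) :=
  exists2 C : R, 0 <= C & forall p, S p -> `|F p| <= C * (W p ^+ i * (ff p)^-1 ^+ j).

Let F0 := Rad ^+ 2 / 4.
Let F00 : 0 < F0. Proof. by rewrite divr_gt0 // exprn_gt0. Qed.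

Lemma ff_le p : S p -> 0 < ff p <= F0.
Proof.
move=> Sp; have f0 : 0 < ff p := SD Sp; rewrite f0 /=.
have := ffE p; have := sqr_ge0 (tau p).
have : rr p ^+ 2 <= Rad ^+ 2 by rewrite lerXn2r ?nnegrE ?rr_ge0 ?SR // ltW.
rewrite /F0; lra.
Qed.

Lemma ordW_weak i j j' F : (j <= j')%N -> ordW i j F -> ordW i j' F.
Proof.
move=> jj [C C0 hC]; exists (C * F0 ^+ (j' - j)); first by rewrite mulr_ge0 // exprn_ge0 // ltW.
move=> p Sp; apply: le_trans (hC p Sp) _; have /andP[f0 fF] := ff_le Sp.
rewrite -mulrA ler_wpM2l // mulrCA ler_wpM2l //; first by rewrite exprn_ge0 // ltW // wgt_gt0.
have -> : (ff p)^-1 ^+ j' = (ff p)^-1 ^+ j * (ff p)^-1 ^+ (j' - j) by rewrite -exprD subnKC.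
rewrite mulrCA ler_peMr //; first by rewrite exprn_ge0 // invr_ge0 ltW.
by rewrite -exprMn exprn_ege1 // ler_pdivlMr // mul1r.
Qed.

Lemma ordWD i j F G : ordW i j F -> ordW i j G -> ordW i j (fun p => F p + G p).
Proof.
move=> [C C0 hC] [K K0 hK]; exists (C + K); first by rewrite addr_ge0.
by move=> p Sp; rewrite mulrDl (le_trans (ler_normD _ _)) // lerD ?hC ?hK.
Qed.

Lemma ordWN i j F : ordW i j F -> ordW i j (fun p => - F p).
Proof. by move=> [C C0 hC]; exists C => // p Sp; rewrite normrN hC. Qed.

Lemma ordWM i j i' j' F G : ordW i j F -> ordW i' j' G ->
  ordW (i + i') (j + j') (fun p => F p * G p).
Proof.
move=> [C C0 hC] [K K0 hK]; exists (C * K); first by rewrite mulr_ge0.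
move=> p Sp; rewrite normrM !exprD.
rewrite (_ : C * K * _ = (C * (W p ^+ i * (ff p)^-1 ^+ j)) * (K * (W p ^+ i' * (ff p)^-1 ^+ j'))); last by ring.
by rewrite ler_pM ?hC ?hK.
Qed.

Lemma ordW_bound F (C : R) : (forall p, S p -> `|F p| <= C) -> ordW 0 0 F.
Proof.
move=> hC; exists `|C| => // p Sp; rewrite !expr0 !mulr1.
by apply: le_trans (hC p Sp) _; exact: ler_norm.
Qed.

Lemma ordW_cst c : ordW 0 0 (fun=> c).
Proof. by apply: (@ordW_bound _ `|c|). Qed.

Lemma ordW_sum i j (F : al -> pt -> R) : (forall k, ordW i j (F k)) ->
  ordW i j (fun p => \sum_k F k p).
Proof.
move=> h; elim: (index_enum _) => [|k s IH].
  by exists 0 => // p Sp; rewrite big_nil normr0 mul0r.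
have [C C0 hC] := ordWD (h k) IH; exists C => // p Sp; rewrite big_cons; exact: hC.
Qed.

Lemma ordW_coord k : ordW 0 0 (fun p : pt => p ord0 k).
Proof.
apply: (@ordW_bound _ Rad) => p Sp; apply: le_trans (coord_le_norm p k) _.
by apply: le_trans (rr_norm (SD Sp)) _; exact: SR.
Qed.

Lemma ordW_rr : ordW 0 0 (@rr R m n).
Proof. by apply: (@ordW_bound _ Rad) => p Sp; rewrite ger0_norm ?rr_ge0 // SR. Qed.

Lemma ordW_iff : ordW 0 1 (fun p : pt => (ff p)^-1).
Proof.
exists 1 => // p Sp; have /andP[f0 _] := ff_le Sp.
by rewrite expr0 expr1 !mul1r ger0_norm // invr_ge0 ltW.
Qed.

(** From [4 f <= r^2 <= Rad r]: the singularity at [r = 0] is met only at the vertex of the cone and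
    costs no more than a power of [1 / f]. *)
Lemma ordW_irr : ordW 0 1 (fun p : pt => (rr p)^-1).
Proof.
exists (Rad / 4); first by rewrite divr_ge0 // ltW.
move=> p Sp; have /andP[f0 _] := ff_le Sp; have r0 := Dom_rr (SD Sp).
rewrite expr0 expr1 mul1r ger0_norm ?invr_ge0 ?(ltW r0) // ler_pdivlMr //.
rewrite mulrC ler_pdivrMr //.
have := ffE p; have := sqr_ge0 (tau p).
have : rr p ^+ 2 <= Rad * rr p by rewrite expr2 ler_pM2r // SR.
lra.
Qed.

Lemma ordW_wgt : ordW 1 0 W.
Proof.
by exists 1 => // p Sp; rewrite expr0 expr1 mulr1 mul1r ger0_norm // ltW // wgt_gt0.
Qed.

Lemma ordW_ifX (c : R) i : ordW 0 i (fun p : pt => c / ff p ^+ i).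
Proof.
exists `|c| => // p Sp; have /andP[f0 _] := ff_le Sp.
rewrite expr0 mul1r normrM exprVn ler_wpM2l // ger0_norm // invr_ge0 exprn_ge0 // ltW //.
Qed.

Lemma ordW_wA : ordW 0 1 (@wA R m n lam).
Proof.
have [C C0 hC] := ordWM (ordW_cst (lam / 2)) ordW_iff; exists C => // p Sp.
by rewrite /wA invfM (mulrA lam); exact: hC.
Qed.

Lemma ordW_wB : ordW 0 1 (@wB R m n be).
Proof.
apply: (ordWM (ordW_cst be)); apply: ordWD; first exact: ordW_irr.
by apply: (@ordW_weak 0 0 1) => //; exact: ordW_cst.
Qed.

Lemma ordW_wq : ordW 0 1 (@wq R m n lam be).
Proof.
apply: ordWD; first apply: ordWD.
- exact: (ordWM (ordW_cst _) ordW_iff).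
- exact: (ordWM (ordW_cst _) ordW_irr).
- by apply: (@ordW_weak 0 0 1) => //; exact: ordW_cst.
Qed.

Lemma ordW_wp : ordW 0 0 (@wp R m n be).
Proof.
apply: (ordWM (ordW_cst be)); apply: ordWD; first exact: ordW_cst.
exact: (ordWM (ordW_cst _) ordW_rr).
Qed.

Lemma ordW_wV : ordW 0 1 (@wV R m n lam be).
Proof.
have cp := ordW_wp; apply: ordWD; first apply: ordWD; first apply: ordWD.
- exact: (ordWM (ordW_cst _) ordW_iff).
- exact: (ordWM (ordWM (ordWM (ordW_cst _) ordW_rr) cp) ordW_iff).
- by apply: (@ordW_weak 0 0 1) => //; exact: (ordWM cp cp).
- by apply: ordWN; exact: (ordWM cp ordW_irr).
Qed.

Lemma ordW_wCt : ordW 0 2 (@wCt R m n lam).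
Proof.
have [C C0 hC] := ordW_ifX (cc0 m n lam / 4) 2; exists C => // p Sp.
by rewrite /wCt invfM (mulrA (cc0 m n lam)); exact: hC.
Qed.

Lemma ordW_wCx : ordW 0 3 (@wCx R m n lam be).
Proof.
apply: ordWD; first by apply: (@ordW_weak 0 2 3) => //; exact: ordW_wCt.
apply: ordWN.
have h3 := ordWM (ordW_cst (cc1 n be / 2)) (ordWM ordW_irr (ordWM ordW_irr ordW_irr)).
have [C C0 hC] := h3; exists C => // p Sp.
by rewrite invfM (mulrA (cc1 n be)) exprS expr2 !invfM; exact: hC.
Qed.

Lemma ordW_ph1 k : ordW 0 1 (@ph1 R m n lam be k).
Proof.
apply: (ordWM (ordW_coord k)); apply: ordWD.
  exact: (ordWM (ordW_cst _) ordW_wA).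
exact: (ordWM (ordW_cst _) ordW_wB).
Qed.

Lemma ordW_cpsi w : ordW 0 0 w -> ordW 1 0 (cpsi lam be w).
Proof. by move=> h; exact: (ordWM ordW_wgt h). Qed.

(** Differentiating [W] costs one factor [1 / f], whereas [w] and its gradient are bounded. *)
Lemma ordW_cpsi1 w w1 k : ordW 0 0 w -> ordW 0 0 (w1 k) -> ordW 1 1 (cpsi1 lam be w w1 k).
Proof.
move=> h h1; apply: ordWD.
  exact: (ordWM (ordWM ordW_wgt (ordW_ph1 k)) h).
by apply: (@ordW_weak 1 0 1) => //; exact: (ordWM ordW_wgt h1).
Qed.

Lemma ordW_sJ psi psi1 k : ordW 1 0 psi -> (forall k, ordW 1 1 (psi1 k)) ->
  ordW 2 3 (sJ lam be psi psi1 k).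
Proof.
move=> h0 h1.
have hX : ordW 1 1 (sX psi1).
  by apply: ordW_sum => l; exact: (ordWM (ordW_cst _) (ordWM (ordW_coord l) (h1 l))).
have hT : ordW 1 1 (sT psi1).
  by apply: ordW_sum => l; exact: (ordWM (ordW_cst _) (ordWM (ordW_coord l) (h1 l))).
have hK : ordW 2 2 (sK psi1).
  by apply: ordW_sum => l; exact: (ordWM (ordW_cst _) (ordWM (h1 l) (h1 l))).
have hpp : ordW 2 0 (fun p => psi p * psi p) by exact: (ordWM h0 h0).
have hM : ordW 1 2 (sM lam be psi psi1).
  apply: ordWD; first apply: ordWD.
  - exact: (ordWM (ordW_cst _) (ordWM ordW_wA (ordWD hX hT))).
  - exact: (ordWM (ordW_cst _) (ordWM ordW_wB hX)).
  - by apply: (@ordW_weak 1 1 2) => //; exact: (ordWM ordW_wq h0).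
have hN : ordW 2 2 (fun p => sK psi1 p - wV lam be p * (psi p * psi p)).
  apply: ordWD => //; apply: ordWN.
  by apply: (@ordW_weak 2 1 2) => //; exact: (ordWM ordW_wV hpp).
have hEt : ordW 2 3 (sEt lam be psi psi1).
  apply: ordWD; first exact: (ordWM hN ordW_wA).
  by apply: (@ordW_weak 2 2 3) => //; exact: (ordWM ordW_wCt hpp).
have hEx : ordW 2 3 (sEx lam be psi psi1).
  apply: ordWD; first exact: (ordWM hN (ordWD ordW_wA ordW_wB)).
  exact: (ordWM ordW_wCx hpp).
apply: ordWD.
  by apply: ordWN; exact: (ordWM hM (ordWM (ordW_cst _) (h1 k))).
apply: (ordWM (ordW_coord k)); apply: ordWD.
  exact: (ordWM (ordW_cst _) hEt).
exact: (ordWM (ordW_cst _) hEx).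
Qed.

Lemma ordW_sE e z z1 k : ordW 0 0 e -> ordW 0 0 z -> ordW 0 0 (z1 k) ->
  ordW 2 3 (sE lam be e z z1 k).
Proof.
move=> he hz hz1; apply: ordWN; apply: (@ordW_weak 2 1 3) => //.
exact: (ordWM (ordWM (ordWM (ordWM he he) (ordWM (ordWM ordW_wgt ordW_wgt) ordW_iff)) hz)
  (ordWM (ordW_cst _) hz1)).
Qed.

(** [W^2 / f^3] is [f^(2 lam - 3)] times a bounded factor, and [2 lam - 5] is positive as
    [lam >= 4]. *)
Lemma ordW_decay F : ordW 2 3 F ->
  exists2 K : R, 0 <= K & forall p, S p -> `|F p| <= K * ff p ^+ 2.
Proof.
move=> [C C0 hC].
have lam4' := lam4; have be0' := be0.
pose E := expR ((2 * lam - 5) * ln F0 + 2 * be * (Rad + Rad ^+ 2)).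
exists (C * E); first by rewrite mulr_ge0 // ltW // expR_gt0.
move=> p Sp; apply: le_trans (hC p Sp) _; have /andP[f0 fF] := ff_le Sp.
rewrite -mulrA ler_wpM2l // exprVn ler_pdivrMr ?exprn_gt0 // -mulrA -exprD /=.
have -> : ff p ^+ 5 = expR (5 * ln (ff p)).
  by rewrite -[in LHS](lnK f0) -expRM_natl.
rewrite -expRM_natl -expRD ler_expR.
have r0 := rr_ge0 p; have rR := SR Sp.
have l1 : (2 * lam - 5) * ln (ff p) <= (2 * lam - 5) * ln F0.
  by rewrite ler_wpM2l //; [lra|rewrite ler_ln].
have l2 : 2 * be * (rr p + rr p ^+ 2) <= 2 * be * (Rad + Rad ^+ 2).
  by rewrite ler_pM2l ?mulr_gt0 // lerD // lerXn2r ?nnegrE // ltW.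
move: l1 l2; move: (ln (ff p)) (ln F0) => x y; rewrite !mulrDr !mulrBl; lra.
Qed.

End Order.

Section BoundaryFlux.
Variables (R : realType) (m n : nat).
Notation pt := 'rV[R]_(m + n).
Notation al := ('I_(m + n)).
Variables (lam be : R).
Notation D := (@Dom R m n).

(** With [psi = 0] and gradient [a n], [n] purely spatial, the multiplier is [2 (A + B) a (x . n)]
    and [K = a^2 |n|^2]. The multiplier term and the [K] term have opposite signs, and the first is
    twice the second. *)
Lemma boundary_flux (psi : pt -> R) (psi1 : al -> pt -> R) (N1 : 'I_n -> 'rV[R]_n -> R) (p : pt) (a : R) :
  D p -> 0 < lam -> 0 < be -> psi p = 0 -> (forall k, psi1 k p = a * pull1 N1 k p) ->
  \sum_j xcoord p ord0 j * N1 j (xcoord p) <= 0 ->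
  0 <= \sum_k pull1 N1 k p * sJ lam be psi psi1 k p.
Proof.
move=> Dp lam0 be0 psi0 e1 hx; have f0 : 0 < ff p := Dp; have r0 := Dom_rr Dp.
pose nn := \sum_k pull1 N1 k p ^+ 2.
pose xn := \sum_k p ord0 k * pull1 N1 k p.
have xn0 : xn <= 0.
  apply: le_trans hx; rewrite /xn big_split_ord /= big1 ?add0r.
    by apply: ler_sum => j _; rewrite pull1_r /xcoord mxE.
  by move=> i _; rewrite pull1_l mulr0.
have isxp k : isx R k * pull1 N1 k p = pull1 N1 k p.
  by case: (split_ordP k) => [i ->|j ->]; rewrite ?pull1_l ?mulr0 // isx_r mul1r.
have XE : sX psi1 p = a * xn.
  rewrite /sX /xn mulr_sumr; apply: eq_bigr => k _; rewrite e1 -{2}(isxp k); ring.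
have TE : sT psi1 p = 0.
  rewrite /sT big1 // => k _; rewrite e1 -(isxp k).
  rewrite (_ : _ * _ = ((1 - isx R k) * isx R k) * (p ord0 k * a * pull1 N1 k p)); last by ring.
  by rewrite mulrBl isx_sq mul1r subrr mul0r.
have KE : sK psi1 p = a ^+ 2 * nn.
  rewrite /sK /nn mulr_sumr; apply: eq_bigr => k _; rewrite e1.
  rewrite (_ : _ * (_ * _) = a ^+ 2 * ((sg R k * pull1 N1 k p) * pull1 N1 k p)); last by ring.
  by rewrite sg_pull1 isxp; ring.
have -> : \sum_k pull1 N1 k p * sJ lam be psi psi1 k p =
    - (wA lam p + wB be p) * (a ^+ 2 * nn) * xn.
  transitivity (- sM lam be psi psi1 p * a * nn + sEx lam be psi psi1 p * xn); last first.
    by rewrite /sM /sEx psi0 XE TE KE; ring.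
  rewrite /nn /xn !mulr_sumr -big_split /=; apply: eq_bigr => k _; rewrite /sJ e1.
  by case: (split_ordP k) => [i ->|j ->]; rewrite ?pull1_l ?pull1_r ?isx_l ?isx_r ?sg_l ?sg_r; ring.
have nn0 : 0 <= nn by apply: sumr_ge0 => k _; exact: sqr_ge0.
rewrite -mulrA mulNr oppr_ge0 mulr_ge0_le0 //.
  by rewrite /wA /wB; nneg.
by rewrite mulr_ge0_le0 // mulr_ge0 // sqr_ge0.
Qed.

End BoundaryFlux.

(** * The combined current: regularity, sign at the boundary, decay at the cone *)

Section Total.
Variables (R : realType) (m n : nat).
Notation pt := 'rV[R]_(m + n).
Notation al := ('I_(m + n)).
Variables (lam be Rad : R) (Om : set 'rV[R]_n) (nu : 'rV[R]_n -> 'rV[R]_n).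
Variables (rho : 'rV[R]_n -> R) (rho1 : 'I_n -> 'rV[R]_n -> R)
  (rho2 : 'I_n -> 'I_n -> 'rV[R]_n -> R).
Variables (chi : 'rV[R]_n -> R) (chi1 : 'I_n -> 'rV[R]_n -> R)
  (chi2 : 'I_n -> 'I_n -> 'rV[R]_n -> R).
Variables (xi : 'rV[R]_n -> R) (xi1 : 'I_n -> 'rV[R]_n -> R)
  (xi2 : 'I_n -> 'I_n -> 'rV[R]_n -> R).
Notation D := (@Dom R m n).
Notation bd := (closure Om `\` Om).
Let U := @cyl R m n Om.
Hypothesis Rad0 : 0 < Rad.
Hypothesis be0 : 0 < be.
Hypothesis lam4 : 4 <= lam.
Hypothesis oOm : open Om.
Hypothesis OmR : forall x, Om x -> enorm x < Rad.
Hypothesis hrho : C2d setT rho rho1 rho2.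
Hypothesis rho_in : forall x, Om x -> rho x < 0.
Hypothesis rho_out : forall x, ~ Om x -> 0 <= rho x.
Hypothesis rho_bd : forall x, bd x -> rho x = 0.
Hypothesis rho_nu : forall x, bd x -> exists2 c, 0 < c & forall j, rho1 j x = c * nu x ord0 j.
Hypothesis nu0 : forall x, bd x -> exists j, nu x ord0 j != 0.
Hypothesis hchi : C2d setT chi chi1 chi2.
Hypothesis hxi : C2d setT xi xi1 xi2.
Hypothesis chi0 : forall x, Gamma_plus Om nu x -> chi x = 0.

Variables (z : pt -> R) (z1 : al -> pt -> R) (z2 : al -> al -> pt -> R).
Hypothesis hz : C2d U z z1 z2.
Hypothesis cz : forall p, closure U p -> contw (closure U) p z.
Hypothesis cz1 : forall p k, closure U p -> contw (closure U) p (z1 k).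
Hypothesis z0 : forall p, (closure U `\` U) p -> D p -> z p = 0.
Variables (CQ k2 : R).
Hypothesis CQ0 : 0 <= CQ.

Notation w := (cw chi z). Notation w1 := (cw1 chi chi1 z z1). Notation w2 := (cw2 chi chi1 chi2 z z1 z2).
Notation psi := (cpsi lam be w). Notation psi1 := (cpsi1 lam be w w1).
Notation psi2 := (cpsi2 lam be w w1 w2).
Notation e := (fun q : pt => xi (xcoord q)). Notation e1 := (pull1 xi1).

Definition tJ (k : al) (p : pt) : R := CQ * sJ lam be psi psi1 k p + k2 * sE lam be e z z1 k p.
Definition tJ' (k : al) (p : pt) : R :=
  CQ * sJ' lam be psi psi1 psi2 k p + k2 * sE' lam be e e1 z z1 z2 k p.

Let hUD : C2d (U `&` D) z z1 z2. Proof. by apply: C2dS hz => p []. Qed.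
Let hpsi : C2d (U `&` D) psi psi1 psi2.
Proof. by apply: C2d_cpsi; [exact: subIsetr|exact: C2d_cw]. Qed.

Lemma is_derive_tJ p k : U p -> D p -> is_derive p (evec R k) (tJ k) (tJ' k p).
Proof.
move=> Up Dp; have [_ _ _ d1 d2] := hz Up.
have [_ _ _ x1 _] := C2d_pull hxi (I : [set: pt] p).
exact: (is_derive_add (is_derive_scale CQ (is_derive_sJ lam be k hpsi (conj Up Dp) Dp))
  (is_derive_scale k2 (is_derive_sE lam be k Dp x1 d1 (fun k => d2 k k)))).
Qed.

Lemma contw_tJ' p k : U p -> D p -> contw setT p (tJ' k).
Proof.
move=> Up Dp; have [c0 c1 c2 _ _] := hz Up.
have [x0 x1 _ _ _] := C2d_pull hxi (I : [set: pt] p).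
have [p0 p1 p2 _ _] := hpsi (conj Up Dp).
apply: contwD; (apply: contwM; first exact: contw_cst).
  exact: contw_sJ'.
exact: contw_sE'.
Qed.

Lemma contw_tJ p k : closure U p -> D p -> contw (closure U) p (tJ k).
Proof.
move=> Up Dp; have c0 := cz Up; have c1 k' := @cz1 p k' Up.
have TS (F : pt -> R) : contw setT p F -> contw (closure U) p F by apply: contwS.
have [x0 _ _ _ _] := C2d_pull hxi (I : [set: pt] p).
have [y0 y1 _ _ _] := C2d_pull hchi (I : [set: pt] p).
have cw0 : contw (closure U) p w by apply: contwM => //; exact: TS.
have cw1 l : contw (closure U) p (w1 l).
  by apply: contwD; apply: contwM => //; apply: TS => //; exact: y1.
have cW := @contw_wgt R m n lam be (closure U) p Dp.
apply: contwD; (apply: contwM; first exact: contw_cst); last by apply: contw_sE => //; exact: TS.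
apply: contw_sJ => //; first exact: contwM.
move=> l; apply: contwD; apply: contwM => //.
by apply: contwM => //; exact: contw_ph1.
Qed.

Let bd_grad p : (closure U `\` U) p -> bd (xcoord p).
Proof. by move=> [/closure_cyl cx nx]; split. Qed.

Let bd_pos x : bd x -> 0 < \sum_j rho1 j x ^+ 2.
Proof.
move=> bx; have [c c0 hc] := rho_nu bx; have [j nj] := nu0 bx.
rewrite (bigD1 j) //= ltr_wpDr //; first by apply: sumr_ge0 => i _; exact: sqr_ge0.
by rewrite exprn_even_gt0 //= hc mulf_neq0 // lt0r_neq0.
Qed.

(** The energy part vanishes with [z]. On [Gamma_+] both [psi] and its gradient vanish because [chi]
    does; elsewhere [x . nu <= 0], and [grad rho] is a positive multiple of [nu]. *)
Lemma total_flux p : (closure U `\` U) p -> D p -> 0 <= \sum_k pull1 rho1 k p * tJ k p.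
Proof.
move=> bp Dp; have bx := bd_grad bp; have zp := z0 bp Dp.
have -> : \sum_k pull1 rho1 k p * tJ k p = CQ * \sum_k pull1 rho1 k p * sJ lam be psi psi1 k p.
  rewrite mulr_sumr; apply: eq_bigr => k _.
  by rewrite /tJ /sE zp mulr0 mul0r oppr0 mulr0 addr0 mulrCA.
have [c hc] : exists c, forall k, z1 k p = c * pull1 rho1 k p.
  apply: (@boundary_gradient R _ U D (fun q => rho (xcoord q)) (pull1 rho1)
    _ _ _ _ _ z z1 _ cz cz1 z0 p bp Dp) => //.
  - exact: open_cyl.
  - exact: open_Dom.
  - exact: C2d_gradcont (C2d_pull hrho).
  - by move=> q Uq; exact: rho_in.
  - by move=> q Uq; exact: rho_out.
  - exact: C2d_gradcont hz.
  - exact: rho_bd.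
  - rewrite (_ : \sum_k _ = \sum_j rho1 j (xcoord p) ^+ 2); first exact: bd_pos.
    rewrite big_split_ord /= big1 ?add0r; last by move=> i _; rewrite pull1_l expr0n.
    by apply: eq_bigr => j _; rewrite pull1_r.
apply: mulr_ge0 => //.
have lam0 : 0 < lam by have := lam4; lra.
have p0 : psi p = 0 by rewrite /cpsi /cw zp !mulr0.
have [gx|gx] := pselect (Gamma_plus Om nu (xcoord p)).
  have chx := chi0 gx.
  rewrite big1 // => k _; rewrite (_ : sJ _ _ _ _ _ _ = 0) ?mulr0 //.
  have q1 l : psi1 l p = 0 by rewrite /cpsi1 /cw /cw1 zp chx; ring.
  have K0 : sK psi1 p = 0 by rewrite /sK big1 // => l _; rewrite q1 !mulr0.
  by rewrite /sJ /sEt /sEx /sM q1 p0 K0; ring.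
apply: (@boundary_flux R m n lam be _ _ rho1 p (wgt lam be p * chi (xcoord p) * c)) => //.
  by move=> k; rewrite /cpsi1 /cw /cw1 zp hc; ring.
have [d d0 hd] := rho_nu bx.
have : dotv (xcoord p) (nu (xcoord p)) <= 0.
  by rewrite leNgt; apply/negP => h; apply: gx.
rewrite /dotv => h; rewrite (eq_bigr (fun j => d * (xcoord p ord0 j * nu (xcoord p) ord0 j))).
  by rewrite -mulr_sumr mulr_ge0_le0 // ltW.
by move=> j _; rewrite hd; ring.
Qed.

(** The sum is twice the flux through the level sets of [f], whose differential is [sg k * p k / 2].
    The bound may depend on [z]: it only serves to remove the cut-off at the cone. *)
Lemma total_bound : exists2 K : R, 0 <= K & forall p, U p -> D p ->
  `|\sum_k sg R k * p ord0 k * tJ k p| <= K * ff p ^+ 2.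
Proof.
pose S := U `&` D.
have SD : S `<=` D by exact: subIsetr.
have SR p : S p -> rr p <= Rad by move=> [Up _]; exact: ltW (OmR Up).
(* The closure of [U] is unbounded in time, so it is intersected with a ball that contains the part
   of interest. *)
have cK : compact (closure U `&` [set p | `|p| <= Rad]).
  apply: (@subclosed_compact _ _ [set p : pt | `|p| <= Rad]) (@closed_ball_rV_compact R _ Rad) _.
    apply: closedI; first exact: closed_closure.
    rewrite (_ : mkset _ = Num.norm @^-1` [set x : R | x <= Rad]) //.
    by apply: preimage_closed; [move=> p _; exact: norm_continuous|exact: closed_le].
  by move=> p [].
have bnd (F : pt -> R) : (forall p, closure U p -> contw (closure U) p F) ->
    ordW lam be S 0 0 F.
  move=> cF; have [p [cp _]|M M0 hM] := @compact_bound R _ _ F cK.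
    by apply: contwS (cF p cp) => q [].
  apply: (@ordW_bound _ _ _ _ _ _ _ M) => p Sp; apply: hM; split.
    by case: Sp => Up _; exact: subset_closure.
  by apply: le_trans (rr_norm (SD _ Sp)) _; exact: SR.
have TS p (F : pt -> R) : contw setT p F -> contw (closure U) p F by apply: contwS.
have ox : ordW lam be S 0 0 e.
  by apply: bnd => p _; apply: TS; have [] := C2d_pull hxi (I : [set: pt] p).
have oc : ordW lam be S 0 0 (fun q : pt => chi (xcoord q)).
  by apply: bnd => p _; apply: TS; have [] := C2d_pull hchi (I : [set: pt] p).
have oc1 k : ordW lam be S 0 0 (pull1 chi1 k).
  by apply: bnd => p _; apply: TS; have [_ h _ _ _] := C2d_pull hchi (I : [set: pt] p).
have oz : ordW lam be S 0 0 z by apply: bnd.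
have oz1 k : ordW lam be S 0 0 (z1 k) by apply: bnd => p; exact: cz1.
have ow : ordW lam be S 0 0 w by exact: (ordWM oc oz).
have ow1 k : ordW lam be S 0 0 (w1 k).
  by apply: ordWD; [exact: (ordWM (oc1 k) oz)|exact: (ordWM oc (oz1 k))].
have oJ k : ordW lam be S 2 3 (tJ k).
  apply: ordWD; apply: (ordWM (ordW_cst _ _ _ _)).
    apply: (ordW_sJ SD SR) => //; first exact: ordW_cpsi.
    by move=> l; apply: (ordW_cpsi1 SD SR).
  exact: (ordW_sE SD SR).
have oS : ordW lam be S 2 3 (fun p => \sum_k sg R k * p ord0 k * tJ k p).
  apply: ordW_sum => k.
  exact: (ordWM (ordWM (ordW_cst _ _ _ _) (ordW_coord lam be SD SR k)) (oJ k)).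
have [K K0 hK] := ordW_decay SD SR Rad0 be0 lam4 oS.
by exists K => // p Up Dp; apply: hK.
Qed.

Theorem total_estimate (A B : pt -> R) (M : R) :
  (forall p, U p -> D p -> contw setT p B) ->
  (forall p, U p -> D p -> 0 <= A p <= B p - \sum_k tJ' k p) ->
  (forall H, cutoff (U `&` D) H -> Rint (fun p => H p * B p) <= M) ->
  (int_over (U `&` D) A <= M%:E)%E.
Proof.
have [K K0 hK] := total_bound.
apply: (@div_estimate R m n Om Rad oOm Rad0 OmR rho rho1 rho2 hrho rho_in rho_out bd_pos tJ tJ' _ _ _ _ K).
- by move=> p k; exact: is_derive_tJ.
- by move=> p k; exact: contw_tJ'.
- by move=> p k; exact: contw_tJ.
- exact: total_flux.
- exact: K0.
- exact: hK.
Qed.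

End Total.

(** * Comparison of the weights and conclusion *)

Section Zeta.
Variables (R : realType) (m n : nat).
Notation pt := 'rV[R]_(m + n).
Notation al := ('I_(m + n)).
Notation D := (@Dom R m n).

(** Since [eps Rad <= 1/4], the denominator of the first factor of [zeta] lies between 1/2 and 1,
    and that in the exponent is at least 1. The base of the power is thus between [f] and [L f], so
    [zeta] is comparable to [f^(2 a)]. *)
Lemma zeta_compare (a b eps be Rad : R) : 0 < a -> 0 < b -> 0 < eps -> 0 < be -> 0 < Rad ->
  eps * Rad <= 4^-1 ->
  exists c1 c2 : R, [/\ 0 < c1, 0 < c2 & forall p : pt, D p -> rr p <= Rad ->
    wgt (a + 2^-1) be p ^+ 2 / ff p <= c1 * zeta a b eps p /\
    zeta a b eps p <= c2 * (wgt (a + 2^-1) be p ^+ 2 / ff p)].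
Proof.
move=> a0 b0 e0 be0 R0 eR.
(* [E0] bounds the exponential left in [W^2 / f]. In [L], the 2 comes from the denominator and the
   exponential from [sqrt f <= Rad]. *)
pose E0 := expR (2 * be * (Rad + Rad ^+ 2)); pose L := 2 * expR (2 * b * Rad).
have E00 : 0 < E0 by exact: expR_gt0.
have L0 : 0 < L by rewrite mulr_gt0 // expR_gt0.
have L20 : 0 < powR L (2 * a) by exact: powR_gt0.
exists E0, (powR L (2 * a)); split => // p Dp rR.
have f0 : 0 < ff p := Dp; have r0 := Dom_rr Dp; have t0 := tau_ge0 p; have tr := Dom_tau Dp.
have u1 : - Rad <= uu p by rewrite /uu; lra.
have u2 : uu p <= 0 by rewrite /uu; lra.
have v1 : 0 <= vv p by rewrite /vv; lra.
have v2 : vv p <= Rad by rewrite /vv; lra.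
have eu1 : - 4^-1 <= eps * uu p.
  have : eps * (- Rad) <= eps * uu p by rewrite ler_pM2l.
  by rewrite mulrN; lra.
have eu2 : eps * uu p <= 0 by rewrite pmulr_rle0.
have ev1 : 0 <= eps * vv p by rewrite mulr_ge0 // ltW.
have ev2 : eps * vv p <= 4^-1 by apply: le_trans eR; rewrite ler_pM2l.
pose d := (1 + eps * uu p) * (1 - eps * vv p).
have d1 : 2^-1 <= d.
  apply: le_trans (_ : (3 / 4) * (3 / 4) <= _); first by lra.
  by apply: ler_pM; lra.
have d2 : d <= 1.
  by rewrite -[leRHS]mulr1; apply: ler_pM; lra.
have d0 : 0 < d by lra.
pose s := Num.sqrt (1 - eps * uu p) * Num.sqrt (1 + eps * vv p).
have s1 : 1 <= s.
  rewrite -[leLHS]mulr1; apply: ler_pM => //.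
    by rewrite -[leLHS]sqrtr1 ler_wsqrtr //; lra.
  by rewrite -[leLHS]sqrtr1 ler_wsqrtr //; lra.
have s0 : 0 < s by lra.
have sf0 := sqrtr_ge0 (ff p).
have sf : Num.sqrt (ff p) <= Rad.
  apply: le_trans rR; rewrite -[leRHS]ger0_norm ?rr_ge0 // -sqrtr_sqr ler_wsqrtr //.
  by have := ffE p; have := sqr_ge0 (tau p); have := sqr_ge0 (rr p); lra.
pose x := ff p / d * expR (2 * b * Num.sqrt (ff p) / s).
have bs0 : 0 <= 2 * b * Num.sqrt (ff p) by rewrite !mulr_ge0 // ltW.
have x1 : ff p <= x.
  rewrite /x -[leLHS]mulr1; apply: ler_pM => //; [exact: ltW| |].
    by rewrite ler_pdivlMr // ler_piMr // ltW.
  by rewrite -[leLHS]expR0 ler_expR divr_ge0 // ltW.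
have x2 : x <= L * ff p.
  rewrite /x (_ : L * ff p = (2 * ff p) * expR (2 * b * Rad)); last by rewrite /L; ring.
  apply: ler_pM; [by rewrite divr_ge0 // ltW|exact: expR_ge0| |].
    rewrite ler_pdivrMr // mulrAC.
    by apply: ler_peMl; [exact: ltW|lra].
  rewrite ler_expR ler_pdivrMr //.
  apply: le_trans (_ : 2 * b * Rad <= _); first by rewrite ler_pM2l // mulr_gt0.
  by rewrite ler_peMr // !mulr_ge0 // ltW.
have zE : zeta a b eps p = powR x (2 * a) by [].
have x0 : 0 < x by apply: lt_le_trans x1.
pose F := powR (ff p) (2 * a).
have F0 : 0 < F by exact: powR_gt0.
have z1 : F <= zeta a b eps p.
  rewrite zE; apply: ge0_ler_powR => //; rewrite ?nnegrE ?(ltW f0) ?(ltW x0) //.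
  by rewrite mulr_ge0 // ltW.
have z2 : zeta a b eps p <= powR L (2 * a) * F.
  rewrite zE -powRM ?(ltW L0) ?(ltW f0) //; apply: ge0_ler_powR => //.
  - by rewrite mulr_ge0 // ltW.
  - by rewrite nnegrE ltW.
  - by rewrite nnegrE mulr_ge0 // ltW.
pose Er := expR (2 * be * (rr p + rr p ^+ 2)).
have WE : wgt (a + 2^-1) be p ^+ 2 / ff p = F * Er.
  rewrite /wgt -expRM_natl /F /powR gt_eqF // /Er -{2}(lnK f0) -expRN -!expRD.
  by congr expR; field.
have Er1 : 1 <= Er by rewrite /Er -[leLHS]expR0 ler_expR; nneg.
have Er2 : Er <= E0.
  rewrite /Er /E0 ler_expR ler_pM2l ?mulr_gt0 // lerD //.
  by rewrite lerXn2r ?nnegrE ?rr_ge0 // ltW.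
rewrite WE; split.
  by rewrite [leRHS]mulrC; apply: ler_pM => //; [exact: ltW|exact: le_trans Er1].
clearbody F Er; apply: (le_trans z2); apply: (ler_wpM2l (ltW L20)).
by rewrite ler_peMr // ltW.
Qed.

(** * Identification with the expressions of the statement *)

Section Identify.
Variables (z : pt -> R) (z1 : al -> pt -> R) (z2 : al -> al -> pt -> R) (p : pt).
Hypothesis e1 : forall k, z1 k p = partial k z p.
Hypothesis e2 : forall k l, z2 k l p = partial l (partial k z) p.

Lemma sX_dotv : dotv (xcoord p) (grad_x z p) = sX z1 p.
Proof. by rewrite /sX sum_isx; apply: eq_bigr => j _; rewrite !mxE e1. Qed.

Lemma sT_dotv : dotv (tcoord p) (grad_t z p) = sT z1 p.
Proof. by rewrite /sT sum_ist; apply: eq_bigr => j _; rewrite !mxE e1. Qed.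

Lemma sKt_dotv : dotv (grad_t z p) (grad_t z p) = sKt z1 p.
Proof. by rewrite /sKt sum_ist; apply: eq_bigr => j _; rewrite !mxE e1 expr2. Qed.

Lemma d_r_sX : d_r z p = sX z1 p / rr p.
Proof. by rewrite /d_r sX_dotv mulrC. Qed.

Lemma d_tau_sD : d_tau z p = sD z1 p.
Proof. by rewrite /d_tau sT_dotv mulrC. Qed.

Lemma gab_angx : D p -> gab_term z p = angx z1 p.
Proof.
move=> Dp; have r0 := Dom_rr Dp; rewrite /angx.
pose c := sX z1 p / rr p / rr p.
transitivity (sKx z1 p - 2 * c * sX z1 p + c ^+ 2 * rr p ^+ 2); last first.
  by rewrite /c; field; rewrite lt0r_neq0.
rewrite rr_sq esq_xcoord /sKx /sX !mulr_sumr -sumrB -big_split /=.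
rewrite (eq_bigr (fun k => isx R k * (z1 k p - c * p ord0 k) ^+ 2)); last first.
  by move=> k _; rewrite /c /sX; ring.
rewrite sum_isx; apply: eq_bigr => j _.
by rewrite /ang_x d_r_sX !mxE e1 expr2.
Qed.

Lemma gCD_angt : gCD_term z p = - angt z1 p.
Proof.
rewrite /gCD_term; congr (- _); rewrite /angt.
pose c := sD z1 p / tau p.
transitivity (sKt z1 p - 2 * c * sT z1 p + c ^+ 2 * tau p ^+ 2); last first.
  rewrite /c sT_sD; have [t0|t0] := eqVneq (tau p) 0; last by field.
  by rewrite /sD t0 invr0; ring.
rewrite tau_sq esq_tcoord /sKt /sT !mulr_sumr -sumrB -big_split /=.
rewrite (eq_bigr (fun k => (1 - isx R k) * (z1 k p - c * p ord0 k) ^+ 2)); last first.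
  by move=> k _; rewrite /c /sD /sT; ring.
rewrite sum_ist; apply: eq_bigr => j _.
by rewrite /ang_t d_tau_sD !mxE e1 expr2.
Qed.

Lemma box_sboxw : box z p = sboxw z2 p.
Proof.
rewrite /box /sboxw big_split_ord /=; congr (_ + _).
  by rewrite -sumrN; apply: eq_bigr => i _; rewrite sg_l e2 mulN1r.
by apply: eq_bigr => i _; rewrite sg_r e2 mul1r.
Qed.

(** With [th = tau / r <= 1], the two null terms are [-+ (2 f / r) D + (1 -+ th) / 2 S]. The factor
    [f] in front of [D] is the gain that makes them controllable at the cone. *)
Lemma null_derivatives_bound : D p ->
  (uu p * d_u z p) ^+ 2 + (vv p * d_v z p) ^+ 2 <=
  16 * ff p ^+ 2 / rr p ^+ 2 * sD z1 p ^+ 2 + 2 * (sX z1 p + sT z1 p) ^+ 2.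
Proof.
move=> Dp; have r0 := Dom_rr Dp; have t0 := tau_ge0 p; have tr := Dom_tau Dp.
pose S := sX z1 p + sT z1 p; pose th := tau p / rr p.
have th0 : 0 <= th by rewrite divr_ge0 // ltW.
have th1 : th ^+ 2 <= 1.
  rewrite -[leRHS](expr1n _ 2) lerXn2r ?nnegrE // /th ler_pdivrMr // mul1r; exact: ltW.
have fE : ff p = (rr p ^+ 2 - tau p ^+ 2) / 4 by rewrite -ffE; field.
have uE : uu p * d_u z p = - (2 * ff p / rr p * sD z1 p) + (1 - th) / 2 * S.
  by rewrite /uu /d_u d_r_sX d_tau_sD /S /th sT_sD fE; field; rewrite lt0r_neq0.
have vE : vv p * d_v z p = 2 * ff p / rr p * sD z1 p + (1 + th) / 2 * S.
  by rewrite /vv /d_v d_r_sX d_tau_sD /S /th sT_sD fE; field; rewrite lt0r_neq0.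
rewrite uE vE -/S.
have -> : 16 * ff p ^+ 2 / rr p ^+ 2 * sD z1 p ^+ 2 = 4 * (2 * ff p / rr p * sD z1 p) ^+ 2.
  by field; rewrite lt0r_neq0.
move: (2 * ff p / rr p * sD z1 p) => y.
have : th ^+ 2 * S ^+ 2 <= 1 * S ^+ 2 by rewrite ler_wpM2r ?sqr_ge0.
have := sqr_ge0 y; have := sqr_ge0 (y - th * S); have := sqr_ge0 (y + th * S); have := sqr_ge0 S.
have -> : (- y + (1 - th) / 2 * S) ^+ 2 + (y + (1 + th) / 2 * S) ^+ 2 =
  2 * y ^+ 2 + 2 * (y * (th * S)) + S ^+ 2 / 2 + th ^+ 2 * S ^+ 2 / 2 by field.
have -> : (y - th * S) ^+ 2 = y ^+ 2 - 2 * (y * (th * S)) + th ^+ 2 * S ^+ 2 by ring.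
have -> : (y + th * S) ^+ 2 = y ^+ 2 + 2 * (y * (th * S)) + th ^+ 2 * S ^+ 2 by ring.
move: (th ^+ 2 * S ^+ 2) (y * (th * S)) (S ^+ 2) (y ^+ 2) => A B C E; lra.
Qed.

Variables (lam be cz Z : R).
Hypothesis Dp : D p.
Hypothesis cz0 : 0 < cz.
Hypothesis Z0 : 0 <= Z.
Hypothesis hZ : Z <= cz * (wgt lam be p ^+ 2 / ff p).

(** The factor 16 is the coefficient of the time-radial derivative in [null_derivatives_bound]; the
    other terms of [Qw] have room to spare. *)
Lemma first_term_bound :
  0 <= Z * (rr p)^-1 * ((uu p * d_u z p) ^+ 2 + (vv p * d_v z p) ^+ 2
             + ff p * gab_term z p - ff p * gCD_term z p) <= 16 * cz * Qw lam be z z1 p.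
Proof.
have f0 : 0 < ff p := Dp; have r0 := Dom_rr Dp; have cz0' := cz0; have Z0' := Z0.
rewrite gab_angx // gCD_angt mulrN opprK.
have ax := angx_ge0 z1 Dp; have at_ := angt_ge0 z1 p.
have fax : 0 <= ff p * angx z1 p by rewrite mulr_ge0 // ltW.
have fat : 0 <= ff p * angt z1 p by rewrite mulr_ge0 // ltW.
have nb := null_derivatives_bound Dp.
have q1 := sqr_ge0 (uu p * d_u z p); have q2 := sqr_ge0 (vv p * d_v z p).
apply/andP; split.
  apply: mulr_ge0; first by rewrite mulr_ge0 // invr_ge0 ltW.
  by lra.
have W0 : 0 < wgt lam be p ^+ 2 by rewrite exprn_gt0 // wgt_gt0.
apply: le_trans (_ : cz * (wgt lam be p ^+ 2 / ff p) * (rr p)^-1 *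
   (16 * ff p ^+ 2 / rr p ^+ 2 * sD z1 p ^+ 2 + 2 * (sX z1 p + sT z1 p) ^+ 2
    + ff p * angx z1 p + ff p * angt z1 p) <= _).
  apply: ler_pM; [by rewrite mulr_ge0 // invr_ge0 ltW|lra| |lra].
  by rewrite ler_wpM2r // invr_ge0 ltW.
rewrite /Qw.
have -> : 16 * cz * (wgt lam be p ^+ 2 * (ff p / rr p ^+ 3 * sD z1 p ^+ 2
    + (sX z1 p + sT z1 p) ^+ 2 / (rr p * ff p) + (angx z1 p + angt z1 p) / rr p
    + rr p / ff p ^+ 2 * z p ^+ 2)) = cz * (wgt lam be p ^+ 2 / ff p) * (rr p)^-1 *
   (16 * ff p ^+ 2 / rr p ^+ 2 * sD z1 p ^+ 2 + 2 * (sX z1 p + sT z1 p) ^+ 2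
    + ff p * angx z1 p + ff p * angt z1 p)
   + cz * wgt lam be p ^+ 2 * (14 * ((sX z1 p + sT z1 p) ^+ 2 / (rr p * ff p))
     + 15 * ((angx z1 p + angt z1 p) / rr p) + 16 * (rr p / ff p ^+ 2 * z p ^+ 2)).
  by field; rewrite !lt0r_neq0.
rewrite lerDl; apply: mulr_ge0; first by rewrite mulr_ge0 // ltW.
by nneg.
Qed.

(** Since [sqrt f <= r], the factor [f^(-1/2)] is at most [r / f], which is the zero-order weight of
    [Qw] after [W^2 / f] is split off. *)
Lemma second_term_bound :
  0 <= Z * powR (ff p) (- 2^-1) * z p ^+ 2 <= 16 * cz * Qw lam be z z1 p.
Proof.
have f0 : 0 < ff p := Dp; have r0 := Dom_rr Dp.
have ax := angx_ge0 z1 Dp; have at_ := angt_ge0 z1 p.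
have W0 : 0 < wgt lam be p ^+ 2 by rewrite exprn_gt0 // wgt_gt0.
apply/andP; split; first by apply: mulr_ge0; [rewrite mulr_ge0 ?powR_ge0|exact: sqr_ge0].
rewrite powRN powR12_sqrt ?(ltW f0) //.
pose s := Num.sqrt (ff p).
have s0 : 0 < s by rewrite sqrtr_gt0.
have sE : s ^+ 2 = ff p by rewrite sqr_sqrtr // ltW.
have sr : s <= rr p.
  rewrite -[leRHS]ger0_norm ?rr_ge0 // -sqrtr_sqr ler_wsqrtr //.
  by have := ffE p; have := sqr_ge0 (tau p); have := sqr_ge0 (rr p); lra.
rewrite -/s.
apply: le_trans (_ : cz * (wgt lam be p ^+ 2 / ff p) * (rr p / ff p) * z p ^+ 2 <= _).
  rewrite ler_wpM2r ?sqr_ge0 //; apply: ler_pM => //; first by rewrite invr_ge0 ltW.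
  by rewrite ler_pdivlMr // -sE expr2 mulrA mulVf ?lt0r_neq0 // mul1r.
rewrite /Qw.
have -> : 16 * cz * (wgt lam be p ^+ 2 * (ff p / rr p ^+ 3 * sD z1 p ^+ 2
    + (sX z1 p + sT z1 p) ^+ 2 / (rr p * ff p) + (angx z1 p + angt z1 p) / rr p
    + rr p / ff p ^+ 2 * z p ^+ 2)) = cz * (wgt lam be p ^+ 2 / ff p) * (rr p / ff p) * z p ^+ 2
   + cz * wgt lam be p ^+ 2 * (16 * (ff p / rr p ^+ 3 * sD z1 p ^+ 2)
     + 16 * ((sX z1 p + sT z1 p) ^+ 2 / (rr p * ff p))
     + 16 * ((angx z1 p + angt z1 p) / rr p) + 15 * (rr p / ff p ^+ 2 * z p ^+ 2)).
  by field; rewrite !lt0r_neq0.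
rewrite lerDl; apply: mulr_ge0; first by rewrite mulr_ge0 // ltW.
by nneg.
Qed.

End Identify.
End Zeta.

Section CutoffIntegral.
Variables (R : realType) (N : nat).

(** The passage from integrals against cut-offs to those on the right of the theorem. Nothing but
    domination is required of [G], and [F] may live on the larger set [S] provided it vanishes off
    [A]. *)
Lemma Rint_cutoff_le (S A : set 'rV[R]_N) (H F G : 'rV[R]_N -> R) (c : R) :
  cutoff S H -> A `<=` S -> 0 < c -> (forall p, S p -> contw setT p F) ->
  (forall p, S p -> 0 <= F p) -> (forall p, A p -> F p <= c * G p) ->
  (forall p, S p -> ~ A p -> F p = 0) ->
  ((c^-1 * Rint (fun p => H p * F p))%:E <= int_over A G)%E.
Proof.
move=> cH AS c0 cF F0 FG FA; have [_ hZ _ _ hL] := @RintP R N.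
have [_ H01 [K _ [KS HK]]] := cH.
have ic : 0 <= c^-1 by rewrite invr_ge0 ltW.
have cHF := cutoff_Cc cH cF.
have HS p : ~ S p -> H p = 0 by move=> nS; apply: HK => /KS.
have HF0 p : 0 <= H p * F p.
  have [Sp|nS] := pselect (S p); last by rewrite HS // mul0r.
  by rewrite mulr_ge0 ?F0 //; have /andP[] := H01 p.
rewrite -hZ // -hL; last exact: CcZ.
apply: lebint_le => p; first by rewrite lee_fin mulr_ge0.
case: asboolP => [Ap|nA].
  have Sp := AS _ Ap; rewrite lee_fin mulrC ler_pdivrMr // [leRHS]mulrC.
  apply: le_trans (FG _ Ap); rewrite ler_piMl ?F0 //; by have /andP[] := H01 p.
rewrite lee_fin; have [Sp|nS] := pselect (S p).
  by rewrite FA // !mulr0.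
by rewrite HS // mul0r mulr0.
Qed.

End CutoffIntegral.

(** The gradient of [z] is replaced by its continuous extensions to the closure. They agree with the
    partial derivatives on the open set [U], so the second derivatives are unchanged there. *)
Lemma C2_closure_data (R : realType) (N : nat) (U : set 'rV[R]_N) (z : 'rV[R]_N -> R) :
  open U -> C2_on U z -> C1_closure U z ->
  exists z1 : 'I_N -> 'rV[R]_N -> R,
  [/\ C2d U z z1 (fun k l => partial l (partial k z)),
      (forall p, closure U p -> contw (closure U) p z),
      (forall p k, closure U p -> contw (closure U) p (z1 k)) &
      (forall p k, U p -> z1 k p = partial k z p)].
Proof.
move=> oU [c0 d1 c1 d2 c2] [wz /choice[z1 hz1]]; exists z1; split.
- move=> p Up; have nU : \forall q \near p, U q by exact: open_nbhs_nbhs.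
  split.
  + by apply/contwTP; apply: c0; rewrite inE.
  + move=> k; have [_ e] := hz1 k.
    apply: (@contw_near R _ _ _ (partial k z)); last by apply/contwTP; apply: c1; rewrite inE.
      by apply: filterS nU => q Uq _; rewrite e.
    by rewrite e.
  + by move=> k l; apply/contwTP; apply: c2; rewrite inE.
  + by move=> k; have [_ ->] := hz1 k => //; apply: derivableP; exact: d1.
  + move=> k l; have [_ e] := hz1 k.
    apply: (@near_eq_is_derive _ _ _ (partial k z)).
      by apply: filterS nU => q Uq; rewrite e.
    by apply: derivableP; exact: d2.
- by move=> p cp; exact: (subspace_continuousP _ _).1 wz p cp.
- by move=> p k cp; have [wz1 _] := hz1 k; exact: (subspace_continuousP _ _).1 wz1 p cp.
- by move=> p k Up; have [_ ->] := hz1 k.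
Qed.

(** * The integrated Carleman estimate *)

Section Carleman.
Variables (R : realType) (m n : nat).
Notation pt := 'rV[R]_(m + n).
Variables (Om : set 'rV[R]_n) (nu : 'rV[R]_n -> 'rV[R]_n) (Rad a b eps sigma : R).
Hypothesis m0 : (0 < m)%N.
Hypothesis n0 : (0 < n)%N.
Hypothesis oOm : open Om.
Hypothesis bOm : bounded_set Om.
Hypothesis sOm : smooth_boundary_normal Om nu.
Hypothesis Rad0 : 0 < Rad.
Hypothesis OmR : forall x, Om x -> enorm x < Rad.
Hypothesis a0 : 0 < a.
Hypothesis b0 : 0 < b.
Hypothesis eps0 : 0 < eps.
Hypothesis aN : ((m + n) ^ 2)%:R <= a.
Hypothesis epsR : eps * Rad <= 4^-1.
Hypothesis sigma0 : 0 < sigma.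
Let omega := nbhd_sigma (Gamma_plus Om nu) sigma `&` Om.
Let U := @cyl R m n Om.
Let D := @Dom R m n.
Let S := U `&` D.
Let So := @cyl R m n omega `&` D.

(** One number [X] bounds the three integrals separately; the weights in front of them are restored
    at the end, at the expense of the constant. An upper bound by a real [X] also replaces any a
    priori integrability. *)
Lemma carleman_integral : exists2 K : R, 0 < K &
  forall (z : pt -> R) (X : R), C2_on U z -> C1_closure U z ->
  (forall p, (closure U `\` U) p -> D p -> z p = 0) ->
  (int_over S (fun p => zeta a b eps p * ff p * (box z p) ^+ 2)%R <= X%:E)%E ->
  (int_over So (fun p => zeta a b eps p * (ff p) ^- 2 * dotv (grad_t z p) (grad_t z p))%R <= X%:E)%E ->
  (int_over So (fun p => zeta a b eps p * (ff p) ^- 3 * z p ^+ 2)%R <= X%:E)%E ->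
  (int_over S (fun p => zeta a b eps p * (rr p)^-1 *
            ((uu p * d_u z p) ^+ 2 + (vv p * d_v z p) ^+ 2
             + ff p * gab_term z p - ff p * gCD_term z p))%R <= (K * X)%:E)%E /\
  (int_over S (fun p => zeta a b eps p * powR (ff p) (- 2^-1) * z p ^+ 2)%R <= (K * X)%:E)%E.
Proof.
(* This [lam] makes [W^2 / f] comparable to [zeta]; this [be] is the largest value allowed by the
   smallness condition. *)
pose lam := a + 2^-1; pose be := (4 * (1 + 2 * Rad) ^+ 3)^-1.
have Rad0' := Rad0; have a0' := a0.
have R1 : 0 < (1 + 2 * Rad) ^+ 3 by rewrite exprn_gt0 //; lra.
have be0 : 0 < be by rewrite invr_gt0 mulr_gt0.
have hbe : be * (1 + 2 * Rad) ^+ 3 <= 4^-1.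
  by rewrite /be invfM -mulrA mulVf ?mulr1 // lt0r_neq0.
have aN' : (m%:R + n%:R) ^+ 2 <= a by rewrite -natrD -natrX.
have N2 : 2 <= m%:R + n%:R :> R by rewrite -natrD (ler_nat _ 2) (leq_add m0 n0).
have a4 : 4 <= a.
  by apply: le_trans aN'; nra.
have lam4 : 4 <= lam by rewrite /lam; lra.
have Nlam : (m%:R + n%:R) ^+ 2 <= lam by rewrite /lam; lra.
have [rho [rho1 [rho2 [hrho rho_in rho_out rho_bd rho_nu]]]] := global_defining_function oOm bOm sOm.
have nu0 := nu_neq0 sOm.
have bG : bounded_set (Gamma_plus Om nu).
  have [M [Mr hM]] := compact_bounded (bounded_closure_compact bOm).
  by exists M; split => // M' MM x [[cx _] _]; exact: hM MM x cx.
have [chi [chi1 [chi2 [xi [xi1 [xi2 [hchi hxi chi0 hcase hxi0]]]]]]] := cutoffs bG sigma0.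
have [CQ [k2 [KB [CQ0 k20 KB0 hcomb]]]] := @combined_pointwise R m n lam be Rad Om _ _ _ _ _ _
  Rad0 be0 hbe lam4 m0 n0 Nlam oOm bOm OmR hchi hxi hcase.
have [c1 [c2 [c10 c20 hzeta]]] := @zeta_compare R m n a b eps be Rad a0 b0 eps0 be0 Rad0 epsR.
have [XM XM0 hXM] : exists2 M : R, 0 < M & forall x, Om x -> xi x ^+ 2 + \sum_j xi1 j x ^+ 2 <= M.
  apply: (bounded_on_Om bOm) => x; have [x0 x1 _ _ _] := hxi x I.
  by apply: contwD; [exact: contwX|apply: contw_sum => j; exact: contwX].
have XiE (p : pt) : Xi xi xi1 p = xi (xcoord p) ^+ 2 + \sum_j xi1 j (xcoord p) ^+ 2.
  rewrite /Xi; congr (_ + _); rewrite big_split_ord /= big1 ?add0r.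
    by apply: eq_bigr => j _; rewrite pull1_r.
  by move=> i _; rewrite pull1_l expr0n.
have Xi0 (p : pt) : 0 <= Xi xi xi1 p.
  by rewrite XiE addr_ge0 ?sqr_ge0 // sumr_ge0 // => j _; exact: sqr_ge0.
(* [16 c2] comes from bounding the left integrands by [Qw], [KB] from the pointwise estimate, and
   the three summands from comparing the weights of the right-hand terms with [zeta], the last two
   with the bound [XM] of [Xi]. *)
exists (16 * c2 * KB * (c1 + c1 * XM + c1 * XM)).
  by rewrite !mulr_gt0 // !addr_gt0 ?mulr_gt0.
move=> z X hz2 hz1 z0 I1 I2 I3.
have oU : open U by exact: open_cyl.
have [z1 [hz cz cz1 e1]] := C2_closure_data oU hz2 hz1.
pose z2 k l := partial l (partial k z).
have hUD : C2d S z z1 z2 by apply: C2dS hz => p [].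
have rS p : S p -> rr p <= Rad by move=> [Up _]; exact: ltW (OmR Up).
pose W (p : pt) := wgt lam be p ^+ 2.
have W0 p : 0 < W p by rewrite exprn_gt0 // wgt_gt0.
have Wz p : S p -> W p <= c1 * (zeta a b eps p * ff p).
  move=> Sp; have f0 : 0 < ff p by case: Sp.
  have [h _] := hzeta p (proj2 Sp) (rS _ Sp).
  by rewrite mulrA -ler_pdivrMr.
pose b1 (p : pt) := W p * sboxw z2 p ^+ 2.
pose b2 (p : pt) := W p * (Xi xi xi1 p / ff p ^+ 3 * sKt z1 p).
pose b3 (p : pt) := W p * (Xi xi xi1 p / ff p ^+ 4 * z p ^+ 2).
have cW p : S p -> contw setT p W.
  by move=> [_ Dp]; apply: contwX; exact: contw_wgt.
have cXi p k : S p -> contw setT p (fun q : pt => Xi xi xi1 q / ff q ^+ k).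
  move=> [_ Dp]; have [x0 x1 _ _ _] := C2d_pull hxi (I : [set: pt] p).
  apply: contwM; last first.
    by apply: contwV; [rewrite expf_neq0 // lt0r_neq0|apply: contwX; exact: contw_ff].
  by apply: contwD; [exact: contwX|apply: contw_sum => j; exact: contwX].
have cb1 p : S p -> contw setT p b1.
  move=> Sp; have [_ _ q2 _ _] := hUD p Sp; apply: contwM; first exact: cW.
  by apply: contwX; apply: contw_sum => j; apply: contwM; [exact: contw_cst|exact: q2].
have cb2 p : S p -> contw setT p b2.
  move=> Sp; have [_ q1 _ _ _] := hUD p Sp; apply: contwM; first exact: cW.
  apply: contwM; first exact: cXi.
  by apply: contw_sum => j; apply: contwM; [exact: contw_cst|apply: contwX; exact: q1].
have cb3 p : S p -> contw setT p b3.
  move=> Sp; have [q0 _ _ _ _] := hUD p Sp; apply: contwM; first exact: cW.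
  by apply: contwM; [exact: cXi|exact: contwX].
have f0S p : S p -> 0 < ff p by case.
have b10 p : S p -> 0 <= b1 p by move=> Sp; rewrite mulr_ge0 ?sqr_ge0 // ltW.
have Xf0 p k : S p -> 0 <= Xi xi xi1 p / ff p ^+ k.
  by move=> Sp; rewrite divr_ge0 // exprn_ge0 // ltW // f0S.
have b20 p : S p -> 0 <= b2 p.
  by move=> Sp; rewrite mulr_ge0 ?(ltW (W0 _)) // mulr_ge0 ?Xf0 ?sKt_ge0.
have b30 p : S p -> 0 <= b3 p.
  by move=> Sp; rewrite mulr_ge0 ?(ltW (W0 _)) // mulr_ge0 ?Xf0 ?sqr_ge0.
have SoS : So `<=` S by move=> p [[_ Up] Dp].
have XiM p : S p -> Xi xi xi1 p <= XM by move=> [Up _]; rewrite XiE; exact: hXM.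
have Xi_off p : S p -> ~ So p -> Xi xi xi1 p = 0.
  move=> [Up Dp] nSo; have [ns|[x0 x1]] := hxi0 (xcoord p).
    by case: nSo; split => //; split.
  by rewrite XiE x0 expr0n big1 ?addr0 // => j _; rewrite x1 expr0n.
have hb1 H : cutoff S H -> Rint (fun p => H p * b1 p) <= c1 * X.
  move=> cH.
  have h : (((c1)^-1 * Rint (fun p => H p * b1 p))%:E <= X%:E)%E.
    apply: le_trans I1.
    apply: (Rint_cutoff_le cH) => // p Sp.
    rewrite /b1 (box_sboxw (fun k l => erefl _ : z2 k l p = _)) [leRHS]mulrA.
    by rewrite ler_wpM2r ?sqr_ge0 //; exact: Wz.
  by move: h; rewrite lee_fin mulrC ler_pdivrMr // mulrC.
have cM0 : 0 < c1 * XM by rewrite mulr_gt0.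
have WX p : S p -> W p * Xi xi xi1 p <= c1 * XM * (zeta a b eps p * ff p).
  move=> Sp; rewrite [leRHS]mulrAC; apply: ler_pM; [exact: ltW|exact: Xi0|exact: Wz|exact: XiM].
have hb2 H : cutoff S H -> Rint (fun p => H p * b2 p) <= c1 * XM * X.
  move=> cH.
  have h : (((c1 * XM)^-1 * Rint (fun p => H p * b2 p))%:E <= X%:E)%E.
    apply: le_trans I2.
    apply: (Rint_cutoff_le cH) => // [p Sop|p Sp nSo]; last first.
      by rewrite /b2 Xi_off // mul0r mul0r mulr0.
    have Sp := SoS _ Sop; have f0 := f0S _ Sp.
    rewrite /b2 (sKt_dotv (fun k => e1 p k (proj1 Sp))) [leLHS]mulrA [leRHS]mulrA.
    rewrite ler_wpM2r ?sKt_ge0 // mulrA.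
    rewrite ler_pdivrMr ?exprn_gt0 // (le_trans (WX p Sp)) // le_eqVlt; apply/orP; left; apply/eqP.
    by field; rewrite lt0r_neq0.
  by move: h; rewrite lee_fin mulrC ler_pdivrMr // mulrC.
have hb3 H : cutoff S H -> Rint (fun p => H p * b3 p) <= c1 * XM * X.
  move=> cH.
  have h : (((c1 * XM)^-1 * Rint (fun p => H p * b3 p))%:E <= X%:E)%E.
    apply: le_trans I3.
    apply: (Rint_cutoff_le cH) => // [p Sop|p Sp nSo]; last first.
      by rewrite /b3 Xi_off // mul0r mul0r mulr0.
    have Sp := SoS _ Sop; have f0 := f0S _ Sp.
    rewrite /b3 [leLHS]mulrA [leRHS]mulrA ler_wpM2r ?sqr_ge0 // mulrA.
    rewrite ler_pdivrMr ?exprn_gt0 // (le_trans (WX p Sp)) // le_eqVlt; apply/orP; left; apply/eqP.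
    by field; rewrite lt0r_neq0.
  by move: h; rewrite lee_fin mulrC ler_pdivrMr // mulrC.
pose cA := 16 * c2.
have cA0 : 0 < cA by rewrite mulr_gt0.
pose B (p : pt) := cA * KB * (b1 p + b2 p + b3 p).
have cAK : 0 < cA * KB by rewrite mulr_gt0.
have cB p : U p -> D p -> contw setT p B.
  move=> Up Dp; have Sp : S p by [].
  apply: contwM; first exact: contw_cst.
  by apply: contwD; [apply: contwD|]; [exact: cb1|exact: cb2|exact: cb3].
have hB H : cutoff S H -> Rint (fun p => H p * B p) <=
    16 * c2 * KB * (c1 + c1 * XM + c1 * XM) * X.
  move=> cH; have [hD hZ _ _ _] := @RintP R (m + n).
  have q1 := cutoff_Cc cH cb1; have q2 := cutoff_Cc cH cb2; have q3 := cutoff_Cc cH cb3.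
  rewrite (@Rint_eq R _ _ (fun p => cA * KB * ((H p * b1 p + H p * b2 p) + H p * b3 p))); last first.
    by move=> p; rewrite /B; ring.
  have q12 := CcD q1 q2; rewrite hZ; last exact: CcD.
  rewrite hD // hD // -[leRHS]mulrA -/cA ler_pM2l // !mulrDl.
  by apply: lerD; [apply: lerD|]; [exact: hb1|exact: hb2|exact: hb3].
(* Both left-hand integrals are instances: scaling the current by [cA] turns the pointwise bound of
   [Qw] into the hypothesis of [total_estimate]. *)
have key (A : pt -> R) : (forall p, U p -> D p -> 0 <= A p <= cA * Qw lam be z z1 p) ->
    (int_over S A <= (16 * c2 * KB * (c1 + c1 * XM + c1 * XM) * X)%:E)%E.
  move=> hA.
  apply: (@total_estimate R m n lam be Rad Om nu rho rho1 rho2 chi chi1 chi2 xi xi1 xi2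
    Rad0 be0 lam4 oOm OmR hrho rho_in rho_out rho_bd rho_nu nu0 hchi hxi chi0 z z1 z2 hz cz cz1 z0
    (cA * CQ) (cA * k2) _ A B) => //.
    by rewrite mulr_ge0 // ltW.
  move=> p Up Dp; have /andP[A0 A1] := hA p Up Dp; rewrite A0 /=; apply: le_trans A1 _.
  have := hcomb z z1 z2 p hUD Up Dp; rewrite -(ler_pM2l cA0) => h; apply: le_trans h _.
  rewrite le_eqVlt; apply/orP; left; apply/eqP.
  rewrite /B /b1 /b2 /b3 /W (_ : \sum_k tJ' _ _ _ _ _ _ _ _ _ _ _ _ k p = cA * (CQ *
     (\sum_k sJ' lam be (cpsi lam be (cw chi z)) (cpsi1 lam be (cw chi z) (cw1 chi chi1 z z1))
      (cpsi2 lam be (cw chi z) (cw1 chi chi1 z z1) (cw2 chi chi1 chi2 z z1 z2)) k p)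
     + k2 * (\sum_k sE' lam be (fun q : pt => xi (xcoord q)) (pull1 xi1) z z1 z2 k p))).
    by ring.
  rewrite mulrDr !mulrA !mulr_sumr -big_split /=; apply: eq_bigr => k _.
  by rewrite /tJ'.
split; apply: key => p Up Dp; have Sp : S p by [].
  have [_ hz'] := hzeta p Dp (rS _ Sp).
  exact: (first_term_bound (fun k => e1 p k Up) Dp c20 (powR_ge0 _ _) hz').
have [_ hz'] := hzeta p Dp (rS _ Sp).
exact: (@second_term_bound R m n z z1 p lam be c2 _ Dp c20 (powR_ge0 _ _) hz').
Qed.

End Carleman.

Lemma weighted_sum_le (R : realType) (x y X c d : R) (L1 L2 : \bar R) :
  0 <= c -> 0 <= d -> (L1 <= x%:E)%E -> (L2 <= y%:E)%E -> c * x + d * y <= X ->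
  (c%:E * L1 + d%:E * L2 <= X%:E)%E.
Proof.
move=> c0 d0 h1 h2 h; apply: le_trans (_ : ((c * x + d * y)%:E <= _)%E); last by rewrite lee_fin.
by rewrite EFinD !EFinM leeD // lee_wpmul2l // lee_fin.
Qed.

Lemma int_over_ge0 (R : realType) N (A : set 'rV[R]_N) (F : 'rV[R]_N -> R) :
  (forall p, A p -> 0 <= F p) -> (0 <= int_over A F)%E.
Proof.
by move=> h; apply: lebint_ge0 => p; case: asboolP => // /h; rewrite lee_fin.
Qed.

Theorem theorem3p13 (R : realType) :
  exists (Ka cb : R), 0 < Ka /\ 0 < cb /\
  forall (m n : nat), (0 < m)%N -> (0 < n)%N ->
  exists ce : R, 0 < ce /\
  forall (Om : set 'rV[R]_n) (nu : 'rV[R]_n -> 'rV[R]_n)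
         (Rad a b eps sigma : R),
    open Om -> bounded_set Om -> smooth_boundary_normal Om nu ->
    0 < Rad -> (forall x, Om x -> enorm x < Rad) ->
    0 < a -> 0 < b -> 0 < eps ->
    ((m + n) ^ 2)%:R <= a -> Ka * Rad <= a ->
    b <= cb / Rad -> eps <= ce * b ->
    0 < sigma ->
    let omega := nbhd_sigma (Gamma_plus Om nu) sigma `&` Om in
    let U := @cyl R m n Om in
    let D := @Dom R m n in
    exists C : R, 0 < C /\
    forall z : 'rV[R]_(m + n) -> R,
      C2_on U z -> C1_closure U z ->
      (forall p, (closure U `\` U) p -> D p -> z p = 0) ->
      ((C * eps)%:E *
         int_over (U `&` D) (fun p => (zeta a b eps p * (rr p)^-1 *
            ((uu p * d_u z p) ^+ 2 + (vv p * d_v z p) ^+ 2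
             + ff p * gab_term z p - ff p * gCD_term z p))%R)
       + (C * b * a ^+ 2)%:E *
         int_over (U `&` D) (fun p => (zeta a b eps p * powR (ff p) (- 2^-1) * z p ^+ 2)%R)
       <= (a^-1)%:E *
         int_over (U `&` D) (fun p => (zeta a b eps p * ff p * (box z p) ^+ 2)%R)
       + (a ^+ 2 * Rad ^+ 3)%:E *
         int_over (@cyl R m n omega `&` D)
           (fun p => (zeta a b eps p * (ff p) ^- 2 * dotv (grad_t z p) (grad_t z p))%R)
       + (a ^+ 4 * Rad ^+ 4)%:E *
         int_over (@cyl R m n omega `&` D)
           (fun p => (zeta a b eps p * (ff p) ^- 3 * z p ^+ 2)%R))%E.

Proof.
(* With both small constants equal to 1/2, [eps <= b / 2] and [b Rad <= 1/2] give [eps Rad <= 1/4],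
   the range in which [zeta] can be compared with the weight. *)
exists 1, 2^-1; split=> //; split; first by rewrite invr_gt0.
move=> m n m0 n0; exists 2^-1; split; first by rewrite invr_gt0.
move=> Om nu Rad a b eps sigma oOm bOm sOm Rad0 OmR a0 b0 eps0 aN _ bR eb sigma0 omega U D.
have epsR : eps * Rad <= 4^-1.
  move: bR; rewrite ler_pdivlMr // => bR.
  have : eps * Rad <= 2^-1 * b * Rad by rewrite ler_pM2r.
  lra.
have [K K0 hK] := @carleman_integral R m n Om nu Rad a b eps sigma m0 n0 oOm bOm sOm Rad0 OmR
  a0 b0 eps0 aN epsR sigma0.
pose al1 := a^-1; pose al2 := a ^+ 2 * Rad ^+ 3; pose al3 := a ^+ 4 * Rad ^+ 4.
have al10 : 0 < al1 by rewrite invr_gt0.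
have al20 : 0 < al2 by rewrite mulr_gt0 ?exprn_gt0.
have al30 : 0 < al3 by rewrite mulr_gt0 ?exprn_gt0.
(* Each right-hand integral is at most [al^-1 X], where [X] is the whole right side; the sum of the
   three inverses serves all of them. *)
pose s := al1^-1 + al2^-1 + al3^-1.
have s0 : 0 < s by rewrite !addr_gt0 ?invr_gt0.
pose q := eps + b * a ^+ 2.
have q0 : 0 < q by rewrite addr_gt0 // mulr_gt0 // exprn_gt0.
(* [q] collects the two left-hand factors [eps] and [b a^2], and each left-hand integral is at most
   [K s X]; with this [C] the left side is at most [X]. *)
pose C := (q * (K * s))^-1.
have C0 : 0 < C by rewrite invr_gt0 !mulr_gt0.
exists C; split=> // z hz2 hz1 z0.
set L1 := int_over _ _; set L2 := int_over _ _; set I1 := int_over _ _.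
set I2 := int_over _ _; set I3 := int_over _ _.
have f0 p : D p -> 0 <= ff p by exact: ltW.
have I10 : (0 <= I1)%E.
  by apply: int_over_ge0 => p [_ Dp]; rewrite mulr_ge0 ?sqr_ge0 // mulr_ge0 ?powR_ge0 // f0.
have I20 : (0 <= I2)%E.
  apply: int_over_ge0 => p [_ Dp]; rewrite mulr_ge0 //.
    by rewrite mulr_ge0 ?powR_ge0 // invr_ge0 exprn_ge0 // f0.
  by apply: sumr_ge0 => i _; rewrite -expr2 sqr_ge0.
have I30 : (0 <= I3)%E.
  apply: int_over_ge0 => p [_ Dp]; rewrite mulr_ge0 ?sqr_ge0 //.
  by rewrite mulr_ge0 ?powR_ge0 // invr_ge0 exprn_ge0 // f0.
rewrite -/al1 -/al2 -/al3.
have J10 : (0 <= al1%:E * I1)%E by rewrite mule_ge0 // lee_fin ltW.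
have J20 : (0 <= al2%:E * I2)%E by rewrite mule_ge0 // lee_fin ltW.
have J30 : (0 <= al3%:E * I3)%E by rewrite mule_ge0 // lee_fin ltW.
(* If the right side is infinite there is nothing to prove, and nonnegativity excludes the value
   [-oo]. Otherwise it is the real number [X]. *)
case XE : (al1%:E * I1 + al2%:E * I2 + al3%:E * I3)%E => [X| |]; last 2 first.
- exact: leey.
- by have := adde_ge0 (adde_ge0 J10 J20) J30; rewrite XE.
have X0 : 0 <= X by rewrite -lee_fin -XE !adde_ge0.
have T (al : R) (I : \bar R) : 0 < al -> (al%:E * I <= X%:E)%E -> al^-1 <= s ->
    (I <= (s * X)%:E)%E.
  move=> al0 h hs; apply: le_trans (_ : ((al^-1 * X)%:E <= _)%E); last first.
    by rewrite lee_fin ler_wpM2r.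
  by rewrite EFinM lee_pdivlMl.
have i10 : 0 < al1^-1 by rewrite invr_gt0.
have i20 : 0 < al2^-1 by rewrite invr_gt0.
have i30 : 0 < al3^-1 by rewrite invr_gt0.
have [|||h1 h2] := hK z (s * X) hz2 hz1 z0.
- apply: (T al1) => //; last by rewrite /s; lra.
  by rewrite -XE -addeA leeDl // adde_ge0.
- apply: (T al2) => //; last by rewrite /s; lra.
  by rewrite -XE addeAC leeDr // adde_ge0.
- apply: (T al3) => //; last by rewrite /s; lra.
  by rewrite -XE leeDr // adde_ge0.
apply: (@weighted_sum_le R (K * (s * X)) (K * (s * X)) X _ _ _ _ _ _ h1 h2).
- by rewrite mulr_ge0 // ltW.
- by rewrite mulr_ge0 ?sqr_ge0 // mulr_ge0 // ltW.
rewrite le_eqVlt; apply/orP; left; apply/eqP.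
transitivity (C * (q * (K * s)) * X); first by rewrite /q; ring.
by rewrite /C mulVf ?mul1r // lt0r_neq0 // !mulr_gt0.
Qed.
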